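(* Let $\lambda>0$, let $\rho_{\mathtt{FE}}=\rho_{\mathtt{FE}}(\lambda)$ be the critical density of fixed-energy activated random walk on $\mathbb{Z}$ with sleep rate $\lambda$, and let $0<\rho\le\rho_{\mathtt{FE}}$. For each integer $n\ge1$, let $\sigma$ be the random configuration consisting of $\lceil\rho n\rceil$ active particles placed independently and uniformly at random on $\{1,\dots,n\}$. Let $M=M(\sigma)$ be the maximum of the number of particles ejected to the left sink $0$ and the number of particles ejected to the right sink $n+1$ when stabilizing $\sigma$ on $\{1,\dots,n\}$ by activated random walk with sleep rate $\lambda$. Then for every $\epsilon>0$ there exist constants $c,C>0$ depending only on $\epsilon$ and $\lambda$ (in particular not on $n$ or $\rho$) such that for all $n\ge 1$, $$\mathbf{P}\bigl(M(\sigma)\le \epsilon n/2\bigr)\ge 1-Ce^{-cn}.$$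
   Context: Activated random walk (ARW) with sleep rate $\lambda\in(0,\infty)$ on a graph (here a subset of $\mathbb{Z}$): particles are active or sleeping. Each active particle performs simple random walk (jumping to a uniformly random neighbor, i.e. left or right with probability $1/2$ each) at exponential rate $1$. An active particle that is alone at its site falls asleep at exponential rate $\lambda$. Sleeping particles do not move, but a sleeping particle becomes active when an active particle moves to its site. A configuration on $\{1,\dots,n\}$ is an element of $\{\mathfrak{s},0,1,2,\dots\}^{\{1,\dots,n\}}$, giving the number of active particles at each site, with $\mathfrak{s}$ denoting a lone sleeping particle. On the interval $\{1,\dots,n\}$, there are sinks at $0$ and $n+1$: a particle that jumps to $0$ or $n+1$ is trapped (ejected) there forever. Stabilizing a configuration on $\{1,\dots,n\}$ means running ARW until every particle is either asleep or trapped at a sink; this happens almost surely in finite time. The probability $\mathbf{P}$ is over both the random initial configuration $\sigma$ and the ARW dynamics. Fixed-energy ARW on $\mathbb{Z}$: ARW on all of $\mathbb{Z}$ started from a translation-invariant ergodic random initial configuration of active particles with mean number of particles per site (density) $\rho$. The critical density $\rho_{\mathtt{FE}}=\rho_{\mathtt{FE}}(\lambda)$ is the number (known to exist and not to depend on the choice of ergodic initial distribution beyond its density) such that for $\rho<\rho_{\mathtt{FE}}$, almost surely activity eventually ceases at each site, while for $\rho>\rho_{\mathtt{FE}}$, almost surely activity persists for all time. *)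

(* Defs.v *)
From mathcomp Require Import all_boot all_order all_algebra.
From mathcomp Require Import all_classical all_reals all_analysis.

Set Implicit Arguments.
Unset Strict Implicit.
Unset Printing Implicit Defensive.

Import Order.TTheory GRing.Theory Num.Theory.
Import numFieldNormedType.Exports.

Local Open Scope classical_set_scope.
Local Open Scope ring_scope.

(* The states {s, 0, 1, 2, ...} of a site; [Awake 0] is the empty site. *)
Inductive site_state := Asleep | Awake of nat.

Definition awake (a : site_state) : nat := if a is Awake k then k else 0%N.

Definition config := int -> site_state.

Definition set_site (eta : config) (x : int) (a : site_state) : config :=
  fun y => if y == x then a else eta y.

(* A particle entering a site with a sleeping particle wakes it up. *)
Definition arrive (a : site_state) : site_state :=
  if a is Awake k then Awake k.+1 else Awake 2.

Definition jump (eta : config) (x y : int) : config :=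
  let eta' := set_site eta x (Awake (awake (eta x)).-1) in
  set_site eta' y (arrive (eta' y)).

(* Generator of activated random walk on [V] with sleep rate [lambda].  Sites
   outside [V] are sinks: the particles there never move or fall asleep, so that
   [Awake k] at such a site records [k] trapped particles.  When [eta] has
   finitely many particles, the sum has finite support (the finitely supported
   sum [\sum_(x \in V)] is 0 by convention otherwise). *)
Definition generator {R : realType} (V : set int) (lambda : R)
    (f : config -> R) (eta : config) : R :=
  \sum_(x \in V)
    ((awake (eta x))%:R *
       (2^-1 * (f (jump eta x (x - 1)) - f eta) +
        2^-1 * (f (jump eta x (x + 1)) - f eta)) +
     (if eta x is Awake 1
      then lambda * (f (set_site eta x Asleep) - f eta) else 0)).

(* The Markov semigroup exp(t L).  The number N of particles is conserved (sinks
   included), so the jump rates out of the configurations reachable from a given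
   finite one are bounded by N (1 + lambda), and the exponential series converges
   for bounded [f]. *)
Definition semigroup {R : realType} (V : set int) (lambda t : R)
    (f : config -> R) (eta : config) : R :=
  limn (series (fun k : nat =>
    t ^+ k / k`!%:R * iter k (generator V lambda) f eta)).

(* For s = [:: (d1, A1); (d2, A2); ...], the probability that the chain started
   from the finite configuration [eta] is in A1 at time d1, in A2 at time
   d1 + d2, and so on. *)
Fixpoint fdd {R : realType} (V : set int) (lambda : R)
    (s : seq (R * set config)) (eta : config) : R :=
  if s is (d, A) :: s'
  then semigroup V lambda d (fun zeta => \1_A zeta * fdd V lambda s' zeta) eta
  else 1.

(* The corresponding event for a trajectory [x], the clock starting at [t]. *)
Fixpoint visits {R : realType} (x : R -> config) (t : R)
    (s : seq (R * set config)) : Prop :=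
  if s is (d, A) :: s' then A (x (t + d)) /\ visits x (t + d) s' else True.

Definition truncate_config (M : nat) (eta : config) : config :=
  fun x => if (`|x| <= M)%N then eta x else Awake 0.

Definition local_event (A : set config) : Prop :=
  exists N : nat, forall eta zeta : config,
    (forall x : int, (`|x| <= N)%N -> eta x = zeta x) -> A eta -> A zeta.

(* [X] is an activated random walk on [V], with random initial configuration
   [X 0].  In infinite volume the law of the process is defined as the limit of
   the laws of the finite systems obtained by truncating the initial
   configuration: it is the one for which the probability of every event
   depending on finitely many sites is the limit of its probabilities for the
   truncated systems.  When [X 0] is supported in a fixed finite set the sequence
   is eventually constant, and this says that [X] is the Markov chain with
   generator [generator V lambda]. *)
Definition is_arw {R : realType} (V : set int) (lambda : R)
    (d : measure_display) (T : measurableType d) (P : probability T R)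
    (X : R -> T -> config) : Prop :=
  [/\ forall t x a, 0 <= t -> measurable [set w | X t w x = a],
      forall w x t, 0 <= t -> \forall u \near t^'+, X u w x = X t w x,
      forall w x t, 0 < t -> exists a, \forall u \near t^'-, X u w x = a &
      forall s : seq (R * set config),
        (forall p, p \in s -> 0 <= p.1 /\ local_event p.2) ->
        (fun M : nat =>
          (\int[P]_w (fdd V lambda s (truncate_config M (X 0%R w)))%:E)%E) @ \oo -->
        P [set w | visits (fun t => X t w) 0 s]].

Definition shift_config (eta : config) : config := fun x => eta (x + 1).

Definition cylinders : set (set config) :=
  [set A | exists (x : int) (a : site_state), A = [set eta | eta x = a]].

Definition translation_invariant {R : realType} (d : measure_display)
    (T : measurableType d) (P : probability T R) (Y : T -> config) : Prop :=
  forall A, <<s cylinders >> A ->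
    P (Y @^-1` (shift_config @^-1` A)) = P (Y @^-1` A).

Definition ergodic {R : realType} (d : measure_display)
    (T : measurableType d) (P : probability T R) (Y : T -> config) : Prop :=
  forall A, <<s cylinders >> A -> shift_config @^-1` A = A ->
    P (Y @^-1` A) = 0%E \/ P (Y @^-1` A) = 1%E.

(* [X] is fixed-energy activated random walk on Z with density [rho]. *)
Definition fixed_energy_arw {R : realType} (lambda rho : R)
    (d : measure_display) (T : measurableType d) (P : probability T R)
    (X : R -> T -> config) : Prop :=
  [/\ is_arw setT lambda P X,
      forall w x, X 0 w x <> Asleep,
      translation_invariant P (X 0),
      ergodic P (X 0) &
      (\int[P]_w ((awake (X 0 w 0))%:R)%R%:E)%E = rho%:E].

Definition activity_ceases {R : realType} (x : R -> config) : Prop :=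
  forall z : int, exists2 t0, 0 <= t0 & forall t, t0 <= t -> awake (x t z) = 0%N.

Definition activity_persists {R : realType} (x : R -> config) : Prop :=
  forall (z : int) t0, 0 <= t0 -> exists2 t, t0 <= t & (0 < awake (x t z))%N.

Definition is_critical_density {R : realType} (lambda rho_FE : R) : Prop :=
  forall (rho : R) (d : measure_display) (T : measurableType d)
    (P : probability T R) (X : R -> T -> config),
    fixed_energy_arw lambda rho P X ->
    (rho < rho_FE -> {ae P, forall w, activity_ceases (fun t => X t w)}) /\
    (rho_FE < rho -> {ae P, forall w, activity_persists (fun t => X t w)}).

Definition sites (n : nat) : set int := [set x : int | 1 <= x <= n%:Z].

Definition stable (V : set int) (eta : config) : Prop :=
  forall x, V x -> awake (eta x) = 0%N.

(* The maximum of the numbers of particles in the sinks 0 and n + 1. *)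
Definition max_ejected (n : nat) (eta : config) : nat :=
  maxn (awake (eta 0)) (awake (eta n.+1%:Z)).

(* Particle [i : 'I_k] is put at the site [p i + 1] of {1, ..., n}. *)
Definition place (n k : nat) (p : {ffun 'I_k -> 'I_n}) : config :=
  fun x => Awake #|[pred i : 'I_k | (p i).+1%:Z == x]|.

(* [Y] is distributed as [k] particles placed independently and uniformly on
   {1, ..., n}, i.e. as [place p] for [p] uniform among the n ^ k functions. *)
Definition uniform_placement {R : realType} (n k : nat) (d : measure_display)
    (T : measurableType d) (P : probability T R) (Y : T -> config) : Prop :=
  forall eta : config,
    P [set w | Y w = eta] =
    (#|[pred p : {ffun 'I_k -> 'I_n} | `[< place p = eta >]]|%:R / (n ^ k)%:R)%:E.

(* Main.v *)
Require Import Defs.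
From mathcomp Require Import all_boot all_order all_algebra.
From mathcomp Require Import all_classical all_reals all_analysis.
From mathcomp Require Import measurable_realfun zify ring lra.
Set Implicit Arguments.
Unset Strict Implicit.
Unset Printing Implicit Defensive.
Import Order.TTheory GRing.Theory Num.Theory.
Import numFieldNormedType.Exports.
Local Open Scope classical_set_scope.
Local Open Scope ring_scope.

(** By the least action principle, any odometer on [{1, ..., n}], legal or not,
    after which all sites are stable dominates that of the walk.  So it suffices
    to find, with probability [1 - C exp(- c n)], such an odometer ejecting at most
    [eps n / 2] particles to the left: the right sink follows by reflection.

    Take [q / p] slightly below [rho_FE] and let [Z] be filled with [q] particles at
    the multiples of [p], shifted by a uniform phase.  The walk started from this
    ergodic configuration is constructed as a limit of discrete-time walks on
    finite boxes.  Its activity ceases, so that the odometers on all the boxes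
    [[- M, M]] are tight.  Hence a block of [m = p b] sites carrying the pattern is
    stabilized with probability [1 - delta] by an odometer ejecting at most [K1]
    particles on each side, where [K1] does not depend on [b].

    The box is explored block by block from left to right.  At each site one first
    uses as many left instructions as it takes for particles to flow only to the
    left; this uses a random number of instructions, but the following ones are
    independent of the past, and they are used to stabilize the pattern.  A good
    block thus absorbs [q b] particles at the cost of [K1], a bad one absorbs
    nothing.  The number of bad blocks is dominated by a binomial variable, and a
    uniform placement has prefix sums close to their means, both up to
    exponentially small probabilities. *)

(** * Stacks of instructions and the least action principle *)

(** The hypothesis on [rho_FE] speaks only of processes that satisfy [fixed_energy_arw], so it says
    nothing until such a process is exhibited; this is why an infinite-volume walk has to be built.
    What is extracted from it is a bound in probability on the odometer at a fixed site, uniform in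
    the box and in time. A block is therefore placed in two ways: starting at site 1, to control its
    left end, and ending at site 0, to control its right end. Whatever its length, each controlled
    end is a fixed site, which makes [K1] independent of [b]. The two odometers are merged by taking
    their minimum. Since [K1] comes before [b], blocks can be made so long that [2 * K1] is a small
    fraction of their length. One bad block in [T] can be afforded; [T] is fixed before [delta], and
    [delta] is the inverse of [2 ^+ (2 * T)], which makes a larger number of bad blocks
    exponentially unlikely. Time is discretized because the law of the walk is given by exponential
    series of the generator. In discrete time the walk is a function of independent coordinates with
    finitely many values, so probabilities are finite sums and boxes are compared pointwise. *)

(* Instructions: [1] = jump left, [2] = jump right, anything else = sleep. *)
Definition stacks := int -> nat -> nat.
Definition odometer := int -> nat.

Fixpoint cnt (b : nat) (s : nat -> nat) (j : nat) : nat :=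
  if j is j'.+1 then (cnt b s j' + (s j' == b))%N else 0%N.

Definition is_sleep (i : nat) := (i != 1%N) && (i != 2%N).

Definition occ (sig : int -> nat) (I : stacks) (u : odometer) (x : int) : int :=
  (sig x)%:Z + (cnt 2 (I (x - 1)) (u (x - 1)))%:Z
  + (cnt 1 (I (x + 1)) (u (x + 1)))%:Z
  - (cnt 1 (I x) (u x))%:Z - (cnt 2 (I x) (u x))%:Z.

(** Between two uses of the stack at [x] the occupation of [x] can only grow. If it is 1 and the
    last instruction used was a sleep, it was already 1 at that use; along a run the state of a site
    can thus be recovered from the odometer alone. *)
Definition st (sig : int -> nat) (I : stacks) (u : odometer) : config := fun x =>
  if [&& occ sig I u x == 1, (0 < u x)%N & is_sleep (I x (u x).-1)]
  then Asleep else Awake `|occ sig I u x|%N.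

Definition app (i : nat) (x : int) (eta : config) : config :=
  if i == 1%N then jump eta x (x - 1) else if i == 2%N then jump eta x (x + 1)
  else if eta x is Awake 1 then set_site eta x Asleep else eta.

Definition incr (u : odometer) (x : int) : odometer :=
  fun y => if y == x then (u y).+1 else u y.

(** In the second clause, the particle that was present when the last sleep was used must still be
    there, as only a jump instruction at [x] could have removed it. This excludes an arrival at
    occupation 0 after a sleep, which [st] would read as a sleeping particle. *)
Definition legal sig I u := forall x : int, 0 <= occ sig I u x /\
  ((0 < u x)%N -> is_sleep (I x (u x).-1) -> 1 <= occ sig I u x).

Lemma cnt_le b s i j : (i <= j)%N -> (cnt b s i <= cnt b s j)%N.
Proof.
move=> ij; rewrite -(subnKC ij); elim: (j - i)%N => [|k IH]; first by rewrite addn0.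
by rewrite addnS /=; lia.
Qed.

Lemma cnt12_le s j : (cnt 1 s j + cnt 2 s j <= j)%N.
Proof. by elim: j => //= j IH; lia. Qed.

Lemma cnt_incr b (I : stacks) u x y :
  cnt b (I y) (incr u x y) = (cnt b (I y) (u y) + (y == x) * (I x (u x) == b))%N.
Proof. by rewrite /incr; case: eqP => [->|_] //=; rewrite ?mul1n ?mul0n ?addn0. Qed.

Lemma occ_incr sig I u x y : occ sig I (incr u x) y = occ sig I u y
  + ((y == x + 1) && (I x (u x) == 2%N))%:R + ((y == x - 1) && (I x (u x) == 1%N))%:R
  - ((y == x) && ((I x (u x) == 1%N) || (I x (u x) == 2%N)))%:R.
Proof.
rewrite /occ !cnt_incr -!mulnb.
have -> : (y - 1 == x) = (y == x + 1) by lia.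
have -> : (y + 1 == x) = (y == x - 1) by lia.
case: (y == x + 1); case: (y == x - 1); case: (y == x) => /=;
case: (eqVneq (I x (u x)) 1%N) => [->|_] /=; case: (I x (u x) == 2%N) => /=; lia.
Qed.

Lemma awake_stP sig I u x : (0 < awake (st sig I u x))%N ->
  awake (st sig I u x) = `|occ sig I u x|%N /\
  ~~ [&& occ sig I u x == 1, (0 < u x)%N & is_sleep (I x (u x).-1)].
Proof. by rewrite /st; case: ifP. Qed.

Lemma occ_gt0 sig I u x : legal sig I u -> (0 < awake (st sig I u x))%N ->
  st sig I u x = Awake `|occ sig I u x|%N /\ 1 <= occ sig I u x.
Proof.
move=> lu; have [p0 _] := lu x; rewrite /st; case: ifP => //= _ h; split=> //.
by rewrite -gtz0_ge1 lt_def p0 andbT -absz_gt0.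
Qed.

Lemma legal_incr sig I u x : legal sig I u -> (0 < awake (st sig I u x))%N ->
  legal sig I (incr u x).
Proof.
move=> lu /(occ_gt0 lu)[_ ogx] y; rewrite occ_incr.
have [py sy] := lu y; rewrite /incr.
case: (eqVneq y x) => [yx|yx] /=; last first.
  case: (_ && _); case: (_ && _) => /=; rewrite subr0; split; try (move=> uy sl; have := sy uy sl);
  clear -py; lia.
rewrite yx in py sy *; clear yx.
have -> : (x == x + 1) = false by lia.
have -> : (x == x - 1) = false by lia.
rewrite /= !addr0 /is_sleep.
case: (I x (u x) == 1%N); case: (I x (u x) == 2%N) => /=; clear -ogx; split; lia.
Qed.

Lemma st_arrive sig I u u' y : legal sig I u -> u' y = u y ->
  occ sig I u' y = occ sig I u y + 1 -> st sig I u' y = arrive (st sig I u y).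
Proof.
move=> lu uu oo; have [p0 sy] := lu y; rewrite /st oo uu.
case: (eqVneq (occ sig I u y) 1) => [eo1|eo1] /=.
  by rewrite eo1 /=; case: ifP => _ //=.
case: (eqVneq (occ sig I u y) 0) => [ez|ez]; last first.
  have -> : (occ sig I u y + 1 == 1) = false by clear -ez; lia.
  by rewrite /=; congr Awake; clear -p0; lia.
rewrite ez /= in sy *; case: ifP => //= /andP[uy sl].
by have := sy uy sl; rewrite ler10.
Qed.

Lemma st_incr sig I u x : legal sig I u -> (0 < awake (st sig I u x))%N ->
  st sig I (incr u x) = app (I x (u x)) x (st sig I u).
Proof.
move=> lu /(occ_gt0 lu)[stx ogx]; apply/funext => y.
have oe := occ_incr sig I u x y.
have x1 : (x == x + 1) = false by lia.
have x2 : (x == x - 1) = false by lia.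
case: (eqVneq y x) => [yx|yx].
  rewrite yx x1 x2 eqxx /= addr0 in oe *; rewrite /app.
  case: (eqVneq (I x (u x)) 1%N) => [e1|n1].
    rewrite e1 /= addr0 in oe; rewrite /jump /set_site eqxx x2 stx /st oe /incr eqxx /= e1 /= andbF.
    by congr Awake; clear -ogx; lia.
  case: (eqVneq (I x (u x)) 2%N) => [e2|n2].
    rewrite e2 /= addr0 in oe; rewrite /jump /set_site eqxx x1 stx /st oe /incr eqxx /= e2 /= andbF.
    by congr Awake; clear -ogx; lia.
  rewrite (negbTE n1) (negbTE n2) /= subr0 addr0 in oe.
  rewrite [LHS]/st oe {1 2}/incr eqxx /= /is_sleep n1 n2 /= andbT stx.
  case: (eqVneq (occ sig I u x) 1) => [->|no]; first by rewrite /= /set_site eqxx.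
  have : (`|occ sig I u x| != 1)%N by clear -ogx no; lia.
  by move: stx; case: `|occ sig I u x|%N => [|[|k]].
have same : (y == x + 1) && (I x (u x) == 2%N) = false ->
    (y == x - 1) && (I x (u x) == 1%N) = false -> st sig I (incr u x) y = st sig I u y.
  by move=> e1 e2; move: oe; rewrite e1 e2 (negbTE yx) /= !addr0 => oe; rewrite /st oe /incr (negbTE yx).
have arr : (y == x + 1) && (I x (u x) == 2%N) (+) ((y == x - 1) && (I x (u x) == 1%N)) ->
    st sig I (incr u x) y = arrive (st sig I u y).
  move=> h; apply: st_arrive => //; first by rewrite /incr (negbTE yx).
  move: oe h; rewrite (negbTE yx).
  by case: (_ && _); case: (_ && _) => //= -> _; rewrite ?subr0 ?addr0.
rewrite /app; case: (eqVneq (I x (u x)) 1%N) => [e1|n1].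
  rewrite e1 /= !andbF !andbT /= in same arr; rewrite /jump /set_site (negbTE yx).
  rewrite (eq_sym _ x) x2.
  by case: eqP => [yx1|/eqP/negbTE yx1]; [rewrite -yx1 arr ?yx1 ?eqxx //|rewrite same].
case: (eqVneq (I x (u x)) 2%N) => [e2|n2].
  rewrite e2 /= !andbF !andbT /= ?addbF in same arr; rewrite /jump /set_site (negbTE yx).
  rewrite (eq_sym _ x) x1.
  by case: eqP => [yx1|/eqP/negbTE yx1]; [rewrite -yx1 arr ?yx1 ?eqxx //|rewrite same].
rewrite same ?(negbTE n1) ?(negbTE n2) ?andbF //.
by rewrite -/(st sig I u x) stx; case: `|occ sig I u x|%N => [|[|k]]; rewrite // /set_site (negbTE yx).
Qed.

(* If the two odometers agree at [x], the system with more arrivals at [x] is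
   at least as active there: it can only be asleep if the other one is. *)
Lemma st_mono sig sig' I u u' x : (forall y, sig y <= sig' y)%N ->
  legal sig I u -> legal sig' I u' ->
  (forall y, u y <= u' y)%N -> u x = u' x ->
  (awake (st sig I u x) <= awake (st sig' I u' x))%N.
Proof.
move=> lsig lu lu' uu' ux.
have oo : occ sig I u x <= occ sig' I u' x.
  rewrite /occ ux; have := lsig x.
  have := cnt_le 2 (I (x - 1)) (uu' (x - 1)); have := cnt_le 1 (I (x + 1)) (uu' (x + 1)); lia.
have [p0 _] := lu x; have [p0' _] := lu' x.
case: (posnP (awake (st sig I u x))) => [->//|/awake_stP[-> ns]].
rewrite /st; case: ifP => /= h; last lia.
case/and3P: h ns => /eqP o1; rewrite -ux => u0 sl; rewrite u0 sl !andbT; lia.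
Qed.

(* The odometer need not be legal, and negative occupations are allowed. *)
Definition stabilizes (V : set int) sig (I : stacks) (U : odometer) : Prop :=
  forall x, V x -> occ sig I U x <= 0 \/
    [/\ occ sig I U x = 1, (0 < U x)%N & is_sleep (I x (U x).-1)].

(** If one more toppling at [x] exceeded [U], the two odometers would agree at [x], while under [u]
    the neighbours have sent no more particles to [x]. Then the occupation of [x] is at most that
    under [U], and neither alternative of [stabilizes] leaves [x] active. *)
Lemma least_action V sig I U u x : stabilizes V sig I U -> legal sig I u ->
  (forall y, u y <= U y)%N -> V x -> (0 < awake (st sig I u x))%N ->
  (forall y, incr u x y <= U y)%N.
Proof.
move=> SU lu uU Vx /[dup] aw /awake_stP[awE nsl] y; rewrite /incr.
case: eqP => [->|_]; last exact: uU.
rewrite ltn_neqAle uU andbT; apply/negP => /eqP ux.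
have [p0 _] := lu x.
have oo : occ sig I u x <= occ sig I U x.
  rewrite /occ ux.
  have := cnt_le 2 (I (x - 1)) (uU (x - 1)); have := cnt_le 1 (I (x + 1)) (uU (x + 1)); lia.
case: (SU x Vx) => [|[p1 U0 sl]]; first by lia.
move: nsl; rewrite ux U0 sl !andbT; lia.
Qed.

(* [(true, x, j)] is the clock of the site [x] at step [j], [(false, x, l)] its
   [l]-th instruction.  The clock is uniform in [{0, ..., kap - 1}] and the site
   topples if it is less than its number of active particles, so a step lasts
   [1 / ((1 + lam) kap)] units of time. *)
Definition coord := (bool * int * nat)%type.
Definition stack_of (om : coord -> nat) : stacks := fun x l => om (false, x, l).
Definition state := (odometer * config)%type.

Definition step (om : coord -> nat) (V : pred int) (a : int * nat) (s : state) : state :=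
  if V a.1 && (om (true, a.1, a.2) < awake (s.2 a.1))%N
  then (incr s.1 a.1, app (om (false, a.1, s.1 a.1)) a.1 s.2) else s.

Fixpoint run om V (as_ : seq (int * nat)) (s : state) : state :=
  if as_ is a :: r then run om V r (step om V a s) else s.

Definition conf (sig : int -> nat) : config := fun x => Awake (sig x).
Definition start sig : state := ((fun _ => 0%N), conf sig).

Lemma run_cat om V r1 r2 s : run om V (r1 ++ r2) s = run om V r2 (run om V r1 s).
Proof. by elim: r1 s => //= a r IH s. Qed.

Lemma run_filter om (V W : pred int) as_ s : (forall x, V x -> W x) ->
  run om V [seq a <- as_ | W a.1] s = run om V as_ s.
Proof.
move=> VW; elim: as_ s => //= a r IH s; case: ifP => /= Wa; first exact: IH.
rewrite IH /step; case Va: (V a.1) => //=; by rewrite (VW _ Va) in Wa.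
Qed.

(** The configuration carried along by a run is the one computed from its odometer. Comparisons
    between runs therefore reduce to comparisons of odometers and occupations. *)
Definition consistent sig om (s : state) :=
  legal sig (stack_of om) s.1 /\ s.2 = st sig (stack_of om) s.1.

Lemma consistent_start sig om : consistent sig om (start sig).
Proof.
split=> [x|] /=; first by split=> //; rewrite /occ /=; lia.
by apply/funext => x; rewrite /st /= andbF /conf; congr Awake; rewrite /occ /=; lia.
Qed.

Lemma consistent_step sig om V a s : consistent sig om s -> consistent sig om (step om V a s).
Proof.
case=> l E; rewrite /step; case: ifP => // /andP[_ lt]; rewrite E in lt *.
have aw : (0 < awake (st sig (stack_of om) s.1 a.1))%N by apply: leq_ltn_trans lt.
by split=> /=; [exact: legal_incr|rewrite -st_incr].
Qed.

Lemma consistent_run sig om V as_ s : consistent sig om s -> consistent sig om (run om V as_ s).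
Proof. by elim: as_ s => //= a r IH s c; apply/IH/consistent_step. Qed.

Lemma run_le om V as_ s y : (s.1 y <= (run om V as_ s).1 y)%N.
Proof.
elim: as_ s => //= a r IH s; apply: leq_trans (IH _); rewrite /step.
by case: ifP => //= _; rewrite /incr; case: ifP.
Qed.

(** Attractiveness of the coupling by common clocks and stacks. A toppling in the smaller system
    could break the order only at a site where the odometers agree; there [st_mono] gives the larger
    system at least as many active particles, so the same clock makes it topple as well. *)
Lemma run_mono om (V V' : pred int) sig sig' as_ s s' : (forall x, V x -> V' x) ->
  (forall y, sig y <= sig' y)%N -> consistent sig om s -> consistent sig' om s' ->
  (forall y, s.1 y <= s'.1 y)%N ->
  (forall y, (run om V as_ s).1 y <= (run om V' as_ s').1 y)%N.
Proof.
move=> VV ss; elim: as_ s s' => //= a r IH s s' c c' uu y.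
apply: IH => //; try exact: consistent_step; move=> z.
rewrite /step; case: ifP => [/andP[Va lt]|_]; last first.
  by case: ifP => _ //=; rewrite /incr; case: ifP => // _; apply: leqW.
rewrite (VV _ Va) /=; case: ifP => /= lt'.
  by rewrite /incr; case: ifP => // _; rewrite ltnS.
rewrite /incr; case: eqP => [->|//].
rewrite ltn_neqAle uu andbT; apply/negP => /eqP e.
case: c c' lt lt' => l -> [l' ->] lt /negP; apply.
by apply: leq_trans lt _; apply: st_mono.
Qed.

Lemma run_stabilizes om (V : pred int) sig U as_ s : stabilizes [set` V] sig (stack_of om) U ->
  consistent sig om s -> (forall y, s.1 y <= U y)%N ->
  (forall y, (run om V as_ s).1 y <= U y)%N.
Proof.
move=> SU; elim: as_ s => //= a r IH s c uU; apply: IH; first exact: consistent_step.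
rewrite /step; case: ifP => //= /andP[Va lt] y.
case: c lt => l -> lt; apply: least_action SU l uU Va _ y.
exact: leq_ltn_trans lt.
Qed.

(** * Finite expectations *)

Section Expectation.
Context (R : realType) (K : eqType) (D : K -> nat) (wt : K -> nat -> R).
Hypothesis wt_ge0 : forall c i, 0 <= wt c i.
Hypothesis wt_sum : forall c, \sum_(i < D c) wt c i = 1.

Definition upd (om : K -> nat) (c : K) (i : nat) : K -> nat :=
  fun c' => if c' == c then i else om c'.

Lemma upd_upd om c i j : upd (upd om c i) c j = upd om c j.
Proof. by apply/funext => c'; rewrite /upd; case: eqP. Qed.

Lemma updC om c c' i j : c != c' -> upd (upd om c i) c' j = upd (upd om c' j) c i.
Proof.
move=> cc; apply/funext => d; rewrite /upd; case: eqP => [->|_] //.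
by rewrite eq_sym (negbTE cc).
Qed.

(* [om] supplies the coordinates outside [cs]. *)
Fixpoint E (cs : seq K) (f : (K -> nat) -> R) (om : K -> nat) : R :=
  if cs is c :: r then \sum_(i < D c) wt c i * E r f (upd om c i) else f om.

Lemma eq_E cs f g om : (forall om, f om = g om) -> E cs f om = E cs g om.
Proof. by move=> fg; congr (E cs _ om); apply/funext. Qed.

Lemma E_le cs f g om : (forall om, f om <= g om) -> E cs f om <= E cs g om.
Proof.
move=> fg; elim: cs om => //= c r IH om.
by apply: ler_sum => i _; apply: ler_wpM2l.
Qed.

Lemma E_D cs f g om : E cs (fun om => f om + g om) om = E cs f om + E cs g om.
Proof.
elim: cs om => //= c r IH om; rewrite -big_split /=.
by apply: eq_bigr => i _; rewrite IH mulrDr.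
Qed.

Lemma E_Z cs a f om : E cs (fun om => a * f om) om = a * E cs f om.
Proof.
elim: cs om => //= c r IH om; rewrite mulr_sumr.
by apply: eq_bigr => i _; rewrite IH mulrCA.
Qed.

Lemma E_cst cs a om : E cs (fun=> a) om = a.
Proof.
elim: cs om => //= c r IH om.
by under eq_bigr do rewrite IH; rewrite -mulr_suml wt_sum mul1r.
Qed.

Lemma E_sum cs (I : Type) (r : seq I) (P : pred I) (F : I -> (K -> nat) -> R) om :
  E cs (fun om => \sum_(i <- r | P i) F i om) om = \sum_(i <- r | P i) E cs (F i) om.
Proof.
elim: r => [|i r IH].
  by rewrite big_nil (@eq_E _ _ (fun=> 0)) ?E_cst// => o; rewrite big_nil.
rewrite big_cons -IH; case: ifP => Pi.
  by rewrite -E_D; apply: eq_E => o; rewrite big_cons Pi.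
by apply: eq_E => o; rewrite big_cons Pi.
Qed.

Lemma E_upd cs f om c i : c \notin cs -> E cs f (upd om c i) = E cs (fun o => f (upd o c i)) om.
Proof.
elim: cs om => //= c' r IH om; rewrite inE negb_or => /andP[cc cr].
by apply: eq_bigr => j _; rewrite updC// IH.
Qed.

(** Fubini for the iterated finite sums. It lets a coordinate be revealed at the moment when the run
    reaches it, although its position in [cs] was fixed in advance. *)
Lemma E_cond cs f om c : uniq cs -> c \in cs ->
  E cs f om = \sum_(i < D c) wt c i * E cs (fun o => f (upd o c i)) om.
Proof.
elim: cs om => //= c' r IH om /andP[cr ur]; rewrite inE.
have [e _|cc /= cin] := eqVneq c c'.
  subst c'.
  apply: eq_bigr => i _; congr (_ * _).
  under eq_bigr do rewrite -(E_upd _ _ _ cr) upd_upd.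
  by rewrite -mulr_suml wt_sum mul1r.
under eq_bigr do rewrite IH//.
rewrite (eq_bigr (fun i : 'I_(D c') => \sum_(j < D c)
   wt c j * (wt c' i * E r (fun o => f (upd o c j)) (upd om c' i)))); last first.
  by move=> i _; rewrite mulr_sumr; apply: eq_bigr => j _; rewrite mulrCA.
by rewrite exchange_big /=; apply: eq_bigr => j _; rewrite mulr_sumr.
Qed.

End Expectation.

(** * Particle numbers and weighted particle numbers *)

Definition num (a : site_state) : nat := if a is Awake k then k else 1%N.

Lemma awake_num a : (awake a <= num a)%N.
Proof. by case: a. Qed.

Lemma num_jump eta x z y : (0 < awake (eta x))%N -> z != x ->
  (num (jump eta x z y) + (y == x) = num (eta y) + (y == z))%N.
Proof.
move=> aw zx; rewrite /jump /set_site (negbTE zx).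
have [->|yz] := eqVneq y z; first by rewrite (negbTE zx); case: (eta z) => //= k; lia.
have [->|yx] := eqVneq y x; last by rewrite !addn0.
by case: (eta x) aw => //= k; lia.
Qed.

Lemma num_sleep (eta : config) x y :
  num ((if eta x is Awake 1 then set_site eta x Asleep else eta) y) = num (eta y).
Proof.
case E: (eta x) => [|[|[|k]]] //; rewrite /set_site; case: eqP => [->|//].
by rewrite E.
Qed.

Section Potential.
Context (R : numDomainType) (wgt : int -> R) (vs : seq int).
Hypothesis vs_uniq : uniq vs.

Definition pot (eta : config) : R := \sum_(y <- vs) wgt y * (num (eta y))%:R.

Let ind z : \sum_(y <- vs) wgt y * (y == z)%:R = if z \in vs then wgt z else 0.
Proof.
case: ifP => zv.
  rewrite (bigD1_seq z) //= eqxx mulr1 big1 ?addr0// => y /negbTE ->.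
  by rewrite mulr0.
rewrite big_seq big1 // => y yv; case: eqP => [e|_]; last by rewrite mulr0.
by rewrite -e yv in zv.
Qed.

Lemma pot_jump eta x z : (0 < awake (eta x))%N -> z != x ->
  pot (jump eta x z) = pot eta - (if x \in vs then wgt x else 0) + (if z \in vs then wgt z else 0).
Proof.
move=> aw zx; apply/eqP; rewrite -(inj_eq (addIr (if x \in vs then wgt x else 0))) addrAC subrK; apply/eqP.
rewrite -!ind -!big_split /=.
apply: eq_bigr => y _; rewrite -!mulrDr; congr (_ * _).
by rewrite -!natrD (num_jump _ aw zx).
Qed.

Lemma pot_sleep (eta : config) x :
  pot (if eta x is Awake 1 then set_site eta x Asleep else eta) = pot eta.
Proof. by apply: eq_bigr => y _; rewrite num_sleep. Qed.

Lemma pot_app i eta x : (0 < awake (eta x))%N -> pot (app i x eta) =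
  if i == 1%N then pot eta - (if x \in vs then wgt x else 0) + (if x - 1 \in vs then wgt (x - 1) else 0)
  else if i == 2%N then pot eta - (if x \in vs then wgt x else 0) + (if x + 1 \in vs then wgt (x + 1) else 0)
  else pot eta.
Proof.
move=> aw; rewrite /app; case: ifP => _; first by rewrite pot_jump //; lia.
by case: ifP => _; [rewrite pot_jump //; lia|rewrite pot_sleep].
Qed.

End Potential.

Definition num_on (vs : seq int) (eta : config) : nat := (\sum_(y <- vs) num (eta y))%N.

Lemma num_on_mem vs eta x : x \in vs -> (num (eta x) <= num_on vs eta)%N.
Proof. by move=> xv; rewrite /num_on (big_rem x) //= leq_addr. Qed.

Lemma num_on_app vs i x eta : uniq vs -> x \in vs -> (0 < awake (eta x))%N ->
  (num_on vs (app i x eta) <= num_on vs eta)%N.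
Proof.
move=> uv xv aw.
have pE e : pot (fun=> (1 : rat)) vs e = (num_on vs e)%:R.
  by rewrite /num_on natr_sum; apply: eq_bigr => y _; rewrite mul1r.
rewrite -(ler_nat rat) -!pE pot_app // xv.
by do ?case: ifP => _ //; rewrite ?subrK// ?addr0 lerBlDr ler_wpDr.
Qed.

(** * Expectations of runs as iterated averages *)

Section Chain.
Context (R : realType) (lam : R) (kap : nat).
Hypothesis lam_gt0 : 0 < lam.
Hypothesis kap_gt0 : (0 < kap)%N.

Definition letters (c : coord) : nat := if c.1.1 then kap else 3.

(** Letter 0 is the sleep instruction. Each active particle uses instructions at rate [1 + lam], of
    which a jump to a given side takes 1/2 and a sleep [lam]. *)
Definition iw (i : nat) : R :=
  if (i == 1%N) || (i == 2%N) then (2 * (1 + lam))^-1 else lam / (1 + lam).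

Definition cw (c : coord) (i : nat) : R := if c.1.1 then kap%:R^-1 else iw i.

Lemma iw_ge0 i : 0 <= iw i.
Proof.
have l1 : 0 <= 1 + lam by rewrite addr_ge0// ltW.
by rewrite /iw; case: ifP => _; rewrite ?invr_ge0 ?divr_ge0 ?mulr_ge0// ltW.
Qed.

Lemma iw_sum : \sum_(i < 3) iw i = 1.
Proof.
rewrite !big_ord_recl big_ord0 /iw /=.
by have h : 1 + lam != 0; [rewrite gt_eqF// addr_gt0|field].
Qed.

Lemma cw_ge0 c i : 0 <= cw c i.
Proof. by rewrite /cw; case: ifP => _; rewrite ?invr_ge0// iw_ge0. Qed.

Lemma cw_sum c : \sum_(i < letters c) cw c i = 1.
Proof.
rewrite /letters /cw; case: ifP => _; last exact: iw_sum.
by rewrite sumr_const card_ord -[_ *+ _]mulr_natl divff// pnatr_eq0 -lt0n.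
Qed.

Notation E := (E letters cw).

Definition avg (f : state -> R) (x : int) (s : state) : R :=
  \sum_(i < 3) iw i * f (incr s.1 x, app i x s.2).

Definition attempt_at (vs : seq int) (x : int) (f : state -> R) (s : state) : R :=
  f s + (if x \in vs then (awake (s.2 x))%:R / kap%:R * (avg f x s - f s) else 0).

Fixpoint tree (vs : seq int) (as_ : seq (int * nat)) (f : state -> R) (s : state) : R :=
  if as_ is a :: r then attempt_at vs a.1 (tree vs r f) s else f s.

Lemma tick_avg k (A B : R) : (k <= kap)%N ->
  \sum_(l < kap) kap%:R^-1 * (if (l < k)%N then A else B) = B + k%:R / kap%:R * (A - B).
Proof.
move=> kk; have kn : kap%:R != 0 :> R by rewrite pnatr_eq0 -lt0n.
rewrite (eq_bigr (fun l : 'I_kap => kap%:R^-1 * B + kap%:R^-1 * (A - B) * (l < k)%N%:R)); last first.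
  by move=> l _; case: ifP => _ /=; ring.
rewrite big_split /= sumr_const card_ord -[_ *+ _]mulr_natl mulrA divff// mul1r -mulr_sumr.
congr (_ + _).
suff h N : (\sum_(l < N) (l < k) = minn k N)%N.
  by rewrite -natr_sum h (minn_idPl kk); ring.
by elim: N => [|N IH]; rewrite ?big_ord0 ?minn0// big_ord_recr /= IH; lia.
Qed.

Lemma step_upd om c i vs a s :
  c != (true, a.1, a.2) -> c != (false, a.1, s.1 a.1) ->
  step (upd om c i) vs a s = step om vs a s.
Proof. by move=> h1 h2; rewrite /step /upd eq_sym (negbTE h1) eq_sym (negbTE h2). Qed.

Lemma run_upd_tick om vs as_ s x j i : (x, j) \notin as_ ->
  run (upd om (true, x, j) i) vs as_ s = run om vs as_ s.
Proof.
elim: as_ s => //= a r IH s; rewrite inE negb_or => /andP[ax ar].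
rewrite step_upd ?IH//; apply: contra ax; case: a => [y k] /eqP[-> ->] //.
Qed.

Lemma run_upd_stack om vs as_ s x l i : (l < s.1 x)%N ->
  run (upd om (false, x, l) i) vs as_ s = run om vs as_ s.
Proof.
elim: as_ s => //= a r IH s lx; rewrite step_upd ?IH//.
  apply: leq_trans lx _; rewrite /step; case: ifP => //= _; rewrite /incr; case: ifP => // _.
by apply/negP => /eqP[xa la]; move: lx; rewrite la -xa ltnn.
Qed.

(** The Markov property. An attempt reads a clock that no other attempt reads and, if the site
    topples, an instruction that has not been used; conditioning on these two coordinates turns the
    expectation into the recursion [tree]. The continuation [C] may go on reading [om], provided
    that it ignores the clocks of [as_] and the instructions below the odometer. [B] bounds the
    depth reached in the stacks, and the bound [kap] on the number of particles keeps the toppling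
    probabilities at most 1. *)
Lemma run_tree cs vs as_ (C : (coord -> nat) -> state -> R) (c : state -> R) B om s :
  uniq cs -> uniq vs -> uniq as_ -> (forall a, a \in as_ -> (true, a.1, a.2) \in cs) ->
  (forall x l, x \in vs -> (l < B)%N -> (false, x, l) \in cs) ->
  (forall x, x \in vs -> s.1 x + size as_ <= B)%N -> (num_on vs s.2 <= kap)%N ->
  (forall a om i s', a \in as_ -> C (upd om (true, a.1, a.2) i) s' = C om s') ->
  (forall x l om i s', x \in vs -> (l < s'.1 x)%N -> C (upd om (false, x, l) i) s' = C om s') ->
  (forall s' om, (forall x, x \in vs -> s'.1 x <= B)%N -> (num_on vs s'.2 <= num_on vs s.2)%N ->
     E cs (C^~ s') om = c s') ->
  E cs (fun om => C om (run om (mem vs) as_ s)) om = tree vs as_ c s.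
Proof.
move=> ucs uvs uas tin sin; elim: as_ s uas tin => [|a r IH] s.
  by move=> _ _ sB nk _ _ Cv /=; apply: Cv => // x /sB; rewrite addn0.
rewrite [uniq _]/= => /andP[ar ur] tin sB nk Ct Cs Cv.
have tin' b : b \in r -> (true, b.1, b.2) \in cs by move=> br; apply: tin; rewrite inE br orbT.
have Ct' b om' i s' : b \in r -> C (upd om' (true, b.1, b.2) i) s' = C om' s'.
  by move=> br; apply: Ct; rewrite inE br orbT.
rewrite (E_cond cw_sum _ _ ucs (tin _ (mem_head _ _))) /=.
set c0 := (true, a.1, a.2).
have toppled : a.1 \in vs -> (0 < awake (s.2 a.1))%N ->
    E cs (fun o => C o (run o (mem vs) r (incr s.1 a.1, app (o (false, a.1, s.1 a.1)) a.1 s.2))) om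
    = avg (tree vs r c) a.1 s.
  move=> av aw; rewrite (@E_cond _ _ _ _ cw_sum _ _ om (false, a.1, s.1 a.1)) //; last first.
    by apply: sin => //; have := sB _ av => /=; lia.
  rewrite /letters /cw /avg /=; apply: eq_bigr => i _; congr (_ * _).
  set s' := (incr s.1 a.1, app i a.1 s.2).
  have nn : (num_on vs s'.2 <= num_on vs s.2)%N by apply: num_on_app.
  rewrite -(IH s') //.
  - apply: eq_E => o; rewrite /upd eqxx run_upd_stack; last by rewrite /= /incr eqxx.
    by rewrite -/(upd o (false, a.1, s.1 a.1) i) Cs //;
       apply: leq_trans (run_le _ _ _ _ _); rewrite /= /incr eqxx.
  - by move=> x xv; rewrite /s' /incr /=; have := sB x xv; clear => /=; case: ifP => _; lia.
  - exact: leq_trans nn nk.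
  - by move=> s1 o h1 h2; apply: Cv => //; apply: leq_trans h2 nn.
have still : E cs (fun o => C o (run o (mem vs) r s)) om = tree vs r c s.
  by apply: IH => // x xv; have := sB x xv => /=; lia.
rewrite /attempt_at -still.
case: (boolP (a.1 \in vs)) => av; last first.
  rewrite addr0 (eq_bigr (fun l : 'I_(letters c0) => cw c0 l * E cs (fun o => C o (run o (mem vs) r s)) om)).
    by rewrite -mulr_suml cw_sum mul1r.
  move=> l _; congr (_ * _); apply: eq_E => o.
  by rewrite /step /= (negbTE av) /= run_upd_tick -?surjective_pairing // /c0 Ct // mem_head.
have awk : (awake (s.2 a.1) <= kap)%N.
  by apply: leq_trans (awake_num _) _; apply: leq_trans (num_on_mem _ av) nk.
case: (posnP (awake (s.2 a.1))) => [aw0|aw].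
  rewrite aw0 !mul0r addr0 (eq_bigr (fun l : 'I_(letters c0) => cw c0 l * E cs (fun o => C o (run o (mem vs) r s)) om)).
    by rewrite -mulr_suml cw_sum mul1r.
  move=> l _; congr (_ * _); apply: eq_E => o.
  by rewrite /step /= aw0 ltn0 andbF run_upd_tick -?surjective_pairing // /c0 Ct // mem_head.
rewrite -toppled // -tick_avg //; apply: eq_bigr => l _; congr (_ * _).
have tk (o : coord -> nat) : upd o c0 l (true, a.1, a.2) = l by rewrite /upd eqxx.
case: ifP => la; (apply: eq_E => o); rewrite /step /= av tk la /=.
  by rewrite run_upd_tick -?surjective_pairing // Ct ?mem_head // /upd.
by rewrite run_upd_tick -?surjective_pairing // /c0 Ct // mem_head.
Qed.

End Chain.

(** * Discretization of the semigroup *)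

Section Generator.
Context (R : realType) (lam : R).
Hypothesis lam_gt0 : 0 < lam.
Implicit Types (f h : config -> R) (eta : config) (x : int) (vs xs : seq int).

Let iw0 := iw_ge0 lam_gt0.
Let iw1 := iw_sum lam_gt0.

Definition rate x f eta : R :=
  (awake (eta x))%:R * (\sum_(i < 3) iw lam i * f (app i x eta) - f eta).

Definition rates vs f eta : R := \sum_(x <- vs) rate x f eta.

Lemma rate_lin x f h a eta : rate x (fun e => f e + a * h e) eta = rate x f eta + a * rate x h eta.
Proof.
rewrite /rate (eq_bigr (fun i : 'I_3 => iw lam i * f (app i x eta) + a * (iw lam i * h (app i x eta)))).
  by rewrite big_split /= -mulr_sumr; ring.
by move=> i _; ring.
Qed.

Lemma rates_lin vs f h a eta :
  rates vs (fun e => f e + a * h e) eta = rates vs f eta + a * rates vs h eta.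
Proof.
rewrite /rates mulr_sumr -big_split; apply: eq_bigr => x _ /=; exact: rate_lin.
Qed.

(** A sleep instruction has no effect on two or more particles, and a lone active particle uses one
    at rate [lam]. Letting every active particle use instructions at rate [1 + lam] thus reproduces
    the generator. *)
Lemma rate_generator x f eta :
  (awake (eta x))%:R * (2^-1 * (f (jump eta x (x - 1)) - f eta)
     + 2^-1 * (f (jump eta x (x + 1)) - f eta))
  + (if eta x is Awake 1 then lam * (f (set_site eta x Asleep) - f eta) else 0)
  = (1 + lam) * rate x f eta.
Proof.
have l1 : 1 + lam != 0 by rewrite gt_eqF// addr_gt0.
rewrite /rate !big_ord_recl big_ord0 /iw /app /=.
by case: (eta x) => [|[|[|k]]] /=; field.
Qed.

Lemma generator_rates vs f eta : uniq vs ->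
  generator [set` vs] lam f eta = (1 + lam) * rates vs f eta.
Proof.
move=> uv; rewrite /generator -fsbig_seq// /rates mulr_sumr.
by apply: eq_bigr => x _; rewrite rate_generator.
Qed.

Lemma iter_generator vs f eta k : uniq vs ->
  iter k (generator [set` vs] lam) f eta = (1 + lam) ^+ k * iter k (rates vs) f eta.
Proof.
move=> uv; elim: k eta => [|k IH] eta; first by rewrite mul1r.
rewrite iterS generator_rates// exprS -mulrA; congr (_ * _).
rewrite iterS /rates mulr_sumr; apply: eq_bigr => x _.
have -> : iter k (generator [set` vs] lam) f =
    fun e => 0 + (1 + lam) ^+ k * iter k (rates vs) f e by apply/funext => e; rewrite IH add0r.
by rewrite (rate_lin _ (fun=> 0)) /rate big1 ?subrr ?mulr0 ?add0r// => i _; rewrite mulr0.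
Qed.

Section Bounds.
Context (vs : seq int) (N : nat).
Hypothesis vs_uniq : uniq vs.

Definition few eta : Prop := (num_on vs eta <= N)%N.
(** Bounds are asked for only on configurations with at most [N] particles in [vs]: the rates are
    unbounded otherwise, and by [few_app] the dynamics does not leave this set. *)
Definition bounded_by b f := forall eta, few eta -> `|f eta| <= b.

Lemma few_app i x eta : x \in vs -> (0 < awake (eta x))%N -> few eta -> few (app i x eta).
Proof. by move=> xv aw; apply: leq_trans; apply: num_on_app. Qed.

Lemma avg_le b f x eta : bounded_by b f -> few eta -> x \in vs -> (0 < awake (eta x))%N ->
  `|\sum_(i < 3) iw lam i * f (app i x eta)| <= b.
Proof.
move=> fb fe xv aw; apply: le_trans (ler_norm_sum _ _ _) _.
have -> : b = \sum_(i < 3) iw lam i * b by rewrite -mulr_suml iw1 mul1r.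
apply: ler_sum => i _; rewrite normrM (ger0_norm (iw0 _)).
by apply: ler_wpM2l => //; apply/fb/few_app.
Qed.

Lemma rate_le b f x eta : 0 <= b -> bounded_by b f -> few eta -> x \in vs ->
  `|rate x f eta| <= (awake (eta x))%:R * (2 * b).
Proof.
move=> b0 fb fe xv; case: (posnP (awake (eta x))) => [|aw].
  by rewrite /rate => ->; rewrite !mul0r normr0.
rewrite /rate normrM normr_nat ler_wpM2l//.
apply: le_trans (ler_normB _ _) _; rewrite mulr_natl mulr2n.
by apply: lerD; [exact: avg_le|exact: fb].
Qed.

Lemma rate_le' b f x : 0 <= b -> bounded_by b f -> x \in vs ->
  bounded_by (2 * N%:R * b) (rate x f).
Proof.
move=> b0 fb xv eta fe; apply: le_trans (rate_le b0 fb fe xv) _.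
rewrite (_ : 2 * N%:R * b = N%:R * (2 * b)); last by ring.
rewrite ler_wpM2r ?mulr_ge0// ler_nat.
by apply: leq_trans (awake_num _) _; apply: leq_trans fe; apply: num_on_mem.
Qed.

Lemma rates_le b f : 0 <= b -> bounded_by b f -> bounded_by (2 * N%:R * b) (rates vs f).
Proof.
move=> b0 fb eta fe; rewrite /rates; apply: le_trans (ler_norm_sum _ _ _) _.
apply: (@le_trans _ _ (\sum_(x <- vs) (num (eta x))%:R * (2 * b))).
  rewrite big_seq [leRHS]big_seq; apply: ler_sum => x xv.
  apply: le_trans (rate_le b0 fb fe xv) _.
  by rewrite ler_wpM2r ?mulr_ge0// ler_nat awake_num.
rewrite (_ : 2 * N%:R * b = N%:R * (2 * b)); last by ring.
by rewrite -mulr_suml -natr_sum ler_wpM2r ?mulr_ge0// ler_nat.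
Qed.

Lemma iter_rates_le b f k : 0 <= b -> bounded_by b f ->
  bounded_by ((2 * N%:R) ^+ k * b) (iter k (rates vs) f).
Proof.
move=> b0 fb; elim: k => [|k IH]; first by rewrite mul1r.
by rewrite exprS -mulrA; apply: rates_le => //; rewrite mulr_ge0// exprn_ge0// mulr_ge0.
Qed.

Definition qstep1 q x f eta := f eta + q * rate x f eta.
Definition qstep q xs f := foldr (qstep1 q) f xs.

Lemma qstep_sub q xs f h eta :
  qstep q xs (fun e => f e - h e) eta = qstep q xs f eta - qstep q xs h eta.
Proof.
elim: xs eta => //= x r IH eta; rewrite /qstep1.
have -> : qstep q r (fun e => f e - h e) = fun e => qstep q r f e + (-1) * qstep q r h e.
  by apply/funext => e; rewrite IH mulN1r.
by rewrite rate_lin; rewrite /qstep; ring.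
Qed.

Lemma qstep1_le q b x f : 0 <= q -> q * N%:R <= 1 -> x \in vs ->
  bounded_by b f -> bounded_by b (qstep1 q x f).
Proof.
move=> q0 qN xv fb eta fe; rewrite /qstep1 /rate.
case: (posnP (awake (eta x))) => [->|aw]; first by rewrite mul0r mulr0 addr0 fb.
set k := (awake _)%:R; set S := \sum_(i < _) _.
have -> : f eta + q * (k * (S - f eta)) = (1 - q * k) * f eta + q * k * S by ring.
have kN : q * k <= 1.
  apply: le_trans qN; rewrite ler_wpM2l// /k ler_nat.
  by apply: leq_trans (awake_num _) _; apply: leq_trans fe; apply: num_on_mem.
have qk : 0 <= q * k by rewrite mulr_ge0.
apply: le_trans (ler_normD _ _) _.
rewrite [X in X + _]normrM [X in _ + X]normrM (ger0_norm qk) [`|1 - _|]ger0_norm ?subr_ge0//.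
have := avg_le fb fe xv aw; have := fb _ fe; rewrite -/S => h1 h2.
have -> : b = (1 - q * k) * b + q * k * b by ring.
by apply: lerD; apply: ler_wpM2l; rewrite ?subr_ge0.
Qed.

Lemma qstep_le q b xs f : 0 <= q -> q * N%:R <= 1 -> {subset xs <= vs} ->
  bounded_by b f -> bounded_by b (qstep q xs f).
Proof.
move=> q0 qN; elim: xs => //= x r IH sub fb; apply: qstep1_le => //.
  by apply: sub; rewrite mem_head.
by apply: IH => // y yr; apply: sub; rewrite inE yr orbT.
Qed.

Lemma qstep_expand xs : {subset xs <= vs} -> exists2 c, 0 <= c &
  forall q b f, 0 <= q -> q <= 1 -> 0 <= b -> bounded_by b f ->
  bounded_by (c * q ^+ 2 * b) (fun eta => qstep q xs f eta - f eta - q * rates xs f eta).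
Proof.
elim: xs => [|x r IH] sub.
  exists 0 => // q b f _ _ _ _ eta _.
  by rewrite /rates big_nil mulr0 subr0 /= subrr normr0 !mul0r.
have xv : x \in vs by apply: sub; rewrite mem_head.
have {}sub : {subset r <= vs} by move=> y yr; apply: sub; rewrite inE yr orbT.
have [c c0 Hc] := IH sub; set g := 2 * N%:R : R.
have g0 : 0 <= g by rewrite mulr_ge0.
exists (c + g * ((size r)%:R * g) + g * c); first by rewrite !addr_ge0// !mulr_ge0.
move=> q b f q0 q1 b0 fb eta fe.
set e := fun eta => qstep q r f eta - f eta - q * rates r f eta.
have eb : bounded_by (c * q ^+ 2 * b) e by exact: Hc.
have Ab : bounded_by ((size r)%:R * g * b) (rates r f).
  move=> eta' fe'; apply: le_trans (ler_norm_sum _ _ _) _.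
  have -> : (size r)%:R * g * b = \sum_(y <- r) g * b.
    by rewrite big_const_seq count_predT iter_addr_0 -mulrA mulr_natl.
  rewrite big_seq [leRHS]big_seq; apply: ler_sum => y yr.
  exact: (rate_le' b0 fb (sub _ yr)).
have qE : qstep q r f = fun z => (f z + q * rates r f z) + 1 * e z.
  by apply/funext => z; rewrite /e; ring.
rewrite /= /qstep1 -/(qstep q r f) /rates big_cons -/(rates r f eta) qE rate_lin rate_lin.
have -> : f eta + q * rates r f eta + 1 * e eta + q * (rate x f eta + q * rate x (rates r f) eta
   + 1 * rate x e eta) - f eta - q * (rate x f eta + rates r f eta)
  = e eta + q ^+ 2 * rate x (rates r f) eta + q * rate x e eta by ring.
have qq : 0 <= q ^+ 2 by rewrite exprn_ge0.
have cb : 0 <= c * q ^+ 2 * b by rewrite !mulr_ge0.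
have sb : 0 <= (size r)%:R * g * b by rewrite !mulr_ge0.
have h1 := eb _ fe; have h2 := rate_le' sb Ab xv fe; have h3 := rate_le' cb eb xv fe.
apply: le_trans (ler_normD _ _) _; rewrite !mulrDl; apply: lerD.
  apply: le_trans (ler_normD _ _) _; apply: lerD => //.
  rewrite normrM (ger0_norm qq).
  have -> : g * ((size r)%:R * g) * q ^+ 2 * b = q ^+ 2 * (g * ((size r)%:R * g * b)) by ring.
  exact: ler_wpM2l.
rewrite normrM (ger0_norm q0); apply: (@le_trans _ _ (1 * `|rate x e eta|)).
  by rewrite ler_wpM2r.
by rewrite mul1r; apply: le_trans h3 _; rewrite /g !mulrA.
Qed.

Definition euler q f eta := f eta + q * rates vs f eta.

Lemma iter_rates_lin k f h a eta : iter k (rates vs) (fun e => f e + a * h e) eta =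
  iter k (rates vs) f eta + a * iter k (rates vs) h eta.
Proof.
elim: k eta => //= k IH eta; rewrite -rates_lin; congr (rates vs _ _).
exact/funext.
Qed.

(** The binomial theorem for powers of [1 + q * rates], to be compared term by term with the
    exponential series. *)
Lemma iter_euler J q f eta : iter J (euler q) f eta =
  \sum_(i < J.+1) 'C(J, i)%:R * q ^+ i * iter i (rates vs) f eta.
Proof.
elim: J f => [|J IH] f; first by rewrite big_ord1 /= !mul1r.
rewrite iterSr IH.
under eq_bigr => i _ do rewrite /euler iter_rates_lin -iterSr mulrDr.
rewrite big_split /= [RHS]big_ord_recl /= bin0 !mul1r.
rewrite [X in _ = _ + X](eq_bigr (fun i : 'I_J.+1 => 'C(J, i.+1)%:R * q ^+ i.+1 * iter i.+1 (rates vs) f eta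
   + 'C(J, i)%:R * q ^+ i * (q * iter i.+1 (rates vs) f eta)) ); last first.
  by move=> i _; rewrite ?/bump ?leq0n ?add1n binS natrD exprS /=; ring.
rewrite big_split /= addrA; congr (_ + _).
rewrite big_ord_recl /= bin0 !mul1r; congr (_ + _).
rewrite big_ord_recr /= bin_small ?mul0r ?addr0 //.
Qed.

Lemma euler_le q b f : 0 <= q -> 0 <= b -> bounded_by b f ->
  bounded_by ((1 + q * (2 * N%:R)) * b) (euler q f).
Proof.
move=> q0 b0 fb eta fe; apply: le_trans (ler_normD _ _) _.
rewrite mulrDl mul1r; apply: lerD; first exact: fb.
rewrite normrM (ger0_norm q0) -mulrA ler_wpM2l//; exact: (rates_le b0 fb).
Qed.

(** Telescoping: an error once made is not amplified by further sweeps, by [qstep_le], and each of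
    the [J] steps adds the second-order error of [qstep_expand] at an Euler iterate. *)
Lemma qstep_euler : exists2 c, 0 <= c & forall q b f J, 0 <= q -> q <= 1 -> q * N%:R <= 1 -> 0 <= b ->
  bounded_by b f ->
  bounded_by (J%:R * c * q ^+ 2 * (1 + q * (2 * N%:R)) ^+ J * b)
    (fun eta => iter J (qstep q vs) f eta - iter J (euler q) f eta).
Proof.
have [c c0 Hc] := @qstep_expand vs (fun _ => id); exists c => // q b f J q0 q1 qN b0 fb.
have g1 : 1 <= 1 + q * (2 * N%:R) by rewrite lerDl !mulr_ge0.
have gn k : 0 <= (1 + q * (2 * N%:R)) ^+ k by rewrite exprn_ge0// (le_trans _ g1).
have ub : forall k, bounded_by ((1 + q * (2 * N%:R)) ^+ k * b) (iter k (euler q) f).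
  elim=> [|k IH]; first by rewrite mul1r.
  by rewrite exprS -mulrA; apply: euler_le => //; rewrite mulr_ge0.
elim: J => [|J IH] eta fe /=; first by rewrite subrr normr0 !mul0r.
set A := iter J (qstep q vs) f; set B := iter J (euler q) f.
have -> : qstep q vs A eta - euler q B eta = qstep q vs (fun e => A e - B e) eta
   + (qstep q vs B eta - B eta - q * rates vs B eta).
  by rewrite qstep_sub /euler; ring.
apply: le_trans (ler_normD _ _) _.
have h1 := qstep_le q0 qN (fun _ => id) IH fe.
have h2 := Hc q _ B q0 q1 (mulr_ge0 (gn J) b0) (ub J) _ fe.
apply: le_trans (lerD h1 h2) _.
set G := 1 + _ in g1 gn *.
have -> : J%:R * c * q ^+ 2 * G ^+ J * b + c * q ^+ 2 * (G ^+ J * b)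
   = J.+1%:R * c * q ^+ 2 * G ^+ J * b by rewrite -natr1; ring.
rewrite ler_wpM2r// ler_wpM2l ?ler_weXn2l// !mulr_ge0// exprn_ge0//.
Qed.

End Bounds.
End Generator.

(** * Exponential series and binomial sums *)

Section ExpSeries.
Context (R : realType).

Lemma bin_le_exp (J i : nat) : ('C(J, i)%:R : R) <= J%:R ^+ i / i`!%:R.
Proof.
rewrite ler_pdivlMr ?ltr0n ?fact_gt0// -natrM bin_ffact -natrX ler_nat.
elim: i => // i IH; rewrite ffactnSr expnSr.
by apply: leq_mul => //; apply: leq_subr.
Qed.

Lemma exp_ge_pow (q g : R) J : 0 <= q -> 0 <= g -> (1 + q * g) ^+ J <= expR (J%:R * q * g).
Proof.
move=> q0 g0; rewrite -mulrA expRM_natl -[leRHS]/(expR (q * g) ^+ J).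
by rewrite lerXn2r ?nnegrE ?expR_ge0 ?expR_ge1Dx// addr_ge0// mulr_ge0.
Qed.

(** This is [expR (- s) >= 1 - s] at [s = y / (1 + y)], where [1 - s] is the inverse of [1 + y]. *)
Lemma pow_ge_exp (y : R) J : 0 <= y -> expR (J%:R * (y / (1 + y))) <= (1 + y) ^+ J.
Proof.
move=> y0; have y1 : 0 < 1 + y by rewrite ltr_pwDl.
rewrite expRM_natl lerXn2r ?nnegrE ?expR_ge0 ?(ltW y1)//.
rewrite -[leLHS]invrK -expRN -[leRHS]invrK lef_pV2 ?posrE ?invr_gt0 ?expR_gt0//.
apply: le_trans (expR_ge1Dx _).
rewrite le_eqVlt; apply/orP; left; apply/eqP; have := gt_eqF y1 => /negbT h; by field.
Qed.

(** Both sums are compared with the exponential series at [x = J * q]. Its coefficients dominate the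
    binomial ones, so that the second error has a sign and sums up to an exponential minus a
    power. *)
Lemma series_binomial (g b tau q : R) (J : nat) (a : nat -> R) :
  0 <= g -> 0 <= b -> 0 <= tau -> 0 <= q -> (forall i, `|a i| <= g ^+ i * b) ->
  `|limn (series (fun i => tau ^+ i / i`!%:R * a i)) - \sum_(i < J.+1) 'C(J, i)%:R * q ^+ i * a i|
  <= b * (`|expR (tau * g) - expR (J%:R * q * g)| + (expR (J%:R * q * g) - (1 + q * g) ^+ J)).
Proof.
move=> g0 b0 t0 q0 ab; set x := J%:R * q; have x0 : 0 <= x by rewrite mulr_ge0.
set u := fun i => tau ^+ i / i`!%:R * a i.
set mx := Num.max tau x; set mn := Num.min tau x.
have mx0 : 0 <= mx by rewrite le_max t0.
have mn0 : 0 <= mn by rewrite le_min t0.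
have f0 i : 0 <= (i`!%:R : R)^-1 by rewrite invr_ge0.
have cvE (y : R) : series (exp_coeff y) @ \oo --> expR y by exact: is_cvg_series_exp_coeff.
have cu : cvgn (series u).
  apply: normed_cvg; apply: (@series_le_cvg _ _ (fun i => b * exp_coeff (tau * g) i)) => [i|i|i|].
  - exact: normr_ge0.
  - by rewrite mulr_ge0// exp_coeff_ge0// mulr_ge0.
  - rewrite /u /exp_coeff /= normrM (ger0_norm (_ : 0 <= tau ^+ i / _)) ?mulr_ge0 ?exprn_ge0//.
    rewrite exprMn (_ : b * _ = tau ^+ i / i`!%:R * (g ^+ i * b)); last by ring.
    by rewrite ler_wpM2l// mulr_ge0// exprn_ge0.
  - exact: (@is_cvg_seriesZ _ (exp_coeff (tau * g)) b (is_cvg_series_exp_coeff _)).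
(* Whichever of [tau] and [x] is larger, the distance of their [i]-th powers is [mx ^+ i - mn ^+ i];
   the bounds then sum to a difference of two exponentials. *)
pose d i := b * ((exp_coeff (mx * g) i - exp_coeff (mn * g) i) +
     (exp_coeff (x * g) i - 'C(J, i)%:R * (q * g) ^+ i)).
have ud i : `|u i - 'C(J, i)%:R * q ^+ i * a i| <= d i.
  rewrite /u -mulrBl normrM.
  apply: (@le_trans _ _ (`|tau ^+ i / i`!%:R - 'C(J, i)%:R * q ^+ i| * (g ^+ i * b))).
    by rewrite ler_wpM2l.
  rewrite /d /exp_coeff /= !(exprMn _ _ g).
  have -> : b * (mx ^+ i * g ^+ i / i`!%:R - mn ^+ i * g ^+ i / i`!%:R +
       (x ^+ i * g ^+ i / i`!%:R - 'C(J, i)%:R * (q ^+ i * g ^+ i)))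
     = ((mx ^+ i - mn ^+ i) / i`!%:R + (x ^+ i / i`!%:R - 'C(J, i)%:R * q ^+ i)) * (g ^+ i * b) by ring.
  rewrite ler_wpM2r ?mulr_ge0 ?exprn_ge0//.
  have -> : tau ^+ i / i`!%:R - 'C(J, i)%:R * q ^+ i =
    (tau ^+ i - x ^+ i) / i`!%:R + (x ^+ i / i`!%:R - 'C(J, i)%:R * q ^+ i) by ring.
  apply: le_trans (ler_normD _ _) _; rewrite normrM (ger0_norm (f0 i)).
  have h : 0 <= x ^+ i / i`!%:R - 'C(J, i)%:R * q ^+ i.
    by rewrite subr_ge0 /x exprMn mulrAC ler_wpM2r ?exprn_ge0// bin_le_exp.
  rewrite (ger0_norm h) lerD2r ler_wpM2r// /mx /mn.
  have [tx|xt] := leP tau x.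
    by rewrite ler0_norm ?opprB// subr_le0 lerXn2r.
  by rewrite ger0_norm// subr_ge0 lerXn2r// ltW.
set B := \sum_(i < J.+1) _; set w := fun i => 'C(J, i)%:R * q ^+ i * a i.
have sB n : (J.+1 <= n)%N -> series w n = B.
  move=> Jn; rewrite /series /= (big_cat_nat _ Jn) //= big_mkord [X in _ + X]big_nat_cond [X in _ + X]big1 ?addr0//.
  by move=> i /andP[/andP[Ji _] _]; rewrite /w bin_small ?mul0r.
have sC n : (J.+1 <= n)%N -> series (fun i => 'C(J, i)%:R * (q * g) ^+ i) n = (1 + q * g) ^+ J.
  move=> Jn; rewrite /series /= (big_cat_nat _ Jn) //= big_mkord [X in _ + X]big_nat_cond [X in _ + X]big1 ?addr0//.
    by rewrite exprDn; apply: eq_bigr => i _; rewrite expr1n mul1r mulr_natl.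
  by move=> i /andP[/andP[Ji _] _]; rewrite bin_small ?mul0r.
pose D n := b * ((series (exp_coeff (mx * g)) n - series (exp_coeff (mn * g)) n) +
   (series (exp_coeff (x * g)) n - (1 + q * g) ^+ J)).
have cD : D @ \oo --> b * ((expR (mx * g) - expR (mn * g)) + (expR (x * g) - (1 + q * g) ^+ J)).
  have h1 := cvgB (cvE (mx * g)) (cvE (mn * g)).
  have h2 := cvgB (cvE (x * g)) (cvg_cst ((1 + q * g) ^+ J)).
  by apply: cvgMl_tmp; apply: cvgD; [exact: h1|exact: h2].
have -> : `|expR (tau * g) - expR (x * g)| = expR (mx * g) - expR (mn * g).
  rewrite /mx /mn; have [tx|xt] := leP tau x.
    by rewrite ler0_norm ?opprB// subr_le0 ler_expR ler_wpM2r.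
  by rewrite ger0_norm// subr_ge0 ler_expR ler_wpM2r// ltW.
rewrite -(cvg_lim _ cD)//.
have cn : (fun n => `|series u n - B|) @ \oo --> `|limn (series u) - B|.
  by apply: cvg_norm; apply: cvgB; [exact: cu|exact: cvg_cst].
rewrite -(cvg_lim _ cn)//; apply: ler_lim; [by apply/cvg_ex; eexists; exact: cn|
  by apply/cvg_ex; eexists; exact: cD|].
exists J.+1 => // n /= Jn; rewrite -(sB n Jn) /D -(sC n Jn) /series /= -!sumrB -big_split /= mulr_sumr.
apply: le_trans (ler_norm_sum _ _ _) _; apply: ler_sum => i _; exact: ud.
Qed.

End ExpSeries.

(** * Convergence of the discrete chain to the semigroup *)

Section ChainLimit.
Context (R : realType) (lam : R).
Hypothesis lam_gt0 : 0 < lam.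
Implicit Types (f h : config -> R) (eta : config) (x : int) (vs xs : seq int).

Definition mesh (k : nat) : R := k.+1%:R^-1.

Lemma mesh_cvg0 : mesh @ \oo --> (0 : R).
Proof. exact: cvg_harmonic. Qed.

Lemma mesh_ge0 k : 0 <= mesh k. Proof. by rewrite invr_ge0. Qed.
Lemma mesh_le1 k : mesh k <= 1. Proof. by rewrite invf_le1// ler1n. Qed.

Lemma semigroup_rates vs t f eta : uniq vs -> semigroup [set` vs] lam t f eta =
  limn (series (fun i => (t * (1 + lam)) ^+ i / i`!%:R * iter i (rates lam vs) f eta)).
Proof.
move=> uv; rewrite /semigroup; congr (limn (series _)); apply/funext => i.
by rewrite iter_generator// exprMn; ring.
Qed.

(** The estimate is uniform in [f] and [eta], because in a finite-dimensional distribution the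
    function to which the semigroup is applied is itself only known approximately. *)
Lemma chain_semigroup vs N t (J : nat -> nat) : uniq vs -> 0 <= t ->
  (fun k => (J k)%:R * mesh k) @ \oo --> t * (1 + lam) ->
  forall eps, 0 < eps -> \forall k \near \oo, forall f, bounded_by vs N 1 f ->
  forall eta, few vs N eta ->
  `|iter (J k) (qstep lam (mesh k) vs) f eta - semigroup [set` vs] lam t f eta| <= eps.
Proof.
move=> uv t0 Jt eps e0.
have [c c0 Hc] := qstep_euler lam_gt0 N uv.
set g := 2 * N%:R : R; have g0 : 0 <= g by rewrite mulr_ge0.
set tau := t * (1 + lam) in Jt *.
have tau0 : 0 <= tau by rewrite mulr_ge0// addr_ge0// ltW.
set x := fun k => (J k)%:R * mesh k in Jt.
(* Three errors: sweeps against Euler steps, [x k] against its limit [tau], and the exponential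
   against the power, bounded below by [pow_ge_exp]. *)
pose B k := x k * mesh k * c * expR (x k * g) + (`|expR (tau * g) - expR (x k * g)|
    + (expR (x k * g) - expR (x k * g / (1 + mesh k * g)))).
have cB : B @ \oo --> (0 : R).
  have ex : (fun k => expR (x k * g)) @ \oo --> expR (tau * g).
    apply: (@continuous_cvg _ _ _ _ _ (fun k => x k * g) expR); first exact: continuous_expR.
    by apply: cvgMr_tmp.
  have ex2 : (fun k => expR (x k * g / (1 + mesh k * g))) @ \oo --> expR (tau * g).
    apply: (@continuous_cvg _ _ _ _ _ (fun k => x k * g / (1 + mesh k * g)) expR); first exact: continuous_expR.
    rewrite -[X in _ --> X]divr1; apply: cvgM; first by apply: cvgMr_tmp.
    apply: cvgV; first exact: oner_neq0.
    rewrite -[X in _ --> X]addr0; apply: cvgD; first exact: cvg_cst.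
    by rewrite -[X in _ --> X](mul0r g); apply: cvgMr_tmp; exact: mesh_cvg0.
  have -> : 0 = tau * 0 * c * expR (tau * g) + (`|expR (tau * g) - expR (tau * g)| +
       (expR (tau * g) - expR (tau * g))) by rewrite subrr normr0 mulr0 !mul0r !addr0.
  apply: cvgD.
    apply: cvgM => //; apply: cvgMr_tmp; apply: cvgM => //; exact: mesh_cvg0.
  apply: cvgD; last exact: cvgB.
  by apply: cvg_norm; apply: cvgB => //; exact: cvg_cst.
have qN : \forall k \near \oo, mesh k * N%:R <= 1.
  near=> k; rewrite mulrC ler_pdivrMr ?ltr0n// mul1r ler_nat; apply: leqW.
  by near: k; exact: nbhs_infty_ge.
have Be : \forall k \near \oo, B k <= eps.
  move/cvgrPdist_le : cB => /(_ _ e0); apply: filterS => k.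
  by rewrite sub0r normrN => /(le_trans (ler_norm _)).
near=> k => f f1 eta fe.
have kN : mesh k * N%:R <= 1 by near: k.
have kB : B k <= eps by near: k.
apply: le_trans _ kB.
have h1 := Hc (mesh k) 1 f (J k) (mesh_ge0 k) (mesh_le1 k) kN ler01 f1 _ fe.
have h2 := @series_binomial R g 1 tau (mesh k) (J k) (fun i => iter i (rates lam vs) f eta) g0 ler01 tau0
   (mesh_ge0 k) (fun i => iter_rates_le lam_gt0 uv i ler01 f1 fe).
rewrite semigroup_rates//.
rewrite -(subrKA (iter (J k) (euler lam vs (mesh k)) f eta)).
apply: le_trans (ler_normD _ _) _; apply: lerD.
  apply: le_trans h1 _; rewrite -/g mulr1 /x.
  have -> : (J k)%:R * mesh k * mesh k * c * expR ((J k)%:R * mesh k * g) =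
     (J k)%:R * c * mesh k ^+ 2 * expR ((J k)%:R * mesh k * g) by ring.
  rewrite ler_wpM2l ?exp_ge_pow ?mesh_ge0// !mulr_ge0 ?exprn_ge0 ?mesh_ge0//.
rewrite distrC iter_euler; apply: le_trans h2 _; rewrite mul1r lerD2l lerD2l lerN2.
have := @pow_ge_exp R (mesh k * g) (J k) (mulr_ge0 (mesh_ge0 k) g0).
by rewrite /x !mulrA.
Unshelve. all: by end_near. Qed.

(* The discrete counterpart of [fdd]: the numbers of steps replace durations. *)
Fixpoint dfdd vs k (s : seq (nat * set config)) eta : R :=
  if s is (j, A) :: s'
  then iter j (qstep lam (mesh k) vs) (fun z => \1_A z * dfdd vs k s' z) eta else 1.

Lemma qstep_ge0 N q vs xs f : uniq vs -> 0 <= q -> q * N%:R <= 1 -> {subset xs <= vs} ->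
  (forall eta, few vs N eta -> 0 <= f eta) -> forall eta, few vs N eta -> 0 <= qstep lam q xs f eta.
Proof.
move=> uv q0 qN; elim: xs => //= x r IH sub f0 eta fe.
have xv : x \in vs by apply: sub; rewrite mem_head.
have {}IH := IH (fun y yr => sub y (@mem_behead _ (x :: r) y yr)) f0.
rewrite /qstep1 /rate -/(qstep _ _ _ _); case: (posnP (awake (eta x))) => [->|aw].
  by rewrite mul0r mulr0 addr0 IH.
set k := (awake _)%:R; set S := \sum_(i < _) _; set a := qstep _ _ _ _ _.
have -> : a + q * (k * (S - a)) = (1 - q * k) * a + q * k * S by ring.
have kN : q * k <= 1.
  apply: le_trans qN; rewrite ler_wpM2l// /k ler_nat.
  by apply: leq_trans (awake_num _) _; apply: leq_trans fe; apply: num_on_mem.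
rewrite addr_ge0// ?mulr_ge0 ?subr_ge0 ?IH//.
apply: sumr_ge0 => i _; apply: mulr_ge0; first exact: iw_ge0.
by apply: IH; apply: few_app.
Qed.

Lemma dfdd_bounds vs N k s eta : uniq vs -> mesh k * N%:R <= 1 -> few vs N eta ->
  0 <= dfdd vs k s eta <= 1.
Proof.
move=> uv kN; elim: s eta => [|[j A] s IH] eta fe /=; first by rewrite ler01 lexx.
have f01 e : few vs N e -> 0 <= \1_A e * dfdd vs k s e <= 1.
  move=> /IH/andP[h0 h1]; rewrite indicE; case: (e \in A); rewrite ?mul1r ?mul0r ?h0 ?h1//.
  by rewrite lexx ler01.
elim: j eta fe => [|j IHj] eta fe /=; first exact: f01.
have IHj0 e : few vs N e -> 0 <= iter j (qstep lam (mesh k) vs) (fun z => \1_A z * dfdd vs k s z) e.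
  by move=> /IHj/andP[].
rewrite (qstep_ge0 uv (mesh_ge0 k) kN (fun _ => id) IHj0 fe) /=.
apply: le_trans (ler_norm _) _.
apply: (qstep_le lam_gt0 uv (mesh_ge0 k) kN (fun _ => id)) => // e fe'.
by have /andP[h0 h1] := IHj _ fe'; rewrite ger0_norm.
Qed.

Lemma iter_qstep_sub vs q j f h eta :
  iter j (qstep lam q vs) (fun e => f e - h e) eta =
  iter j (qstep lam q vs) f eta - iter j (qstep lam q vs) h eta.
Proof.
elim: j eta => //= j IH eta; rewrite -qstep_sub; congr (qstep _ _ _ _ _).
exact/funext.
Qed.

(** Each element of [s] carries a duration and the number of steps that approximates it. In the
    induction the error of the inner function is not amplified, since [qstep] does not increase
    bounds. That [fdd] lies in [0, 1] is not visible on its series; it is inherited from the chain,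
    whose sweeps preserve positivity and the bound 1. *)
Lemma dfdd_cvg vs N (s : seq ((R * (nat -> nat)) * set config)) : uniq vs ->
  (forall p, p \in s -> 0 <= p.1.1 /\ (fun k => (p.1.2 k)%:R * mesh k) @ \oo --> p.1.1 * (1 + lam)) ->
  (forall eta, few vs N eta -> 0 <= fdd [set` vs] lam [seq (p.1.1, p.2) | p <- s] eta <= 1) /\
  forall eps, 0 < eps -> \forall k \near \oo, forall eta, few vs N eta ->
  `|dfdd vs k [seq (p.1.2 k, p.2) | p <- s] eta - fdd [set` vs] lam [seq (p.1.1, p.2) | p <- s] eta| <= eps.
Proof.
move=> uv; elim: s => [_|[[d J] A] s IH Hs].
  split=> [eta _|eps e0] /=; first by rewrite ler01 lexx.
  by near=> k => eta _; rewrite subrr normr0 ltW.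
have [d0 cJ] := Hs _ (mem_head _ _).
have [IH1 IH2] := IH (fun p ps => Hs p (@mem_behead _ (_ :: s) p ps)).
set F := fun eta => \1_A eta * fdd [set` vs] lam [seq (p.1.1, p.2) | p <- s] eta.
have F1 : bounded_by vs N 1 F.
  move=> eta /IH1/andP[h0 h1]; rewrite /F indicE; case: (_ \in _); rewrite ?mul1r ?mul0r ?normr0//.
  by rewrite ger0_norm.
have qN : \forall k \near \oo, mesh k * N%:R <= 1.
  near=> k; rewrite mulrC ler_pdivrMr ?ltr0n// mul1r ler_nat; apply: leqW.
  by near: k; exact: nbhs_infty_ge.
have main eps : 0 < eps -> \forall k \near \oo, forall eta, few vs N eta ->
  `|dfdd vs k [seq (p.1.2 k, p.2) | p <- (d, J, A) :: s] eta
    - fdd [set` vs] lam [seq (p.1.1, p.2) | p <- (d, J, A) :: s] eta| <= eps.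
  move=> e0; have e20 : 0 < eps / 2 by rewrite divr_gt0.
  have H1 := chain_semigroup N uv d0 cJ e20.
  near=> k => eta fe.
  have kN : mesh k * N%:R <= 1 by near: k.
  have h1 : `|iter (J k) (qstep lam (mesh k) vs) F eta - semigroup [set` vs] lam d F eta| <= eps / 2.
    by apply: (near H1 k _ F F1) => //; near: k.
  have h2 : forall eta, few vs N eta -> `|dfdd vs k [seq (p.1.2 k, p.2) | p <- s] eta -
      fdd [set` vs] lam [seq (p.1.1, p.2) | p <- s] eta| <= eps / 2.
    by near: k; apply: IH2.
  rewrite [X in X - _]/= [X in _ - X]/= -/F.
  set G := (fun z => \1_A z * dfdd vs k _ z).
  have -> : iter (J k) (qstep lam (mesh k) vs) G eta - semigroup [set` vs] lam d F eta =
     iter (J k) (qstep lam (mesh k) vs) (fun e => G e - F e) eta +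
     (iter (J k) (qstep lam (mesh k) vs) F eta - semigroup [set` vs] lam d F eta).
    by rewrite iter_qstep_sub; ring.
  apply: le_trans (ler_normD _ _) _; rewrite [eps]splitr; apply: lerD => //.
  have GF : bounded_by vs N (eps / 2) (fun e => G e - F e).
    move=> e fe'; rewrite /G /F -mulrBr indicE; case: (_ \in _); rewrite ?mul1r ?mul0r ?normr0 ?(ltW e20)//.
    exact: h2.
  have : bounded_by vs N (eps / 2) (iter (J k) (qstep lam (mesh k) vs) (fun e => G e - F e)).
    by elim: (J k) => //= j IHj; apply: qstep_le => //; exact: mesh_ge0.
  by apply.
split=> // eta fe.
set s' := (_ :: s) in main *.
have cv : (fun k => dfdd vs k [seq (p.1.2 k, p.2) | p <- s'] eta) @ \oo -->
   fdd [set` vs] lam [seq (p.1.1, p.2) | p <- s'] eta.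
  apply/cvgrPdist_le => e e0; near=> k; rewrite distrC.
  by move: (eta) fe; near: k; exact: main.
rewrite -(cvg_lim _ cv)//; apply/andP; split.
  apply: limr_ge; first by apply/cvg_ex; eexists; exact: cv.
  by near=> k; have kN : mesh k * N%:R <= 1; [near: k|have /andP[] := dfdd_bounds [seq (p.1.2 k, p.2) | p <- s'] uv kN fe].
apply: limr_le; first by apply/cvg_ex; eexists; exact: cv.
by near=> k; have kN : mesh k * N%:R <= 1; [near: k|have /andP[] := dfdd_bounds [seq (p.1.2 k, p.2) | p <- s'] uv kN fe].
Unshelve. all: by end_near. Qed.

End ChainLimit.

Definition zs (B : nat) : seq int := [seq (i%:Z - B%:Z) | i <- iota 0 B.*2.+1].

Lemma mem_zs B (x : int) : (x \in zs B) = (`|x| <= B)%N.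
Proof.
apply/mapP/idP => [[i]|xB]; first by rewrite mem_iota => ? ->; lia.
exists `|(x + B%:Z)%R|%N; first by rewrite mem_iota; lia.
lia.
Qed.

Lemma zs_sorted B : sorted <%R (zs B).
Proof.
rewrite sorted_map; apply: sub_sorted (iota_ltn_sorted 0 _) => i j /=; lia.
Qed.

Lemma zs_uniq B : uniq (zs B).
Proof. exact: lt_sorted_uniq (zs_sorted B). Qed.

Lemma zs_filter M L : (M <= L)%N -> [seq x <- zs L | (`|x| <= M)%N] = zs M.
Proof.
move=> ML; apply: lt_sorted_eq; [|exact: zs_sorted|].
  by apply: lt_sorted_filter; exact: zs_sorted.
by move=> x; rewrite mem_filter !mem_zs; lia.
Qed.

(** * The whole line as a limit of boxes *)

Section FullSpace.
Context (R : realType) (lam : R).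
Hypothesis lam_gt0 : 0 < lam.
Implicit Types (f h : config -> R) (eta : config) (x : int) (vs xs : seq int).

Definition supported (B : nat) eta := forall x : int, (B < `|x|)%N -> eta x = Awake 0.

Lemma supported_app B i x eta : supported B eta -> (`|x| <= B)%N -> supported B.+1 (app i x eta).
Proof.
move=> sB xB y yB; have y0 : eta y = Awake 0 by apply: sB; lia.
have yx : (y == x) = false by apply/eqP => e; lia.
have yx1 : (y == x - 1) = false by apply/eqP => e; lia.
have yx2 : (y == x + 1) = false by apply/eqP => e; lia.
rewrite /app; case: ifP => _; first by rewrite /jump /set_site yx yx1.
case: ifP => _; first by rewrite /jump /set_site yx yx2.
by case: (eta x) => [|[|[|k]]]; rewrite // /set_site yx.
Qed.

Lemma num_on_zs B L eta : (B <= L)%N -> supported B eta -> num_on (zs L) eta = num_on (zs B) eta.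
Proof.
move=> BL sB; rewrite /num_on -(zs_filter BL) big_filter [in RHS]big_mkcond /=.
by apply: eq_bigr => y _; case: ifP => // /negbT; rewrite -ltnNge => /sB ->.
Qed.

Let term f eta x :=
   ((awake (eta x))%:R * (2^-1 * (f (jump eta x (x - 1)) - f eta)
     + 2^-1 * (f (jump eta x (x + 1)) - f eta))
  + (if eta x is Awake 1 then lam * (f (set_site eta x Asleep) - f eta) else 0)).

Lemma generator_zs B f eta (V : set int) : supported B eta -> [set` zs B] `<=` V ->
  generator V lam f eta = (1 + lam) * rates lam (zs B) f eta.
Proof.
move=> sB BV; rewrite -generator_rates ?zs_uniq// /generator.
rewrite -(@fsbig_widen _ _ _ _ [set` zs B] V)// => x /= [_ /negP].
by rewrite /= mem_zs -ltnNge => /sB ->; rewrite /= mul0r addr0.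
Qed.

(** One application of the generator enlarges the support by one site on each side, so a fixed
    number of applications involves only finitely many sites, all contained in the box for large
    [L]. The function may vary with [L], as the inner functions of [fdd] do. *)
Lemma iter_generator_cvg k (fL : nat -> config -> R) f :
  (forall B eta, supported B eta -> (fL ^~ eta) @ \oo --> f eta) ->
  forall B eta, supported B eta ->
  (fun L => iter k (generator [set` zs L] lam) (fL L) eta) @ \oo --> iter k (generator setT lam) f eta.
Proof.
move=> cf; elim: k => [|k IH] B eta sB; first exact: (cf B).
rewrite /= (generator_zs _ sB)//.
pose r L := (1 + lam) * rates lam (zs B) (iter k (generator [set` zs L] lam) (fL L)) eta.
have : r @ \oo --> (1 + lam) * rates lam (zs B) (iter k (generator setT lam) f) eta.
  apply: cvgMl_tmp; rewrite /rates.
  rewrite big_seq; under eq_fun do rewrite big_seq.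
  apply: cvg_big => [|x]; first exact: add_continuous.
  rewrite mem_zs => xB; apply: cvgMl_tmp; apply: cvgB; last exact: IH sB.
  apply: cvg_big => [|i _]; first exact: add_continuous.
  by apply: cvgMl_tmp; apply: (IH B.+1); exact: supported_app.
apply: cvg_trans; apply: near_eq_cvg; near=> L.
have BL : (B <= L)%N by near: L; exact: nbhs_infty_ge.
rewrite /r (generator_zs _ sB)// => x /=; rewrite !mem_zs => h; exact: leq_trans h BL.
Unshelve. all: by end_near. Qed.

Lemma series_le_tail (a : nat -> R) (b y : R) n : 0 <= b -> 0 <= y ->
  (forall i, `|a i| <= b * (y ^+ i / i`!%:R)) ->
  cvgn (series a) /\ `|limn (series a) - series a n| <= b * (expR y - series (exp_coeff y) n).
Proof.
move=> b0 y0 ab.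
have cE : series (exp_coeff y) @ \oo --> expR y by exact: is_cvg_series_exp_coeff.
have ca : cvgn (series a).
  apply: normed_cvg; apply: (@series_le_cvg _ _ (fun i => b * exp_coeff y i)) => [i|i|i|].
  - exact: normr_ge0.
  - by rewrite mulr_ge0// exp_coeff_ge0.
  - exact: ab.
  - exact: (@is_cvg_seriesZ _ (exp_coeff y) b (is_cvg_series_exp_coeff _)).
split=> //.
have c1 : (fun m => `|series a m - series a n|) @ \oo --> `|limn (series a) - series a n|.
  by apply: cvg_norm; apply: cvgB; [exact: ca|exact: cvg_cst].
have c2 : (fun m => b * (series (exp_coeff y) m - series (exp_coeff y) n)) @ \oo
   --> b * (expR y - series (exp_coeff y) n).
  by apply: cvgMl_tmp; apply: cvgB; [exact: cE|exact: cvg_cst].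
rewrite -(cvg_lim _ c1)// -(cvg_lim _ c2)//; apply: ler_lim.
- by apply/cvg_ex; eexists; exact: c1.
- by apply/cvg_ex; eexists; exact: c2.
exists n => // m /= nm; rewrite !sub_series_geq// mulr_sumr.
by apply: le_trans (ler_norm_sum _ _ _) _; apply: ler_sum => i _; exact: ab.
Qed.

Lemma series_dominated (aL : nat -> nat -> R) (a : nat -> R) (b y : R) : 0 <= b -> 0 <= y ->
  (\forall L \near \oo, forall i, `|aL L i| <= b * (y ^+ i / i`!%:R)) ->
  (forall i, aL ^~ i @ \oo --> a i) ->
  (fun L => limn (series (aL L))) @ \oo --> limn (series a).
Proof.
move=> b0 y0 aLb aLa.
have ab i : `|a i| <= b * (y ^+ i / i`!%:R).
  have ci : (fun L => `|aL L i|) @ \oo --> `|a i| by apply: cvg_norm.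
  rewrite -(cvg_lim _ ci)//; apply: limr_le; first by apply/cvg_ex; eexists; exact: ci.
  by apply: filterS aLb => L; apply.
apply/cvgrPdist_le => e e0.
have e3 : 0 < e / 3 by rewrite divr_gt0.
have [n tail] : exists n, b * (expR y - series (exp_coeff y) n) <= e / 3.
  have c2 : (fun m => b * (expR y - series (exp_coeff y) m)) @ \oo --> b * (expR y - expR y).
    by apply: cvgMl_tmp; apply: cvgB; [exact: cvg_cst|exact: is_cvg_series_exp_coeff].
  move: c2; rewrite subrr mulr0 => /cvgrPdist_le/(_ _ e3)[n _ Hn]; exists n.
  by have := Hn n (leqnn n); rewrite sub0r normrN; apply: le_trans; exact: ler_norm.
have cn : (fun L => series (aL L) n) @ \oo --> series a n.
  rewrite /series /=; apply: cvg_big => [|i _]; first exact: add_continuous.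
  exact: aLa.
near=> L.
have h1 : forall i, `|aL L i| <= b * (y ^+ i / i`!%:R) by near: L.
have h2 : `|series a n - series (aL L) n| <= e / 3.
  by near: L; move/cvgrPdist_le : cn; exact.
have [_ t1] := series_le_tail n b0 y0 ab.
have [_ t2] := series_le_tail n b0 y0 h1.
have -> : limn (series a) - limn (series (aL L)) = (limn (series a) - series a n) +
  (series a n - series (aL L) n) - (limn (series (aL L)) - series (aL L) n) by ring.
apply: le_trans (ler_normB _ _) _.
have -> : e = e / 3 + e / 3 + e / 3 by field.
apply: lerD; last exact: le_trans t2 tail.
by apply: le_trans (ler_normD _ _) _; apply: lerD; [exact: le_trans t1 tail|].
Unshelve. all: by end_near. Qed.

(** The number of steps of the chain with [k + 1] clock values that fit into the time [t]. It is 0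
    for negative [t], so odometers can be indexed by all rational times. *)
Definition steps (t : R) (k : nat) : nat := Num.truncn (t * (1 + lam) * k.+1%:R).

Lemma steps_bounds t k : 0 <= t ->
  (steps t k)%:R * mesh R k <= t * (1 + lam) <= (steps t k)%:R * mesh R k + mesh R k.
Proof.
move=> t0; have x0 : 0 <= t * (1 + lam) * k.+1%:R by rewrite !mulr_ge0// addr_ge0// ltW.
have /andP[h1 h2] := truncn_itv x0; rewrite /mesh; apply/andP; split.
  by rewrite ler_pdivrMr ?ltr0n.
rewrite -[X in _ <= _ + X]mul1r -[leRHS]mulrDl.
by rewrite ler_pdivlMr ?ltr0n// natr1 ltW.
Qed.

Lemma steps_cvg t : 0 <= t -> (fun k => (steps t k)%:R * mesh R k) @ \oo --> t * (1 + lam).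
Proof.
move=> t0; apply: (@squeeze_cvgr _ _ _ _ (fun k => t * (1 + lam) - mesh R k) (fun=> t * (1 + lam))).
- by near=> k; have /andP[h1 h2] := steps_bounds k t0; rewrite h1 lerBlDr h2.
- rewrite -[X in _ --> X]subr0; apply: cvgB; [exact: cvg_cst|exact: mesh_cvg0].
- exact: cvg_cst.
Unshelve. all: by end_near. Qed.

Lemma fdd_bounds vs s eta : uniq vs -> (forall p : R * set config, p \in s -> 0 <= p.1) ->
  0 <= fdd [set` vs] lam s eta <= 1.
Proof.
move=> uv s0.
have [] := @dfdd_cvg R lam lam_gt0 vs (num_on vs eta) [seq ((p.1, steps p.1), p.2) | p <- s] uv.
  by move=> _ /mapP[p ps ->] /=; split; [exact: s0|apply: steps_cvg; exact: s0].
move=> /(_ eta (leqnn _)) + _.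
rewrite -map_comp (_ : map _ s = s)//.
by rewrite -[RHS]map_id; apply: eq_map => -[].
Qed.

(** Dominated convergence in the exponential series: with [N] particles the [i]-th iterate of the
    generator is at most the [i]-th power of [(1 + lam) * (2 * N)], whatever the box. *)
Lemma fdd_cvg_setT s : (forall p : R * set config, p \in s -> 0 <= p.1) ->
  forall B eta, supported B eta ->
  (fun L => fdd [set` zs L] lam s eta) @ \oo --> fdd setT lam s eta.
Proof.
elim: s => [_|[d A] s IH s0] B eta sB /=; first exact: cvg_cst.
have d0 : 0 <= d by have := s0 _ (mem_head _ _).
have {}s0 : forall p, p \in s -> 0 <= p.1 by move=> p ps; apply: s0; rewrite inE ps orbT.
pose N := num_on (zs B) eta; have l1 : 0 <= 1 + lam by rewrite addr_ge0// ltW.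
apply: (@series_dominated _ _ 1 (d * ((1 + lam) * (2 * N%:R)))) => //.
- by rewrite !mulr_ge0.
- near=> L => i.
  have BL : (B <= L)%N by near: L; exact: nbhs_infty_ge.
  rewrite mul1r normrM ger0_norm ?mulr_ge0 ?exprn_ge0 ?invr_ge0//.
  rewrite (exprMn _ d) [leLHS]mulrAC ler_wpM2r ?invr_ge0// ler_wpM2l ?exprn_ge0//.
  rewrite iter_generator ?zs_uniq// normrM ger0_norm ?exprn_ge0// exprMn ler_wpM2l ?exprn_ge0//.
  rewrite -[leRHS]mulr1; apply: (iter_rates_le lam_gt0 (zs_uniq L)) => //.
    move=> e _; rewrite indicE; case: (_ \in _); rewrite ?mul0r ?mul1r ?normr0//.
    by have /andP[h0 h1] := fdd_bounds e (zs_uniq L) s0; rewrite ger0_norm.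
  by rewrite /few (num_on_zs BL sB).
- move=> i; apply: cvgMl_tmp; apply: iter_generator_cvg sB => B' e sB'.
  by apply: cvgMl_tmp; exact: IH sB'.
Unshelve. all: by end_near. Qed.

End FullSpace.

(** * Realization of limit laws *)

Section UltraLimit.
Context (R : realType).

Lemma ultra_infty : exists U : set_system nat, UltraFilter U /\ \oo `<=` U.
Proof. exact: ultraFilterLemma. Qed.

(** A limit along an ultrafilter exists for every bounded sequence and is linear and monotone. The
    limit law can be defined at once by it, without extracting a subsequence along which all
    marginals converge. *)
Definition ufilter : set_system nat := sval (cid ultra_infty).
Definition ulim (a : nat -> R) : R := lim (a @ ufilter).

Let ufU : UltraFilter ufilter. Proof. exact: (svalP (cid ultra_infty)).1. Qed.
Let ufP : ProperFilter ufilter. Proof. exact: ultra_proper. Qed.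
#[local] Existing Instance ufP.
Let uf_infty : \oo `<=` ufilter. Proof. exact: (svalP (cid ultra_infty)).2. Qed.

Definition bounded_seq (a : nat -> R) := exists B : R, forall k, `|a k| <= B.

Lemma ulim_cvg a : bounded_seq a -> a @ ufilter --> ulim a.
Proof.
move=> [B aB]; apply/cvg_ex.
have inside : (a @ ufilter) [set` `[- B, B]].
  apply: uf_infty; exists 0%N => // k _; rewrite /= in_itv /=.
  by have := aB k; rewrite ler_norml.
have [l [_ cl]] : [set` `[- B, B]] `&` cluster (a @ ufilter) !=set0.
  apply: (@segment_compact R (- B) B (a x @[x --> ufilter]) _); last exact: inside.
exists l => V Vl; have [//|aV] := in_ultra_setVsetC (a @^-1` V) ufU.
by have [x []] := cl (~` V) V aV Vl.
Qed.

Lemma ulim_eq a l : a @ \oo --> l -> ulim a = l.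
Proof. move=> al; apply: cvg_lim => //; move=> V /al; exact: uf_infty. Qed.

Lemma ulim_le a b : bounded_seq a -> bounded_seq b -> (\forall k \near \oo, a k <= b k) ->
  ulim a <= ulim b.
Proof.
move=> /ulim_cvg ca /ulim_cvg cb ab.
have c : (fun k => b k - a k) @ ufilter --> ulim b - ulim a by apply: cvgB.
rewrite -subr_ge0 -(cvg_lim _ c)//; apply: limr_ge; first exact: cvgP c.
by apply: uf_infty; apply: filterS ab => k; rewrite subr_ge0.
Qed.

Lemma ulim_cst l : ulim (fun=> l) = l.
Proof. by apply: ulim_eq; exact: cvg_cst. Qed.

Lemma ulim_lin a b c : bounded_seq a -> bounded_seq b ->
  ulim (fun k => a k + c * b k) = ulim a + c * ulim b.
Proof.
move=> /ulim_cvg ca /ulim_cvg cb; apply: cvg_lim => //.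
by apply: cvgD; [exact: ca|apply: cvgMl_tmp; exact: cb].
Qed.

End UltraLimit.

Section Realization.
Context (R : realType) (Lam : ((nat -> nat) -> R) -> R).

Definition bnd (T : Type) (f : T -> R) := exists B : R, forall y, `|f y| <= B.
Hypothesis Lam_le : forall f g, bnd f -> bnd g -> (forall y, f y <= g y) -> Lam f <= Lam g.
Hypothesis Lam_lin : forall f g c, bnd f -> bnd g -> Lam (fun y => f y + c * g y) = Lam f + c * Lam g.
Hypothesis Lam1 : Lam (fun=> 1) = 1.
Hypothesis tight : forall i (e : R), 0 < e -> exists c : nat, Lam (fun y => (c <= y i)%N%:R) <= e.

Let bndb (T : Type) (b : T -> bool) : bnd (fun y => (b y)%:R : R).
Proof. by exists 1 => y; case: (b y); rewrite ?normr1 ?normr0 ?ler01. Qed.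

Let bnd_lin (T : Type) (f g : T -> R) c : bnd f -> bnd g -> bnd (fun y => f y + c * g y).
Proof.
move=> [B fB] [C gC]; exists (B + `|c| * C) => y.
apply: le_trans (ler_normD _ _) _; apply: lerD => //.
by rewrite normrM ler_wpM2l.
Qed.

Let Lam0 : Lam (fun=> 0) = 0.
Proof.
have b1 : bnd (fun _ : nat -> nat => 1 : R) by exists 1 => _; rewrite normr1.
have := @Lam_lin (fun=> 1) (fun=> 1) (-1) b1 b1; rewrite Lam1 mulr1 subrr => {2}<-.
by congr Lam; apply/funext => y; rewrite mulN1r subrr.
Qed.

Let Lam_sum (I : Type) (r : seq I) (b : I -> (nat -> nat) -> bool) :
  bnd (fun y => \sum_(i <- r) (b i y)%:R) /\
  Lam (fun y => \sum_(i <- r) (b i y)%:R) = \sum_(i <- r) Lam (fun y => (b i y)%:R).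
Proof.
elim: r => [|i r [IH1 IH2]].
  have -> : (fun y => \sum_(i <- [::]) (b i y)%:R) = (fun=> 0 : R).
    by apply/funext => y; rewrite big_nil.
  by rewrite big_nil Lam0; split=> //; exists 0 => y; rewrite normr0.
have -> : (fun y => \sum_(j <- i :: r) (b j y)%:R) =
   (fun y => (b i y)%:R + 1 * \sum_(j <- r) (b j y)%:R :> R).
  by apply/funext => y; rewrite big_cons mul1r.
split; first by apply: bnd_lin IH1; exact: bndb.
by rewrite Lam_lin// IH2 big_cons mul1r.
Qed.

(** The functional [Lam] is realized on the unit interval. A word [w] receives a subinterval of
    length [wmass w] with left end [wlo w], the extensions of [w] being laid side by side inside it;
    a uniform point then reads off the sequence whose prefixes label its intervals. *)
Definition wmass (w : seq nat) : R := Lam (fun y => (mkseq y (size w) == w)%:R).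

Lemma wmass_ge0 w : 0 <= wmass w.
Proof.
rewrite -Lam0; apply: Lam_le => //; first by exists 0 => y; rewrite normr0.
Qed.

Lemma wmass_nil : wmass [::] = 1.
Proof. by rewrite -Lam1; congr Lam; apply/funext => y /=. Qed.

Let mkseq_rcons (y : nat -> nat) w a :
  (mkseq y (size (rcons w a)) == rcons w a) = (mkseq y (size w) == w) && (y (size w) == a).
Proof. by rewrite size_rcons mkseqS eqseq_rcons. Qed.

Lemma wmass_partial (w : seq nat) c : \sum_(a < c) wmass (rcons w a) <= wmass w.
Proof.
rewrite -(big_mkord xpredT (fun a => wmass (rcons w a))).
have [b1 e1] := Lam_sum (index_iota 0 c) (fun a y => mkseq y (size (rcons w a)) == rcons w a).
rewrite -[leLHS]e1; apply: Lam_le => // y.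
have [yw|yw] := boolP (mkseq y (size w) == w); last first.
  by rewrite big1 // => a _; rewrite mkseq_rcons (negbTE yw).
rewrite (eq_bigr (fun a => (y (size w) == a)%:R)); last by move=> a _; rewrite mkseq_rcons yw.
elim: c {b1 e1} => [|c IH]; first by rewrite big_nil ler01.
have [yc|yc] := eqVneq (y (size w)) c; last by rewrite big_nat_recr //= (negbTE yc) addr0.
rewrite big_nat_recr //= yc eqxx big_nat_cond big1 ?add0r// => a /andP[/andP[_ ac] _].
by rewrite gtn_eqF.
Qed.

(** Here tightness enters: no mass of the next letter escapes to infinity, so the intervals of the
    one-letter extensions exhaust that of [w] and each of its points has a next letter. *)
Lemma wmass_total (w : seq nat) e : 0 < e -> exists c, wmass w - e <= \sum_(a < c) wmass (rcons w a).
Proof.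
move=> e0; have [c Hc] := tight (size w) e0; exists c.
rewrite -(big_mkord xpredT (fun a => wmass (rcons w a))).
have [b1 e1] := Lam_sum (index_iota 0 c) (fun a y => mkseq y (size (rcons w a)) == rcons w a).
rewrite -[leRHS]e1.
have h := @Lam_lin (fun y => (mkseq y (size w) == w)%:R) (fun y => (c <= y (size w))%N%:R) (-1)
  (bndb _) (bndb _).
apply: (@le_trans _ _ (Lam (fun y => (mkseq y (size w) == w)%:R + -1 * (c <= y (size w))%N%:R))).
  by rewrite h mulN1r lerD2l lerN2.
apply: Lam_le => //; first by apply: bnd_lin; exact: bndb.
move=> y; have [yw|yw] := boolP (mkseq y (size w) == w); last first.
  apply: (@le_trans _ _ 0); first by rewrite mulN1r add0r oppr_le0.
  by apply: sumr_ge0.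
rewrite (eq_bigr (fun a => (y (size w) == a)%:R)); last by move=> a _; rewrite mkseq_rcons yw.
have [cy|yc] := leqP c (y (size w)).
  by rewrite mulN1r subrr sumr_ge0.
rewrite mulr0 addr0 (bigD1_seq (y (size w))) /= ?mem_index_iota ?iota_uniq// eqxx lerDl.
exact: sumr_ge0.
Qed.

Definition wlo (w : seq nat) : R :=
  \sum_(i < size w) \sum_(b < nth 0%N w i) wmass (rcons (take i w) b).

Lemma wlo_rcons w a : wlo (rcons w a) = wlo w + \sum_(b < a) wmass (rcons w b).
Proof.
rewrite /wlo size_rcons big_ord_recr /= nth_rcons ltnn eqxx -cats1 take_size_cat//.
congr (_ + _); apply: eq_bigr => i _; rewrite nth_cat ltn_ord.
by rewrite takel_cat// ltnW.
Qed.

Definition cell w (t : R) := wlo w <= t < wlo w + wmass w.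

Definition letter_at (w : seq nat) (t : R) : nat :=
  if pselect (exists a, t < wlo (rcons w a.+1)) is left h then ex_minn h else 0%N.

Lemma wlo_rcons_mono w a b : (a <= b)%N -> wlo (rcons w a) <= wlo (rcons w b).
Proof.
move=> /subnKC <-; elim: (b - a)%N => [|k IH]; first by rewrite addn0.
apply: le_trans IH _; rewrite addnS !wlo_rcons lerD2l big_ord_recr /= lerDl.
exact: wmass_ge0.
Qed.

Lemma cell_rcons w a t : cell (rcons w a) t = (wlo (rcons w a) <= t < wlo (rcons w a.+1)).
Proof. by rewrite /cell [wlo (rcons w a.+1)]wlo_rcons big_ord_recr /= addrA -wlo_rcons. Qed.

Lemma cell_letter w t : cell w t -> cell (rcons w (letter_at w t)) t.
Proof.
move=> /andP[lt tl]; rewrite cell_rcons /letter_at; case: pselect => [h|nh].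
  case: ex_minnP => a -> amin; rewrite andbT; case: a amin => [|a] amin.
    by rewrite wlo_rcons big_ord0 addr0.
  by rewrite leNgt; apply/negP => /amin; rewrite ltnn.
exfalso; apply: nh.
have e0 : 0 < (wlo w + wmass w - t) / 2 by rewrite divr_gt0// subr_gt0.
have [c Hc] := wmass_total w e0.
have tc : t < wlo (rcons w c) by rewrite wlo_rcons; move: Hc tl; lra.
exists c; apply: lt_le_trans tc _; exact: wlo_rcons_mono.
Qed.

Lemma letter_cell w a t : cell (rcons w a) t -> letter_at w t = a.
Proof.
rewrite cell_rcons => /andP[at_ ta]; rewrite /letter_at; case: pselect => [h|[]]; last by exists a.
case: ex_minnP => b tb bmin; apply/eqP; rewrite eqn_leq bmin// leqNgt; apply/negP => ba.
by have := lt_le_trans tb (le_trans (wlo_rcons_mono w ba) at_); rewrite ltxx.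
Qed.

Fixpoint word_at (t : R) n : seq nat :=
  if n is n'.+1 then rcons (word_at t n') (letter_at (word_at t n') t) else [::].

Lemma word_cell t n : 0 <= t < 1 -> cell (word_at t n) t.
Proof.
move=> t01; elim: n => [|n IH]; last exact: cell_letter.
by rewrite /cell /wlo /= big_ord0 wmass_nil add0r.
Qed.

Lemma cell_sub w a t : cell (rcons w a) t -> cell w t.
Proof.
rewrite cell_rcons => /andP[h1 h2]; apply/andP; split.
  by apply: le_trans h1; rewrite wlo_rcons lerDl sumr_ge0// => i _; exact: wmass_ge0.
by apply: lt_le_trans h2 _; rewrite wlo_rcons lerD2l; exact: wmass_partial.
Qed.

Lemma cell_word w t : cell w t -> word_at t (size w) = w.
Proof.
elim/last_ind: w => //= w a IH c; rewrite size_rcons /= IH; last exact: cell_sub c.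
by rewrite (letter_cell c).
Qed.

Lemma wlo_bounds w : 0 <= wlo w /\ wlo w + wmass w <= 1.
Proof.
elim/last_ind: w => [|w a [IH1 IH2]].
  by rewrite /wlo /= big_ord0 wmass_nil add0r.
have s0 : 0 <= \sum_(b < a) wmass (rcons w b) by apply: sumr_ge0 => i _; exact: wmass_ge0.
rewrite wlo_rcons; split; first by rewrite addr_ge0.
have := wmass_partial w a.+1; rewrite big_ord_recr /=.
by move: IH2; lra.
Qed.

(** The words only subdivide the half-open unit interval; elsewhere the zero sequence is chosen, on
    a null set. *)
Definition outcome (t : R) (i : nat) : nat := if 0 <= t < 1 then letter_at (word_at t i) t else 0%N.

Lemma mkseq_outcome t n : 0 <= t < 1 -> mkseq (outcome t) n = word_at t n.
Proof.
move=> t01; elim: n => //= n IH; rewrite mkseqS IH; congr rcons.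
by rewrite /outcome t01.
Qed.

Let P : probability (measurableTypeR R) R := uniform_prob (@ltr01 R).

Lemma uniform_itv (a b : R) : 0 <= a -> a <= b -> b <= 1 -> P [set` `[a, b[] = (b - a)%:E.
Proof.
move=> a0 ab b1; rewrite /P /= /uniform_prob integral_uniform_pdf setIidl; last first.
  move=> x /=; rewrite !in_itv /= => /andP[ax xb]; rewrite (le_trans a0 ax) /=.
  exact: ltW (lt_le_trans xb b1).
rewrite (eq_integral (cst 1%E)); last first.
  move=> x; rewrite inE /= in_itv /= => /andP[ax xb]; rewrite /uniform_pdf.
  by rewrite (le_trans a0 ax) (ltW (lt_le_trans xb b1)) subr0 invr1.
rewrite integral_cst//= mul1e lebesgue_measure_itv /= lte_fin.
by move: ab; rewrite le_eqVlt => /orP[/eqP->|->]; rewrite ?ltxx ?subrr ?EFinB.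
Qed.

Let nin : set R := [set t | ~~ (0 <= t < 1)].

Let m01 : measurable ([set` `[0, 1[] : set R). Proof. exact: measurable_itv. Qed.

Let ninE : nin = ~` [set` `[(0:R), 1[].
Proof. by apply/seteqP; split => t /=; rewrite /nin /= in_itv /= => /negP. Qed.

Let nin0 : P nin = 0%E.
Proof.
rewrite ninE probability_setC// uniform_itv// subr0.
by rewrite -EFinB subrr.
Qed.

Let outcome_word (w : seq nat) : [set t : R | mkseq (outcome t) (size w) = w] =
  [set` `[wlo w, wlo w + wmass w[] `|` (if w == nseq (size w) 0%N then nin else set0).
Proof.
have [l0 l1] := wlo_bounds w.
apply/seteqP; split => t /=.
  have [t01|tn] := boolP (0 <= t < 1).
    rewrite (mkseq_outcome _ t01) => wE; left; rewrite in_itv /= -wE.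
    exact: word_cell.
  move=> wE; right; rewrite -{1}wE.
  suff -> : mkseq (outcome t) (size w) == nseq (size w) 0%N by [].
  apply/eqP/(@eq_from_nth _ 0%N); rewrite size_mkseq ?size_nseq// => i iw.
  by rewrite nth_mkseq// nth_nseq iw /outcome (negbTE tn).
case.
  rewrite in_itv /= => c; rewrite mkseq_outcome; first exact: cell_word.
  by move/andP: c => [c1 c2]; rewrite (le_trans l0 c1) (lt_le_trans c2 l1).
case: eqP => // wE tn; rewrite wE size_nseq.
apply/(@eq_from_nth _ 0%N); rewrite size_mkseq ?size_nseq// => i iw.
by rewrite nth_mkseq// nth_nseq iw /outcome (negbTE tn).
Qed.

Lemma measurable_outcome_word n w : measurable [set t : R | mkseq (outcome t) n = w].
Proof.
have [<-|nw] := eqVneq (size w) n; last first.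
  rewrite (_ : [set _ | _] = set0)//; apply/seteqP; split => t //= wE.
  by move: nw; rewrite -wE size_mkseq eqxx.
rewrite outcome_word; apply: measurableU; first exact: measurable_itv.
by case: ifP => _ //; rewrite ninE; apply: measurableC.
Qed.

Lemma prob_outcome_word w : P [set t : R | mkseq (outcome t) (size w) = w] = (wmass w)%:E.
Proof.
have [l0 l1] := wlo_bounds w; have w0 := wmass_ge0 w.
rewrite outcome_word measureU0 //.
- by apply: (etrans (uniform_itv l0 _ l1)); rewrite ?lerDl//; congr EFin; ring.
- by case: ifP => _ //; rewrite ninE; apply: measurableC.
- by case: ifP => _; rewrite ?measure0.
Qed.

Fixpoint words (c n : nat) : seq (seq nat) :=
  if n is n'.+1 then [seq rcons w a | w <- words c n', a <- iota 0 c] else [:: [::]].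

Lemma mem_words c n y : (forall i, (i < n)%N -> (y i < c)%N) -> mkseq y n \in words c n.
Proof.
elim: n => //= n IH yc; rewrite mkseqS; apply/allpairsP; exists (mkseq y n, y n) => /=.
split=> //; last by rewrite mem_iota /=; exact: yc.
by apply: IH => i ni; apply: yc; exact: ltnW.
Qed.

Lemma size_words c n w : w \in words c n -> size w = n.
Proof.
elim: n w => [|n IH] w /=; first by rewrite inE => /eqP ->.
by case/allpairsP => -[w' a] /= [/IH <- _ ->]; rewrite size_rcons.
Qed.

Lemma words_uniq c n : uniq (words c n).
Proof.
elim: n => //= n IH; apply: allpairs_uniq => //; first exact: iota_uniq.
by move=> [w a] [w' a'] _ _ /= /rcons_inj.
Qed.

Lemma prob_outcome_words n (ws : seq (seq nat)) : uniq ws -> (forall w, w \in ws -> size w = n) ->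
  measurable [set t : R | mkseq (outcome t) n \in ws] /\
  (\sum_(w <- ws) (wmass w)%:E)%E = P [set t : R | mkseq (outcome t) n \in ws].
Proof.
elim: ws => [_ _|w ws IH /= /andP[wws uws] sz].
  rewrite big_nil (_ : [set _ | _] = set0) ?measure0//.
  by apply/seteqP; split.
have [m1 e1] := IH uws (fun v vws => sz v (mem_behead (s := w :: ws) vws)).
have m2 := measurable_outcome_word n w.
have -> : [set t : R | mkseq (outcome t) n \in w :: ws] =
    [set t | mkseq (outcome t) n = w] `|` [set t | mkseq (outcome t) n \in ws].
  apply/seteqP; split => t /=; first by rewrite inE => /orP[/eqP|]; [left|right].
  by case=> [->|h]; rewrite inE ?eqxx// h orbT.
split; first exact: measurableU.
have dj : [set t : R | mkseq (outcome t) n = w] `&` [set t | mkseq (outcome t) n \in ws] = set0.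
  by apply/seteqP; split => t //= [->]; rewrite (negbTE wws).
have pw := prob_outcome_word w; rewrite (sz w (mem_head _ _)) in pw.
by rewrite big_cons e1 -pw; exact: (esym (measureU P m2 m1 dj)).
Qed.

Let valw (w : seq nat) : nat -> nat := fun i => nth 0%N w i.

Let cylA (A : set (nat -> nat)) n :=
  forall y y', (forall i, (i < n)%N -> y i = y' i) -> A y -> A y'.

Let cyl_mkseq A n y : cylA A n -> A y <-> A (valw (mkseq y n)).
Proof.
move=> cA; split; apply: cA => i ni; by rewrite /valw nth_mkseq.
Qed.

Lemma measurable_outcome (A : set (nat -> nat)) n :
  (forall y y', (forall i, (i < n)%N -> y i = y' i) -> A y -> A y') ->
  measurable [set t : R | A (outcome t)].
Proof.
move=> cA.
rewrite (_ : [set _ | _] = \bigcup_(w in [set: seq nat])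
   (if `[< A (valw w) >] then [set t : R | mkseq (outcome t) n = w] else set0)).
  apply: countable_bigcupT_measurable; first exact: countableP.
  by move=> w; case: ifP => _ //; exact: measurable_outcome_word.
apply/seteqP; split => t /=.
  move=> At; exists (mkseq (outcome t) n) => //.
  by rewrite asboolT //; exact: (iffLR (cyl_mkseq (outcome t) cA) At).
by case=> w _; case: asboolP => // Aw /= wE; apply/(cyl_mkseq _ cA); rewrite wE.
Qed.

(** When the first [n] letters are below [c], the event is a finite union of words, on which the
    probability and [Lam] agree; tightness makes the remainder smaller than [e]. This gives one
    inequality, and its application to the complement gives the other. *)
Let prob_ge (A : set (nat -> nat)) n : cylA A n ->
  ((Lam (fun y => `[< A y >]%:R))%:E <= P [set t : R | A (outcome t)])%E.
Proof.
move=> cA; apply/lee_addgt0Pr => e e0.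
have en : 0 < e / n.+1%:R by rewrite divr_gt0.
pose ci i := sval (cid (tight i en)).
pose c := \max_(i < n) ci i.
pose ws := [seq w <- words c n | `[< A (valw w) >]].
have [m1 e1] : measurable [set t : R | mkseq (outcome t) n \in ws] /\
  (\sum_(w <- ws) (wmass w)%:E)%E = P [set t : R | mkseq (outcome t) n \in ws].
  apply: prob_outcome_words; first exact/filter_uniq/words_uniq.
  by move=> w; rewrite mem_filter => /andP[_ /size_words].
have le1 : (P [set t : R | mkseq (outcome t) n \in ws] <= P [set t : R | A (outcome t)])%E.
  apply: le_measure; rewrite ?inE //; first exact: (measurable_outcome cA).
  by move=> t /=; rewrite mem_filter => /andP[/asboolP h _]; apply/(cyl_mkseq _ cA).
apply: le_trans (leeD2r _ le1); rewrite -e1 sumEFin -EFinD lee_fin.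
have [b1 s1] := Lam_sum ws (fun w y => mkseq y (size w) == w).
have [b2 s2] := Lam_sum (index_iota 0 n) (fun i y => (c <= y i)%N).
apply: (@le_trans _ _ (Lam (fun y => \sum_(w <- ws) (mkseq y (size w) == w)%:R
   + 1 * \sum_(i <- index_iota 0 n) (c <= y i)%N%:R))).
  apply: Lam_le; [exact: bndb|exact: bnd_lin|move=> y].
  case: asboolP => Ay; last by rewrite mul1r addr_ge0 ?sumr_ge0.
  have [/allP yc|/allPn[i ic yc]] := boolP (all (fun i => (y i < c)%N) (iota 0 n)).
    have yw : mkseq y n \in ws.
      rewrite mem_filter; apply/andP; split; first exact/asboolP/(iffLR (cyl_mkseq y cA) Ay).
      by apply: mem_words => i ni; apply: yc; rewrite mem_iota.
    rewrite (bigD1_seq (mkseq y n)) //=; last exact/filter_uniq/words_uniq.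
    by rewrite size_mkseq eqxx -addrA lerDl addr_ge0 ?mul1r ?sumr_ge0.
  rewrite mul1r [X in _ + X](bigD1_seq i) /= ?iota_uniq ?mem_index_iota//; last first.
    by move: ic; rewrite mem_iota.
  by rewrite leqNgt yc addrA addrAC lerDr addr_ge0 ?sumr_ge0.
rewrite Lam_lin// s1 s2 mul1r lerD2l.
rewrite big_mkord; apply: (@le_trans _ _ (\sum_(i < n) e / n.+1%:R)).
  apply: ler_sum => i _; apply: (@le_trans _ _ (Lam (fun y => (ci i <= y i)%N%:R))).
    apply: Lam_le; [exact: bndb|exact: bndb|move=> y].
    rewrite ler_nat; have : (ci i <= c)%N by exact: (leq_bigmax i).
    by case: (leqP c (y i)) => // h1 h2; rewrite (leq_trans h2 h1).
  exact: svalP (cid (tight i en)).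
rewrite sumr_const card_ord -[_ *+ _]mulr_natr -mulrA ler_piMr ?(ltW e0)//.
by rewrite mulrC ler_pdivrMr ?ltr0n// mul1r ler_nat.
Qed.

Lemma prob_outcome (A : set (nat -> nat)) n :
  (forall y y', (forall i, (i < n)%N -> y i = y' i) -> A y -> A y') ->
  P [set t : R | A (outcome t)] = (Lam (fun y => `[< A y >]%:R))%:E.
Proof.
move=> cA; apply/eqP; rewrite eq_le; apply/andP; split; last exact: (prob_ge cA).
have cB : cylA (~` A) n.
  by move=> y y' yy nA /cA h; apply: nA; apply: h => i ni; rewrite yy.
have mA := measurable_outcome cA.
have := prob_ge cB.
have -> : [set t : R | (~` A) (outcome t)] = ~` [set t : R | A (outcome t)] by [].
rewrite probability_setC// => h.
have b1 : bnd (fun _ : nat -> nat => 1 : R) by exists 1 => _; rewrite normr1.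
have := @Lam_lin (fun=> 1) (fun y => `[< A y >]%:R) (-1) b1 (bndb _).
have -> : (fun y => 1 + -1 * `[< A y >]%:R) = (fun y => `[< (~` A) y >]%:R : R).
  apply/funext => y; case: asboolP => Ay; case: asboolP => nAy //=.
  - by rewrite mulN1r subrr.
  - by rewrite mulr0 addr0.
rewrite Lam1 mulN1r => LB; move: h; rewrite LB.
have fP : P [set t : R | A (outcome t)] \is a fin_num by exact: fin_num_measure.
rewrite -(fineK fP) -EFinB !lee_fin; lra.
Qed.

End Realization.

(** A tight, finitely additive mean is realized by countably many integer variables, as far as
    events of finitely many coordinates are concerned. Indices are numbered by [pickle], and numbers
    that code no index carry the constant 0. *)
Lemma realization (R : realType) (I : countType) (Lam : ((I -> nat) -> R) -> R) :
  (forall f g, bnd f -> bnd g -> (forall y, f y <= g y) -> Lam f <= Lam g) ->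
  (forall f g c, bnd f -> bnd g -> Lam (fun y => f y + c * g y) = Lam f + c * Lam g) ->
  Lam (fun=> 1) = 1 ->
  (forall i (e : R), 0 < e -> exists c : nat, Lam (fun y => (c <= y i)%N%:R) <= e) ->
  exists (d : measure_display) (T : measurableType d) (P : probability T R) (Y : T -> I -> nat),
  forall (s : seq I) (A : set (I -> nat)),
  (forall y y', (forall i, i \in s -> y i = y' i) -> A y -> A y') ->
  measurable [set t | A (Y t)] /\ P [set t | A (Y t)] = (Lam (fun y => `[< A y >]%:R))%:E.
Proof.
move=> Lle Llin L1 tight.
pose enc (y : I -> nat) (n : nat) : nat := if unpickle n is Some i then y i else 0%N.
pose Ln (g : (nat -> nat) -> R) := Lam (fun y => g (enc y)).
have bE (g : (nat -> nat) -> R) : bnd g -> bnd (fun y => g (enc y)).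
  by move=> [B gB]; exists B => y.
have Lnle f g : bnd f -> bnd g -> (forall y, f y <= g y) -> Ln f <= Ln g.
  by move=> bf bg fg; apply: Lle => //; exact: bE.
have Lnlin f g c : bnd f -> bnd g -> Ln (fun y => f y + c * g y) = Ln f + c * Ln g.
  by move=> bf bg; apply: Llin; exact: bE.
have Ln1 : Ln (fun=> 1) = 1 by [].
have Lntight i (e : R) : 0 < e -> exists c : nat, Ln (fun y => (c <= y i)%N%:R) <= e.
  move=> e0; rewrite /Ln /enc; case: (unpickle i) => [j|]; first exact: tight.
  exists 1%N; apply: le_trans (ltW e0).
  have b1 : bnd (fun _ : I -> nat => 1 : R) by exists 1 => _; rewrite normr1.
  have := Llin (fun=> 1) (fun=> 1) (-1) b1 b1; rewrite L1 mulr1 subrr => h.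
  by have -> : (fun _ : I -> nat => (1 <= 0)%N%:R) = (fun=> 0 : R); [|rewrite h].
exists _, (measurableTypeR R), (uniform_prob (@ltr01 R)), (fun t i => outcome Ln t (pickle i)).
move=> s A cA; pose B : set (nat -> nat) := [set z | A (fun i => z (pickle i))].
pose n := (\max_(i <- s) pickle i).+1.
have cB y y' : (forall i, (i < n)%N -> y i = y' i) -> B y -> B y'.
  move=> yy; apply: cA => i si; apply: yy; rewrite /n ltnS.
  by rewrite (big_rem _ si) /= leq_maxl.
split; first exact: (measurable_outcome Lnle Lnlin Ln1 Lntight cB).
apply: etrans (prob_outcome Lnle Lnlin Ln1 Lntight cB) _.
congr (_%:E); congr Lam; apply/funext => y; rewrite /B /=.
have -> : (fun i => enc y (pickle i)) = y by apply/funext => i; rewrite /enc pickleK.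
by [].
Qed.

(** * The discrete chain *)

(** Attempts are made in sweeps over [vs]; the second component numbers the sweeps and keeps the
    clocks of a site apart. *)
Definition att (vs : seq int) (J0 j : nat) : seq (int * nat) :=
  flatten [seq [seq (x, i) | x <- vs] | i <- iota J0 j].

Lemma attS vs J0 j : att vs J0 j.+1 = [seq (x, J0) | x <- vs] ++ att vs J0.+1 j.
Proof. by []. Qed.

Lemma att_cat vs J0 i j : att vs J0 (i + j) = att vs J0 i ++ att vs (J0 + i) j.
Proof. by rewrite /att iotaD map_cat flatten_cat. Qed.

Lemma mem_att vs J0 j a : (a \in att vs J0 j) = (a.1 \in vs) && (J0 <= a.2 < J0 + j)%N.
Proof.
case: a => x i; apply/flatten_mapP/andP => /= [[i' ii /mapP[y yv [-> ->]]]|[xv ij]].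
  by rewrite mem_iota in ii.
exists i; first by rewrite mem_iota.
by apply/mapP; exists x.
Qed.

Lemma att_uniq vs J0 j : uniq vs -> uniq (att vs J0 j).
Proof.
move=> uv; elim: j J0 => // j IH J0; rewrite attS cat_uniq IH andbT.
rewrite map_inj_uniq ?uv//=; last by move=> x y [].
by apply/hasPn => a; rewrite mem_att => /andP[_ /andP[h _]]; apply/mapP => -[y _ ay]; move: h; rewrite ay /= ltnn.
Qed.

Lemma size_att vs J0 j : size (att vs J0 j) = (j * size vs)%N.
Proof. by elim: j J0 => // j IH J0; rewrite attS size_cat size_map IH mulSn. Qed.

Lemma att_filter vs (P : pred int) J0 j :
  [seq a <- att vs J0 j | P a.1] = att [seq x <- vs | P x] J0 j.
Proof.
elim: j J0 => // j IH J0; rewrite !attS filter_cat IH; congr (_ ++ _).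
by rewrite filter_map.
Qed.

Section Runs.
Context (R : realType) (lam : R).
Hypothesis lam_gt0 : 0 < lam.
Context (k : nat) (vs : seq int).
Hypothesis vs_uniq : uniq vs.

Notation m := (mesh R k).
Notation E := (E (letters k.+1) (cw lam k.+1)).
Notation attempt := (attempt_at lam k.+1 vs).
Notation tree := (tree lam k.+1 vs).
Notation few s := (num_on vs s.2 <= k.+1)%N.

Let iw0 i : 0 <= iw lam i. Proof. exact: iw_ge0. Qed.
Let iw1 : \sum_(i < 3) iw lam i = 1. Proof. exact: iw_sum. Qed.
Let m0 : 0 <= m. Proof. exact: mesh_ge0. Qed.

Lemma few_incr i x (s : state) : few s -> x \in vs -> (0 < awake (s.2 x))%N -> few (incr s.1 x, app i x s.2).
Proof. by move=> fs xv aw; apply: leq_trans fs; exact: num_on_app. Qed.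

Lemma attempt_lin x (f g : state -> R) c s :
  attempt x (fun s => f s + c * g s) s = attempt x f s + c * attempt x g s.
Proof.
rewrite /attempt_at /avg; case: ifP => _; last by rewrite !addr0.
rewrite (eq_bigr (fun i : 'I_3 => iw lam i * f (incr s.1 x, app i x s.2)
   + c * (iw lam i * g (incr s.1 x, app i x s.2)))); last by move=> i _; ring.
by rewrite big_split /= -mulr_sumr; ring.
Qed.

Lemma attempt_le x (f g : state -> R) s : few s -> x \in vs ->
  (forall s, few s -> f s <= g s) -> attempt x f s <= attempt x g s.
Proof.
move=> fs xv fg; rewrite /attempt_at xv.
case: (posnP (awake (s.2 x))) => [->|aw]; first by rewrite !mul0r !addr0 fg.
set c := (awake _)%:R / _; have c1 : c <= 1.
  rewrite /c ler_pdivrMr ?ltr0n// mul1r ler_nat.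
  by apply: leq_trans (awake_num _) _; apply: leq_trans fs; exact: num_on_mem.
have c0 : 0 <= c by rewrite /c divr_ge0.
have a1 : avg lam f x s <= avg lam g x s.
  by apply: ler_sum => i _; rewrite ler_wpM2l//; apply: fg; exact: few_incr.
have -> : f s + c * (avg lam f x s - f s) = (1 - c) * f s + c * avg lam f x s by ring.
have -> : g s + c * (avg lam g x s - g s) = (1 - c) * g s + c * avg lam g x s by ring.
by apply: lerD; apply: ler_wpM2l => //; rewrite ?subr_ge0// fg.
Qed.

Lemma tree_le as_ (f g : state -> R) s : few s -> (forall a, a \in as_ -> a.1 \in vs) ->
  (forall s, few s -> f s <= g s) -> tree as_ f s <= tree as_ g s.
Proof.
elim: as_ s => [|a r IH] s fs av fg /=; first exact: fg.
apply: attempt_le => //; first by apply: av; rewrite mem_head.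
by move=> s' fs'; apply: IH => // b br; apply: av; rewrite inE br orbT.
Qed.

Lemma tree_lin as_ (f g : state -> R) c s :
  tree as_ (fun s => f s + c * g s) s = tree as_ f s + c * tree as_ g s.
Proof.
elim: as_ s => //= a r IH s; rewrite -attempt_lin; congr (attempt _ _ _).
exact/funext.
Qed.

Lemma tree_cat a b (f : state -> R) s : tree (a ++ b) f s = tree a (tree b f) s.
Proof. by elim: a s => //= x a IH s; congr (attempt _ _ _); exact/funext. Qed.

Lemma attempt_snd x (f : config -> R) s : x \in vs ->
  attempt x (fun s => f s.2) s = qstep1 lam m x f s.2.
Proof.
by move=> xv; rewrite /attempt_at xv /qstep1 /rate /avg /= /mesh; ring.
Qed.

Lemma tree_step xs i (f : config -> R) s : {subset xs <= vs} ->
  tree [seq (x, i) | x <- xs] (fun s => f s.2) s = qstep lam m xs f s.2.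
Proof.
elim: xs s => //= x r IH s sub; rewrite -attempt_snd; last by apply: sub; rewrite mem_head.
congr (attempt _ _ _); apply/funext => s'; apply: IH => y yr; apply: sub.
by rewrite inE yr orbT.
Qed.

Lemma tree_att J0 j (f : config -> R) s :
  tree (att vs J0 j) (fun s => f s.2) s = iter j (qstep lam m vs) f s.2.
Proof.
elim: j J0 s => // j IH J0 s; rewrite attS tree_cat iterS -(tree_step J0)//.
congr (tree _ _ _); apply/funext => s'; exact: IH.
Qed.

Fixpoint vis (om : coord -> nat) (J0 : nat) (l : seq (nat * set config)) (s : state) : R :=
  if l is (j, A) :: r then
    let s' := run om (mem vs) (att vs J0 j) s in \1_A s'.2 * vis om (J0 + j) r s'
  else 1.

Lemma vis_upd_tick om x i v J0 l s : (i < J0)%N ->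
  vis (upd om (true, x, i) v) J0 l s = vis om J0 l s.
Proof.
elim: l J0 s => //= -[j A] r IH J0 s iJ; rewrite run_upd_tick ?IH//; first by rewrite ltn_addr.
by rewrite mem_att /= leqNgt iJ andbF.
Qed.

Lemma vis_upd_stack om x i v J0 l s : (i < s.1 x)%N ->
  vis (upd om (false, x, i) v) J0 l s = vis om J0 l s.
Proof.
elim: l J0 s => //= -[j A] r IH J0 s iJ; rewrite run_upd_stack ?IH//.
exact: leq_trans (run_le _ _ _ _ _).
Qed.

Definition total (l : seq (nat * set config)) : nat := sumn [seq p.1 | p <- l].

Context (cs : seq coord) (Jm B : nat).
Hypothesis cs_uniq : uniq cs.
Hypothesis cs_tick : forall x i, x \in vs -> (i < Jm)%N -> (true, x, i) \in cs.
Hypothesis cs_stack : forall x i, x \in vs -> (i < B)%N -> (false, x, i) \in cs.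

Lemma E_vis om0 J0 l s : (J0 + total l <= Jm)%N ->
  (forall x, x \in vs -> s.1 x + total l * size vs <= B)%N -> few s ->
  E cs (fun om => vis om J0 l s) om0 = dfdd lam vs k l s.2.
Proof.
elim: l J0 s om0 => [|[j A] r IH] J0 s om0 Jl Bl fs; first by rewrite /= E_cst// => c; exact: cw_sum.
rewrite /total /= in Jl Bl; rewrite -/(total r) in Jl Bl.
pose C om (s' : state) := \1_A s'.2 * vis om (J0 + j) r s'.
rewrite (@run_tree R lam k.+1 lam_gt0 _ cs vs (att vs J0 j) C
   (fun s' => \1_A s'.2 * dfdd lam vs k r s'.2) (B - total r * size vs)%N) //=.
- by rewrite (tree_att J0 j (fun z => \1_A z * dfdd lam vs k r z)).
- exact: att_uniq.
- by move=> a; rewrite mem_att => /andP[av /andP[_ ai]]; apply: cs_tick => //; apply: leq_trans ai _; lia.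
- by move=> x l xv lB; apply: cs_stack => //; lia.
- move=> x xv; have := Bl x xv; rewrite size_att mulnDl addnA => h.
  by rewrite leq_subRL ?(leq_trans (leq_addl _ _) h)// addnC.
- by move=> a om i s'; rewrite mem_att => /andP[_ /andP[_ ai]]; rewrite /C vis_upd_tick.
- by move=> x l om i s' xv li; rewrite /C vis_upd_stack.
- move=> s' om h1 h2; rewrite /C E_Z IH//; [by lia| |exact: leq_trans h2 fs].
  move=> x xv; rewrite addnC -leq_subRL ?h1//; apply: leq_trans (Bl x xv).
  by rewrite mulnDl addnA leq_addl.
Qed.

Lemma E_run om0 J0 j (f : state -> R) s : (J0 + j <= Jm)%N ->
  (forall x, x \in vs -> s.1 x + j * size vs <= B)%N -> few s ->
  E cs (fun om => f (run om (mem vs) (att vs J0 j) s)) om0 = tree (att vs J0 j) f s.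
Proof.
move=> Jj Bl fs.
rewrite (@run_tree R lam k.+1 lam_gt0 _ cs vs (att vs J0 j) (fun _ => f) f B) //=.
- exact: att_uniq.
- by move=> a; rewrite mem_att => /andP[av /andP[_ ai]]; apply: cs_tick => //; apply: leq_trans ai _; lia.
- by move=> x /Bl; rewrite size_att.
- by move=> s' om h1 h2; rewrite E_cst// => c; exact: cw_sum.
Qed.

(** The Markov property at an intermediate time, for functions of both states: beyond [s1], the run
    uses clocks and instructions that have not been read. *)
Lemma E_run2 om0 i j (f : state -> state -> R) s : (i + j <= Jm)%N ->
  (forall x, x \in vs -> s.1 x + (i + j) * size vs <= B)%N -> few s ->
  E cs (fun om => let s1 := run om (mem vs) (att vs 0 i) s in
     f s1 (run om (mem vs) (att vs i j) s1)) om0 =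
  tree (att vs 0 i) (fun s1 => tree (att vs i j) (f s1) s1) s.
Proof.
move=> Jj Bl fs.
rewrite (@run_tree R lam k.+1 lam_gt0 _ cs vs (att vs 0 i)
   (fun om s1 => f s1 (run om (mem vs) (att vs i j) s1))
   (fun s1 => tree (att vs i j) (f s1) s1) (B - j * size vs)%N) //=.
- exact: att_uniq.
- by move=> a; rewrite mem_att => /andP[av /andP[_ ai]]; apply: cs_tick => //; apply: leq_trans ai _; lia.
- by move=> x l xv lB; apply: cs_stack => //; lia.
- move=> x xv; have := Bl x xv; rewrite size_att mulnDl addnA => h.
  by rewrite leq_subRL ?(leq_trans (leq_addl _ _) h)// addnC.
- move=> a om v s'; rewrite mem_att => /andP[_ /andP[_ ai]]; congr (f _ _); apply: run_upd_tick.
  by rewrite mem_att /=; apply/negP => /andP[_ /andP[]]; rewrite leqNgt; move: ai; rewrite add0n => ->.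
- by move=> x l om v s' xv li; congr (f _ _); exact: run_upd_stack.
- move=> s' om h1 h2; apply: E_run => //; last exact: leq_trans h2 fs.
  move=> x xv; rewrite addnC -leq_subRL ?h1//; apply: leq_trans (Bl x xv).
  by rewrite mulnDl addnA leq_addl.
Qed.

End Runs.

(** * Expected numbers of topplings *)

Section Costs.
Context (R : realType) (lam : R).
Hypothesis lam_gt0 : 0 < lam.
Context (k : nat) (vs : seq int).
Hypothesis vs_uniq : uniq vs.
Hypothesis k3 : (3 <= k)%N.

Notation m := (mesh R k).
Notation attempt := (attempt_at lam k.+1 vs).
Notation tree := (tree lam k.+1 vs).
Notation few s := (num_on vs s.2 <= k.+1)%N.

Let iw0 i : 0 <= iw lam i. Proof. exact: iw_ge0. Qed.
Let iw1 : \sum_(i < 3) iw lam i = 1. Proof. exact: iw_sum. Qed.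
Let m0 : 0 <= m. Proof. exact: mesh_ge0. Qed.
Let m4 : 4 * m <= 1.
Proof. by rewrite /mesh ler_pdivrMr ?ltr0n// mul1r ler_nat. Qed.

(* A summable weight halving at each step, so that expected weighted totals grow
   at most exponentially in time. *)
Definition wz (y : int) : R := 2^-1 ^+ `|y|%N.

Lemma wz_gt0 y : 0 < wz y. Proof. by rewrite exprn_gt0// invr_gt0. Qed.

Lemma wz_near y z : (`|(y - z)%R| <= 1)%N -> wz z <= 2 * wz y.
Proof.
move=> yz; have h : (`|y| <= `|z|.+1)%N by lia.
have h2 : (2^-1 : R) ^+ `|z|.+1 <= 2^-1 ^+ `|y| by rewrite ler_wiXn2l ?invr_ge0// invf_le1// ler1n.
by rewrite exprS in h2; rewrite /wz; move: h2; set a := _ ^+ `|z|; set b := _ ^+ `|y|; lra.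
Qed.

Lemma attempt_bound x (f : state -> R) s c : x \in vs -> (0 < awake (s.2 x))%N ->
  (forall i : 'I_3, f (incr s.1 x, app i x s.2) - f s <= c) ->
  attempt x f s <= f s + m * (awake (s.2 x))%:R * c.
Proof.
move=> xv aw fc; rewrite /attempt_at xv lerD2l /avg.
have -> : \sum_(i < 3) iw lam i * f (incr s.1 x, app i x s.2) - f s =
   \sum_(i < 3) iw lam i * (f (incr s.1 x, app i x s.2) - f s).
  by under [in RHS]eq_bigr do rewrite mulrBr; rewrite sumrB -mulr_suml iw1 mul1r.
rewrite [_ / _]mulrC -/(mesh R k) ler_wpM2l ?mulr_ge0//.
by rewrite -[c]mul1r -iw1 mulr_suml; apply: ler_sum => i _; rewrite ler_wpM2l.
Qed.

Notation W := (pot wz vs).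

Lemma pot_app_le (r : seq int) i x eta : uniq r -> (0 < awake (eta x))%N ->
  pot wz r (app i x eta) - pot wz r eta <= (if x \in r then 1 else 2) * wz x.
Proof.
move=> ur aw; rewrite pot_app//.
have h z : (`|(x - z)%R| <= 1)%N -> (if z \in r then wz z else 0) <= 2 * wz x.
  by move=> xz; case: ifP => _; [exact: wz_near|rewrite mulr_ge0// ltW// wz_gt0].
have h1 := h (x - 1); have h2 := h (x + 1); have w0 := ltW (wz_gt0 x).
case: ifP => _; last case: ifP => _; last first.
- by rewrite subrr mulr_ge0//; case: ifP.
- have {}h2 := h2 ltac:(lia); move: h2; set b := (if x + 1 \in r then _ else _).
  by case: ifP => _; lra.
- have {}h1 := h1 ltac:(lia); move: h1; set b := (if x - 1 \in r then _ else _).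
  by case: ifP => _; lra.
Qed.

(** Inside a sweep, [r] lists the sites still to be visited. A jump from [x] adds at most [wz x] to
    [W] and at most [2 * wz x] to the potential of [r], which does not contain [x]. As [4 * m <= 1],
    the total gain is at most [2 * wz x], and the term of [x] in the potential of [x :: r] pays for
    it. *)
Lemma attempt_W x r s : x \in vs -> x \notin r -> uniq r -> few s ->
  attempt x (fun s => W s.2 + 2 * m * pot wz r s.2) s <= W s.2 + 2 * m * pot wz (x :: r) s.2.
Proof.
move=> xv xr ur fs; have w0 := ltW (wz_gt0 x).
have -> : pot wz (x :: r) s.2 = wz x * (num (s.2 x))%:R + pot wz r s.2 by rewrite /pot big_cons.
have nn : 0 <= (num (s.2 x))%:R :> R by [].
case: (posnP (awake (s.2 x))) => [a0|aw].
  rewrite /attempt_at xv a0 !mul0r addr0 lerD2l ler_wpM2l ?mulr_ge0// lerDr mulr_ge0//.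
apply: le_trans (@attempt_bound x _ s (wz x + 2 * m * (2 * wz x)) xv aw _) _.
  move=> i; have := pot_app_le i vs_uniq aw; have := pot_app_le i ur aw.
  rewrite xv (negbTE xr) /= mul1r => h1 h2.
  have h3 : 2 * m * (pot wz r (app i x s.2) - pot wz r s.2) <= 2 * m * (2 * wz x).
    by rewrite ler_wpM2l ?mulr_ge0.
  by move: h2 h3; rewrite mulrBr; lra.
have an : (awake (s.2 x))%:R <= (num (s.2 x))%:R :> R by rewrite ler_nat awake_num.
set a := (awake _)%:R in an *; set n := (num _)%:R in an nn *.
have e1 : m * a * (wz x + 2 * m * (2 * wz x)) <= m * a * (2 * wz x).
  rewrite ler_wpM2l ?mulr_ge0//.
  have := ler_wpM2r w0 m4; lra.
have e2 : m * a * (2 * wz x) <= m * n * (2 * wz x) by rewrite ler_wpM2r ?mulr_ge0// ler_wpM2l.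
by move: e1 e2; lra.
Qed.

Lemma W_ge z (s : state) : z \in vs -> (awake (s.2 z))%:R <= (wz z)^-1 * W s.2.
Proof.
move=> zv; rewrite -ler_pdivrMl ?invr_gt0 ?wz_gt0// invrK /pot (big_rem z)//=.
apply: (@le_trans _ _ (wz z * (num (s.2 z))%:R)).
  by apply: ler_wpM2l; [exact: ltW (wz_gt0 z)|rewrite ler_nat awake_num].
by rewrite lerDl sumr_ge0// => y _; rewrite mulr_ge0// ltW// wz_gt0.
Qed.

Lemma W_ge0 eta : 0 <= W eta.
Proof. by rewrite sumr_ge0// => y _; rewrite mulr_ge0// ltW// wz_gt0. Qed.

(** The visit to [z] topples with probability [m] times its activity, which is at most [W / wz z].
    The coefficient [c] carries the cost of the sweeps to come. *)
Lemma tree_step_cost z c i xs s : 0 <= c -> z \in vs -> uniq xs -> {subset xs <= vs} -> few s ->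
  tree [seq (x, i) | x <- xs] (fun s => (s.1 z)%:R + c * W s.2) s <=
  (s.1 z)%:R + (c + (if z \in xs then m * (wz z)^-1 else 0)) * (W s.2 + 2 * m * pot wz xs s.2).
Proof.
move=> c0 zv; elim: xs s => [|x r IH] s /=.
  by move=> _ _ fs; rewrite /pot big_nil mulr0 !addr0.
move=> /andP[xr ur] sub fs.
have xv : x \in vs by apply: sub; rewrite mem_head.
have subr' : {subset r <= vs} by move=> y yr; apply: sub; rewrite inE yr orbT.
set c' := c + (if z \in r then m * (wz z)^-1 else 0).
apply: (@le_trans _ _ (attempt x (fun s => (s.1 z)%:R + c' * (W s.2 + 2 * m * pot wz r s.2)) s)).
  by apply: attempt_le => // s' fs'; apply: IH.
rewrite attempt_lin.
have wi0 : 0 <= (wz z)^-1 by rewrite invr_ge0 ltW// wz_gt0.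
have c'0 : 0 <= c' by rewrite /c' addr_ge0//; case: ifP => _ //; rewrite mulr_ge0.
have P0 : 0 <= pot wz (x :: r) s.2 by rewrite sumr_ge0// => y _; rewrite mulr_ge0// ltW// wz_gt0.
have h1 := ler_wpM2l c'0 (attempt_W xv xr ur fs).
have h2 : attempt x (fun s => (s.1 z)%:R) s <= (s.1 z)%:R + (if z == x then m * (wz z)^-1 * W s.2 else 0).
  case: (posnP (awake (s.2 x))) => [a0|aw].
    rewrite /attempt_at xv a0 !mul0r addr0 lerDl.
    by case: ifP => _ //; rewrite !mulr_ge0// W_ge0.
  apply: le_trans (@attempt_bound x _ s (z == x)%:R xv aw _) _.
    move=> i' /=; rewrite /incr; case: eqP => _ /=; first by rewrite -natr1 addrAC subrr add0r.
    by rewrite subrr.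
  rewrite lerD2l; case: eqP => [<-|_]; last by rewrite mulr0.
  by rewrite mulr1 -mulrA ler_wpM2l// W_ge.
apply: le_trans (lerD h2 h1) _; rewrite inE.
have PW : 0 <= 2 * m * pot wz (x :: r) s.2 by rewrite !mulr_ge0.
case: eqP => [zx|_] /=; last by rewrite addr0.
have -> : c' = c by rewrite /c' zx (negbTE xr) addr0.
have h3 : 0 <= m / wz z * (2 * m * pot wz (x :: r) s.2) by rewrite mulr_ge0// mulr_ge0.
by move: h3; rewrite mulrDl !mulrDr; lra.
Qed.

(** A discrete Gronwall argument: the potential grows by a factor of at most [1 + 2 * m] per sweep,
    and each sweep costs at most [m / wz z] times the current potential. *)
Lemma tree_cost z J0 j s : z \in vs -> few s ->
  tree (att vs J0 j) (fun s => (s.1 z)%:R) s <=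
  (s.1 z)%:R + j%:R * m * (wz z)^-1 * (1 + 2 * m) ^+ j * W s.2.
Proof.
move=> zv; have wi0 : 0 <= (wz z)^-1 by rewrite invr_ge0 ltW// wz_gt0.
have g0 n : 0 <= (1 + 2 * m) ^+ n by rewrite exprn_ge0// addr_ge0// mulr_ge0.
have g1 n : 1 <= (1 + 2 * m) ^+ n by rewrite exprn_ege1// lerDl mulr_ge0.
elim: j J0 s => [|j IH] J0 s fs; first by rewrite /= !mul0r addr0.
rewrite attS tree_cat.
set c := j%:R * m * (wz z)^-1 * (1 + 2 * m) ^+ j.
have c0 : 0 <= c by rewrite !mulr_ge0.
apply: (@le_trans _ _ (tree [seq (x, J0) | x <- vs] (fun s => (s.1 z)%:R + c * W s.2) s)).
  apply: tree_le => //; first by move=> a /mapP[x xv ->].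
  by move=> s' fs'; exact: IH.
apply: le_trans (tree_step_cost J0 c0 zv vs_uniq (fun _ => id) fs) _.
rewrite zv lerD2l.
have -> : W s.2 + 2 * m * W s.2 = (1 + 2 * m) * W s.2 by ring.
rewrite mulrA ler_wpM2r ?W_ge0//.
apply: (@le_trans _ _ ((c + m * (wz z)^-1 * (1 + 2 * m) ^+ j) * (1 + 2 * m))).
  by rewrite ler_wpM2r ?addr_ge0 ?mulr_ge0// lerD2l ler_peMr ?mulr_ge0.
by rewrite le_eqVlt /c exprSr -natr1; apply/orP; left; apply/eqP; ring.
Qed.

Lemma iter_W j eta : (num_on vs eta <= k.+1)%N ->
  iter j (qstep lam m vs) W eta <= (1 + 2 * m) ^+ j * W eta.
Proof.
have g0 n : 0 <= (1 + 2 * m) ^+ n by rewrite exprn_ge0// addr_ge0// mulr_ge0.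
move=> fe.
suff H J0 (s : state) : few s ->
    tree (att vs J0 j) (fun s => W s.2) s <= (1 + 2 * m) ^+ j * W s.2.
  by have := H 0%N (fun=> 0%N, eta) fe; rewrite tree_att.
elim: j J0 s => [|j IH] J0 s fs; first by rewrite mul1r.
rewrite attS tree_cat exprS.
apply: (@le_trans _ _ (tree [seq (x, J0) | x <- vs] (fun s => (1 + 2 * m) ^+ j * W s.2) s)).
  apply: tree_le => //; first by move=> a /mapP[x xv ->].
  by move=> s' fs'; exact: IH.
have step xs s' : uniq xs -> {subset xs <= vs} -> few s' ->
    tree [seq (x, J0) | x <- xs] (fun s => W s.2) s' <= W s'.2 + 2 * m * pot wz xs s'.2.
  elim: xs s' => [|x r IHr] s' /=; first by rewrite /pot big_nil mulr0 addr0.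
  move=> /andP[xr ur] sub fs'; have xv : x \in vs by apply: sub; rewrite mem_head.
  apply: le_trans (attempt_W xv xr ur fs'); apply: attempt_le => // s1 fs1.
  by apply: IHr => // y yr; apply: sub; rewrite inE yr orbT.
have := step vs s vs_uniq (fun _ => id) fs => h.
have := @tree_lin R lam k vs [seq (x, J0) | x <- vs] (fun=> 0) (fun s => W s.2) ((1 + 2 * m) ^+ j) s.
have -> : (fun s : state => 0 + (1 + 2 * m) ^+ j * W s.2) = (fun s => (1 + 2 * m) ^+ j * W s.2).
  by apply/funext => s'; rewrite add0r.
move=> ->.
have -> : tree [seq (x, J0) | x <- vs] (fun=> 0 : R) s = 0.
  elim: (map _ _) s {fs h} => //= a r IHr s.
  by rewrite /attempt_at /avg IHr big1 ?subrr ?mulr0 ?add0r// => [|i _]; rewrite ?if_same ?IHr ?mulr0.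
rewrite add0r; apply: le_trans (ler_wpM2l (g0 j) h) _.
by rewrite le_eqVlt; apply/orP; left; apply/eqP; ring.
Qed.

(** Topplings of the two neighbours since [s0]: an upper bound for the arrivals at [z] that can only
    grow along a run. *)
Definition arrivals (z : int) (s0 s : state) : R :=
  ((s.1 (z - 1))%:R - (s0.1 (z - 1))%:R) + ((s.1 (z + 1))%:R - (s0.1 (z + 1))%:R).

Lemma arrivals_incr i x z s0 (s : state) :
  arrivals z s0 s <= arrivals z s0 (incr s.1 x, app i x s.2).
Proof. by rewrite /arrivals /= lerD// lerD2r ler_nat /incr; case: ifP. Qed.

Lemma arrivals_tree as_ z s0 s : (forall a, a \in as_ -> a.1 \in vs) -> few s ->
  arrivals z s0 s <= tree as_ (arrivals z s0) s.
Proof.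
elim: as_ s => //= a r IH s' av fs.
have av' : a.1 \in vs by apply: av; rewrite mem_head.
apply: (@le_trans _ _ (attempt a.1 (arrivals z s0) s')).
  rewrite /attempt_at av' lerDl.
  case: (posnP (awake (s'.2 a.1))) => [->|aw]; first by rewrite !mul0r.
  rewrite mulr_ge0 ?divr_ge0// subr_ge0 -[leLHS]mul1r -iw1 mulr_suml.
  by apply: ler_sum => i _; rewrite ler_wpM2l// arrivals_incr.
by apply: attempt_le => // s1 fs1; apply: IH => // b br; apply: av; rewrite inE br orbT.
Qed.

(* To topple at a site that was inactive, a neighbour has to topple first, so
   the probability of this during a short time is quadratically small. *)
Lemma tree_inactive z s0 as_ s : (forall a, a \in as_ -> a.1 \in vs) -> few s ->
  (awake (s.2 z))%:R <= 2 * arrivals z s0 s ->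
  tree as_ (fun s => (s.1 z)%:R) s <= (s.1 z)%:R
    + 2 * m * (count (fun a => a.1 == z) as_)%:R * tree as_ (arrivals z s0) s.
Proof.
elim: as_ s => [|a r IH] s av fs inv /=; first by rewrite mulr0 mul0r addr0.
have av1 : a.1 \in vs by apply: av; rewrite mem_head.
have avr : forall b, b \in r -> b.1 \in vs by move=> b br; apply: av; rewrite inE br orbT.
set A := attempt a.1 (tree r (arrivals z s0)).
have As : arrivals z s0 s <= A s by exact: (@arrivals_tree (a :: r)).
case: (posnP (awake (s.2 a.1))) => [a0|aw].
  have AE f : attempt a.1 f s = f s by rewrite /attempt_at av1 a0 !mul0r addr0.
  rewrite /A !AE in As *; apply: le_trans (IH s avr fs inv) _.
  have a00 : 0 <= arrivals z s0 s by rewrite -(pmulr_rge0 _ (ltr0n R 2)); apply: le_trans inv.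
  by rewrite lerD2l ler_wpM2r ?(le_trans a00)// ler_wpM2l ?mulr_ge0// ler_nat leq_addl.
(* Every instruction preserves the invariant. An arrival raises the activity of [z] by at most 2,
   which happens when it wakes a sleeping particle; hence the factor 2. *)
have inv' i : (awake ((app i a.1 s.2) z))%:R <= 2 * arrivals z s0 (incr s.1 a.1, app i a.1 s.2).
  have [az|az] := eqVneq a.1 z.
    apply: (@le_trans _ _ (awake (s.2 z))%:R); last by apply: le_trans inv _; rewrite ler_wpM2l// arrivals_incr.
    rewrite ler_nat -az /app; case: ifP => _.
      by rewrite /jump /set_site eqxx (_ : (a.1 == a.1 - 1) = false) /=; lia.
    case: ifP => _; first by rewrite /jump /set_site eqxx (_ : (a.1 == a.1 + 1) = false) /=; lia.
    by case E: (s.2 a.1) => [|[|[|n]]] //; rewrite ?E// /set_site eqxx.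
  have same : ((app i a.1 s.2) z = s.2 z) ->
     (awake ((app i a.1 s.2) z))%:R <= 2 * arrivals z s0 (incr s.1 a.1, app i a.1 s.2).
    by move=> ->; apply: le_trans inv _; rewrite ler_wpM2l// arrivals_incr.
  have arr : z = a.1 - 1 \/ z = a.1 + 1 ->
     (awake (arrive (s.2 z)))%:R <= 2 * arrivals z s0 (incr s.1 a.1, app i a.1 s.2).
    move=> za; have aw2 : (awake (arrive (s.2 z)) <= awake (s.2 z) + 2)%N by case: (s.2 z) => //= n; lia.
    apply: (@le_trans _ _ ((awake (s.2 z))%:R + 2)); first by rewrite -natrD ler_nat.
    have : arrivals z s0 s + 1 <= arrivals z s0 (incr s.1 a.1, app i a.1 s.2).
      rewrite /arrivals /= /incr; case: za => ->.
        rewrite (_ : (a.1 - 1 - 1 == a.1) = false); last lia.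
        by rewrite subrK eqxx -natr1; lra.
      rewrite (_ : (a.1 + 1 + 1 == a.1) = false); last lia.
      by rewrite addrK eqxx -natr1; lra.
    by move: inv; lra.
  have zx : (z == a.1) = false by rewrite eq_sym (negbTE az).
  rewrite /app in same *; move: same; case: ifP => _ same.
    move: same; rewrite /jump /set_site zx.
    case: eqP => [zE _|_]; last exact.
    by rewrite zE (_ : (a.1 - 1 == a.1) = false) -?zE; [apply: arr; left|lia].
  move: same; case: ifP => _ same.
    move: same; rewrite /jump /set_site zx.
    case: eqP => [zE _|_]; last exact.
    by rewrite zE (_ : (a.1 + 1 == a.1) = false) -?zE; [apply: arr; right|lia].
  apply: same; case: (s.2 a.1) => [|[|[|n]]] //; by rewrite /set_site zx.
set n := count _ r.
pose g s' := (s'.1 z)%:R + 2 * m * n%:R * tree r (arrivals z s0) s'.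
have le1 : attempt a.1 (tree r (fun s => (s.1 z)%:R)) s <= attempt a.1 g s.
  rewrite /attempt_at av1.
  set c := (awake _)%:R / _; have c1 : c <= 1.
    rewrite /c ler_pdivrMr ?ltr0n// mul1r ler_nat.
    by apply: leq_trans (awake_num _) _; apply: leq_trans fs; exact: num_on_mem.
  have c0 : 0 <= c by rewrite /c divr_ge0.
  have h0 := IH s avr fs inv.
  have h1 : avg lam (tree r (fun s => (s.1 z)%:R)) a.1 s <= avg lam g a.1 s.
    apply: ler_sum => i _; rewrite ler_wpM2l//; apply: IH => //; [exact: few_incr|exact: inv'].
  have cE (f : state -> R) : f s + c * (avg lam f a.1 s - f s) = (1 - c) * f s + c * avg lam f a.1 s by ring.
  rewrite !cE.
  by apply: lerD; apply: ler_wpM2l => //; rewrite subr_ge0.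
apply: le_trans le1 _; rewrite /g attempt_lin -/A.
have h2 : attempt a.1 (fun s => (s.1 z)%:R) s <= (s.1 z)%:R + (a.1 == z)%:R * (2 * m * A s).
  apply: le_trans (@attempt_bound a.1 _ s (a.1 == z)%:R av1 aw _) _.
    move=> i /=; rewrite /incr eq_sym; case: eqP => _ /=; first by rewrite -natr1 addrAC subrr add0r.
    by rewrite subrr.
  rewrite lerD2l; case: eqP => [az|_] /=; last by rewrite mulr0 mul0r.
  rewrite mulr1 mul1r az -mulrA mulrCA ler_wpM2l//; apply: le_trans inv _.
  by rewrite ler_wpM2l.
apply: le_trans (lerD h2 (lexx _)) _; rewrite -/A natrD.
by rewrite le_eqVlt; apply/orP; left; apply/eqP; ring.
Qed.

End Costs.

Lemma run_out om (V : pred int) as_ s x : ~~ V x -> (run om V as_ s).1 x = s.1 x.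
Proof.
move=> Vx; elim: as_ s => //= a r IH s; rewrite IH /step; case: ifP => //= /andP[Va _].
by rewrite /incr; case: eqP => // xa; rewrite -xa (negbTE Vx) in Va.
Qed.

Lemma big_zs (R : zmodType) (F : int -> R) n :
  \sum_(y <- zs n) F y = F 0 + \sum_(i < n) (F i.+1%:Z + F (- i.+1%:Z)).
Proof.
have -> : \sum_(i < n) (F i.+1%:Z + F (- i.+1%:Z)) =
    \sum_(y <- [seq i.+1%:Z | i <- iota 0 n] ++ [seq - i.+1%:Z | i <- iota 0 n]) F y.
  have iE (G : nat -> R) : \sum_(i < n) G i = \sum_(i <- iota 0 n) G i.
    by rewrite -(big_mkord xpredT G) /index_iota subn0.
  rewrite big_cat !big_map big_split /=; congr (_ + _).
    exact: (iE (fun i => F i.+1%:Z)).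
  exact: (iE (fun i => F (- i.+1%:Z))).
rewrite -(big_cons _ _ 0 _ xpredT F); apply: perm_big; apply: uniq_perm.
- exact: zs_uniq.
- rewrite /= cat_uniq mem_cat !map_inj_uniq ?iota_uniq /=; try by move=> i j; lia.
  rewrite andbT negb_or -andbA; apply/and3P; split.
  + by apply/mapP => -[i _]; lia.
  + by apply/mapP => -[i _]; lia.
  + by apply/hasPn => y /mapP[i _ ->]; apply/mapP => -[j _]; lia.
move=> y; rewrite mem_zs inE mem_cat; apply/idP/or3P => [yn|].
  case: (ltrgt0P y) => y0.
  - constructor 2; apply/mapP; exists (`|y|.-1)%N; rewrite ?mem_iota; lia.
  - constructor 3; apply/mapP; exists (`|y|.-1)%N; rewrite ?mem_iota; lia.
  - by constructor 1.
case=> [/eqP->//|/mapP[i]|/mapP[i]]; rewrite mem_iota => ? ->; lia.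
Qed.

(** * The walk started from the truncated pattern *)

Section System.
Context (R : realType) (lam : R).
Hypothesis lam_gt0 : 0 < lam.
Context (p q : nat).

Definition pat (s : nat) (x : int) : nat := if (p%:Z %| x + s%:Z)%Z then q else 0%N.
Definition patM (M s : nat) (x : int) : nat := if (`|x| <= M)%N then pat s x else 0%N.

Lemma patM_le M s x : (patM M s x <= pat s x)%N. Proof. by rewrite /patM; case: ifP. Qed.
Lemma pat_le s x : (pat s x <= q)%N. Proof. by rewrite /pat; case: ifP. Qed.

Lemma patM_mono M M' s x : (M <= M')%N -> (patM M s x <= patM M' s x)%N.
Proof. by move=> MM; rewrite /patM; case: ifP => // xM; rewrite (leq_trans xM MM). Qed.

(** The pattern fills [[- M, M]] and the walk lives on [[- L, L]]. The infinite-volume walk is built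
    from the systems with [L = M]; letting [L] grow with [M] fixed gives the truncated systems by
    which [is_arw] prescribes the law. *)
Definition sys om M L s J : state :=
  run om (mem (zs L)) (att (zs L) 0 J) (start (patM M s)).

Lemma sys_consistent om M L s J : consistent (patM M s) om (sys om M L s J).
Proof. exact/consistent_run/consistent_start. Qed.

Lemma sys_add om M L s i j :
  sys om M L s (i + j) = run om (mem (zs L)) (att (zs L) i j) (sys om M L s i).
Proof. by rewrite /sys att_cat run_cat add0n. Qed.

Lemma sys_mono_time om M L s i j x : (i <= j)%N -> ((sys om M L s i).1 x <= (sys om M L s j).1 x)%N.
Proof. by move=> /subnKC <-; rewrite sys_add; exact: run_le. Qed.

Lemma sys_mono om M L M' L' s J x : (M <= M')%N -> (L <= L')%N ->
  ((sys om M L s J).1 x <= (sys om M' L' s J).1 x)%N.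
Proof.
move=> MM LL; rewrite /sys.
have -> : att (zs L) 0 J = [seq a <- att (zs L') 0 J | (`|a.1| <= L)%N].
  by rewrite (att_filter _ (fun x => (`|x| <= L)%N)) zs_filter.
rewrite (run_filter om (V := mem (zs L)) (W := fun x => (`|x| <= L)%N)); last first.
  by move=> y /=; rewrite mem_zs.
apply: run_mono; try exact: consistent_start; last by [].
- by move=> y /=; rewrite !mem_zs => h; exact: leq_trans h LL.
- by move=> y; exact: patM_mono.
Qed.

Lemma sys_out om M L s J x : x \notin zs L -> (sys om M L s J).1 x = 0%N.
Proof. by move=> xL; rewrite /sys run_out. Qed.

Definition ticks (k : nat) : nat := steps lam k%:R k.
Definition depth (k : nat) : nat := (ticks k * size (zs k))%N.

(** All the coordinates that the [k]-th chain can read in [[- k, k]] up to time [k]: an attempt uses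
    at most one instruction, so the total number [depth k] of attempts bounds the depth of every
    stack. *)
Definition box (k : nat) : seq coord :=
  [seq (true, x, i) | x <- zs k, i <- iota 0 (ticks k)] ++
  [seq (false, x, i) | x <- zs k, i <- iota 0 (depth k)].

Lemma box_uniq k : uniq (box k).
Proof.
rewrite /box cat_uniq; apply/and3P; split.
- by apply: allpairs_uniq; rewrite ?zs_uniq ?iota_uniq// => -[x i] [y j] _ _ [-> ->].
- apply/hasPn => c /allpairsP[[x i] [_ _ ->]]; apply/negP => /allpairsP[[y j] [_ _ e]].
  by case: e.
- by apply: allpairs_uniq; rewrite ?zs_uniq ?iota_uniq// => -[x i] [y j] _ _ [-> ->].
Qed.

Lemma box_tick k x i : x \in zs k -> (i < ticks k)%N -> (true, x, i) \in box k.
Proof.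
move=> xk ik; rewrite mem_cat; apply/orP; left; apply/allpairsP; exists (x, i).
by rewrite mem_iota.
Qed.

Lemma box_stack k x i : x \in zs k -> (i < depth k)%N -> (false, x, i) \in box k.
Proof.
move=> xk ik; rewrite mem_cat; apply/orP; right; apply/allpairsP; exists (x, i).
by rewrite mem_iota.
Qed.

Definition Ek k (f : (coord -> nat) -> R) : R := E (letters k.+1) (cw lam k.+1) (box k) f (fun=> 0%N).

Definition big_enough (L : nat) (t : R) (k : nat) :=
  [/\ (3 <= k)%N, (L <= k)%N, ((2 * L + 1) * q <= k.+1)%N & t <= k%:R].

Lemma near_big_enough L t : \forall k \near \oo, big_enough L t k.
Proof.
near=> k; split.
- by near: k; exact: nbhs_infty_ge.
- by near: k; exact: nbhs_infty_ge.
- by apply: leqW; near: k; exact: nbhs_infty_ge.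
- by near: k; exact: nbhs_infty_ger.
Unshelve. all: by end_near. Qed.

Lemma steps_mono t t' k : t <= t' -> (steps lam t k <= steps lam t' k)%N.
Proof.
by move=> tt; apply: le_truncn; rewrite ler_wpM2r// ler_wpM2r// addr_ge0// ltW.
Qed.

Lemma num_patM M L s : (num_on (zs L) (conf (patM M s)) <= (2 * L + 1) * q)%N.
Proof.
apply: (@leq_trans (\sum_(y <- zs L) q)).
  by apply: leq_sum => y _ /=; exact: leq_trans (patM_le _ _ _) (pat_le _ _).
by rewrite big_const_seq count_predT iter_addn_0 size_map size_iota; lia.
Qed.

Lemma Ek_le k f g : (forall om, f om <= g om) -> Ek k f <= Ek k g.
Proof. by move=> fg; apply: E_le => // c i; exact: cw_ge0. Qed.

Lemma Ek_lin k f g c : Ek k (fun om => f om + c * g om) = Ek k f + c * Ek k g.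
Proof. by rewrite /Ek E_D E_Z. Qed.

Lemma Ek_cst k a : Ek k (fun=> a) = a.
Proof. by apply: E_cst => c; exact: cw_sum. Qed.

Lemma Ek_vis k M L s (l : seq (nat * set config)) : big_enough L 0 k -> (total l <= ticks k)%N ->
  Ek k (fun om => vis R (zs L) om 0 l (start (patM M s))) = dfdd lam (zs L) k l (conf (patM M s)).
Proof.
move=> [k3 Lk qk _] lk.
have sub x : x \in zs L -> x \in zs k by rewrite !mem_zs => h; exact: leq_trans h Lk.
rewrite /Ek (@E_vis R lam lam_gt0 k (zs L) (zs_uniq L) (box k) (ticks k) (depth k)) //.
- exact: box_uniq.
- by move=> x i /sub xk; exact: box_tick.
- by move=> x i /sub xk; exact: box_stack.
- move=> x _; rewrite add0n /depth; apply: leq_mul => //.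
  by rewrite !size_map !size_iota; lia.
- exact: leq_trans (num_patM _ _ _) qk.
Qed.

Definition W0 : R := 3 * q%:R.

Lemma wz_sum n : \sum_(y <- zs n) wz R y <= 3.
Proof.
rewrite big_zs /wz expr0.
have -> : \sum_(i < n) (2^-1 ^+ `|i.+1%:Z|%N + 2^-1 ^+ `|- i.+1%:Z|%N) = \sum_(i < n) 2^-1 ^+ i :> R.
  by apply: eq_bigr => i _; rewrite abszN /= exprS; field.
suff -> : \sum_(i < n) 2^-1 ^+ i = 2 - 2 * 2^-1 ^+ n :> R.
  by have : 0 <= 2^-1 ^+ n :> R; [rewrite exprn_ge0|lra].
elim: n => [|n IH]; first by rewrite big_ord0 expr0; ring.
by rewrite big_ord_recr /= IH exprS; field.
Qed.

Lemma pot_patM M L s : pot (wz R) (zs L) (conf (patM M s)) <= W0.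
Proof.
apply: (@le_trans _ _ (\sum_(y <- zs L) wz R y * q%:R)).
  apply: ler_sum => y _; rewrite ler_wpM2l ?(ltW (wz_gt0 _ _))// ler_nat /=.
  exact: leq_trans (patM_le _ _ _) (pat_le _ _).
by rewrite -mulr_suml ler_wpM2r// wz_sum.
Qed.

(** Bound on the mean toppling intensity at [z] up to time [t]. The initial potential is at most
    [W0], since the weights sum to at most 3; it grows at most by the exponential factor, and the
    inverse weight extracts the share of [z]. No box size and no mesh enters. *)
Definition Kz (z : int) (t : R) : R := (wz R z)^-1 * expR (2 * (t * (1 + lam))) * W0.

Lemma Kz_ge0 z t : 0 <= Kz z t.
Proof. by rewrite !mulr_ge0 ?expR_ge0// invr_ge0 ltW// wz_gt0. Qed.

Lemma pow_mesh k j t : 0 <= t -> (j <= steps lam t k)%N ->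
  (1 + 2 * mesh R k) ^+ j <= expR (2 * (t * (1 + lam))).
Proof.
move=> t0 jk; have := @exp_ge_pow R (mesh R k) 2 j (mesh_ge0 R k) (ler0n R 2).
rewrite [mesh R k * 2]mulrC => /le_trans; apply; rewrite ler_expR mulrC ler_wpM2l//.
have /andP[h _] := steps_bounds lam_gt0 k t0; apply: le_trans h.
by rewrite ler_wpM2r ?mesh_ge0// ler_nat.
Qed.

Lemma steps_diff t t' k : 0 <= t -> t <= t' ->
  (steps lam t' k - steps lam t k)%N%:R * mesh R k <= (t' - t) * (1 + lam) + mesh R k.
Proof.
move=> t0 tt; have /andP[h1 h2] := steps_bounds lam_gt0 k t0.
have /andP[h3 h4] := steps_bounds lam_gt0 k (le_trans t0 tt).
rewrite natrB ?steps_mono// !mulrBl; lra.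
Qed.

Lemma Ek_run2 k M L s i j (f : state -> state -> R) : big_enough L 0 k -> (i <= j)%N -> (j <= ticks k)%N ->
  Ek k (fun om => f (sys om M L s i) (sys om M L s j)) =
  tree lam k.+1 (zs L) (att (zs L) 0 i)
   (fun s1 => tree lam k.+1 (zs L) (att (zs L) i (j - i)) (f s1) s1) (start (patM M s)).
Proof.
move=> [k3 Lk qk _] ij jk.
have sub x : x \in zs L -> x \in zs k by rewrite !mem_zs => h; exact: leq_trans h Lk.
rewrite -(@E_run2 R lam lam_gt0 k (zs L) (zs_uniq L) (box k) (ticks k) (depth k) _ _ _ (fun=> 0%N)) //.
- by rewrite /Ek; apply: eq_E => om; rewrite /= -[in LHS](subnKC ij) sys_add.
- exact: box_uniq.
- by move=> x l /sub xk; exact: box_tick.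
- by move=> x l /sub xk; exact: box_stack.
- by rewrite subnKC.
- move=> x _; rewrite add0n subnKC// /depth; apply: leq_mul => //.
  by rewrite !size_map !size_iota; lia.
- exact: leq_trans (num_patM _ _ _) qk.
Qed.

Lemma tree_snd_le k L J (f : state -> R) (g : config -> R) s : (num_on (zs L) s.2 <= k.+1)%N ->
  (forall s, (num_on (zs L) s.2 <= k.+1)%N -> f s <= g s.2) ->
  tree lam k.+1 (zs L) (att (zs L) 0 J) f s <= iter J (qstep lam (mesh R k) (zs L)) g s.2.
Proof.
move=> fs fg; rewrite -(@tree_att R lam k (zs L) 0 J g s).
apply: tree_le => //; first exact: zs_uniq.
by move=> a; rewrite mem_att => /andP[].
Qed.

Lemma iter_qstepZ k (vs : seq int) J c (f : config -> R) eta :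
  iter J (qstep lam (mesh R k) vs) (fun e => c * f e) eta =
  c * iter J (qstep lam (mesh R k) vs) f eta.
Proof.
have q1 x (h : config -> R) e : qstep1 lam (mesh R k) x (fun e => c * h e) e = c * qstep1 lam (mesh R k) x h e.
  rewrite /qstep1 /rate; under eq_bigr do rewrite mulrCA.
  by rewrite -mulr_sumr; ring.
have qs h e : qstep lam (mesh R k) vs (fun e => c * h e) e = c * qstep lam (mesh R k) vs h e.
  elim: vs e => //= x r IH e; rewrite -q1; congr (qstep1 _ _ _ _ _); exact/funext.
elim: J eta => //= J IH eta; rewrite -qs.
by rewrite (_ : iter J _ (fun e => c * f e) = fun e => c * iter J (qstep lam (mesh R k) vs) f e) //; exact/funext.
Qed.

Lemma tree_cst1 k vs as_ (s : state) : tree lam k vs as_ (fun=> 1) s = 1 :> R.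
Proof.
elim: as_ s => //= a r IH s; rewrite /attempt_at /avg IH.
have -> : \sum_(i < 3) iw lam i * tree lam k vs r (fun=> 1) (incr s.1 a.1, app i a.1 s.2) = 1.
  by under eq_bigr do rewrite IH mulr1; exact: iw_sum.
by rewrite subrr mulr0 if_same addr0.
Qed.

Lemma tree_cst0 k vs as_ (s : state) : tree lam k vs as_ (fun=> 0) s = 0 :> R.
Proof.
elim: as_ s => //= a r IH s; rewrite /attempt_at /avg IH.
by rewrite big1 ?subrr ?mulr0 ?if_same ?addr0// => i _; rewrite IH mulr0.
Qed.

Lemma count_att vs J0 j z : uniq vs -> (count (fun a : int * nat => a.1 == z) (att vs J0 j) <= j)%N.
Proof.
move=> uv; elim: j J0 => // j IH J0; rewrite attS count_cat -[j.+1]add1n leq_add//.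
by rewrite count_map (eq_count (a2 := pred1 z))// count_uniq_mem// leq_b1.
Qed.

(** Given the state at time [t], [tree_cost] bounds the topplings up to [t'] by the potential at
    time [t], whose mean is bounded by [iter_W]. The term [mesh R k] accounts for rounding the times
    to steps. *)
Lemma Ek_incr k M L s z t t' : 0 <= t -> t <= t' -> big_enough L t' k ->
  Ek k (fun om => ((sys om M L s (steps lam t' k)).1 z)%:R - ((sys om M L s (steps lam t k)).1 z)%:R)
  <= ((t' - t) * (1 + lam) + mesh R k) * Kz z t'.
Proof.
move=> t0 tt be; have t'0 := le_trans t0 tt.
have be0 : big_enough L 0 k by case: be => *; split.
have [k3 Lk qk tk] := be.
have d0 : 0 <= (t' - t) * (1 + lam) + mesh R k.
  by rewrite addr_ge0 ?mesh_ge0// mulr_ge0 ?subr_ge0// addr_ge0// ltW.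
case: (boolP (z \in zs L)) => zL; last first.
  rewrite (_ : (fun om => _) = (fun=> 0)); last by apply/funext => om; rewrite !sys_out// subrr.
  by rewrite Ek_cst mulr_ge0// Kz_ge0.
have fs0 : (num_on (zs L) (conf (patM M s)) <= k.+1)%N by exact: leq_trans (num_patM _ _ _) qk.
have ij := steps_mono k tt.
rewrite (@Ek_run2 k M L s _ _ (fun s1 s2 => (s2.1 z)%:R - (s1.1 z)%:R) be0 ij); last exact: steps_mono.
set i := steps lam t k in ij *; set j := steps lam t' k in ij *.
set c := (j - i)%N%:R * mesh R k * (wz R z)^-1 * (1 + 2 * mesh R k) ^+ (j - i).
apply: (@le_trans _ _ (iter i (qstep lam (mesh R k) (zs L)) (fun e => c * pot (wz R) (zs L) e) (conf (patM M s)))).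
  apply: (@tree_snd_le k L i _ _ (start (patM M s))) => // s1 fs1.
  have := @tree_lin R lam k (zs L) (att (zs L) i (j - i)) (fun s2 => (s2.1 z)%:R) (fun=> 1) (- ((s1.1 z)%:R : R)) s1.
  have -> : (fun s0 : state => (s0.1 z)%:R + - ((s1.1 z)%:R : R) * 1) = (fun s2 => (s2.1 z)%:R - (s1.1 z)%:R).
    by apply/funext => s2; rewrite mulr1.
  move=> ->.
  rewrite tree_cst1 mulr1 lerBlDl addrC -lerBlDr.
  have := tree_cost lam_gt0 (zs_uniq L) k3 i (j - i) zL fs1.
  by rewrite /c lerBlDr addrC [leRHS]addrC.
rewrite iter_qstepZ.
have g0 n : 0 <= (1 + 2 * mesh R k) ^+ n by rewrite exprn_ge0// addr_ge0// mulr_ge0// mesh_ge0.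
have c0 : 0 <= c by rewrite !mulr_ge0 ?mesh_ge0// invr_ge0 ltW// wz_gt0.
apply: le_trans (ler_wpM2l c0 (iter_W lam_gt0 (zs_uniq L) k3 i fs0)) _.
have WW := pot_patM M L s.
apply: (@le_trans _ _ (c * ((1 + 2 * mesh R k) ^+ i * W0))).
  by rewrite ler_wpM2l// ler_wpM2l.
have -> : c * ((1 + 2 * mesh R k) ^+ i * W0) =
  ((j - i)%N%:R * mesh R k) * ((wz R z)^-1 * (1 + 2 * mesh R k) ^+ j * W0).
  have -> : (1 + 2 * mesh R k) ^+ j = (1 + 2 * mesh R k) ^+ (j - i) * (1 + 2 * mesh R k) ^+ i.
    by rewrite -exprD subnK.
  by rewrite /c; ring.
apply: ler_pM; rewrite ?mulr_ge0 ?mesh_ge0 ?invr_ge0 ?(ltW (wz_gt0 _ _))//.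
  exact: steps_diff.
rewrite /Kz ler_wpM2r ?mulr_ge0// ler_wpM2l ?invr_ge0 ?(ltW (wz_gt0 _ _))//.
exact: pow_mesh.
Qed.

(** Given the state at time [t], [tree_inactive] yields one factor [t' - t] times the mean number of
    topplings of the neighbours, and [Ek_incr] yields the second factor. *)
Lemma Ek_inactive k M L s z t t' : 0 <= t -> t <= t' -> big_enough L t' k ->
  Ek k (fun om => let s1 := sys om M L s (steps lam t k) in
     (awake (s1.2 z) == 0%N)%:R * (((sys om M L s (steps lam t' k)).1 z)%:R - (s1.1 z)%:R))
  <= 2 * ((t' - t) * (1 + lam) + mesh R k) ^+ 2 * (Kz (z - 1) t' + Kz (z + 1) t').
Proof.
move=> t0 tt be; have t'0 := le_trans t0 tt.
have be0 : big_enough L 0 k by case: be => *; split.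
have [k3 Lk qk tk] := be.
have d0 : 0 <= (t' - t) * (1 + lam) + mesh R k.
  by rewrite addr_ge0 ?mesh_ge0// mulr_ge0 ?subr_ge0// addr_ge0// ltW.
have ij := steps_mono k tt.
set i := steps lam t k in ij *; set j := steps lam t' k in ij *.
set dt := (t' - t) * (1 + lam) + mesh R k.
pose F (s1 s2 : state) : R := (awake (s1.2 z) == 0%N)%:R * ((s2.1 z)%:R - (s1.1 z)%:R).
pose G (s1 s2 : state) : R := 2 * dt * arrivals R z s1 s2.
have jt : (j <= ticks k)%N by exact: steps_mono.
apply: (@le_trans _ _ (Ek k (fun om => G (sys om M L s i) (sys om M L s j)))).
  have := @Ek_run2 k M L s _ _ F be0 ij jt; rewrite /F => ->.
  rewrite (@Ek_run2 k M L s _ _ G be0 ij jt).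
  have fs0 : (num_on (zs L) (conf (patM M s)) <= k.+1)%N by exact: leq_trans (num_patM _ _ _) qk.
  apply: (@tree_le R lam lam_gt0 k (zs L) (zs_uniq L)); [exact: fs0|by move=> a; rewrite mem_att => /andP[]|].
  move=> s1 fs1.
  have av a : a \in att (zs L) i (j - i) -> a.1 \in zs L by rewrite mem_att => /andP[].
  have ar0 : arrivals R z s1 s1 = 0 by rewrite /arrivals !subrr addr0.
  have age : 0 <= tree lam k.+1 (zs L) (att (zs L) i (j - i)) (arrivals R z s1) s1.
    have := arrivals_tree lam_gt0 (zs_uniq L) z s1 av fs1; by rewrite ar0.
  have tZ c (f : state -> R) : tree lam k.+1 (zs L) (att (zs L) i (j - i)) (fun s => c * f s) s1 =
     c * tree lam k.+1 (zs L) (att (zs L) i (j - i)) f s1.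
    have := @tree_lin R lam k (zs L) (att (zs L) i (j - i)) (fun=> 0) f c s1.
    under eq_fun do rewrite add0r.
    by rewrite tree_cst0 add0r.
  rewrite tZ tZ.
  case: eqP => [a0|_]; last by rewrite mul0r !mulr_ge0.
  rewrite mul1r.
  have := @tree_lin R lam k (zs L) (att (zs L) i (j - i)) (fun s2 => (s2.1 z)%:R) (fun=> 1) (- ((s1.1 z)%:R : R)) s1.
  have -> : (fun s0 : state => (s0.1 z)%:R + - ((s1.1 z)%:R : R) * 1) = (fun s2 => (s2.1 z)%:R - (s1.1 z)%:R).
    by apply/funext => s2; rewrite mulr1.
  move=> ->; rewrite tree_cst1 mulr1 lerBlDl.
  have inv : (awake (s1.2 z))%:R <= 2 * arrivals R z s1 s1 by rewrite a0 ar0 mulr0.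
  apply: le_trans (tree_inactive lam_gt0 (zs_uniq L) k3 av fs1 inv) _.
  rewrite lerD2l ler_wpM2r// -[2 * mesh R k * _]mulrA ler_wpM2l//.
  apply: le_trans (steps_diff k t0 tt); rewrite mulrC ler_wpM2r ?mesh_ge0// ler_nat.
  exact/count_att/zs_uniq.
have -> : (fun om => G (sys om M L s i) (sys om M L s j)) = (fun om => 
    (2 * dt) * (((sys om M L s j).1 (z - 1))%:R - ((sys om M L s i).1 (z - 1))%:R) +
    (2 * dt) * (((sys om M L s j).1 (z + 1))%:R - ((sys om M L s i).1 (z + 1))%:R)).
  by apply/funext => om; rewrite /G /arrivals mulrDr.
rewrite Ek_lin.
have := Ek_lin k (fun=> 0) (fun om => ((sys om M L s j).1 (z - 1))%:R - ((sys om M L s i).1 (z - 1))%:R) (2 * dt).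
under eq_fun do rewrite add0r.
move=> ->; rewrite Ek_cst add0r.
have h1 := @Ek_incr k M L s (z - 1) t t' t0 tt be; have h2 := @Ek_incr k M L s (z + 1) t t' t0 tt be.
have dt2 : 0 <= 2 * dt by rewrite mulr_ge0.
apply: le_trans (lerD (ler_wpM2l dt2 h1) (ler_wpM2l dt2 h2)) _.
by rewrite -/dt le_eqVlt; apply/orP; left; apply/eqP; ring.
Qed.

End System.

Definition code (a : site_state) : nat := if a is Awake j then j.+1 else 0%N.
Definition decode (n : nat) : site_state := if n is j.+1 then Awake j else Asleep.

Lemma codeK : cancel code decode. Proof. by case. Qed.
Lemma decodeK : cancel decode code. Proof. by case. Qed.

(** * Construction of a fixed-energy activated random walk *)

(* [None] stands for the shift, [Some (true, (M, r, x))] for the odometer at [x]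
   at time [r] of the system in [-M, M], and [Some (false, (M, r, x))] for the
   state of [x] in that system. *)
Definition idx : countType := option (bool * (nat * rat * int)).

Definition iu (M : nat) (r : rat) (x : int) : idx := Some (true, (M, r, x)).
Definition ic (M : nat) (r : rat) (x : int) : idx := Some (false, (M, r, x)).

Lemma st_local sig sig' I w w' x : sig x = sig' x ->
  (forall y, (`|y - x| <= 1)%N -> w y = w' y) -> st sig I w x = st sig' I w' x.
Proof.
move=> ss ww; rewrite /st /occ ss !ww//; lia.
Qed.

Section Fields.
Context (R : realType) (lam : R).
Hypothesis lam_gt0 : 0 < lam.
Context (p q : nat).
Hypothesis p_gt0 : (0 < p)%N.

Definition fields (k s : nat) (om : coord -> nat) (i : idx) : nat :=
  if i is Some (b, (M, r, x)) then
    let S := sys p q om M M s (steps lam (ratr r : R) k) in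
    if b then S.1 x else code (S.2 x)
  else s.

Lemma fields_iu k s om M r x : fields k s om (iu M r x) =
  (sys p q om M M s (steps lam (ratr r : R) k)).1 x.
Proof. by []. Qed.

Lemma fields_ic k s om M r x : fields k s om (ic M r x) =
  code ((sys p q om M M s (steps lam (ratr r : R) k)).2 x).
Proof. by []. Qed.

(** Besides clocks and instructions, the phase is averaged over its [p] values; this is what makes
    the limiting initial law translation invariant. *)
Definition mean k (f : (idx -> nat) -> R) : R :=
  p%:R^-1 * \sum_(s < p) Ek lam k (fun om => f (fields k s om)).

Definition Q f := ulim (fun k => mean k f).

Lemma mean_le k f g :
  (forall (s : 'I_p) om, f (fields k s om) <= g (fields k s om)) -> mean k f <= mean k g.
Proof.
move=> fg; rewrite ler_wpM2l ?invr_ge0//; apply: ler_sum => s _.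
by apply: Ek_le => // om; exact: fg.
Qed.

Lemma mean_lin k f g c : mean k (fun y => f y + c * g y) = mean k f + c * mean k g.
Proof.
rewrite /mean mulrCA -mulrDr; congr (_ * _).
by rewrite mulr_sumr -big_split; apply: eq_bigr => s _; rewrite Ek_lin.
Qed.

Lemma mean_cst k a : mean k (fun=> a) = a.
Proof.
rewrite /mean (eq_bigr (fun=> a)) => [|s _]; last exact: Ek_cst.
by rewrite sumr_const card_ord -[a *+ p]mulr_natl mulrA mulVf ?mul1r// pnatr_eq0 -lt0n.
Qed.

Lemma mean_bounded f : bnd f -> bounded_seq (fun k => mean k f).
Proof.
move=> [B fB]; exists B => k; rewrite ler_norml; apply/andP; split.
  rewrite -(mean_cst k (- B)); apply: mean_le => s om.
  by have := fB (fields k s om); rewrite ler_norml => /andP[].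
rewrite -(mean_cst k B); apply: mean_le => s om.
by have := fB (fields k s om); rewrite ler_norml => /andP[].
Qed.

Lemma Q_le f g : bnd f -> bnd g -> (forall y, f y <= g y) -> Q f <= Q g.
Proof.
move=> bf bg fg; apply: ulim_le; try exact: mean_bounded.
by near=> k; apply: mean_le.
Unshelve. all: by end_near. Qed.

Lemma Q_lin f g c : bnd f -> bnd g -> Q (fun y => f y + c * g y) = Q f + c * Q g.
Proof.
move=> bf bg; rewrite /Q -ulim_lin; try exact: mean_bounded.
by congr ulim; apply/funext => k; rewrite mean_lin.
Qed.

Lemma Q_cst a : Q (fun=> a) = a.
Proof. by rewrite /Q -[RHS]ulim_cst; congr ulim; apply/funext => k; exact: mean_cst. Qed.

Lemma Q_le_lim f b l : bnd f -> (\forall k \near \oo, mean k f <= b k) ->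
  b @ \oo --> l -> Q f <= l.
Proof.
move=> bf fb bl; apply/ler_addgt0Pr => e e0; rewrite -[l + e]ulim_cst.
apply: ulim_le; [exact: mean_bounded|by exists `|l + e| => k|].
near=> k; apply: (@le_trans _ _ (b k)); first by near: k.
have : `|l - b k| < e by near: k; move/cvgrPdist_lt : bl; apply.
by rewrite ltr_distl => /andP[]; lra.
Unshelve. all: by end_near. Qed.

Lemma bnd_nat (b : (idx -> nat) -> bool) : bnd (fun y => (b y)%:R : R).
Proof. by exists 1 => y; case: (b y); rewrite ?normr1 ?normr0. Qed.

Lemma mesh_lin_cvg (a b d : R) : (fun k => (a + d * mesh R k) * b) @ \oo --> a * b.
Proof.
rewrite -[X in X * b]addr0 -(mulr0 d); apply: cvgMr_tmp; apply: cvgD; first exact: cvg_cst.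
by apply: cvgMl_tmp; exact: mesh_cvg0.
Qed.

Lemma ratr0_le (r : rat) k : ratr r <= 0 :> R -> steps lam (ratr r) k = 0%N.
Proof.
move=> r0; apply/eqP; rewrite -leqn0 -(@Num.Theory.truncn0 R).
apply: le_truncn; rewrite -mulrA mulr_le0_ge0// mulr_ge0// addr_ge0// ltW//.
Qed.

Lemma fields_mono k s om M M' (r r' : rat) x : (M <= M')%N -> r <= r' ->
  (fields k s om (iu M r x) <= fields k s om (iu M' r' x))%N.
Proof.
move=> MM rr; apply: leq_trans (sys_mono _ _ _ _ _ _ MM MM) _.
by apply: sys_mono_time; apply: steps_mono; rewrite // ler_rat.
Qed.

Lemma fields0 k s om M (r : rat) x : ratr r <= 0 :> R -> fields k s om (iu M r x) = 0%N.
Proof. by move=> r0; rewrite fields_iu ratr0_le. Qed.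

Lemma fields_c0 k s om M (r : rat) x : ratr r <= 0 :> R -> (`|x| <= M)%N ->
  fields k s om (ic M r x) = (pat p q s x).+1.
Proof. by move=> r0 xM; rewrite fields_ic ratr0_le//= /patM xM. Qed.

(** The state of [x] depends on its initial value and on the odometers at distance at most 1,
    through stacks common to all boxes and times. Convergence of the odometers thus entails that of
    the states. *)
Lemma fields_local k s om M M' (r r' : rat) x : (`|x| <= M)%N -> (`|x| <= M')%N ->
  (forall y, (`|y - x| <= 1)%N -> fields k s om (iu M r y) = fields k s om (iu M' r' y)) ->
  fields k s om (ic M r x) = fields k s om (ic M' r' x).
Proof.
move=> xM xM' uu; rewrite /fields; congr code.
have [_ ->] := sys_consistent p q om M M s (steps lam (ratr r) k).
have [_ ->] := sys_consistent p q om M' M' s (steps lam (ratr r') k).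
by apply: st_local => //; rewrite /patM xM xM'.
Qed.

Lemma mean_incr M (r r' : rat) x : 0 <= r -> r <= r' -> \forall k \near \oo,
  mean k (fun y => (y (iu M r' x))%:R - (y (iu M r x))%:R) <=
  ((ratr r' - ratr r) * (1 + lam) + mesh R k) * Kz lam q x (ratr r').
Proof.
move=> r0 rr; near=> k; rewrite -[leRHS](mean_cst k) /mean ler_wpM2l ?invr_ge0//.
have be : big_enough q M (ratr r' : R) k by near: k; exact: near_big_enough.
have rr0 : 0 <= ratr r :> R by rewrite ler0q.
have rrr : ratr r <= ratr r' :> R by rewrite ler_rat.
by apply: ler_sum => s _; rewrite Ek_cst//; exact: (Ek_incr lam_gt0 p M s x rr0 rrr be).
Unshelve. all: by end_near. Qed.

Lemma Q_incr M (r r' : rat) x : 0 <= r -> r <= r' ->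
  Q (fun y => (y (iu M r' x) != y (iu M r x))%:R) <=
  ((ratr r' - ratr r) * (1 + lam)) * Kz lam q x (ratr r').
Proof.
move=> r0 rr; apply: (Q_le_lim _ _ (@mesh_lin_cvg _ _ 1)); first exact: (bnd_nat (fun y => y (iu M r' x) != y (iu M r x))).
near=> k; rewrite mul1r; apply: (@le_trans _ _ (mean k (fun y => (y (iu M r' x))%:R - (y (iu M r x))%:R))); last first.
  by near: k; exact: mean_incr.
apply: mean_le => s om; have := fields_mono k s om x (leqnn M) rr.
rewrite leq_eqVlt => /orP[/eqP ->|lt]; first by rewrite eqxx subrr.
by rewrite gtn_eqF//= lerBrDr -natrD ler_nat add1n.
Unshelve. all: by end_near. Qed.

Lemma Q_large M (r : rat) x n : 0 <= r ->
  Q (fun y => (n < y (iu M r x))%N%:R) <= (ratr r * (1 + lam)) * Kz lam q x (ratr r) / n.+1%:R.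
Proof.
move=> r0; rewrite -mulrA.
have := @mesh_lin_cvg (ratr r * (1 + lam)) (Kz lam q x (ratr r) / n.+1%:R) 1.
apply: Q_le_lim; first exact: (bnd_nat (fun y => (n < y (iu M r x))%N)).
have h0 := @mean_incr M 0 r x (lexx _) r0; rewrite rmorph0 subr0 in h0.
near=> k; rewrite mul1r mulrA ler_pdivlMr ?ltr0n//.
apply: (@le_trans _ _ (mean k (fun y => (y (iu M r x))%:R - (y (iu M 0 x))%:R))); last first.
  by near: k; exact: h0.
rewrite mulrC; have := mean_lin k (fun=> 0) (fun y => (n < y (iu M r x))%N%:R) n.+1%:R.
rewrite mean_cst add0r => <-; apply: mean_le => s om.
rewrite add0r (fields0 _ _ _ _ (r := 0)) ?rmorph0// subr0.
by case: ltnP => [h|_]; rewrite ?mulr1 ?mulr0 ?ler_nat.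
Unshelve. all: by end_near. Qed.

Lemma Q_inactive M (r r' : rat) z : 0 <= r -> r <= r' ->
  Q (fun y => ((awake (decode (y (ic M r z))) == 0%N) && (y (iu M r' z) != y (iu M r z)))%:R) <=
  2 * ((ratr r' - ratr r) * (1 + lam)) ^+ 2 * (Kz lam q (z - 1) (ratr r') + Kz lam q (z + 1) (ratr r')).
Proof.
move=> r0 rr; set K := Kz _ _ _ _ + _; set a := (_ - _) * _.
have bl : (fun k => 2 * (a + mesh R k) ^+ 2 * K) @ \oo --> 2 * a ^+ 2 * K.
  apply: cvgMr_tmp; apply: cvgMl_tmp; rewrite expr2.
  have h : (fun k => a + mesh R k) @ \oo --> a.
    by rewrite -[X in _ --> X]addr0; apply: cvgD; [exact: cvg_cst|exact: mesh_cvg0].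
  by under eq_fun do rewrite expr2; apply: cvgM; exact: h.
apply: Q_le_lim bl; first exact: (bnd_nat (fun y => (awake (decode (y (ic M r z))) == 0%N) && (y (iu M r' z) != y (iu M r z)))).
near=> k; rewrite -[leRHS](mean_cst k) /mean ler_wpM2l ?invr_ge0//.
apply: ler_sum => s _; rewrite Ek_cst.
have be : big_enough q M (ratr r' : R) k by near: k; exact: near_big_enough.
have rr0 : 0 <= ratr r :> R by rewrite ler0q.
have rrr : ratr r <= ratr r' :> R by rewrite ler_rat.
have := Ek_inactive lam_gt0 p M s z rr0 rrr be; apply: le_trans; apply: Ek_le => // om.
rewrite /= codeK; case: eqP => _; last by rewrite mul0r.
rewrite mul1r /=; have := fields_mono k s om z (leqnn M) rr; rewrite /fields.
rewrite leq_eqVlt => /orP[/eqP ->|lt]; first by rewrite eqxx subrr.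
by rewrite gtn_eqF//= lerBrDr -natrD ler_nat add1n.
Unshelve. all: by end_near. Qed.

Lemma fields_code k s om M (r : rat) x :
  (fields k s om (ic M r x) <= 1 + q + fields k s om (iu M r (x - 1)%R) + fields k s om (iu M r (x + 1)%R))%N.
Proof.
rewrite fields_ic !fields_iu; have [l ->] := sys_consistent p q om M M s (steps lam (ratr r) k).
set w := (sys _ _ _ _ _ _ _).1 in l *.
apply: (@leq_trans (1 + `|occ (patM p q M s) (stack_of om) w x|)%N).
  by rewrite /st; case: ifP.
rewrite -!addnA leq_add2l; have [ocx _] := l x.
have h1 := cnt12_le (stack_of om (x - 1)%R) (w (x - 1)%R).
have h2 := cnt12_le (stack_of om (x + 1)%R) (w (x + 1)%R).
have h3 := patM_le p q M s x; have h4 := pat_le p q s x.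
rewrite /occ in ocx *; set a := cnt 2 _ _ in h1 ocx *; set b := cnt 1 _ _ in h2 ocx *.
move: ocx; set d := cnt 1 _ _; set e := cnt 2 _ _.
clear l; clearbody a b d e; move: h1 h2 h3 h4; lia.
Qed.

Lemma Q_tight i (e : R) : 0 < e -> exists n : nat, Q (fun y => (n <= y i)%N%:R) <= e.
Proof.
have big (K : R) : 0 < e -> exists n : nat, K / n.+1%:R <= e.
  move=> e0; exists (Num.truncn (`|K| / e)); rewrite ler_pdivrMr ?ltr0n//.
  apply: le_trans (ler_norm _) _; rewrite mulrC -ler_pdivrMr//; apply: ltW.
  exact: truncnS_gt.
have le0 (f : (idx -> nat) -> R) : (forall k (s : 'I_p) om, f (fields k s om) = 0) -> Q f = 0.
  move=> f0; rewrite /Q -[RHS]ulim_cst; congr ulim; apply/funext => k.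
  rewrite /mean big1 ?mulr0// => s _.
  rewrite (_ : (fun om => _) = (fun=> 0)) ?Ek_cst//; exact/funext.
have ut M (r : rat) x (e' : R) : 0 < e' -> exists n, Q (fun y => (n < y (iu M r x))%N%:R) <= e'.
  move=> e0; have [r0|r0] := lerP 0 r.
    set K := (ratr r * (1 + lam)) * Kz lam q x (ratr r) : R.
    exists (Num.truncn (`|K| / e')); apply: le_trans (Q_large _ _ _ r0) _.
    rewrite -/K ler_pdivrMr ?ltr0n//; apply: le_trans (ler_norm _) _.
    by rewrite mulrC -ler_pdivrMr//; apply/ltW/truncnS_gt.
  exists 0%N; rewrite le0 ?(ltW e0)// => k s om.
  by rewrite fields0// lerq0 ltW.
move=> e0; case: i => [[[] [[M r] x]]|].
- by have [n h] := ut M r x e e0; exists n.+1.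
- have e2 : 0 < e / 2 by rewrite divr_gt0.
  have [n1 h1] := ut M r (x - 1)%R _ e2; have [n2 h2] := ut M r (x + 1)%R _ e2.
  exists (2 + q + n1 + n2)%N; apply: (@le_trans _ _ (Q (fun y =>
     (n1 < y (iu M r (x - 1)%R))%N%:R + 1 * (n2 < y (iu M r (x + 1)%R))%N%:R))); last first.
    by rewrite Q_lin ?mul1r; try exact: bnd_nat; move: h1 h2; lra.
  apply: ulim_le; try apply: mean_bounded; try exact: bnd_nat.
    exists 2 => y; rewrite mul1r; apply: le_trans (ler_normD _ _) _.
    by rewrite -[2]/(1 + 1); apply: lerD; case: ltnP; rewrite ?normr1 ?normr0.
  near=> k; apply: mean_le => s om; rewrite mul1r.
  have := fields_code k s om M r x; rewrite -/(ic M r x).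
  case: (leqP (2 + q + n1 + n2)) => [h h'|_ _]; last by rewrite addr_ge0.
  have [a|a] := ltnP n1; first by rewrite lerDl.
  have [b|b] := ltnP n2; first by rewrite lerDr.
  by exfalso; move: h h' a b; lia.
- exists p; rewrite le0 ?(ltW e0)// => k s om /=.
  by rewrite leqNgt ltn_ord.
Unshelve. all: by end_near. Qed.

Lemma fields_exist : exists (d : measure_display) (T : measurableType d) (P : probability T R)
    (Y : T -> idx -> nat), forall (s : seq idx) (A : set (idx -> nat)),
  (forall y y', (forall i, i \in s -> y i = y' i) -> A y -> A y') ->
  measurable [set t | A (Y t)] /\ P [set t | A (Y t)] = (Q (fun y => `[< A y >]%:R))%:E.
Proof.
apply: realization; [exact: Q_le|exact: Q_lin|exact: Q_cst|exact: Q_tight].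
Qed.

End Fields.

(** * Countable operations on events *)

Section CountableEvents.
Context (R : realType) (d : measure_display) (T : measurableType d).

Lemma measurable_ex (I : countType) (F : I -> T -> Prop) :
  (forall i, measurable [set w | F i w]) -> measurable [set w | exists i, F i w].
Proof.
move=> mF; rewrite (_ : [set w | _] = \bigcup_i [set w | F i w]).
  by apply: countable_bigcupT_measurable.
by apply/seteqP; split=> w /= [i]; [exists i|move=> _; exists i].
Qed.

Lemma measurable_not (F : T -> Prop) : measurable [set w | F w] -> measurable [set w | ~ F w].
Proof. by move=> /measurableC. Qed.

Lemma measurable_all (I : countType) (F : I -> T -> Prop) :
  (forall i, measurable [set w | F i w]) -> measurable [set w | forall i, F i w].
Proof.
move=> mF; rewrite (_ : [set w | _] = ~` [set w | exists i, ~ F i w]).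
  by apply/measurableC/measurable_ex => i; exact: measurable_not.
apply/seteqP; split=> w /= h; first by case.
by move=> i; apply: contrapT => ni; apply: h; exists i.
Qed.

Lemma measurable_imp (Q : Prop) (F : T -> Prop) :
  (Q -> measurable [set w | F w]) -> measurable [set w | Q -> F w].
Proof.
move=> mF; have [h|h] := pselect Q.
  rewrite (_ : [set w | _] = [set w | F w]); first exact: mF.
  by apply/seteqP; split=> w /=; [apply|].
by rewrite (_ : [set w | _] = setT) //; apply/seteqP; split=> // w _ /h.
Qed.

Lemma measurable_and (F G : T -> Prop) : measurable [set w | F w] ->
  measurable [set w | G w] -> measurable [set w | F w /\ G w].
Proof. exact: measurableI. Qed.

Context (P : probability T R).

Lemma ae_all (I : countType) (F : I -> T -> Prop) :
  (forall i, {ae P, forall w, F i w}) -> {ae P, forall w, forall i, F i w}.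
Proof.
move=> aF; have : {ae P, forall w n, if unpickle n is Some i then F i w else True}.
  apply: ae_foralln => n; case: (unpickle n) => [i|]; first exact: aF.
  by apply: aeW.
by apply: filterS => w h i; have := h (pickle i); rewrite pickleK.
Qed.

Lemma prob_le_ae (A B : set T) : measurable A -> measurable B ->
  {ae P, forall w, A w -> B w} -> (P A <= P B)%E.
Proof.
move=> mA mB [N [mN N0 sub]].
apply: (@le_trans _ _ (P (B `|` N))).
  apply: le_measure; rewrite ?inE//; first exact: measurableU.
  move=> w Aw; have [Bw|nB] := pselect (B w); [by left|right; apply: sub => /(_ Aw)].
  by [].
by apply: le_trans (measureU2 P mB mN) _; rewrite [X in (_ + X)%E](_ : _ = 0%E) ?adde0.
Qed.

Lemma prob_le_union (A : (set T)^nat) (B : set T) b : (forall n, measurable (A n)) -> measurable B ->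
  (forall n, A n `<=` A n.+1) -> (forall n, (P (A n) <= b)%E) ->
  {ae P, forall w, B w -> exists n, A n w} -> (P B <= b)%E.
Proof.
move=> mA mB nd Ab BA.
have mU : measurable (\bigcup_n A n) by exact: bigcupT_measurable.
apply: (@le_trans _ _ (P (\bigcup_n A n))).
  by apply: prob_le_ae => //; apply: filterS BA => w h /h [n An]; exists n.
have c : (P \o A) n @[n --> \oo] --> P (\bigcup_n A n).
  by apply: nondecreasing_cvg_mu => //; apply/nondecreasing_seqP => n; apply/subsetPset/nd.
rewrite -(cvg_lim _ c)//; apply: lime_le; first exact: cvgP c.
by near=> n; exact: Ab.
Unshelve. all: by end_near. Qed.

Lemma prob_decreasing (A : (set T)^nat) (e : R) : (forall n, measurable (A n)) ->
  (forall n, A n.+1 `<=` A n) -> {ae P, forall w, exists n, ~ A n w} -> 0 < e ->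
  \forall n \near \oo, (P (A n) <= e%:E)%E.
Proof.
move=> mA nd [N [mN N0 sub]] e0.
have mI : measurable (\bigcap_n A n) by exact: bigcapT_measurable.
have c : (P \o A) n @[n --> \oo] --> P (\bigcap_n A n).
  apply: nonincreasing_cvg_mu => //.
    by apply: le_lt_trans (probability_le1 P (mA 0%N)) _; rewrite ltry.
  by apply/nonincreasing_seqP => n; apply/subsetPset/nd.
have I0 : P (\bigcap_n A n) = 0%E.
  apply: (subset_measure0 mI mN _ N0) => w Aw; apply: sub => -[n nA].
  by apply: nA; exact: Aw.
rewrite I0 in c.
have : \forall n \near \oo, ((P \o A) n < e%:E)%E.
  have nb : nbhs (0%E : \bar R) [set y | (y < e%:E)%E].
    by apply: open_nbhs_nbhs; split; [exact: open_ereal_lt_ereal|rewrite /= lte_fin].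
  exact: (c _ nb).
by apply: filterS => n /ltW.
Qed.

Lemma prob0_ae (B : set T) : measurable B -> P B = 0%E -> {ae P, forall w, ~ B w}.
Proof. by move=> mB B0; exists B; split=> // w /=; apply: contra_notP => h; exact: h. Qed.

End CountableEvents.

(** * Almost sure properties of the limit fields *)

Section Process.
Context (R : realType) (lam : R).
Hypothesis lam_gt0 : 0 < lam.
Context (p q : nat).
Hypothesis p_gt0 : (0 < p)%N.
Context (d : measure_display) (T : measurableType d) (P : probability T R) (Y : T -> idx -> nat).
Hypothesis law : forall (s : seq idx) (A : set (idx -> nat)),
  (forall y y', (forall i, i \in s -> y i = y' i) -> A y -> A y') ->
  measurable [set t | A (Y t)] /\ P [set t | A (Y t)] = (Q lam p q (fun y => `[< A y >]%:R))%:E.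

Definition determined (s : seq idx) (A : set (idx -> nat)) :=
  forall y y', (forall i, i \in s -> y i = y' i) -> A y -> A y'.

(** A relation among finitely many fields that holds in every realization of every chain has mean 1
    in the limit as well. *)
Lemma law_ae s A : determined s A -> (forall k (t : 'I_p) om, A (fields lam p q k t om)) ->
  {ae P, forall w, A (Y w)}.
Proof.
move=> dA tA; have [mA PA] := law dA.
have PA1 : P [set t | A (Y t)] = 1%E.
  rewrite PA; congr EFin; rewrite -[RHS](Q_cst lam_gt0 q p_gt0) /Q; congr ulim; apply/funext => k.
  congr (_ * _); apply: eq_bigr => t _; congr Ek; apply/funext => om.
  by rewrite asboolT.
exists (~` [set t | A (Y t)]); split=> //; first exact: measurableC.
by rewrite (probability_setC P mA) PA1 subee.
Qed.

Lemma law_bool (s : seq idx) (b : (idx -> nat) -> bool) : (forall y y', (forall i : idx, i \in s -> y i = y' i) -> b y = b y') ->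
  measurable [set w | b (Y w)] /\ P [set w | b (Y w)] = (Q lam p q (fun y => (b y)%:R))%:E.
Proof.
move=> db; have [|mA PA] := @law s [set y | b y]; first by move=> y y' /db /= ->.
split=> //; rewrite PA; congr (Q _ _ _ _)%:E; apply/funext => y; congr (_%:R).
by rewrite asboolb.
Qed.

Notation sh w := (Y w None).
Notation u w M r x := (Y w (iu M r x)).
Notation c w M r x := (Y w (ic M r x)).

Lemma meas_idx (s : seq idx) (b : (idx -> nat) -> bool) :
  (forall y y', (forall i : idx, i \in s -> y i = y' i) -> b y = b y') -> measurable [set w | b (Y w)].
Proof. by move=> db; have [] := law_bool db. Qed.

Lemma prob_jump (M : nat) (r r' : rat) (x : int) : 0 <= r -> r <= r' ->
  (P [set w | u w M r' x != u w M r x] <= (((ratr r' - ratr r) * (1 + lam)) * Kz lam q x (ratr r'))%:E)%E.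
Proof.
move=> r0 rr; have [|_ ->] := @law_bool [:: iu M r' x; iu M r x] (fun y => y (iu M r' x) != y (iu M r x)).
  by move=> y y' yy; rewrite !yy// !inE eqxx ?orbT.
by rewrite lee_fin; exact: Q_incr.
Qed.

Lemma ae_mono : {ae P, forall w, forall (a : nat * nat * rat * rat * int),
  (a.1.1.1.1 <= a.1.1.1.2)%N -> a.1.1.2 <= a.1.2 ->
  (u w a.1.1.1.1 a.1.1.2 a.2 <= u w a.1.1.1.2 a.1.2 a.2)%N}.
Proof.
apply: ae_all => -[[[[M M'] r] r'] x] /=.
apply: (@law_ae [:: iu M r x; iu M' r' x] (fun y => (M <= M')%N -> r <= r' -> (y (iu M r x) <= y (iu M' r' x))%N)).
  by move=> y y' yy; rewrite !yy// !inE eqxx ?orbT.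
by move=> k t om MM rr; exact: fields_mono.
Qed.

Lemma ae_shift : {ae P, forall w, (sh w < p)%N}.
Proof.
apply: (@law_ae [:: None] (fun y => (y None < p)%N)).
  by move=> y y' yy; rewrite yy// inE.
by move=> k t om /=.
Qed.

Lemma ae_zero : {ae P, forall w, forall (a : nat * rat * int), a.1.2 <= 0 ->
  u w a.1.1 a.1.2 a.2 = 0%N /\ ((`|a.2| <= a.1.1)%N -> c w a.1.1 a.1.2 a.2 = (pat p q (sh w) a.2).+1)}.
Proof.
apply: ae_all => -[[M r] x] /=.
apply: (@law_ae [:: None; iu M r x; ic M r x] (fun y => r <= 0 -> y (iu M r x) = 0%N /\
   ((`|x| <= M)%N -> y (ic M r x) = (pat p q (y None) x).+1))).
  by move=> y y' yy; rewrite !yy// !inE eqxx ?orbT.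
move=> k t om r0; have rr : ratr r <= 0 :> R by rewrite lerq0.
by rewrite fields0//; split=> // xM; rewrite fields_c0.
Qed.

Lemma ae_local : {ae P, forall w, forall (a : nat * nat * rat * rat * int),
  (`|a.2| <= a.1.1.1.1)%N -> (`|a.2| <= a.1.1.1.2)%N ->
  u w a.1.1.1.1 a.1.1.2 (a.2 - 1)%R = u w a.1.1.1.2 a.1.2 (a.2 - 1)%R ->
  u w a.1.1.1.1 a.1.1.2 a.2 = u w a.1.1.1.2 a.1.2 a.2 ->
  u w a.1.1.1.1 a.1.1.2 (a.2 + 1)%R = u w a.1.1.1.2 a.1.2 (a.2 + 1)%R ->
  c w a.1.1.1.1 a.1.1.2 a.2 = c w a.1.1.1.2 a.1.2 a.2}.
Proof.
apply: ae_all => -[[[[M M'] r] r'] x] /=.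
apply: (@law_ae [:: iu M r (x - 1); iu M r x; iu M r (x + 1); iu M' r' (x - 1); iu M' r' x; iu M' r' (x + 1);
   ic M r x; ic M' r' x] (fun y => (`|x| <= M)%N -> (`|x| <= M')%N -> y (iu M r (x - 1)) = y (iu M' r' (x - 1)) ->
   y (iu M r x) = y (iu M' r' x) -> y (iu M r (x + 1)) = y (iu M' r' (x + 1)) -> y (ic M r x) = y (ic M' r' x))).
  by move=> y y' yy; rewrite !yy// !inE eqxx ?orbT.
move=> k t om xM xM' e1 e2 e3; apply: fields_local => // y yx.
have [->|[->|->]] // : y = x - 1 \/ y = x \/ y = x + 1 by clear -yx; lia.
Qed.

Lemma meas_ule M r x M' r' : measurable [set w | (u w M r x <= u w M' r' x)%N].
Proof.
apply: (@meas_idx [:: iu M r x; iu M' r' x] (fun y => (y (iu M r x) <= y (iu M' r' x))%N)).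
by move=> y y' yy; rewrite !yy// !inE eqxx ?orbT.
Qed.

Lemma meas_uleb M r x b : measurable [set w | (u w M r x <= b)%N].
Proof.
apply: (@meas_idx [:: iu M r x] (fun y => (y (iu M r x) <= b)%N)).
by move=> y y' yy; rewrite !yy// !inE eqxx ?orbT.
Qed.

(** The odometers are nondecreasing in [M], so the events that they exceed [n] are nondecreasing
    too, and [Q_large] bounds their probabilities uniformly in [M] by a multiple of
    [1 / (n + 1)]. *)
Lemma ae_bounded : {ae P, forall w, forall (a : rat * int), exists b, forall M, (u w M a.1 a.2 <= b)%N}.
Proof.
apply: ae_all => -[r x] /=; case: (lerP 0 r) => r0; last first.
  have := ae_zero; apply: filterS => w h; exists 0%N => M.
  by have [] := h (M, r, x) (ltW r0) => /= ->.
set B := [set w | ~ exists b, forall M, (u w M r x <= b)%N].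
have mB : measurable B.
  apply: measurable_not; apply: measurable_ex => b; apply: measurable_all => M; exact: meas_uleb.
set K := (ratr r * (1 + lam)) * Kz lam q x (ratr r) : R.
have PB n : (P B <= (K / n.+1%:R)%:E)%E.
  have mA (M : nat) : measurable [set w | ~ (u w M r x <= n)%N] by apply/measurable_not/meas_uleb.
  apply: (@prob_le_union _ _ _ P (fun M => [set w | exists2 M', (M' <= M)%N & ~ (u w M' r x <= n)%N]) B) => //.
  - move=> M; rewrite (_ : [set w | _] = \bigcup_(M' < M.+1) [set w | ~ (u w M' r x <= n)%N]).
      by apply: bigcup_measurable => M' _.
    by apply/seteqP; split=> w /= [M' h h']; exists M'.
  - by move=> M w [M' h h']; exists M' => //; exact: leqW.
  - move=> M; apply: (@le_trans _ _ (P [set w | (n < u w M r x)%N])).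
      apply: prob_le_ae => //.
      + rewrite (_ : [set w | _] = \bigcup_(M' < M.+1) [set w | ~ (u w M' r x <= n)%N]).
          by apply: bigcup_measurable => M' _.
        by apply/seteqP; split=> w /= [M' h h']; exists M'.
      + apply: (@meas_idx [:: iu M r x] (fun y => (n < y (iu M r x))%N)).
        by move=> y y' yy; rewrite !yy// !inE eqxx ?orbT.
      + have := ae_mono; apply: filterS => w mono [M' h h'] /=.
        apply: leq_trans (mono (M', M, r, r, x) h (lexx _)) => /=.
        by rewrite ltnNge; apply/negP.
    have [|_ ->] := @law_bool [:: iu M r x] (fun y => (n < y (iu M r x))%N).
      by move=> y y' yy; rewrite !yy// !inE eqxx ?orbT.
    by rewrite lee_fin; exact: Q_large.
  - apply: aeW => w nb; apply: contrapT => h; apply: nb; exists n => M.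
    by apply: contrapT => h'; apply: h; exists M; exists M.
have PB0 : P B = 0%E.
  apply/eqP; rewrite eq_le measure_ge0 andbT.
  apply/lee_addgt0Pr => e e0; rewrite add0e.
  apply: le_trans (PB (Num.truncn (`|K| / e))) _; rewrite lee_fin ler_pdivrMr ?ltr0n//.
  apply: le_trans (ler_norm _) _; rewrite mulrC -ler_pdivrMr//; apply: ltW.
  exact: truncnS_gt.
have := prob0_ae mB PB0; apply: filterS => w; exact: contrapT.
Qed.

(** Right-continuity of the limit in [M] of the odometer at a rational time, written without the
    limit. A move between [r] and [r'] has probability of order [r' - r], which can be made
    arbitrarily small. *)
Lemma ae_right : {ae P, forall w, forall (a : rat * int), exists2 r', a.1 < r' &
  forall M, exists M', (u w M r' a.2 <= u w M' a.1 a.2)%N}.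
Proof.
apply: ae_all => -[r x] /=; case: (lerP 0 r) => r0; last first.
  have := ae_zero; apply: filterS => w h; exists 0 => // M; exists 0%N.
  by have [] := h (M, 0, x) (lexx _) => /= ->.
pose C (r' : rat) w := forall M, exists M', (u w M r' x <= u w M' r x)%N.
have mC r' : measurable [set w | C r' w].
  apply: measurable_all => M; apply: measurable_ex => M'; exact: meas_ule.
have PC r' : r < r' -> (P [set w | ~ C r' w] <= (((ratr r' - ratr r) * (1 + lam)) * Kz lam q x (ratr r'))%:E)%E.
  move=> rr.
  apply: (@prob_le_union _ _ _ P (fun M0 => [set w | forall M, (M0 <= M)%N -> u w M r' x != u w M r x])).
  - move=> M0; apply: measurable_all => M; apply: measurable_imp => _.
    apply: (@meas_idx [:: iu M r x; iu M r' x] (fun y => y (iu M r' x) != y (iu M r x))).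
    by move=> y y' yy; rewrite !yy// !inE eqxx ?orbT.
  - exact/measurable_not.
  - by move=> M0 w h M MM; apply: h; exact: ltnW.
  - move=> M0; apply: le_trans (@prob_jump M0 r r' x r0 (ltW rr)); apply: le_measure; rewrite ?inE.
    + apply: measurable_all => M; apply: measurable_imp => _.
      apply: (@meas_idx [:: iu M r x; iu M r' x] (fun y => y (iu M r' x) != y (iu M r x))).
      by move=> y y' yy; rewrite !yy// !inE eqxx ?orbT.
    + apply: (@meas_idx [:: iu M0 r x; iu M0 r' x] (fun y => y (iu M0 r' x) != y (iu M0 r x))).
      by move=> y y' yy; rewrite !yy// !inE eqxx ?orbT.
    + by move=> w; apply.
  - have := ae_mono; apply: filterS => w mono nC.
    have [M hM] : exists M, forall M', (u w M r x < u w M r' x)%N /\ (u w M' r x < u w M r' x)%N.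
      apply: contrapT => h; apply: nC => M; apply: contrapT => h'; apply: h; exists M => M'.
      by split; rewrite ltnNge; apply/negP => h''; apply: h'; [exists M|exists M'].
    exists M => M' MM; rewrite gtn_eqF//; have [_ h] := hM M'.
    exact: leq_trans h (mono (M, M', r', r', x) MM (lexx _)).
set B := [set w | forall r', r < r' -> ~ C r' w].
have mB : measurable B by apply: measurable_all => r'; apply: measurable_imp => _; exact: measurable_not.
have PB0 : P B = 0%E.
  apply/eqP; rewrite eq_le measure_ge0 andbT.
  apply/lee_addgt0Pr => e e0; rewrite add0e.
  set K := (1 + lam) * Kz lam q x (ratr r + 1) : R.
  have K0 : 0 <= K by rewrite mulr_ge0 ?Kz_ge0// addr_ge0// ltW.
  have h : ratr r < Num.min (ratr r + 1) (ratr r + e / (K + 1)) :> R.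
    by rewrite lt_min !ltrDl ltr01 divr_gt0// ltr_wpDl.
  have [r'] := rat_in_itvoo h; rewrite in_itv /= lt_min ltr_rat => /andP[rr /andP[r1 re]].
  apply: (@le_trans _ _ (P [set w | ~ C r' w])).
    by apply: le_measure; rewrite ?inE//; [exact/measurable_not|move=> w; apply].
  apply: le_trans (PC r' rr) _; rewrite lee_fin -mulrA.
  have KK : (1 + lam) * Kz lam q x (ratr r') <= K.
    rewrite ler_wpM2l ?addr_ge0 ?(ltW lam_gt0)// /Kz.
    rewrite ler_wpM2r ?mulr_ge0// ler_wpM2l ?invr_ge0 ?(ltW (wz_gt0 _ _))// ler_expR.
    by rewrite ler_wpM2l// ler_wpM2r ?addr_ge0 ?(ltW lam_gt0)// ltW.
  apply: (@le_trans _ _ (e / (K + 1) * K)).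
    apply: ler_pM => //; first by rewrite subr_ge0 ler_rat ltW.
      by rewrite mulr_ge0 ?Kz_ge0// addr_ge0// ltW.
    by rewrite lerBlDl ltW.
  by rewrite mulrAC ler_pdivrMr ?ltr_wpDl// ler_pM2l// lerDl.
have := prob0_ae mB PB0; apply: filterS => w h.
apply: contrapT => h'; apply: h => r' rr Cr; apply: h'; exists r' => //.
Qed.

(* The almost sure properties from which the trajectories are built pathwise:
   monotonicity, initial values, locality and right-continuity. *)
Definition good w := [/\ (sh w < p)%N,
  forall M M' r r' x, (M <= M')%N -> r <= r' -> (u w M r x <= u w M' r' x)%N,
  forall M r x, r <= 0 -> u w M r x = 0%N /\ ((`|x| <= M)%N -> c w M r x = (pat p q (sh w) x).+1),
  forall M M' r r' x, (`|x| <= M)%N -> (`|x| <= M')%N ->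
    (forall y, (`|y - x| <= 1)%N -> u w M r y = u w M' r' y) -> c w M r x = c w M' r' x &
  (forall r x, exists b, forall M, (u w M r x <= b)%N) /\
  forall r x, exists2 r', r < r' & forall M, exists M', (u w M r' x <= u w M' r x)%N].

Lemma ae_good : {ae P, forall w, good w}.
Proof.
have h1 := ae_shift; have h2 := ae_mono; have h3 := ae_zero; have h4 := ae_local.
have h5 := ae_bounded; have h6 := ae_right.
apply: filterS3 (filterI h1 h2) (filterI h3 h4) (filterI h5 h6) => w [g1 g2] [g3 g4] [g5 g6].
split; [exact: g1| | | |].
- by move=> M M' r r' x; exact: (g2 (M, M', r, r', x)).
- by move=> M r x; exact: (g3 (M, r, x)).
- move=> M M' r r' x xM xM' uu; apply: (g4 (M, M', r, r', x)) => //=; apply: uu; lia.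
- by split=> r x; [exact: (g5 (r, x))|exact: (g6 (r, x))].
Qed.

Definition U w (r : rat) x : nat := xget 0%N [set n | exists M0, forall M, (M0 <= M)%N -> u w M r x = n].
Definition cfin w (r : rat) x a := exists M0, forall M, (M0 <= M)%N -> c w M r x = a.
(* A right limit along rational times, so that trajectories are right-continuous
   by construction. *)
Definition near_val w (t : R) x a := exists2 r0 : rat, t < ratr r0 &
  forall r : rat, t < ratr r -> ratr r <= ratr r0 :> R -> cfin w r x a.

Section Good.
Context (w : T).
Hypothesis gw : good w.

Lemma U_ev r x : exists M0, forall M, (M0 <= M)%N -> u w M r x = U w r x.
Proof.
have [_ mono _ _ [bd _]] := gw.
suff : exists n, [set n | exists M0, forall M, (M0 <= M)%N -> u w M r x = n] n.
  by move=> [n h]; rewrite /U; case: xgetP => [m _ [M0 hm]|/(_ n)//]; exists M0.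
have [b hb] := bd r x.
have ex : exists n, `[< exists M, u w M r x = n >].
  by exists (u w 0%N r x); apply/asboolP; exists 0%N.
have ub n : `[< exists M, u w M r x = n >] -> (n <= b)%N by move=> /asboolP[M <-].
case: (ex_maxnP ex ub) => n /asboolP[M0 <-] mx; exists (u w M0 r x); exists M0 => M MM.
apply/anti_leq/andP; split; last exact: mono.
by apply: mx; apply/asboolP; exists M.
Qed.

Lemma u_le_U M r x : (u w M r x <= U w r x)%N.
Proof.
have [_ mono _ _ _] := gw; have [M0 h] := U_ev r x.
rewrite -(h (maxn M M0)) ?leq_maxr//; apply: mono => //; exact: leq_maxl.
Qed.

Lemma U_mono r r' x : r <= r' -> (U w r x <= U w r' x)%N.
Proof.
have [_ mono _ _ _] := gw => rr; have [M0 h] := U_ev r x; rewrite -(h M0)//.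
by apply: leq_trans (u_le_U M0 r' x); exact: mono.
Qed.

Lemma U_right r x : exists2 r', r < r' & forall s, r <= s -> s <= r' -> U w s x = U w r x.
Proof.
have [_ _ _ _ [_ rt]] := gw; have [r' rr h] := rt r x; exists r' => // s rs sr.
apply/anti_leq/andP; split; last exact: U_mono.
apply: leq_trans (U_mono x sr) _.
have [M0 h0] := U_ev r' x; rewrite -(h0 M0)//; have [M' h'] := h M0.
exact: leq_trans h' (u_le_U _ _ _).
Qed.

Lemma U_near_right (t : R) x : exists2 r0 : rat, t < ratr r0 &
  forall r : rat, t < ratr r -> ratr r <= ratr r0 :> R -> U w r x = U w r0 x.
Proof.
have t1 : t < t + 1 by rewrite ltrDl.
have [r1] := rat_in_itvoo t1; rewrite in_itv /= => /andP[tr1 _].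
have ex : exists n, `[< exists2 r : rat, t < ratr r & U w r x = n >].
  by exists (U w r1 x); apply/asboolP; exists r1.
case: (ex_minnP ex) => n /asboolP[r0 tr0 <-] mn; exists r0 => // r tr rr.
apply/anti_leq/andP; split; first by apply: U_mono; rewrite -(ler_rat R).
by apply: mn; apply/asboolP; exists r.
Qed.

Lemma U_near_left (t : R) x : 0 < t -> exists2 r0 : rat, ratr r0 < t &
  forall r : rat, ratr r < t -> ratr r0 <= ratr r :> R -> U w r x = U w r0 x.
Proof.
move=> t0; have [r1] := rat_in_itvoo t0; rewrite in_itv /= => /andP[_ tr1].
have t1 : t < t + 1 by rewrite ltrDl.
have [r2] := rat_in_itvoo t1; rewrite in_itv /= => /andP[tr2 _].
have ex : exists n, `[< exists2 r : rat, ratr r < t & U w r x = n >].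
  by exists (U w r1 x); apply/asboolP; exists r1.
have ub n : `[< exists2 r : rat, ratr r < t & U w r x = n >] -> (n <= U w r2 x)%N.
  move=> /asboolP[r rt <-]; apply: U_mono; rewrite -(ler_rat R); exact/ltW/(lt_trans rt).
case: (ex_maxnP ex ub) => n /asboolP[r0 tr0 <-] mx; exists r0 => // r tr rr.
apply/anti_leq/andP; split; last by apply: U_mono; rewrite -(ler_rat R).
by apply: mx; apply/asboolP; exists r.
Qed.

Lemma U_ev3 r x : exists M0, forall M, (M0 <= M)%N ->
  forall y, (`|y - x| <= 1)%N -> u w M r y = U w r y.
Proof.
have [M1 h1] := U_ev r (x - 1); have [M2 h2] := U_ev r x; have [M3 h3] := U_ev r (x + 1).
exists (maxn M1 (maxn M2 M3)) => M; rewrite !geq_max => /and3P[m1 m2 m3] y yx.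
have [->|[->|->]] : y = x - 1 \/ y = x \/ y = x + 1 by clear -yx; lia.
- exact: h1.
- exact: h2.
- exact: h3.
Qed.

Lemma cfin_ex r x : exists a, cfin w r x a.
Proof.
have [_ _ _ loc _] := gw; have [M0 h] := U_ev3 r x.
exists (c w (maxn M0 `|x|) r x), (maxn M0 `|x|%N) => M; rewrite geq_max => /andP[m1 m2].
apply: loc => //; rewrite ?leq_maxr// => y yx; rewrite !h ?leq_maxl//.
Qed.

Lemma cfin_uniq r x a b : cfin w r x a -> cfin w r x b -> a = b.
Proof.
move=> [M1 h1] [M2 h2]; rewrite -(h1 (maxn M1 M2)) ?leq_maxl//.
by rewrite -(h2 (maxn M1 M2)) ?leq_maxr.
Qed.

Lemma cfin_local r r' x a : (forall y, (`|y - x| <= 1)%N -> U w r y = U w r' y) ->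
  cfin w r x a -> cfin w r' x a.
Proof.
move=> UU [M1 h1]; have [_ _ _ loc _] := gw; have [M0 h] := U_ev3 r x; have [M2 h2] := U_ev3 r' x.
exists (maxn (maxn M1 M2) (maxn M0 `|x|%N)) => M; rewrite !geq_max => /andP[/andP[m1 m2] /andP[m3 m4]].
rewrite -(h1 M m1); apply: loc => // y yx; by rewrite h// h2// UU.
Qed.

Lemma U_near_right3 (t : R) x : exists2 r0 : rat, t < ratr r0 &
  forall r : rat, t < ratr r -> ratr r <= ratr r0 :> R ->
  forall y, (`|y - x| <= 1)%N -> U w r y = U w r0 y.
Proof.
have [r1 t1 h1] := U_near_right t (x - 1); have [r2 t2 h2] := U_near_right t x.
have [r3 t3 h3] := U_near_right t (x + 1).
have tm : t < ratr (Num.min r1 (Num.min r2 r3)) by rewrite /Num.min; case: ifP; case: ifP.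
have m1 : Num.min r1 (Num.min r2 r3) <= r1 by rewrite ge_min lexx.
have m2 : Num.min r1 (Num.min r2 r3) <= r2 by rewrite !ge_min lexx orbT.
have m3 : Num.min r1 (Num.min r2 r3) <= r3 by rewrite !ge_min lexx !orbT.
exists (Num.min r1 (Num.min r2 r3)) => // r tr; rewrite ler_rat => rr y yx.
have [->|[->|->]] : y = x - 1 \/ y = x \/ y = x + 1 by clear -yx; lia.
- by rewrite h1 ?ler_rat ?(le_trans rr)// [RHS]h1// ler_rat.
- by rewrite h2 ?ler_rat ?(le_trans rr)// [RHS]h2// ler_rat.
- by rewrite h3 ?ler_rat ?(le_trans rr)// [RHS]h3// ler_rat.
Qed.

Lemma U_near_left3 (t : R) x : 0 < t -> exists2 r0 : rat, ratr r0 < t &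
  forall r : rat, ratr r < t -> ratr r0 <= ratr r :> R ->
  forall y, (`|y - x| <= 1)%N -> U w r y = U w r0 y.
Proof.
move=> t0; have [r1 t1 h1] := U_near_left (x - 1) t0; have [r2 t2 h2] := U_near_left x t0.
have [r3 t3 h3] := U_near_left (x + 1) t0.
have tm : ratr (Num.max r1 (Num.max r2 r3)) < t by rewrite /Num.max; case: ifP; case: ifP.
have m1 : r1 <= Num.max r1 (Num.max r2 r3) by rewrite le_max lexx.
have m2 : r2 <= Num.max r1 (Num.max r2 r3) by rewrite !le_max lexx orbT.
have m3 : r3 <= Num.max r1 (Num.max r2 r3) by rewrite !le_max lexx !orbT.
exists (Num.max r1 (Num.max r2 r3)) => // r tr; rewrite ler_rat => rr y yx.
have [->|[->|->]] : y = x - 1 \/ y = x \/ y = x + 1 by clear -yx; lia.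
- by rewrite h1 ?ler_rat ?(le_trans m1)// [RHS]h1// ler_rat.
- by rewrite h2 ?ler_rat ?(le_trans m2)// [RHS]h2// ler_rat.
- by rewrite h3 ?ler_rat ?(le_trans m3)// [RHS]h3// ler_rat.
Qed.

Lemma near_val_ex (t : R) x : exists a, near_val w t x a.
Proof.
have [r0 t0 h] := U_near_right3 t x; have [a ha] := cfin_ex r0 x.
exists a, r0 => // r tr rr; apply: cfin_local ha => y yx; by rewrite (h r).
Qed.

Lemma near_val_uniq (t : R) x a b : near_val w t x a -> near_val w t x b -> a = b.
Proof.
move=> [r1 t1 h1] [r2 t2 h2].
have tm : t < ratr (Num.min r1 r2) by rewrite /Num.min; case: ifP.
apply: (@cfin_uniq (Num.min r1 r2) x).
  by apply: h1 => //; rewrite ler_rat ge_min lexx.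
by apply: h2 => //; rewrite ler_rat ge_min lexx orbT.
Qed.

Lemma near_val_right (t : R) x a : near_val w t x a -> \forall s \near t^'+, near_val w s x a.
Proof.
move=> [r0 t0 h]; near=> s.
have ts : t < s by near: s; exact: nbhs_right_gt.
exists r0; first by near: s; exact: nbhs_right_lt.
by move=> r sr; apply: h; exact: lt_trans sr.
Unshelve. all: by end_near. Qed.

Lemma near_val_left (t : R) x : 0 < t -> exists a, \forall s \near t^'-, near_val w s x a.
Proof.
move=> t0; have [r0 rt h] := U_near_left3 x t0; have [a ha] := cfin_ex r0 x.
exists a; near=> s.
have st : s < t by near: s; exact: nbhs_left_lt.
have r0s : ratr r0 < s by near: s; exact: nbhs_left_gt.
have [r1] := rat_in_itvoo st; rewrite in_itv /= => /andP[sr1 r1t].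
exists r1 => // r sr rr1; apply: cfin_local ha => y yx; rewrite (h r)//.
  exact: le_lt_trans r1t.
exact/ltW/(lt_trans r0s).
Unshelve. all: by end_near. Qed.

Lemma near_val_rat r x a : cfin w r x a -> near_val w (ratr r) x a.
Proof.
move=> ha; have [r1 t1 h1] := U_right r (x - 1); have [r2 t2 h2] := U_right r x.
have [r3 t3 h3] := U_right r (x + 1).
exists (Num.min r1 (Num.min r2 r3)); first by rewrite ltr_rat !lt_min t1 t2 t3.
move=> s; rewrite ltr_rat ler_rat !le_min => rs /and3P[s1 s2 s3].
apply: cfin_local ha => y yx.
have [->|[->|->]] : y = x - 1 \/ y = x \/ y = x + 1 by clear -yx; lia.
- by rewrite h1// ltW.
- by rewrite h2// ltW.
- by rewrite h3// ltW.
Qed.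

Lemma near_val0 x : near_val w 0 x (pat p q (sh w) x).+1.
Proof.
rewrite -(rmorph0 ratr : ratr (0 : rat) = 0 :> R); apply: near_val_rat.
by have [_ _ z _ _] := gw; exists `|x|%N => M xM; have [_] := z M 0 x (lexx _); apply.
Qed.

End Good.

End Process.

Lemma near_all_seq (I : eqType) (l : seq I) (G : I -> nat -> Prop) :
  (forall a, a \in l -> \forall n \near \oo, G a n) -> \forall n \near \oo, forall a, a \in l -> G a n.
Proof.
elim: l => [|a l IH] h; first by near=> n.
have h1 := h a (mem_head _ _).
have h2 : \forall n \near \oo, forall b, b \in l -> G b n.
  by apply: IH => b bl; apply: h; rewrite inE bl orbT.
apply: filterS2 h1 h2 => n g1 g2 b; rewrite inE => /orP[/eqP->//|]; exact: g2.
Unshelve. all: by end_near. Qed.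

(** Fatou's lemma for events, by which both the limit in the box and the right limit in time are
    taken. *)
Lemma prob_liminf (R : realType) (d : measure_display) (T : measurableType d) (P : probability T R)
  (A : nat -> set T) (B : set T) b : (forall n, measurable (A n)) -> measurable B ->
  (\forall n \near \oo, (P (A n) <= b)%E) ->
  {ae P, forall w, B w -> \forall n \near \oo, A n w} -> (P B <= b)%E.
Proof.
move=> mA mB [n0 _ Ab] BA.
have mI m : measurable [set w | forall n, (m <= n)%N -> A n w].
  by apply: measurable_all => n; apply: measurable_imp => _; exact: mA.
apply: (@prob_le_union _ _ _ P (fun m => [set w | forall n, (m <= n)%N -> A n w]) B) => //.
- by move=> m w h n mn; apply: h; exact: ltnW.
- move=> m; apply: le_trans (Ab (maxn m n0) (leq_maxr _ _)); apply: le_measure; rewrite ?inE//.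
  by move=> w /(_ (maxn m n0)); apply; exact: leq_maxl.
- by apply: filterS BA => w h /h[m _ hm]; exists m.
Qed.

(** For nonnegative [t], the least multiple of [1 / (D + 1)] that exceeds [t]. The inequality is
    strict because a trajectory at time [t] is defined as a right limit along rational times. *)
Definition above (R : realType) (D : nat) (t : R) : rat := (Num.truncn (t * D.+1%:R)).+1%:R / D.+1%:R.

Section Above.
Context (R : realType).

Lemma ratr_above D (t : R) : ratr (above D t) = (Num.truncn (t * D.+1%:R)).+1%:R / D.+1%:R :> R.
Proof. by rewrite /above fmorph_div /= !ratr_nat. Qed.

Lemma above_gt D (t : R) : t < ratr (above D t).
Proof. by rewrite ratr_above ltr_pdivlMr ?ltr0n// truncnS_gt. Qed.

Lemma above_le D (t : R) : 0 <= t -> ratr (above D t) <= t + D.+1%:R^-1 :> R.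
Proof.
move=> t0; rewrite ratr_above ler_pdivrMr ?ltr0n// mulrDl mulVf ?pnatr_eq0// -natr1 lerD2r.
by rewrite truncn_le// mulr_ge0.
Qed.

Lemma above_le1 D (t : R) : 0 <= t -> ratr (above D t) <= t + 1 :> R.
Proof. by move=> t0; apply: le_trans (above_le D t0) _; rewrite lerD2l invf_le1// ler1n. Qed.

Lemma above_near (t e : R) : 0 <= t -> 0 < e -> \forall D \near \oo, ratr (above D t) < t + e.
Proof.
move=> t0 e0; near=> D; apply: le_lt_trans (above_le D t0) _; rewrite ltrD2l.
near: D; exact: near_infty_natSinv_lt (PosNum e0).
Unshelve. all: by end_near. Qed.

Lemma above_ge0 D (t : R) : 0 <= above D t.
Proof. by rewrite /above divr_ge0. Qed.

End Above.

Definition win (x : int) : seq int := [:: x - 1; x; x + 1].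

Lemma mem_win x y : (y \in win x) = (`|y - x| <= 1)%N.
Proof. by rewrite !inE; lia. Qed.

(** * Trajectories in infinite volume *)

Section Trajectory.
Context (R : realType) (lam : R).
Hypothesis lam_gt0 : 0 < lam.
Context (p q : nat).
Hypothesis p_gt0 : (0 < p)%N.
Context (d : measure_display) (T : measurableType d) (P : probability T R) (Y : T -> idx -> nat).
Hypothesis law : forall (s : seq idx) (A : set (idx -> nat)),
  (forall y y', (forall i, i \in s -> y i = y' i) -> A y -> A y') ->
  measurable [set t | A (Y t)] /\ P [set t | A (Y t)] = (Q lam p q (fun y => `[< A y >]%:R))%:E.
Context (N : set T).
Hypotheses (mN : measurable N) (N0 : P N = 0%E) (Ngood : forall w, ~ N w -> good p q Y w).

Notation sh w := (Y w None).
Notation u w M r x := (Y w (iu M r x)).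
Notation c w M r x := (Y w (ic M r x)).
Notation law_bool := (@law_bool R lam p q d T P Y law).
Notation meas_idx := (@meas_idx R lam p q d T P Y law).

Lemma aeN : {ae P, forall w, ~ N w}.
Proof. exact: prob0_ae. Qed.

Definition sh0 w := if `[< N w >] then 0%N else sh w.

(** [is_arw] asks for regular paths at every [w]. On the null set [N] the trajectory is therefore
    frozen at the pattern of phase 0, in agreement with [sh0]. *)
Definition traj (t : R) w : config := fun x =>
  if `[< N w >] then Awake (pat p q 0 x) else decode (xget 0%N (near_val Y w t x)).

Lemma traj_near t w x : ~ N w -> near_val Y w t x (code (traj t w x)).
Proof.
move=> Nw; rewrite /traj asboolF// decodeK; case: xgetP => // /= h.
by have [a /h] := near_val_ex (Ngood Nw) t x.
Qed.

Lemma near_traj t w x a : ~ N w -> near_val Y w t x a -> traj t w x = decode a.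
Proof.
move=> Nw h; apply: (can_inj codeK); rewrite decodeK.
exact: near_val_uniq (traj_near _ _ Nw) h.
Qed.

Lemma traj_near_eq s t w x a : ~ N w -> near_val Y w t x a -> near_val Y w s x a ->
  traj s w x = traj t w x.
Proof. by move=> Nw h1 h2; rewrite (near_traj Nw h1) (near_traj Nw h2). Qed.

Lemma traj0 w : traj 0 w = conf (pat p q (sh0 w)).
Proof.
apply/funext => x; rewrite /sh0 /conf; have [Nw|Nw] := pselect (N w); first by rewrite /traj asboolT.
by rewrite asboolF// (near_traj Nw (near_val0 R (Ngood Nw) x)).
Qed.

Lemma sh0_lt w : (sh0 w < p)%N.
Proof.
rewrite /sh0; case: asboolP => // /Ngood; by case.
Qed.

Lemma measurable_near_val (t : R) x a : measurable [set w | near_val Y w t x a].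
Proof.
have -> : [set w | near_val Y w t x a] = [set w | exists r0 : rat, t < ratr r0 /\
   forall r : rat, t < ratr r -> ratr r <= ratr r0 :> R -> exists M0, forall M, (M0 <= M)%N -> c w M r x = a].
  by apply/seteqP; split=> w [r0]; [exists r0|move=> [? ?]; exists r0].
apply: measurable_ex => r0; have [h|h] := pselect (t < ratr r0); last first.
  rewrite (_ : [set w | _] = set0) //; apply/seteqP; split=> // w /= [].
  by move=> /h.
apply: measurable_and; first by rewrite (_ : [set w | _] = setT) //; apply/seteqP; split.
apply: measurable_all => r; do 2!(apply: measurable_imp => _).
apply: measurable_ex => M0; apply: measurable_all => M; apply: measurable_imp => _.
have := @meas_idx [:: ic M r x] (fun y => y (ic M r x) == a).
rewrite (_ : [set w | c w M r x == a] = [set w | c w M r x = a]).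
  by apply=> y y' yy; rewrite yy// inE.
by apply/seteqP; split=> w /= /eqP.
Qed.

Lemma measurable_traj t x a : measurable [set w | traj t w x = a].
Proof.
have -> : [set w | traj t w x = a] = (N `&` [set w | Awake (pat p q 0 x) = a]) `|`
   (~` N `&` [set w | near_val Y w t x (code a)]).
  apply/seteqP; split=> w /=.
    have [Nw|Nw] := pselect (N w); first by rewrite /traj asboolT// => h; left.
    by move=> <-; right; split=> //; exact: traj_near.
  case=> -[Nw]; first by rewrite /traj asboolT.
  by move=> h; rewrite (near_traj Nw h) codeK.
apply: measurableU; apply: measurableI => //.
- have [h|h] := pselect (Awake (pat p q 0 x) = a).
    by rewrite (_ : [set w | _] = setT) //; apply/seteqP; split.
  by rewrite (_ : [set w | _] = set0) //; apply/seteqP; split.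
- exact: measurableC.
- exact: measurable_near_val.
Qed.

Lemma traj_right w x t : \forall s \near t^'+, traj s w x = traj t w x.
Proof.
have [Nw|Nw] := pselect (N w); first by near=> s; rewrite /traj asboolT.
have h := traj_near t x Nw; have := near_val_right h.
by apply: filterS => s; exact: traj_near_eq.
Unshelve. all: by end_near. Qed.

Lemma traj_left w x t : 0 < t -> exists a, \forall s \near t^'-, traj s w x = a.
Proof.
move=> t0; have [Nw|Nw] := pselect (N w).
  by exists (Awake (pat p q 0 x)); near=> s; rewrite /traj asboolT.
have [a h] := near_val_left (Ngood Nw) x t0; exists (decode a).
by apply: filterS h => s; exact: near_traj.
Unshelve. all: by end_near. Qed.

Lemma prob_sh (s : 'I_p) : P [set w | sh0 w = s] = (p%:R^-1)%:E.
Proof.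
have [|m1 P1] := @law_bool [:: None] (fun y => y None == s); first by move=> y y' yy; rewrite yy// inE.
have E1 : Q lam p q (fun y => (y None == s)%:R) = p%:R^-1 :> R.
  rewrite /Q -[RHS]ulim_cst; congr ulim; apply/funext => k.
  rewrite /mean (eq_bigr (fun t : 'I_p => (t == s)%:R)) => [|t _]; last by rewrite /= Ek_cst.
  by rewrite (bigD1 s)//= eqxx big1 ?addr0 ?mulr1// => t /negbTE ->.
rewrite E1 in P1.
have m2 : measurable [set w | sh0 w = s].
  rewrite (_ : [set w | _] = (N `&` [set w | 0%N = s]) `|` (~` N `&` [set w | sh w == s])).
    apply: measurableU; apply: measurableI => //; last exact: measurableC.
    have [h|h] := pselect (0%N = s).
      by rewrite (_ : [set w | _] = setT) //; apply/seteqP; split.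
    by rewrite (_ : [set w | _] = set0) //; apply/seteqP; split.
  apply/seteqP; split=> w /=; rewrite /sh0.
    by case: asboolP => Nw h; [left|right; split=> //; exact/eqP].
  by case=> -[Nw]; [rewrite asboolT|rewrite asboolF// => /eqP].
rewrite -P1; apply/eqP; rewrite eq_le; apply/andP; split; apply: prob_le_ae => //.
  by have := aeN; apply: filterS => w Nw; rewrite /sh0 /= asboolF// => ->.
by have := aeN; apply: filterS => w Nw; rewrite /sh0 /= asboolF// => /eqP.
Qed.

Lemma measurable_sh (s : nat) : measurable [set w | sh0 w = s].
Proof.
rewrite (_ : [set w | _] = (N `&` [set w | 0%N = s]) `|` (~` N `&` [set w | sh w == s])).
  apply: measurableU; apply: measurableI => //; last 2 first.
  - exact: measurableC.
  - by apply: (@meas_idx [:: None] (fun y => y None == s)) => y y' yy; rewrite yy// inE.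
  have [h|h] := pselect (0%N = s).
    by rewrite (_ : [set w | _] = setT) //; apply/seteqP; split.
  by rewrite (_ : [set w | _] = set0) //; apply/seteqP; split.
apply/seteqP; split=> w /=; rewrite /sh0.
  by case: asboolP => Nw h; [left|right; split=> //; exact/eqP].
by case=> -[Nw]; [rewrite asboolT|rewrite asboolF// => /eqP].
Qed.

Lemma integral_sh (g : nat -> R) : (forall s, 0 <= g s) ->
  (\int[P]_w (g (sh0 w))%:E)%E = (p%:R^-1 * \sum_(s < p) g s)%:E.
Proof.
move=> g0.
have gE w : (g (sh0 w))%:E = (\sum_(s < p) (g s * \1_[set w | sh0 w = s] w)%:E)%E.
  rewrite sumEFin; congr EFin; rewrite (bigD1 (Ordinal (sh0_lt w)))//=.
  rewrite indicE mem_set//= mulr1 big1 ?addr0// => s ns.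
  rewrite indicE memNset ?mulr0//= => h; case/eqP: ns; exact: val_inj.
under eq_integral do rewrite gE.
rewrite ge0_integral_sum//; last 2 first.
- move=> s; apply/measurable_EFinP; apply: measurable_funM; first exact: measurable_cst.
  by apply: measurable_indic; exact: measurable_sh.
- by move=> s w _; rewrite lee_fin mulr_ge0.
rewrite mulr_sumr -sumEFin; apply: eq_bigr => s _.
under eq_integral do rewrite EFinM.
rewrite ge0_integralZl//; last 2 first.
- by apply/measurable_EFinP; apply: measurable_indic; exact: measurable_sh.
- by rewrite lee_fin.
rewrite integral_indic//; last exact: measurable_sh.
transitivity ((g s)%:E * (p%:R^-1)%:E)%E; last by rewrite -EFinM mulrC.
by congr (_ * _)%E; rewrite setIT; exact: prob_sh.
Qed.

Lemma prob_initial (B : set config) : P [set w | B (traj 0 w)] =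
  (p%:R^-1 * \sum_(s < p) `[< B (conf (pat p q s)) >]%:R)%:E.
Proof.
rewrite -(integral_sh (g := fun s => `[< B (conf (pat p q s)) >]%:R))//.
have mB : measurable [set w | B (traj 0 w)].
  rewrite (_ : [set w | _] = [set w | exists s : 'I_p, B (conf (pat p q s)) /\ sh0 w = s]).
    apply: measurable_ex => s; have [h|h] := pselect (B (conf (pat p q s))).
      apply: measurable_and; last exact: measurable_sh.
      by rewrite (_ : [set w | _] = setT) //; apply/seteqP; split.
    by rewrite (_ : [set w | _] = set0) //; apply/seteqP; split=> // w /= [].
  apply/seteqP; split=> w /=; rewrite traj0.
    by move=> h; exists (Ordinal (sh0_lt w)).
  by move=> [s [h ->]].
rewrite -[X in P X]setIT -integral_indic//; apply: eq_integral => w _.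
by rewrite indicE; congr (nat_of_bool _)%:R%:E; apply/idP/asboolP; rewrite inE /= traj0.
Qed.

Lemma pat_shift s x : pat p q s (x + 1) = pat p q (s.+1 %% p)%N x.
Proof.
rewrite /pat; congr (if _ then _ else _).
have e : (x + 1 + s%:Z)%R = x + (s.+1 %% p)%N%:Z + (s.+1 %/ p)%N%:Z * p%:Z.
  have := divn_eq s.+1 p; move: (_ %/ _)%N (_ %% _)%N => a b ab.
  by rewrite -PoszM; lia.
rewrite e -[LHS]/(_ \in dvdz p) rpredDr//; exact: dvdz_mull.
Qed.

Lemma shift_pat s : shift_config (conf (pat p q s)) = conf (pat p q (s.+1 %% p)%N).
Proof. by apply/funext => x; rewrite /shift_config /conf pat_shift. Qed.

Lemma sum_shift (F : nat -> R) : \sum_(s < p) F (s.+1 %% p)%N = \sum_(s < p) F s.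
Proof.
case: p p_gt0 => // n _; rewrite big_ord_recr big_ord_recl /= modnn addrC; congr (_ + _).
by apply: eq_bigr => i _; rewrite modn_small// ltnS.
Qed.

Lemma traj_invariant : translation_invariant P (traj 0).
Proof.
move=> A _; rewrite /preimage /=.
rewrite (prob_initial (shift_config @^-1` A)) (prob_initial A) /preimage /=; congr (_ * _)%:E.
under eq_bigr do rewrite shift_pat.
exact: (sum_shift (fun s => `[< A (conf (pat p q s)) >]%:R)).
Qed.

(** The shift permutes the [p] phases cyclically, so an invariant event contains all the initial
    patterns or none of them. *)
Lemma traj_ergodic : ergodic P (traj 0).
Proof.
move=> A _ AA; rewrite /preimage /= (prob_initial A).
have all s : (s < p)%N -> A (conf (pat p q s)) <-> A (conf (pat p q 0)).
  elim: s => // s IH sp; rewrite -(IH (ltnW sp)) -[in X in _ <-> X]AA /preimage /= shift_pat.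
  by rewrite modn_small.
have [h|h] := pselect (A (conf (pat p q 0))); [right|left]; congr EFin.
  rewrite (eq_bigr (fun=> 1)) => [|s _]; last by rewrite asboolT//; apply/all.
  by rewrite sumr_const card_ord -mulr_natl mulr1 mulVf// pnatr_eq0 -lt0n.
by rewrite big1 ?mulr0// => s _; rewrite asboolF// => /(all _ (ltn_ord s)); exact: h.
Qed.

Lemma traj_density : (\int[P]_w ((awake (traj 0 w 0))%:R)%R%:E)%E = (q%:R / p%:R)%:E :> \bar R.
Proof.
under eq_integral do rewrite traj0 /conf /=.
rewrite (integral_sh (g := fun s => (pat p q s 0)%:R))//; congr EFin.
have -> : \sum_(s < p) (pat p q s 0)%:R = q%:R :> R.
  rewrite (bigD1 (Ordinal p_gt0))//= /pat add0r dvdz0 big1 ?addr0// => s s0.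
  rewrite add0r dvdzE /= gtnNdvd//.
  by rewrite lt0n; apply: contra s0 => /eqP h; apply/eqP/val_inj.
by rewrite mulrC.
Qed.

Lemma traj_awake w x : traj 0 w x <> Asleep.
Proof. by rewrite traj0. Qed.

Lemma meas_une M r x M' r' : measurable [set w | u w M r x != u w M' r' x].
Proof.
apply: (@meas_idx [:: iu M r x; iu M' r' x] (fun y => y (iu M r x) != y (iu M' r' x))).
by move=> y y' yy; rewrite !yy// !inE eqxx ?orbT.
Qed.

Lemma settled r x (e : R) : 0 < e -> \forall M \near \oo, forall M', (M <= M')%N ->
  (P [set w | u w M r x != u w M' r x] <= e%:E)%E.
Proof.
move=> e0.
have : \forall M \near \oo, (P [set w | exists M', (M <= M')%N /\ u w M r x != u w M' r x] <= e%:E)%E.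
  have mA M : measurable [set w | exists M', (M <= M')%N /\ u w M r x != u w M' r x].
    apply: measurable_ex => M'; have [h|h] := boolP (M <= M')%N; last first.
      by rewrite (_ : [set w | _] = set0) //; apply/seteqP; split=> // w /= [].
    apply: measurable_and; first by rewrite (_ : [set w | _] = setT) //; apply/seteqP; split.
    exact: meas_une.
  pose A M := [set w | exists M1, (M <= M1)%N /\ (exists M', (M1 <= M')%N /\ u w M1 r x != u w M' r x)].
  have mA' M : measurable (A M).
    apply: measurable_ex => M'; have [h|h] := boolP (M <= M')%N; last first.
      by rewrite (_ : [set w | _] = set0) //; apply/seteqP; split=> // w /= [].
    by apply: measurable_and; first by rewrite (_ : [set w | _] = setT) //; apply/seteqP; split.
  have dA M : A M.+1 `<=` A M by move=> w [M1 [h h']]; exists M1; split=> //; exact: ltnW.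
  have aA : {ae P, forall w, exists n, ~ A n w}.
    have := aeN; apply: filterS => w /Ngood gw; have [M0 h] := U_ev gw r x.
    by exists M0 => -[M1 [h1 [M' [h2]]]]; rewrite !h ?eqxx// (leq_trans h1).
  have := prob_decreasing mA' dA aA e0; apply: filterS => M; apply: le_trans.
  apply: le_measure; rewrite ?inE//; by move=> w h; exists M.
apply: filterS => M h M' MM; apply: le_trans h; apply: le_measure; rewrite ?inE.
- exact: meas_une.
- apply: measurable_ex => M1; have [h|h] := boolP (M <= M1)%N; last first.
    by rewrite (_ : [set w | _] = set0) //; apply/seteqP; split=> // w /= [].
  apply: measurable_and; first by rewrite (_ : [set w | _] = setT) //; apply/seteqP; split.
  exact: meas_une.
- by move=> w h; exists M'.
Qed.

Lemma meas_tc t M r x : measurable [set w | traj t w x <> decode (c w M r x)].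
Proof.
apply: measurable_not.
rewrite (_ : [set w | _] = [set w | exists a, traj t w x = decode a /\ c w M r x == a]).
  apply: measurable_ex => a; apply: measurable_and; first exact: measurable_traj.
  by apply: (@meas_idx [:: ic M r x] (fun y => y (ic M r x) == a)) => y y' yy; rewrite yy// inE.
apply/seteqP; split=> w /=; first by move=> ->; exists (c w M r x).
by move=> [a [-> /eqP ->]].
Qed.

Lemma prob_c M M' r r' x : (`|x| <= M)%N -> (`|x| <= M')%N ->
  (P [set w | c w M r x != c w M' r' x] <= \sum_(y <- win x) P [set w | u w M r y != u w M' r' y])%E.
Proof.
move=> xM xM'; rewrite /win !big_cons big_nil adde0.
have m y := meas_une M r y M' r'.
apply: (@le_trans _ _ (P ([set w | u w M r (x - 1) != u w M' r' (x - 1)] `|`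
   ([set w | u w M r x != u w M' r' x] `|` [set w | u w M r (x + 1) != u w M' r' (x + 1)])))).
  apply: prob_le_ae.
  - apply: (@meas_idx [:: ic M r x; ic M' r' x] (fun y => y (ic M r x) != y (ic M' r' x))).
    by move=> y y' yy; rewrite !yy// !inE eqxx ?orbT.
  - by do 2!apply: measurableU => //.
  - have := aeN; apply: filterS => w /Ngood [_ _ _ loc _]; apply: contraPP => /= h.
    apply/negP; rewrite negbK; apply/eqP/loc => // y; rewrite -mem_win => yx; apply/eqP.
    move: yx; rewrite !inE => /or3P[] /eqP ->; apply/negPn/negP => h'; apply: h.
    + by left.
    + by right; left.
    + by right; right.
apply: le_trans (measureU2 P (m _) (measurableU _ _ (m _) (m _))) _.
by rewrite leeD2l// measureU2.
Qed.

Lemma Kz_mono z (t t' : R) : t <= t' -> Kz lam q z t <= Kz lam q z t'.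
Proof.
move=> tt; rewrite /Kz ler_wpM2r ?mulr_ge0// ler_wpM2l ?invr_ge0 ?(ltW (wz_gt0 _ _))// ler_expR.
by rewrite ler_wpM2l// ler_wpM2r ?addr_ge0 ?(ltW lam_gt0).
Qed.

(** The state at time [t] is that of large boxes at times slightly above [t]. Around [x] their
    odometers differ from those of the box [M] at time [above D t] either because of the box, which
    [settled] controls, or because of the time, which [prob_jump] controls. *)
Lemma traj_approx (t : R) x (e : R) : 0 <= t -> 0 < e -> \forall D \near \oo, \forall M \near \oo,
  (P [set w | traj t w x <> decode (c w M (above D t) x)] <= e%:E)%E.
Proof.
move=> t0 e0.
set K := (1 + lam) * (Kz lam q (x - 1) (t + 1) + Kz lam q x (t + 1) + Kz lam q (x + 1) (t + 1)).
have K0 : 0 <= K by rewrite mulr_ge0 ?addr_ge0 ?Kz_ge0// ltW.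
have e1 : 0 < e / 2 / (K + 1) by rewrite !divr_gt0// ltr_wpDl.
have := above_near t0 e1; apply: filterS => D hD.
(* The three sites of the window contribute [3 * (e / 6)] through the box; the other half of [e] is
   left for the time. *)
have e6 : 0 < e / 6 by rewrite divr_gt0.
have := near_all_seq (l := win x) (fun y _ => settled (above D t) y e6) => hM.
near=> M.
have xM : (`|x| <= M)%N by near: M; exact: nbhs_infty_ge.
have st : forall y, y \in win x -> forall M', (M <= M')%N ->
  (P [set w | u w M (above D t) y != u w M' (above D t) y] <= (e / 6)%:E)%E.
  by near: M.
apply: (@prob_liminf _ _ _ P (fun n => [set w | exists M0, forall M', (M0 <= M')%N ->
    c w M' (above n t) x != c w M (above D t) x])).
- move=> n; apply: measurable_ex => M0; apply: measurable_all => M'; apply: measurable_imp => _.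
  apply: (@meas_idx [:: ic M' (above n t) x; ic M (above D t) x] (fun y => y (ic M' (above n t) x) != y (ic M (above D t) x))).
  by move=> y y' yy; rewrite !yy// !inE eqxx ?orbT.
- exact: meas_tc.
- have e2 : 0 < ratr (above D t) - t by rewrite subr_gt0 above_gt.
  have := above_near t0 e2; apply: filterS => n; rewrite addrC subrK => nD.
  apply: (@prob_liminf _ _ _ P (fun M' => [set w | c w M' (above n t) x != c w M (above D t) x])).
  + move=> M'; apply: (@meas_idx [:: ic M' (above n t) x; ic M (above D t) x] (fun y => y (ic M' (above n t) x) != y (ic M (above D t) x))).
    by move=> y y' yy; rewrite !yy// !inE eqxx ?orbT.
  + apply: measurable_ex => M0; apply: measurable_all => M'; apply: measurable_imp => _.
    apply: (@meas_idx [:: ic M' (above n t) x; ic M (above D t) x] (fun y => y (ic M' (above n t) x) != y (ic M (above D t) x))).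
    by move=> y y' yy; rewrite !yy// !inE eqxx ?orbT.
  + exists M => // M' MM'; apply: le_trans (prob_c _ _ (leq_trans xM MM') xM) _.
    have step y : y \in win x -> (P [set w | u w M' (above n t) y != u w M (above D t) y] <=
        (e / 6 + (ratr (above D t) - t) * (1 + lam) * Kz lam q y (t + 1))%:E)%E.
      move=> yx; apply: (@le_trans _ _ (P ([set w | u w M (above D t) y != u w M' (above D t) y] `|`
         [set w | u w M' (above D t) y != u w M' (above n t) y]))).
        apply: le_measure; rewrite ?inE; [exact: meas_une|by apply: measurableU; exact: meas_une|].
        move=> w /= h; have [h1|h1] := eqVneq (u w M (above D t) y) (u w M' (above D t) y); last by left.
        by right; rewrite -h1 eq_sym.
      apply: le_trans (measureU2 P (meas_une _ _ _ _ _) (meas_une _ _ _ _ _)) _.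
      rewrite EFinD; apply: leeD; first exact: st.
      have nD' : above n t <= above D t by rewrite -(ler_rat R) ltW.
      apply: le_trans (prob_jump lam_gt0 p_gt0 law M' y (above_ge0 n t) nD') _.
      rewrite lee_fin; apply: ler_pM; rewrite ?Kz_ge0//.
      * by rewrite mulr_ge0 ?subr_ge0 ?ler_rat// addr_ge0// ltW.
      * by rewrite ler_wpM2r ?addr_ge0 ?(ltW lam_gt0)// lerD2l lerN2 ltW// above_gt.
      * by apply: Kz_mono; exact: above_le1.
    apply: (@le_trans _ _ (\sum_(y <- win x) (e / 6 + (ratr (above D t) - t) * (1 + lam) * Kz lam q y (t + 1))%:E)%E).
      by rewrite big_seq [leRHS]big_seq; apply: lee_sum => y; exact: step.
    rewrite sumEFin lee_fin /win !big_cons big_nil addr0.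
    have : (ratr (above D t) - t) * K <= e / 2.
      apply: (@le_trans _ _ (e / 2 / (K + 1) * K)).
        by rewrite ler_wpM2r// lerBlDl ltW.
      by rewrite mulrAC ler_pdivrMr ?ltr_wpDl// ler_wpM2l ?lerDl// divr_ge0// ltW.
    by rewrite /K; lra.
  + by apply: aeW => w [M0 h]; exists M0.
- have := aeN; apply: filterS => w Nw /= h; have [r0 tr0 hr] := traj_near t x Nw.
  have e3 : 0 < ratr r0 - t by rewrite subr_gt0.
  have := above_near t0 e3; apply: filterS => n; rewrite addrC subrK => nr.
  have [M0 hM0] := hr (above n t) (above_gt n t) (ltW nr); exists M0 => M' MM'.
  by rewrite hM0//; apply: contra_notN h => /eqP <-; rewrite codeK.
Unshelve. all: by end_near. Qed.

End Trajectory.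

Lemma cvg_sum_seq (R : realType) (I : Type) (l : seq I) (F : I -> nat -> R) (a : I -> R) :
  (forall i, F i @ \oo --> a i) -> (fun k => \sum_(i <- l) F i k) @ \oo --> \sum_(i <- l) a i.
Proof.
move=> Fa; elim: l => [|i l IH].
  by rewrite big_nil; under eq_fun do rewrite big_nil; exact: cvg_cst.
rewrite big_cons; under eq_fun do rewrite big_cons.
by apply: cvgD; [exact: Fa|exact: IH].
Qed.

Lemma le_sum_mem (R : realType) (I : eqType) (l : seq I) (F : I -> R) i : (forall j, 0 <= F j) ->
  i \in l -> F i <= \sum_(j <- l) F j.
Proof. by move=> F0 il; rewrite (big_rem i)//= lerDl sumr_ge0. Qed.

(** * Finite-dimensional events *)

Section Visits.
Context (R : realType).
Implicit Types (s : seq (R * set config)) (X : R -> config).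

Fixpoint times (t : R) s : seq R := if s is (d, A) :: r then (t + d) :: times (t + d) r else [::].

Definition local_within (n : nat) (A : set config) :=
  forall eta zeta : config, (forall x : int, x \in zs n -> eta x = zeta x) -> A eta -> A zeta.

Lemma local_common s : (forall a, a \in s -> local_event a.2) ->
  exists n, forall a, a \in s -> local_within n a.2.
Proof.
elim: s => [|a r IH] h; first by exists 0%N.
have [n1 h1] : exists n, local_within n a.2.
  have [n hn] := h a (mem_head _ _); exists n => eta zeta ez; apply: hn => x xn.
  by apply: ez; rewrite mem_zs.
have [n2 h2] : exists n, forall b, b \in r -> local_within n b.2.
  by apply: IH => b br; apply: h; rewrite inE br orbT.
have wide n n' A : (n <= n')%N -> local_within n A -> local_within n' A.
  move=> nn lA eta zeta ez; apply: lA => x; rewrite mem_zs => xn; apply: ez.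
  by rewrite mem_zs (leq_trans xn).
exists (maxn n1 n2) => b; rewrite inE => /orP[/eqP->|br].
  exact: wide (leq_maxl _ _) h1.
exact: wide (leq_maxr _ _) (h2 b br).
Qed.

Lemma visits_agree n s X X' t : (forall a, a \in s -> local_within n a.2) ->
  (forall t' x, t' \in times t s -> x \in zs n -> X t' x = X' t' x) ->
  visits X t s -> visits X' t s.
Proof.
elim: s t => //= -[d A] r IH t loc XX [AX vX]; split.
  apply: (loc (d, A) (mem_head _ _) _ _ _ AX) => x xn.
  by apply: XX => //; rewrite mem_head.
apply: IH vX => [a ar|t' x tr xn]; first by apply: loc; rewrite inE ar orbT.
by apply: XX => //; rewrite inE tr orbT.
Qed.

Lemma times_ge0 s t t' : (forall a, a \in s -> 0 <= a.1) -> 0 <= t -> t' \in times t s -> 0 <= t'.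
Proof.
elim: s t => //= -[d A] r IH t h t0; have d0 : 0 <= d by apply: (h (d, A)); rewrite mem_head.
rewrite inE => /orP[/eqP ->|]; first exact: addr_ge0.
by apply: IH; rewrite ?addr_ge0// => a ar; apply: h; rewrite inE ar orbT.
Qed.

End Visits.

Lemma prob_cover (R : realType) (d : measure_display) (T : measurableType d) (P : probability T R)
  (I : eqType) (l : seq I) (V V' : set T) (B : I -> set T) : measurable V -> measurable V' ->
  (forall i, measurable (B i)) -> (forall w, V w -> V' w \/ exists2 i, i \in l & B i w) ->
  (P V <= P V' + \sum_(i <- l) P (B i))%E.
Proof.
move=> mV + mB; elim: l V' => [|i l IH] V' mV' cov.
  rewrite big_nil adde0; apply: le_measure; rewrite ?inE// => w /cov[//|[]//].
rewrite big_cons addeA.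
apply: (@le_trans _ _ (P (V' `|` B i) + \sum_(j <- l) P (B j))%E).
  apply: IH; first exact: measurableU.
  move=> w /cov[h|[j]]; first by left; left.
  by rewrite inE => /orP[/eqP-> h|jl h]; [left; right|right; exists j].
by apply: leeD => //; exact: measureU2.
Qed.

Section Chain.
Context (R : realType) (lam : R).
Hypothesis lam_gt0 : 0 < lam.
Context (p q : nat).
Hypothesis p_gt0 : (0 < p)%N.

Definition Xsys om k M L s0 : R -> config := fun t => (sys p q om M L s0 (steps lam t k)).2.

(** The step counts are differences of rounded times, not rounded durations, so that they add up to
    the rounded total time. *)
Fixpoint incs (t : R) k (s : seq (R * set config)) : seq (nat * set config) :=
  if s is (d, A) :: r then ((steps lam (t + d) k - steps lam t k)%N, A) :: incs (t + d) k r else [::].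

Lemma vis_visits om k M L s0 t s : (forall a, a \in s -> 0 <= a.1) ->
  vis R (zs L) om (steps lam t k) (incs t k s) (sys p q om M L s0 (steps lam t k)) =
  `[< visits (Xsys om k M L s0) t s >]%:R.
Proof.
elim: s t => [|[d A] r IH] t h; first by rewrite /= asboolT.
have d0 : 0 <= d by apply: (h (d, A)); rewrite mem_head.
have tt : (steps lam t k <= steps lam (t + d) k)%N by apply: steps_mono => //; rewrite lerDl.
rewrite [LHS]/= -sys_add subnKC// IH; last by move=> a ar; apply: h; rewrite inE ar orbT.
rewrite indicE -/(Xsys om k M L s0 (t + d)) -natrM mulnb /= asbool_and; congr (nat_of_bool (_ && _))%:R.
Qed.

Lemma total_incs t k s : (forall a, a \in s -> 0 <= a.1) ->
  (steps lam t k + total (incs t k s) = steps lam (last t (times t s)) k)%N.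
Proof.
elim: s t => [|[d A] r IH] t h /=; first by rewrite /total addn0.
have d0 : 0 <= d by apply: (h (d, A)); rewrite mem_head.
have tt : (steps lam t k <= steps lam (t + d) k)%N by apply: steps_mono => //; rewrite lerDl.
rewrite /total /= -/(total _) addnA subnKC// IH// => a ar; apply: h; by rewrite inE ar orbT.
Qed.

Fixpoint plan (t : R) (s : seq (R * set config)) : seq ((R * (nat -> nat)) * set config) :=
  if s is (d, A) :: r then ((d, fun k => steps lam (t + d) k - steps lam t k)%N, A) :: plan (t + d) r else [::].

Lemma plan_incs t k s : [seq (a.1.2 k, a.2) | a <- plan t s] = incs t k s.
Proof. by elim: s t => //= -[d A] r IH t; rewrite /= IH. Qed.

Lemma plan_times t s : [seq (a.1.1, a.2) | a <- plan t s] = s.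
Proof. by elim: s t => //= -[d A] r IH t; rewrite /= IH. Qed.

Lemma plan_cvg t s : 0 <= t -> (forall a, a \in s -> 0 <= a.1) -> forall a, a \in plan t s ->
  0 <= a.1.1 /\ (fun k => (a.1.2 k)%:R * mesh R k) @ \oo --> a.1.1 * (1 + lam).
Proof.
elim: s t => [|[d A] r IH] t //= t0 h a.
have d0 : 0 <= d by apply: (h (d, A)); rewrite mem_head.
rewrite inE => /orP[/eqP ->|]; last first.
  by apply: IH; rewrite ?addr_ge0// => b br; apply: h; rewrite inE br orbT.
split=> //=.
have -> : (fun k => (steps lam (t + d) k - steps lam t k)%N%:R * mesh R k) =
   (fun k => (steps lam (t + d) k)%:R * mesh R k - (steps lam t k)%:R * mesh R k).
  by apply/funext => k; rewrite natrB ?mulrBl// steps_mono// lerDl.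
rewrite (_ : d * (1 + lam) = (t + d) * (1 + lam) - t * (1 + lam)); last by ring.
by apply: cvgB; apply: steps_cvg => //; exact: addr_ge0.
Qed.

Definition shift_mean k (F : nat -> (coord -> nat) -> R) : R := p%:R^-1 * \sum_(s < p) Ek lam k (F s).

Lemma mean2_le k (F G : nat -> (coord -> nat) -> R) : (forall (s : 'I_p) om, F s om <= G s om) -> shift_mean k F <= shift_mean k G.
Proof.
move=> FG; rewrite ler_wpM2l ?invr_ge0//; apply: ler_sum => s _; apply: Ek_le => // om; exact: FG.
Qed.

Lemma mean2_D k F G : shift_mean k (fun s om => F s om + G s om) = shift_mean k F + shift_mean k G.
Proof.
rewrite /shift_mean -mulrDr -big_split; congr (_ * _); apply: eq_bigr => s _ /=.
by have := Ek_lin lam k (F s) (G s) 1; rewrite mul1r => <-; congr Ek; apply/funext => om; rewrite mul1r.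
Qed.

Lemma mean2_0 k : shift_mean k (fun _ _ => 0) = 0.
Proof. by rewrite /shift_mean big1 ?mulr0// => s _; exact: Ek_cst. Qed.

Lemma mean2_sum k (I : Type) (l : seq I) (F : I -> nat -> (coord -> nat) -> R) :
  shift_mean k (fun s om => \sum_(i <- l) F i s om) = \sum_(i <- l) shift_mean k (F i).
Proof.
elim: l => [|i l IH].
  rewrite big_nil -[RHS](mean2_0 k); congr shift_mean; apply/funext => s; apply/funext => om.
  by rewrite big_nil.
rewrite big_cons -IH -mean2_D; congr shift_mean; apply/funext => s; apply/funext => om.
by rewrite big_cons.
Qed.

Lemma mean2_norm k (F G H : nat -> (coord -> nat) -> R) : (forall (s : 'I_p) om, `|F s om - G s om| <= H s om) ->
  `|shift_mean k F - shift_mean k G| <= shift_mean k H.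
Proof.
move=> FGH; rewrite ler_norml; apply/andP; split.
  rewrite lerBrDr addrC lerBlDr -mean2_D; apply: mean2_le => s om.
  by have := FGH s om; rewrite ler_norml => /andP[]; lra.
rewrite lerBlDr -mean2_D; apply: mean2_le => s om.
by have := FGH s om; rewrite ler_norml => /andP[]; lra.
Qed.

Lemma fdd_mean2 M L s : (forall a, a \in s -> 0 <= a.1) ->
  (fun k => shift_mean k (fun s0 om => `[< visits (Xsys om k M L s0) 0 s >]%:R)) @ \oo -->
  p%:R^-1 * \sum_(s0 < p) fdd [set` zs L] lam s (conf (patM p q M s0)).
Proof.
move=> h; apply: cvgMl_tmp; apply: cvg_sum_seq => s0.
have [_ dc] := @dfdd_cvg R lam lam_gt0 (zs L) ((2 * L + 1) * q) (plan 0 s) (zs_uniq L) (plan_cvg (lexx 0) h).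
rewrite plan_times in dc; apply/cvgrPdist_le => e e0.
have hc := dc e e0.
near=> k.
have be : big_enough q L (0 : R) k by near: k; exact: near_big_enough.
have tl : last 0 (times 0 s) <= k%:R by near: k; exact: nbhs_infty_ger.
have -> : Ek lam k (fun om => `[< visits (Xsys om k M L s0) 0 s >]%:R) =
  dfdd lam (zs L) k (incs 0 k s) (conf (patM p q M s0)).
  rewrite -Ek_vis//; last first.
    have := total_incs 0 k h; rewrite {1}/steps mul0r mul0r Num.Theory.truncn0 add0n => ->.
    exact: steps_mono.
  congr Ek; apply/funext => om; rewrite -vis_visits//.
  by rewrite /steps mul0r mul0r Num.Theory.truncn0.
have fk : forall eta, (num_on (zs L) eta <= (2 * L + 1) * q)%N ->
  `|dfdd lam (zs L) k [seq (a.1.2 k, a.2) | a <- plan 0 s] eta - fdd [set` zs L] lam s eta| <= e.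
  by near: k.
rewrite distrC -(plan_incs 0); apply: fk; exact: num_patM.
Unshelve. all: by end_near. Qed.

Lemma sys_config_eq om M L s0 J J' x :
  (forall y, (`|y - x| <= 1)%N -> (sys p q om M L s0 J).1 y = (sys p q om M M s0 J').1 y) ->
  (sys p q om M L s0 J).2 x = (sys p q om M M s0 J').2 x.
Proof.
move=> uu; have [_ ->] := sys_consistent p q om M L s0 J.
have [_ ->] := sys_consistent p q om M M s0 J'.
by apply: st_local.
Qed.

(* A site can only be in different states in the two systems if the odometer
   of one of its neighbours moves during [[t, r]] or differs at time [r]. *)
Lemma visits_diff n M L D s k (s0 : 'I_p) om : (M <= L)%N ->
  (forall a, a \in s -> 0 <= a.1) -> (forall a, a \in s -> local_within n a.2) ->
  `| `[< visits (Xsys om k M L s0) 0 s >]%:R -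
     `[< visits (fun t x => decode (fields lam p q k s0 om (ic M (above D t) x))) 0 s >]%:R | <=
  \sum_(t <- times 0 s) \sum_(x <- zs n) \sum_(y <- win x)
    (((sys p q om M L s0 (steps lam (ratr (above D t)) k)).1 y)%:R
      - ((sys p q om M L s0 (steps lam t k)).1 y)%:R
     + (fields lam p q k s0 om (iu M (above D t) y) != fields lam p q k s0 om (iu L (above D t) y))%:R) :> R.
Proof.
move=> ML h loc.
have mono t y : ((sys p q om M L s0 (steps lam t k)).1 y <=
   (sys p q om M L s0 (steps lam (ratr (above D t)) k)).1 y)%N.
  by apply: sys_mono_time; apply: steps_mono => //; rewrite ltW// above_gt.
have g0 t y : 0 <= ((sys p q om M L s0 (steps lam (ratr (above D t)) k)).1 y)%:R
      - ((sys p q om M L s0 (steps lam t k)).1 y)%:R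
     + (fields lam p q k s0 om (iu M (above D t) y) != fields lam p q k s0 om (iu L (above D t) y))%:R :> R.
  by rewrite addr_ge0// subr_ge0 ler_nat.
set S := \sum_(t <- _) _.
have S0 : 0 <= S by rewrite !sumr_ge0// => t _; rewrite sumr_ge0// => x _; rewrite sumr_ge0.
have [S1|S1] := lerP 1 S.
  apply: le_trans S1; case: (`[< _ >]); case: (`[< _ >]);
  by rewrite ?subrr ?normr0 ?subr0 ?normr1 ?sub0r ?normrN ?normr1.
have eqs t x y : t \in times 0 s -> x \in zs n -> y \in win x ->
    (sys p q om M L s0 (steps lam t k)).1 y = (sys p q om M M s0 (steps lam (ratr (above D t)) k)).1 y.
  move=> ts xn yx.
  have : ((sys p q om M L s0 (steps lam (ratr (above D t)) k)).1 y)%:R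
      - ((sys p q om M L s0 (steps lam t k)).1 y)%:R
     + (fields lam p q k s0 om (iu M (above D t) y) != fields lam p q k s0 om (iu L (above D t) y))%:R < 1 :> R.
    apply: le_lt_trans S1; rewrite /S.
    pose f t y := ((sys p q om M L s0 (steps lam (ratr (above D t)) k)).1 y)%:R
      - ((sys p q om M L s0 (steps lam t k)).1 y)%:R
     + (fields lam p q k s0 om (iu M (above D t) y) != fields lam p q k s0 om (iu L (above D t) y))%:R : R.
    have f0 t' y' : 0 <= f t' y' by exact: g0.
    have s1 x' t' : 0 <= \sum_(y' <- win x') f t' y' by rewrite sumr_ge0.
    have s2 t' : 0 <= \sum_(x' <- zs n) \sum_(y' <- win x') f t' y' by rewrite sumr_ge0.
    apply: le_trans (le_sum_mem s2 ts); apply: le_trans (le_sum_mem (s1^~ t) xn).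
    exact: (le_sum_mem (g0 t) yx).
  have := mono t y; rewrite !fields_iu.
  (* The odometer for the pattern on [[- M, M]] run on [[- L, L]] lies between those of the boxes
     [M] and [L]; where these two agree, all three do. *)
  have m1 := @sys_mono p q om M M M L s0 (steps lam (ratr (above D t)) k) y (leqnn _) ML.
  have m2 := @sys_mono p q om M L L L s0 (steps lam (ratr (above D t)) k) y ML (leqnn _).
  move: m1 m2; set a := (sys p q om M M s0 _).1 y; set b := (sys p q om L L s0 _).1 y.
  set e := (sys p q om M L s0 _).1 y; set f := (sys p q om M L s0 (steps lam t k)).1 y.
  move=> m1 m2 fe; have [ab|ab] := eqVneq a b; last first.
    by rewrite /= ltNge lerDr subr_ge0 ler_nat fe.
  rewrite /= addr0 ltrBlDr -[1]/(1%:R) -natrD ltr_nat add1n ltnS => ef.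
  by apply/anti_leq/andP; split; move: m1 m2 ef fe; rewrite -ab; lia.
have agree t x : t \in times 0 s -> x \in zs n ->
    Xsys om k M L s0 t x = decode (fields lam p q k s0 om (ic M (above D t) x)).
  move=> ts xn; rewrite fields_ic codeK; apply: sys_config_eq => y; rewrite -mem_win; exact: eqs.
rewrite (_ : `[< visits _ 0 s >] = `[< visits (fun t x => decode (fields lam p q k s0 om (ic M (above D t) x))) 0 s >]).
  by rewrite subrr normr0.
by apply: asbool_equiv_eq; split; apply: visits_agree loc _ => t x ts xn; rewrite agree.
Qed.

End Chain.

Lemma measurable_local_event (d : measure_display) (T : measurableType d) (Y : T -> config) n (A : set config) :
  (forall x a, measurable [set w | Y w x = a]) -> local_within n A -> measurable [set w | A (Y w)].
Proof.
move=> mY lA; pose cfg (v : seq nat) : config := fun x => decode (nth 0%N v (index x (zs n))).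
rewrite (_ : [set w | _] = [set w | exists v, A (cfg v) /\
   forall x : int, x \in zs n -> Y w x = cfg v x]).
  apply: measurable_ex => v; have [h|h] := pselect (A (cfg v)); last first.
    by rewrite (_ : [set w | _] = set0) //; apply/seteqP; split=> // w /= [].
  apply: measurable_and; first by rewrite (_ : [set w | _] = setT) //; apply/seteqP; split.
  by apply: measurable_all => x; apply: measurable_imp => _; exact: mY.
apply/seteqP; split=> w /=; last by move=> [v [h e]]; apply: lA h => x /e ->.
move=> h; pose v := [seq code (Y w x) | x <- zs n].
have vE x : x \in zs n -> Y w x = cfg v x.
  move=> xn; rewrite /cfg /v (nth_map 0) ?index_mem// nth_index//; exact/esym/codeK.
by exists v; split=> //; apply: lA h => x /vE.
Qed.

(** * The law of the trajectories *)

Section Law.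
Context (R : realType) (lam : R).
Hypothesis lam_gt0 : 0 < lam.
Context (p q : nat).
Hypothesis p_gt0 : (0 < p)%N.
Context (d : measure_display) (T : measurableType d) (P : probability T R) (Y : T -> idx -> nat).
Hypothesis law : forall (s : seq idx) (A : set (idx -> nat)),
  (forall y y', (forall i, i \in s -> y i = y' i) -> A y -> A y') ->
  measurable [set t | A (Y t)] /\ P [set t | A (Y t)] = (Q lam p q (fun y => `[< A y >]%:R))%:E.
Context (N : set T).
Hypotheses (mN : measurable N) (N0 : P N = 0%E) (Ngood : forall w, ~ N w -> good p q Y w).

Notation u w M r x := (Y w (iu M r x)).
Notation c w M r x := (Y w (ic M r x)).
Notation traj := (@traj R p q d T Y N).
Notation mean2 := (shift_mean lam p).
Notation Xsys := (Xsys lam p q).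
Notation zX w M D := (fun t x => decode (c w M (above D t) x)).

Lemma measurable_visits n (t : R) s : (forall a, a \in s -> local_within n a.2) ->
  measurable [set w | visits (fun t => traj t w) t s].
Proof.
elim: s t => [|[e A] r IH] t loc /=.
  by rewrite (_ : [set w | _] = setT) //; apply/seteqP; split.
apply: measurable_and.
  by apply: (@measurable_local_event _ _ (traj (t + e)) n); [move=> x a; exact: (measurable_traj law)|exact: (loc (e, A) (mem_head _ _))].
by apply: IH => a ar; apply: loc; rewrite inE ar orbT.
Qed.

Lemma law_visits n M D (t : R) s : (forall a, a \in s -> local_within n a.2) ->
  measurable [set w | visits (zX w M D) t s] /\
  P [set w | visits (zX w M D) t s] =
    (Q lam p q (fun y => `[< visits (fun t x => decode (y (ic M (above D t) x))) t s >]%:R))%:E.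
Proof.
move=> loc.
apply: (@law [seq ic M (above D t') x | t' <- times t s, x <- zs n]
  (fun y => visits (fun t x => decode (y (ic M (above D t) x))) t s)).
move=> y y' yy; apply: visits_agree loc _ => t' x ts xn; rewrite yy//.
by apply/allpairsP; exists (t', x).
Qed.

Lemma prob_visits n M D (s : seq (R * set config)) : (forall a, a \in s -> local_within n a.2) ->
  (P [set w | visits (fun t => traj t w) 0 s] <= P [set w | visits (zX w M D) 0 s] +
    \sum_(i <- [seq (t, x) | t <- times 0 s, x <- zs n])
      P [set w | traj i.1 w i.2 <> decode (c w M (above D i.1) i.2)])%E /\
  (P [set w | visits (zX w M D) 0 s] <= P [set w | visits (fun t => traj t w) 0 s] +
    \sum_(i <- [seq (t, x) | t <- times 0 s, x <- zs n])
      P [set w | traj i.1 w i.2 <> decode (c w M (above D i.1) i.2)])%E.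
Proof.
move=> loc; have mV := measurable_visits 0 loc; have [mV' _] := law_visits M D 0 loc.
have mB (i : R * int) : measurable [set w | traj i.1 w i.2 <> decode (c w M (above D i.1) i.2)].
  exact: (meas_tc law).
have cov w : (exists2 i, i \in [seq (t, x) | t <- times 0 s, x <- zs n] &
    traj i.1 w i.2 <> decode (c w M (above D i.1) i.2)) \/
   (forall t x, t \in times 0 s -> x \in zs n -> traj t w x = decode (c w M (above D t) x)).
  have [h|h] := pselect (exists2 i, i \in [seq (t, x) | t <- times 0 s, x <- zs n] &
    traj i.1 w i.2 <> decode (c w M (above D i.1) i.2)); [by left|right].
  move=> t x ts xn; apply: contrapT => h'; apply: h; exists (t, x) => //.
  by apply/allpairsP; exists (t, x).
split; apply: (@prob_cover _ _ _ P _ _ _ _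
   (fun i => [set w | traj i.1 w i.2 <> decode (c w M (above D i.1) i.2)])) => // w /= V.
  by case: (cov w) => [|h]; [right|left; apply: visits_agree loc _ V => t x ts xn; rewrite h].
by case: (cov w) => [|h]; [right|left; apply: visits_agree loc _ V => t x ts xn; rewrite h].
Qed.

Definition trunc_law M s : R := p%:R^-1 * \sum_(s0 < p) fdd setT lam s (conf (patM p q M s0)).

Lemma truncate_pat M s0 : truncate_config M (conf (pat p q s0)) = conf (patM p q M s0).
Proof. by apply/funext => x; rewrite /truncate_config /conf /patM; case: ifP. Qed.

Lemma supported_pat M s0 : supported M (conf (patM p q M s0)).
Proof. by move=> x; rewrite /conf /patM ltnNge => /negbTE ->. Qed.

Lemma ulim_dist (a b h : nat -> R) : bounded_seq a -> bounded_seq b -> bounded_seq h ->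
  (\forall k \near \oo, `|a k - b k| <= h k) -> `|ulim a - ulim b| <= ulim h.
Proof.
move=> Ba Bb Bh ab; rewrite ler_norml; apply/andP; split.
  rewrite lerBrDr addrC -[ulim h]mul1r -mulNr mulrC mulrN1 -[- ulim h]mulN1r -ulim_lin//.
  apply: ulim_le => //; last by apply: filterS ab => k; rewrite ler_norml => /andP[]; lra.
  have [B1 h1] := Bb; have [B2 h2] := Bh; exists (B1 + B2) => k.
  by apply: le_trans (ler_normD _ _) _; rewrite lerD// normrM normrN1 mul1r.
rewrite lerBlDr -[X in _ + X]mul1r -ulim_lin//; apply: ulim_le => //.
  have [B1 h1] := Bb; have [B2 h2] := Bh; exists (B2 + B1) => k; rewrite mul1r.
  by apply: le_trans (ler_normD _ _) _; rewrite lerD.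
by apply: filterS ab => k; rewrite ler_norml mul1r => /andP[]; lra.
Qed.

Lemma ulim_sum (I : Type) (l : seq I) (F : I -> nat -> R) : (forall i, bounded_seq (F i)) ->
  bounded_seq (fun k => \sum_(i <- l) F i k) /\
  ulim (fun k => \sum_(i <- l) F i k) = \sum_(i <- l) ulim (F i).
Proof.
move=> BF; elim: l => [|i l [B1 IH]].
  rewrite big_nil; split; first by exists 0 => k; rewrite big_nil normr0.
  by rewrite -[RHS]ulim_cst; congr ulim; apply/funext => k; rewrite big_nil.
split.
  have [b1 h1] := BF i; have [b2 h2] := B1; exists (b1 + b2) => k; rewrite big_cons.
  by apply: le_trans (ler_normD _ _) _; rewrite lerD.
rewrite big_cons -IH -[X in _ = _ + X]mul1r -ulim_lin//; congr ulim; apply/funext => k.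
by rewrite big_cons mul1r.
Qed.

Lemma mean2_bounded (F : nat -> nat -> (coord -> nat) -> R) B :
  (forall k s om, `|F k s om| <= B) -> bounded_seq (fun k => mean2 k (F k)).
Proof.
move=> FB; exists B => k.
have c b : p%:R^-1 * \sum_(s < p) Ek lam k (fun=> b) = b.
  rewrite (eq_bigr (fun=> b)) => [|s _]; last exact: Ek_cst.
  by rewrite sumr_const card_ord -[b *+ p]mulr_natl mulrA mulVf ?mul1r// pnatr_eq0 -lt0n.
have := @mean2_norm R lam lam_gt0 p k (F k) (fun _ _ => 0) (fun _ _ => B).
rewrite mean2_0// subr0 => h; rewrite -[leRHS]c; apply: h => s om; by rewrite subr0.
Qed.

(** The ultralimit of [visits_diff]: the mean increments are bounded by [Ek_incr], the probabilities
    that two boxes differ converge to those of the fields by definition of [Q], and the first term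
    on the left is a genuine limit. *)
Lemma fdd_approx n M L D s : (M <= L)%N ->
  (forall a, a \in s -> 0 <= a.1) -> (forall a, a \in s -> local_within n a.2) ->
  (`|(p%:R^-1 * \sum_(s0 < p) fdd [set` zs L] lam s (conf (patM p q M s0)))%:E
     - P [set w | visits (zX w M D) 0 s]|
  <= \sum_(t <- times 0 s) \sum_(x <- zs n) \sum_(y <- win x)
    (((ratr (above D t) - t) * (1 + lam) * Kz lam q y (ratr (above D t)))%:E
     + P [set w | u w M (above D t) y != u w L (above D t) y]))%E.
Proof.
move=> ML h loc; have [_ ->] := law_visits M D 0 loc.
have law2 t y : P [set w | u w M (above D t) y != u w L (above D t) y] =
    (Q lam p q (fun z => (z (iu M (above D t) y) != z (iu L (above D t) y))%:R))%:E.
  have [|_ //] := @law_bool R lam p q d T P Y law [:: iu M (above D t) y; iu L (above D t) y]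
    (fun z => z (iu M (above D t) y) != z (iu L (above D t) y)).
  by move=> z z' zz; rewrite !zz// !inE eqxx ?orbT.
pose G t y : R := (ratr (above D t) - t) * (1 + lam) * Kz lam q y (ratr (above D t))
  + Q lam p q (fun z => (z (iu M (above D t) y) != z (iu L (above D t) y))%:R).
set Z := (X in (_ <= X)%E); have -> : Z = (\sum_(t <- times 0 s) \sum_(x <- zs n) \sum_(y <- win x) G t y)%:E.
  rewrite /Z -sumEFin; apply: eq_bigr => t _; rewrite -sumEFin; apply: eq_bigr => x _.
  by rewrite -sumEFin; apply: eq_bigr => y _; rewrite law2 -EFinD.
rewrite -EFinB abse_EFin lee_fin {Z}.
have b01 (b : bool) : `|b%:R| <= 1 :> R by case: b; rewrite ?normr1 ?normr0.
rewrite -(ulim_eq (@fdd_mean2 R lam lam_gt0 p q M L s h)).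
pose H k t y : R := ((ratr (above D t) - t) * (1 + lam) + mesh R k) * Kz lam q y (ratr (above D t))
  + mean lam p q k (fun z => (z (iu M (above D t) y) != z (iu L (above D t) y))%:R).
have Hb t y : bounded_seq (fun k => H k t y).
  have [B hB] := mean_bounded lam_gt0 q p_gt0 (bnd_nat R (fun z => z (iu M (above D t) y) != z (iu L (above D t) y))).
  set K := Kz lam q y (ratr (above D t)).
  exists ((`|(ratr (above D t) - t) * (1 + lam)| + 1) * `|K| + B) => k.
  apply: le_trans (ler_normD _ _) _; rewrite lerD// -/K normrM ler_wpM2r//.
  by apply: le_trans (ler_normD _ _) _; rewrite lerD2l ger0_norm ?mesh_ge0// mesh_le1.
have HQ t y : ulim (fun k => H k t y) = G t y.
  rewrite /G; have c1 := @mesh_lin_cvg R ((ratr (above D t) - t) * (1 + lam)) (Kz lam q y (ratr (above D t))) 1.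
  rewrite -(ulim_eq c1) -[Q _ _ _ _]mul1r -ulim_lin; last first.
  - by apply: mean_bounded => //; exact: bnd_nat.
  - set K := Kz lam q y (ratr (above D t)); exists ((`|(ratr (above D t) - t) * (1 + lam)| + 1) * `|K|) => k.
    rewrite normrM ler_wpM2r// mul1r.
    by apply: le_trans (ler_normD _ _) _; rewrite lerD2l ger0_norm ?mesh_ge0// mesh_le1.
  by congr ulim; apply/funext => k; rewrite /H !mul1r.
have S1 t x := @ulim_sum int (win x) (fun y k => H k t y) (Hb t).
have S2 t := @ulim_sum int (zs n) (fun x k => \sum_(y <- win x) H k t y) (fun x => (S1 t x).1).
have [B3 S3] := @ulim_sum R (times 0 s) (fun t k => \sum_(x <- zs n) \sum_(y <- win x) H k t y) (fun t => (S2 t).1).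
have -> : \sum_(t <- times 0 s) \sum_(x <- zs n) \sum_(y <- win x) G t y =
    ulim (fun k => \sum_(t <- times 0 s) \sum_(x <- zs n) \sum_(y <- win x) H k t y).
  rewrite S3; apply: eq_bigr => t _; rewrite (S2 t).2; apply: eq_bigr => x _.
  by rewrite (S1 t x).2; apply: eq_bigr => y _; rewrite HQ.
apply: ulim_dist => //.
- by apply: mean2_bounded => k s0 om.
- by apply: mean_bounded => //; exact: (bnd_nat R (fun y => `[< visits (fun t x => decode (y (ic M (above D t) x))) 0 s >])).
have near_be : \forall k \near \oo, forall t, t \in times 0 s -> big_enough q L (ratr (above D t) : R) k.
  by apply: near_all_seq => t _; exact: near_big_enough.
near=> k.
have be : forall t, t \in times 0 s -> big_enough q L (ratr (above D t) : R) k by near: k.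
apply: le_trans (@mean2_norm R lam lam_gt0 p k
  (fun s0 om => `[< visits (Xsys om k M L s0) 0 s >]%:R)
  (fun s0 om => `[< visits (fun t x => decode (fields lam p q k s0 om (ic M (above D t) x))) 0 s >]%:R)
  (fun s0 om => \sum_(t <- times 0 s) \sum_(x <- zs n) \sum_(y <- win x)
    (((sys p q om M L s0 (steps lam (ratr (above D t)) k)).1 y)%:R
      - ((sys p q om M L s0 (steps lam t k)).1 y)%:R
     + (fields lam p q k s0 om (iu M (above D t) y) != fields lam p q k s0 om (iu L (above D t) y))%:R))
  (fun s0 om => visits_diff lam_gt0 q p_gt0 D k s0 om ML h loc)) _.
rewrite mean2_sum// big_seq [leRHS]big_seq; apply: ler_sum => t ts.
rewrite mean2_sum//; apply: ler_sum => x _; rewrite mean2_sum//; apply: ler_sum => y _.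
rewrite mean2_D// lerD2r.
rewrite (_ : _ * Kz _ _ _ _ = mean2 k (fun _ _ => ((ratr (above D t) - t) * (1 + lam) + mesh R k) * Kz lam q y (ratr (above D t)))); last first.
  rewrite /shift_mean; under eq_bigr do rewrite Ek_cst//.
  set v := (X in \sum_i X); rewrite sumr_const card_ord -[v *+ p]mulr_natl mulrA mulVf ?mul1r//.
  by rewrite pnatr_eq0 -lt0n.
rewrite /shift_mean ler_wpM2l ?invr_ge0//; apply: ler_sum => s0 _; rewrite Ek_cst//.
apply: (Ek_incr lam_gt0 p M s0 y _ _ (be t ts)); first exact: times_ge0 h (lexx 0) ts.
exact/ltW/above_gt.
Unshelve. all: by end_near. Qed.

Lemma fdd_setT_ge0 M s0 s : (forall a, a \in s -> 0 <= a.1) -> 0 <= fdd setT lam s (conf (patM p q M s0)).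
Proof.
move=> h; have c1 := fdd_cvg_setT lam_gt0 h (@supported_pat M s0).
rewrite -(cvg_lim _ c1)//; apply: limr_ge; first exact: cvgP c1.
near=> L; have /andP[//] := fdd_bounds lam_gt0 (conf (patM p q M s0)) (zs_uniq L) h.
Unshelve. all: by end_near. Qed.

Lemma integral_trunc M s : (forall a, a \in s -> 0 <= a.1) ->
  (\int[P]_w (fdd setT lam s (truncate_config M (traj 0 w)))%:E)%E = (trunc_law M s)%:E.
Proof.
move=> h; rewrite /trunc_law.
rewrite -(integral_sh lam_gt0 p_gt0 law mN N0 Ngood (g := fun s0 => fdd setT lam s (conf (patM p q M s0)))).
  by apply: eq_integral => w _; rewrite (traj0 R Ngood) truncate_pat.
by move=> s0; exact: fdd_setT_ge0.
Qed.

(** The trajectory is compared with the box [M] by [prob_visits], the box [M] with the pattern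
    truncated at [M] and run on [[- L, L]] by [fdd_approx], and [L] tends to infinity last, by
    [fdd_cvg_setT]. *)
Lemma trunc_cvg s : (forall a, a \in s -> 0 <= a.1 /\ local_event a.2) ->
  (fun M => trunc_law M s) @ \oo --> fine (P [set w | visits (fun t => traj t w) 0 s]).
Proof.
move=> hs; have h a : a \in s -> 0 <= a.1 by move=> /hs[].
have [n loc] := local_common (fun a ha => (hs a ha).2).
have mV := measurable_visits 0 loc.
have fV := fin_num_measure P _ mV.
set ps := [seq (t, x) | t <- times 0 s, x <- zs n].
apply/cvgrPdist_le => e e0.
(* Each pair of a time and a site costs one error in the first comparison and six in the second,
   namely two at each of the three sites of the window; hence 7. *)
set e' := e / (7 * (size ps)%:R + 1).
have e'0 : 0 < e' by rewrite divr_gt0// ltr_wpDl.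
have t0 t : t \in times 0 s -> 0 <= t by exact: times_ge0.
have n1 : \forall D \near \oo, forall i, i \in ps -> \forall M \near \oo,
    (P [set w | traj i.1 w i.2 <> decode (c w M (above D i.1) i.2)] <= e'%:E)%E.
  apply: near_all_seq => i /allpairsP[[t x] [ts xn ->]] /=.
  exact: (traj_approx lam_gt0 p_gt0 law mN N0 Ngood x (t0 t ts) e'0).
have n2 : \forall D \near \oo, forall t, t \in times 0 s -> forall x, x \in zs n -> forall y, y \in win x ->
    (ratr (above D t) - t) * (1 + lam) * Kz lam q y (ratr (above D t)) <= e'.
  apply: near_all_seq => t ts; apply: near_all_seq => x xn; apply: near_all_seq => y yx.
  set K := (1 + lam) * Kz lam q y (t + 1).
  have K0 : 0 <= K by rewrite mulr_ge0 ?Kz_ge0// addr_ge0// ltW.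
  have e1 : 0 < e' / (K + 1) by rewrite divr_gt0// ltr_wpDl.
  have := above_near (t0 t ts) e1; apply: filterS => D hD.
  apply: (@le_trans _ _ (e' / (K + 1) * K)); last first.
    by rewrite mulrAC ler_pdivrMr ?ltr_wpDl// ler_pM2l// lerDl.
  rewrite -mulrA; apply: ler_pM.
  - by rewrite subr_ge0 ltW// above_gt.
  - by rewrite mulr_ge0 ?Kz_ge0// addr_ge0// ltW.
  - by rewrite lerBlDl ltW.
  - rewrite /K ler_wpM2l ?addr_ge0 ?(ltW lam_gt0)// (Kz_mono lam_gt0)// above_le1// t0//.
have [D [hD1 hD2]] : exists D, (forall i, i \in ps -> \forall M \near \oo,
    (P [set w | traj i.1 w i.2 <> decode (c w M (above D i.1) i.2)] <= e'%:E)%E) /\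
   forall t, t \in times 0 s -> forall x, x \in zs n -> forall y, y \in win x ->
    (ratr (above D t) - t) * (1 + lam) * Kz lam q y (ratr (above D t)) <= e'.
  have [D0 _ hD] := filterI n1 n2; have [a b] := hD D0 (leqnn _); by exists D0.
have n3 := near_all_seq hD1.
have n4 : \forall M \near \oo, forall t, t \in times 0 s -> forall x, x \in zs n -> forall y, y \in win x ->
    forall M', (M <= M')%N -> (P [set w | u w M (above D t) y != u w M' (above D t) y] <= e'%:E)%E.
  apply: near_all_seq => t ts; apply: near_all_seq => x xn; apply: near_all_seq => y yx.
  exact: (settled law mN N0 Ngood _ _ e'0).
near=> M.
have h3 : forall i, i \in ps -> (P [set w | traj i.1 w i.2 <> decode (c w M (above D i.1) i.2)] <= e'%:E)%E.
  by near: M.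
have h4 : forall t, t \in times 0 s -> forall x, x \in zs n -> forall y, y \in win x ->
    forall M', (M <= M')%N -> (P [set w | u w M (above D t) y != u w M' (above D t) y] <= e'%:E)%E.
  by near: M.
have [mVM _] := law_visits M D 0 loc; have fVM := fin_num_measure P _ mVM.
set pv := fine _; set pm := fine (P [set w | visits (zX w M D) 0 s]).
have sz : (\sum_(i <- ps) P [set w | traj i.1 w i.2 <> decode (c w M (above D i.1) i.2)] <=
   ((size ps)%:R * e')%:E)%E.
  apply: (@le_trans _ _ (\sum_(i <- ps) e'%:E)%E).
    by rewrite big_seq [leRHS]big_seq; apply: lee_sum => i; exact: h3.
  by rewrite sumEFin big_const_seq count_predT iter_addr_0 mulr_natl.
have [v1 v2] := prob_visits M D loc.
have d1 : `|pv - pm| <= (size ps)%:R * e'.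
  rewrite ler_norml; apply/andP; split.
    rewrite lerBrDr addrC lerBlDr -lee_fin EFinD !fineK//.
    by apply: le_trans v2 _; rewrite leeD2l.
  rewrite lerBlDr addrC -lee_fin EFinD !fineK//.
  by apply: le_trans v1 _; rewrite leeD2l.
have d2 L : (M <= L)%N ->
   `|p%:R^-1 * \sum_(s0 < p) fdd [set` zs L] lam s (conf (patM p q M s0)) - pm| <= 6 * (size ps)%:R * e'.
  move=> ML; have := fdd_approx D ML h loc; rewrite -(fineK fVM) -EFinB abse_EFin => fa.
  rewrite -lee_fin; apply: le_trans fa _.
  apply: (@le_trans _ _ (\sum_(t <- times 0 s) \sum_(x <- zs n) \sum_(y <- win x) (2 * e')%:E)%E).
    rewrite big_seq [leRHS]big_seq; apply: lee_sum => t ts.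
    rewrite big_seq [leRHS]big_seq; apply: lee_sum => x xn.
    rewrite big_seq [leRHS]big_seq; apply: lee_sum => y yx.
    rewrite mulr_natl mulr2n EFinD; apply: leeD; first by rewrite lee_fin; exact: hD2 xn _ yx.
    exact: h4 xn _ yx _ ML.
  have -> : (\sum_(t <- times 0 s) \sum_(x <- zs n) \sum_(y <- win x) (2 * e')%:E)%E =
      ((size (times 0 s))%:R * ((size (zs n))%:R * (3%:R * (2 * e'))))%:E.
    have sc (I : Type) (l : seq I) (a : R) : (\sum_(i <- l) a%:E)%E = ((size l)%:R * a)%:E.
      by rewrite sumEFin big_const_seq count_predT iter_addr_0 mulr_natl.
    rewrite -sc; apply: eq_bigr => t _; rewrite -sc; apply: eq_bigr => x _; exact: (sc _ (win x)).
  rewrite lee_fin /ps size_allpairs natrM le_eqVlt; apply/orP; left; apply/eqP; ring.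
have d3 L : (M <= L)%N ->
   `|p%:R^-1 * \sum_(s0 < p) fdd [set` zs L] lam s (conf (patM p q M s0)) - pv| <= e.
  move=> /d2 dd; apply: (@le_trans _ _ (7 * (size ps)%:R * e')).
    apply: le_trans (ler_distD pm _ _) _; rewrite distrC in d1.
    have := lerD dd d1; rewrite distrC; lra.
  by rewrite /e' mulrA ler_pdivrMr ?ltr_wpDl// mulrC ler_pM2l// lerDl.
have cL : (fun L => p%:R^-1 * \sum_(s0 < p) fdd [set` zs L] lam s (conf (patM p q M s0))) @ \oo -->
    trunc_law M s.
  apply: cvgMl_tmp; apply: cvg_sum_seq => s0.
  exact: (fdd_cvg_setT lam_gt0 h (@supported_pat M s0)).
rewrite distrC ler_norml; apply/andP; split.
  rewrite lerBrDr -(cvg_lim _ cL)//; apply: limr_ge; first exact: cvgP cL.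
  near=> L; have : (M <= L)%N by near: L; exact: nbhs_infty_ge.
  by move=> /d3; rewrite ler_norml => /andP[]; lra.
rewrite lerBlDr -(cvg_lim _ cL)//; apply: limr_le; first exact: cvgP cL.
near=> L; have : (M <= L)%N by near: L; exact: nbhs_infty_ge.
by move=> /d3; rewrite ler_norml => /andP[]; lra.
Unshelve. all: by end_near. Qed.

Lemma traj_fixed_energy : fixed_energy_arw lam (q%:R / p%:R) P (fun t w => traj t w).
Proof.
split.
- split.
  + by move=> t x a _; exact: (measurable_traj law).
  + by move=> w x t _; exact: traj_right.
  + by move=> w x t t0; exact: traj_left.
  + move=> s hs; have [n loc] := local_common (fun a ha => (hs a ha).2).
    have mV := measurable_visits 0 loc.
    rewrite -(fineK (fin_num_measure P _ mV)).
    have -> : (fun M => \int[P]_w (fdd setT lam s (truncate_config M (traj 0 w)))%:E)%E =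
      (fun M => (trunc_law M s)%:E).
      by apply/funext => M; apply: integral_trunc => a /hs[].
    apply: cvg_EFin; first by near=> M.
    exact: trunc_cvg.
- by move=> w x; exact: (traj_awake (R:=R) Ngood).
- exact: (traj_invariant lam_gt0 p_gt0 law mN N0 Ngood).
- exact: (traj_ergodic lam_gt0 p_gt0 law mN N0 Ngood).
- exact: (traj_density lam_gt0 p_gt0 law mN N0 Ngood).
Unshelve. all: by end_near. Qed.

End Law.

(** * Tightness of the odometer below criticality *)

Section Tightness.
Context (R : realType) (lam : R).
Hypothesis lam_gt0 : 0 < lam.
Context (p q : nat).
Hypothesis p_gt0 : (0 < p)%N.
Context (d : measure_display) (T : measurableType d) (P : probability T R) (Y : T -> idx -> nat).
Hypothesis law : forall (s : seq idx) (A : set (idx -> nat)),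
  (forall y y', (forall i, i \in s -> y i = y' i) -> A y -> A y') ->
  measurable [set t | A (Y t)] /\ P [set t | A (Y t)] = (Q lam p q (fun y => `[< A y >]%:R))%:E.
Context (N : set T).
Hypotheses (mN : measurable N) (N0 : P N = 0%E) (Ngood : forall w, ~ N w -> good p q Y w).

Notation u w M r x := (Y w (iu M r x)).
Notation c w M r x := (Y w (ic M r x)).
Notation traj := (@traj R p q d T Y N).
Notation asleep w M r z := (awake (decode (c w M r z)) == 0%N).

Definition quiet (t0 : rat) z : set T := [set w | forall r : rat, t0 <= r ->
  exists M0, forall M, (M0 <= M)%N -> asleep w M r z].
Definition moves (r0 r1 : rat) z : set T := [set w | exists M, forall M', (u w M' r0 z < u w M r1 z)%N].

Lemma measurable_asleep M r z : measurable [set w | asleep w M r z].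
Proof.
apply: (@meas_idx R lam p q d T P Y law [:: ic M r z] (fun y => awake (decode (y (ic M r z))) == 0%N)).
by move=> y y' yy; rewrite !yy// !inE eqxx ?orbT.
Qed.

Lemma measurable_quiet t0 z : measurable (quiet t0 z).
Proof.
apply: measurable_all => r; apply: measurable_imp => _; apply: measurable_ex => M0.
apply: measurable_all => M; apply: measurable_imp => _; exact: measurable_asleep.
Qed.

Lemma measurable_moves r0 r1 z : measurable (moves r0 r1 z).
Proof.
apply: measurable_ex => M; apply: measurable_all => M'.
apply: (@meas_idx R lam p q d T P Y law [:: iu M' r0 z; iu M r1 z] (fun y => (y (iu M' r0 z) < y (iu M r1 z))%N)).
by move=> y y' yy; rewrite !yy// !inE eqxx ?orbT.
Qed.

(* The probability that an inactive site topples during a time step of length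
   [h] is of order [h ^ 2], hence vanishes when summed over the time steps. *)
Lemma quiet_moves t0 r0 r1 z : 0 <= t0 -> t0 <= r0 -> r0 <= r1 ->
  P (quiet t0 z `&` moves r0 r1 z) = 0%E.
Proof.
move=> t00 tr rr; have mQ := measurable_quiet t0 z; have mM := measurable_moves r0 r1 z.
set C := 2 * ((ratr r1 - ratr r0) * (1 + lam)) ^+ 2 * (Kz lam q (z - 1) (ratr r1) + Kz lam q (z + 1) (ratr r1)) : R.
have bound n : (P (quiet t0 z `&` moves r0 r1 z) <= (C / n.+1%:R)%:E)%E.
  pose g j : rat := r0 + (r1 - r0) * (j%:R / n.+1%:R).
  have g0 : g 0%N = r0 by rewrite /g mul0r mulr0 addr0.
  have gn : g n.+1 = r1 by rewrite /g divff ?pnatr_eq0// mulr1 addrC subrK.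
  have gm j : g j <= g j.+1.
    by rewrite /g lerD2l ler_wpM2l ?subr_ge0// ler_wpM2r// ler_nat.
  have gr j : r0 <= g j by rewrite /g lerDl mulr_ge0 ?subr_ge0// divr_ge0.
  have g1 j : (j <= n.+1)%N -> g j <= r1.
    move=> jn; rewrite -[leRHS]gn /g lerD2l ler_wpM2l ?subr_ge0// ler_wpM2r// ler_nat//.
  pose B M (j : nat) := [set w | asleep w M (g j) z && (u w M (g j.+1) z != u w M (g j) z)].
  have mB M j : measurable (B M j) /\ ((j < n.+1)%N -> (P (B M j) <= (C / n.+1%:R ^+ 2)%:E)%E).
    have [|m1 P1] := @law_bool R lam p q d T P Y law [:: ic M (g j) z; iu M (g j.+1) z; iu M (g j) z]
      (fun y => (awake (decode (y (ic M (g j) z))) == 0%N) && (y (iu M (g j.+1) z) != y (iu M (g j) z))).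
      by move=> y y' yy; rewrite !yy// !inE eqxx ?orbT.
    split=> // jn; rewrite P1 lee_fin.
    have gj0 : 0 <= g j by rewrite (le_trans _ (gr j))// (le_trans t00).
    apply: le_trans (Q_inactive lam_gt0 q p_gt0 M z gj0 (gm j)) _.
    have -> : C / n.+1%:R ^+ 2 = 2 * ((ratr r1 - ratr r0) / n.+1%:R * (1 + lam)) ^+ 2 *
        (Kz lam q (z - 1) (ratr r1) + Kz lam q (z + 1) (ratr r1)).
      have m0 : (n.+1%:R : R) != 0 by rewrite pnatr_eq0.
      by rewrite /C !expr2; move: m0; move: (n.+1%:R : R) => m m0; field.
    have -> : ratr (g j.+1) - ratr (g j) = (ratr r1 - ratr r0) / n.+1%:R :> R.
      rewrite -!rmorphB /= (_ : g j.+1 - g j = (r1 - r0) / n.+1%:R).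
        by rewrite fmorph_div; congr (_ / _); exact: ratr_nat.
      have m0 : (n.+1%:R : rat) != 0 by rewrite pnatr_eq0.
      by rewrite /g -(natr1 j); move: m0; move: (n.+1%:R : rat) => m m0; field.
    apply: ler_wpM2l; first by rewrite mulr_ge0 ?sqr_ge0.
    by apply: lerD; apply: (Kz_mono lam_gt0); rewrite ler_rat g1.
  have mU M : measurable [set w | exists2 j, j \in iota 0 n.+1 & B M j w].
    rewrite (_ : [set w | _] = [set w | exists j, j \in iota 0 n.+1 /\ B M j w]).
      apply: measurable_ex => j; have [h|h] := boolP (j \in iota 0 n.+1); last first.
        by rewrite (_ : [set w | _] = set0) //; apply/seteqP; split=> // w /= [].
      apply: measurable_and; first by rewrite (_ : [set w | _] = setT) //; apply/seteqP; split.
      exact: (mB M j).1.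
    by apply/seteqP; split=> w /= [j]; [exists j|move=> [? ?]; exists j].
  apply: (@prob_liminf _ _ _ P (fun M => [set w | exists2 j, j \in iota 0 n.+1 & B M j w])) => //.
  - exact: measurableI.
  - near=> M.
    apply: (@le_trans _ _ (P set0 + \sum_(j <- iota 0 n.+1) P (B M j))%E).
      apply: prob_cover => //; first by move=> j; exact: (mB M j).1.
      by move=> w [j jn Bw]; right; exists j.
    rewrite measure0 add0e.
    apply: (@le_trans _ _ (\sum_(j <- iota 0 n.+1) (C / n.+1%:R ^+ 2)%:E)%E).
      rewrite big_seq [leRHS]big_seq; apply: lee_sum => j; rewrite mem_iota => /andP[_ jn].
      exact: (mB M j).2.
    rewrite sumEFin big_const_seq count_predT iter_addr_0 size_iota lee_fin le_eqVlt.
    apply/orP; left; apply/eqP; rewrite -[LHS]mulr_natl expr2.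
    have m0 : (n.+1%:R : R) != 0 by rewrite pnatr_eq0.
    by move: m0; move: (n.+1%:R : R) => m m0; field.
  - have := aeN mN N0; apply: filterS => w /Ngood gw [qw [M1 hM1]].
    have [_ mono _ _ _] := gw.
    have near_q : \forall M \near \oo, forall j, j \in iota 0 n.+1 -> asleep w M (g j) z.
      apply: near_all_seq => j _; have [M0 h] := qw (g j) (le_trans tr (gr j)).
      by exists M0.
    near=> M; have qj : forall j, j \in iota 0 n.+1 -> asleep w M (g j) z by near: M.
    have MM : (M1 <= M)%N by near: M; exact: nbhs_infty_ge.
    apply: contrapT => nB.
    have same j : (j <= n.+1)%N -> u w M (g j) z = u w M r0 z.
      elim: j => [|j IH] jn; first by rewrite g0.
      rewrite -IH ?(ltnW jn)//; apply/eqP; apply: contrapT => /negP h; apply: nB.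
      by exists j; rewrite ?mem_iota//= /B /= h andbT; apply: qj; rewrite mem_iota.
    have := hM1 M; rewrite -(same n.+1)// gn ltnNge => /negP; apply.
    exact: mono.
apply/eqP; rewrite eq_le measure_ge0 andbT; apply/lee_addgt0Pr => e e0; rewrite add0e.
apply: le_trans (bound (Num.truncn (`|C| / e))) _; rewrite lee_fin ler_pdivrMr ?ltr0n//.
apply: le_trans (ler_norm _) _; rewrite mulrC -ler_pdivrMr//; apply: ltW; exact: truncnS_gt.
Unshelve. all: by end_near. Qed.

(** Once [z] remains inactive its odometer no longer moves, by [quiet_moves], and at that time it is
    bounded uniformly in the box. The random time is replaced by an integer above it, so that
    countably many null events are discarded. *)
Lemma ceases_bounded z : {ae P, forall w, activity_ceases (fun t => traj t w)} ->
  {ae P, forall w, exists K, forall M r, (u w M r z <= K)%N}.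
Proof.
move=> ceases.
have qm : {ae P, forall w, forall (a : nat * rat), a.1%:R <= a.2 -> ~ (quiet a.1%:R z w /\ moves a.1%:R a.2 z w)}.
  apply: ae_all => -[t0 r] /=; have [tr|tr] := pselect ((t0%:R : rat) <= r); last by apply: aeW => w /tr.
  have := prob0_ae (measurableI _ _ (measurable_quiet t0%:R z) (measurable_moves t0%:R r z))
    (quiet_moves z (ler0n _ _) (lexx _) tr).
  by apply: filterS => w h _; exact: h.
apply: filterS3 ceases qm (aeN mN N0) => w cw qw Nw.
have gw := Ngood Nw; have [_ mono _ _ [bd _]] := gw.
have [t0 t00 ht0] := cw z.
pose n := (Num.truncn t0).+1.
have t0n : t0 <= n%:R by apply/ltW/truncnS_gt.
have Q : quiet n%:R z w.
  move=> r nr; have [a ha] := cfin_ex gw r z; have [M0 hM0] := ha; exists M0 => M MM.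
  rewrite (hM0 M MM); have nv := near_val_rat R gw ha.
  have := near_traj Ngood Nw nv => <-; apply/eqP/ht0; apply: le_trans t0n _.
  by rewrite -(ratr_nat R) ler_rat.
have [b hb] := bd n%:R z; exists b => M r.
have [rn|nr] := lerP r n%:R; first exact: leq_trans (mono M M r n%:R z (leqnn _) rn) (hb M).
apply: contrapT => h; apply: (qw (n, r) (ltW nr)); split=> //; exists M => M'.
by apply: leq_ltn_trans (hb M') _; rewrite ltnNge; apply/negP.
Qed.

Lemma tight_odometer z (e : R) : {ae P, forall w, activity_ceases (fun t => traj t w)} -> 0 < e ->
  exists K, forall M r, Q lam p q (fun y => (K < y (iu M r z))%N%:R) <= e.
Proof.
move=> ceases e0; have bz := ceases_bounded z ceases.
pose A K := [set w | exists (a : nat * rat), (K < u w a.1 a.2 z)%N].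
have mlt K M r : measurable [set w | (K < u w M r z)%N] /\
    P [set w | (K < u w M r z)%N] = (Q lam p q (fun y => (K < y (iu M r z))%N%:R))%:E.
  apply: (@law_bool R lam p q d T P Y law [:: iu M r z] (fun y => (K < y (iu M r z))%N)).
  by move=> y y' yy; rewrite !yy// !inE eqxx ?orbT.
have mA K : measurable (A K) by apply: measurable_ex => -[M r]; exact: (mlt K M r).1.
have := @prob_decreasing _ _ _ P A e mA.
case=> [K w [a h]|||K0 _ hK]; [by exists a; exact: ltnW| |exact: e0|].
  by apply: filterS bz => w [K h]; exists K => -[a]; rewrite ltnNge h.
exists K0 => M r; rewrite -lee_fin -(mlt K0 M r).2; apply: le_trans (hK K0 (leqnn _)).
by apply: le_measure; rewrite ?inE//; [exact: (mlt K0 M r).1|move=> w h; exists (M, r)].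
Qed.

End Tightness.

(** An ultralimit gives information on the chain for infinitely many [k] only. This is enough, as
    the law of the instructions is the same for all [k] and [block_side] calls for a single large
    one. *)
Lemma ulim_frequently (R : realType) (a : nat -> R) e e' : bounded_seq a -> ulim a <= e -> e < e' ->
  forall k0, exists2 k, (k0 <= k)%N & a k <= e'.
Proof.
move=> Ba ae ee k0; apply: contrapT => h.
suff : e' <= ulim a by move=> h'; have := le_lt_trans (le_trans h' ae) ee; rewrite ltxx.
rewrite -[e']ulim_cst; apply: ulim_le => //; first by exists `|e'| => k.
exists k0 => // k kk; rewrite leNgt; apply/negP => h'; apply: h; exists k => //; exact: ltW.
Qed.

Section Subcritical.
Context (R : realType) (lam rho_FE : R).
Hypothesis lam_gt0 : 0 < lam.
Hypothesis crit : is_critical_density lam rho_FE.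
Context (p q : nat).
Hypothesis p_gt0 : (0 < p)%N.
Hypothesis sub : q%:R / p%:R < rho_FE.

(** Here the hypothesis on [rho_FE] enters, through the walk constructed above. The mean over the
    phases is at least [1 / p] times that of phase 0, hence the division by [p]; the division by 2
    makes room for the strict inequality of [ulim_frequently]. *)
Lemma tight_chain z (e : R) : 0 < e -> exists K, forall M (r : rat) k0, exists2 k, (k0 <= k)%N &
  Ek lam k (fun om => (K < (sys p q om M M 0 (steps lam (ratr r) k)).1 z)%N%:R) <= e.
Proof.
move=> e0; have [d [T [P [Y law]]]] := fields_exist lam_gt0 q p_gt0.
have [N [mN N0 sN]] := ae_good lam_gt0 p_gt0 law.
have Ngood w : ~ N w -> good p q Y w by move=> Nw; apply: contrapT => h; apply: Nw; exact: sN.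
have fe := traj_fixed_energy lam_gt0 p_gt0 law mN N0 Ngood.
have ceases := (crit fe).1 sub.
have p0 : 0 < p%:R :> R by rewrite ltr0n.
have e1 : 0 < e / p%:R / 2 by rewrite !divr_gt0.
have [K hK] := tight_odometer lam_gt0 p_gt0 law mN N0 Ngood z ceases e1.
exists K => M r k0.
have lt : e / p%:R / 2 < e / p%:R by have : 0 < e / p%:R; [rewrite divr_gt0|lra].
have [k kk h] := ulim_frequently (mean_bounded lam_gt0 q p_gt0 (bnd_nat R (fun y => (K < y (iu M r z))%N))) (hK M r) lt k0.
exists k => //; move: h; rewrite /mean mulrC ler_pdivrMr// mulfVK ?gt_eqF//; apply: le_trans.
rewrite (bigD1 (Ordinal p_gt0))//= lerDl sumr_ge0// => s _.
by rewrite -[0](@Ek_cst R lam lam_gt0 k); apply: Ek_le => // om.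
Qed.

End Subcritical.

(** * Absorption in an interval *)

Definition interval (a : int) (n : nat) : seq int := [seq a + i.+1%:Z | i <- iota 0 n].

Lemma mem_interval a n x : (x \in interval a n) = (a < x <= a + n%:Z).
Proof.
apply/mapP/andP => [[i]|[h1 h2]]; first by rewrite mem_iota => /andP[_ h] ->; split; lia.
by exists (`|x - a|.-1)%N; rewrite ?mem_iota; lia.
Qed.

Lemma interval_uniq a n : uniq (interval a n).
Proof. by rewrite map_inj_uniq ?iota_uniq// => i j; lia. Qed.

Lemma size_interval a n : size (interval a n) = n.
Proof. by rewrite size_map size_iota. Qed.

Lemma intervalS a n : interval a n.+1 = a + 1 :: interval (a + 1) n.
Proof.
rewrite /interval /=; congr (_ :: _).
by rewrite (iotaDl 1 0) -map_comp; apply: eq_map => i /=; lia.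
Qed.

Lemma interval_sorted a n : sorted <%R (interval a n).
Proof.
elim: n a => // n IH a; rewrite intervalS /=; case: n IH => // n IH; rewrite intervalS /=.
by have := IH (a + 1); rewrite intervalS /= => ->; rewrite andbT; lia.
Qed.

Lemma zs_interval a n M : (forall x, x \in interval a n -> (`|x| <= M)%N) ->
  [seq x <- zs M | x \in interval a n] = interval a n.
Proof.
move=> h; apply: (@irr_sorted_eq _ <%R).
- exact: lt_trans.
- exact: ltxx.
- by apply: sorted_filter; [exact: lt_trans|exact: zs_sorted].
- exact: interval_sorted.
- move=> x; rewrite mem_filter mem_zs; case E: (x \in interval a n) => //=.
  exact: h.
Qed.

Section Absorption.
Context (R : realType) (lam : R).
Hypothesis lam_gt0 : 0 < lam.
Context (k : nat) (a : int) (n : nat).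

Notation vs := (interval a n).
Notation m := (mesh R k).
Notation few eta := (num_on vs eta <= k.+1)%N.
Notation qs := (qstep lam m vs).

Let vu : uniq vs. Proof. exact: interval_uniq. Qed.

Lemma iter_mono J (f g : config -> R) eta : few eta -> (forall eta, few eta -> f eta <= g eta) ->
  iter J qs f eta <= iter J qs g eta.
Proof.
move=> fe fg; have := @tree_le R lam lam_gt0 k vs vu (att vs 0 J) (fun s => f s.2) (fun s => g s.2) (fun=> 0%N, eta) fe.
rewrite !(tree_att lam k vs 0 J); apply=> [b|s fs]; last exact: fg.
by rewrite mem_att => /andP[].
Qed.

Lemma qstep1_mono x (f g : config -> R) eta : x \in vs -> few eta -> (forall eta, few eta -> f eta <= g eta) ->
  qstep1 lam m x f eta <= qstep1 lam m x g eta.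
Proof.
move=> xv fe fg; have := @attempt_le R lam lam_gt0 k vs vu x (fun s => f s.2) (fun s => g s.2) (fun=> 0%N, eta) fe xv.
by rewrite !attempt_snd//; apply=> s fs; exact: fg.
Qed.

Definition awk (r : seq int) (eta : config) : bool := has (fun x => 0 < awake (eta x))%N r.

(* Discrete Laplacian [-2]: [pot quad] decreases by [1] on average at each jump. *)
Definition quad (x : int) : R := ((x - a) * (a + n%:Z + 1 - x))%:~R.

Lemma quad_ge0 x : x \in vs -> 0 <= quad x.
Proof. by rewrite mem_interval => /andP[h1 h2]; rewrite /quad ler0z mulr_ge0//; clear -h1 h2; lia. Qed.

Lemma quad_out x : a <= x <= a + n%:Z + 1 -> (if x \in vs then quad x else 0) = quad x.
Proof.
rewrite mem_interval => h; case: ifP => // h'; rewrite /quad.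
have [->|->] : x = a \/ x = a + n%:Z + 1 by clear -h h'; lia.
  by rewrite subrr mul0r.
by rewrite subrr mulr0.
Qed.

Lemma rate_quad x eta : x \in vs -> (0 < awake (eta x))%N ->
  rate lam x (pot quad vs) eta = - ((awake (eta x))%:R / (1 + lam)).
Proof.
move=> xv aw; rewrite /rate !big_ord_recl big_ord0 !pot_app// xv /=.
have l0 : 1 + lam != 0 by rewrite gt_eqF// addr_gt0.
have hx := xv; rewrite mem_interval in hx.
rewrite !quad_out; try (clear -hx; lia).
have h : quad (x - 1) + quad (x + 1) = 2 * quad x - 2.
  rewrite /quad -!rmorphD /= -[2]/(2%:~R) -!rmorphM -rmorphB /=; congr (_ %:~R); ring.
have -> : quad (x + 1) = 2 * quad x - 2 - quad (x - 1) by rewrite -h; ring.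
by rewrite /iw /=; field.
Qed.

Definition drop_rate : R := m / (1 + lam).

Lemma drop_ge0 : 0 <= drop_rate.
Proof. by rewrite divr_ge0 ?mesh_ge0// addr_ge0// ltW. Qed.

(** The gain comes from the first active site of the sweep; nothing happens at the sites before it,
    and those after it do not increase the potential on average. *)
Lemma qstep_quad r eta : {subset r <= vs} -> few eta ->
  qstep lam m r (pot quad vs) eta <= pot quad vs eta - drop_rate * (awk r eta)%:R.
Proof.
elim: r eta => [|x r IH] eta sub fe /=; first by rewrite mulr0 subr0.
have xv : x \in vs by apply: sub; rewrite mem_head.
have subr' : {subset r <= vs} by move=> y yr; apply: sub; rewrite inE yr orbT.
have le1 e : few e -> qstep lam m r (pot quad vs) e <= pot quad vs e.
  move=> fe'; by apply: le_trans (IH e subr' fe') _; rewrite gerBl mulr_ge0// drop_ge0.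
case: (posnP (awake (eta x))) => [a0|aw] /=.
  rewrite /qstep1 /rate a0 mul0r mulr0 addr0; exact: IH.
apply: le_trans (qstep1_mono xv fe le1) _; rewrite /qstep1 rate_quad// mulr1 mulrN lerD2l lerN2.
rewrite /drop_rate mulrA ler_wpM2r ?invr_ge0 ?addr_ge0 ?(ltW lam_gt0)//.
by rewrite ler_peMr ?mesh_ge0// ler1n.
Qed.

Lemma qstep_asleep r f eta : ~~ awk r eta -> qstep lam m r f eta = f eta.
Proof.
elim: r => //= x r IH; rewrite negb_or -leqNgt leqn0 => /andP[/eqP a0 ar].
by rewrite /qstep1 /rate a0 mul0r mulr0 addr0 IH.
Qed.

Lemma qstep_le1 r f eta : {subset r <= vs} -> few eta -> (forall eta, few eta -> f eta <= 1) -> qstep lam m r f eta <= 1.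
Proof.
elim: r eta => [|x r IH] eta sub fe f1 /=; first exact: f1.
have xv : x \in vs by apply: sub; rewrite mem_head.
have subr' : {subset r <= vs} by move=> y yr; apply: sub; rewrite inE yr orbT.
apply: le_trans (@qstep1_mono x _ (fun=> 1) eta xv fe (fun e fe' => IH e subr' fe' f1)) _.
by rewrite /qstep1 /rate -mulr_suml iw_sum// mul1r subrr !mulr0 addr0.
Qed.

Lemma qstep_awk eta : few eta -> qs (fun e => (awk vs e)%:R) eta <= (awk vs eta)%:R.
Proof.
move=> fe; have [aw|aw] := boolP (awk vs eta); last by rewrite qstep_asleep// (negbTE aw).
by apply: qstep_le1 => // e _; rewrite lern1 leq_b1.
Qed.

Lemma pot_quad_ge0 eta : 0 <= pot quad vs eta.
Proof. by rewrite /pot big_seq sumr_ge0// => y yv; rewrite mulr_ge0// quad_ge0. Qed.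

(** The nonnegative potential cannot drop by more than its initial value. Activity never resumes
    after stabilization, so each of the [J] sweeps has an expected drop of at least [drop_rate]
    times the final probability of being active. *)
Lemma absorption J eta : few eta ->
  J%:R * drop_rate * iter J qs (fun e => (awk vs e)%:R) eta <= pot quad vs eta.
Proof.
move=> fe.
suff : J%:R * drop_rate * iter J qs (fun e => (awk vs e)%:R) eta <= pot quad vs eta - iter J qs (pot quad vs) eta.
  move=> h; apply: le_trans h _; rewrite gerBl.
  have := @iter_mono J (fun=> 0) (pot quad vs) eta fe (fun e _ => pot_quad_ge0 e).
  apply: le_trans; have := @iter_qstep_sub R lam vs m J (fun=> 0) (fun=> 0) eta.
  by under eq_fun do rewrite subrr; move=> ->; rewrite subrr.
elim: J => [|J IH]; first by rewrite /= !mul0r subrr.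
rewrite !iterSr.
set g := fun e => (awk vs e)%:R in IH *; set W := pot quad vs in IH *.
have h1 : iter J qs (qs g) eta <= iter J qs g eta by apply: iter_mono => // e; exact: qstep_awk.
have h2 : iter J qs (qs W) eta <= iter J qs W eta - drop_rate * iter J qs g eta.
  rewrite -(iter_qstepZ lam k) -iter_qstep_sub; apply: iter_mono => // e fe'; exact: qstep_quad.
have h3 : J.+1%:R * drop_rate * iter J qs (qs g) eta <= J.+1%:R * drop_rate * iter J qs g eta.
  by rewrite ler_wpM2l// mulr_ge0// drop_ge0.
apply: le_trans h3 _; rewrite -natr1 !mulrDl mul1r.
by move: h2 IH; set x := _ * iter _ _ _ _; lra.
Qed.

End Absorption.

(** * Exploration of the instructions from left to right *)

Section Lists.
Context (R : realType) (lam : R).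
Hypothesis lam_gt0 : 0 < lam.

Let iw0 i : 0 <= iw lam i. Proof. exact: iw_ge0. Qed.
Let iw1 : \sum_(i < 3) iw lam i = 1. Proof. exact: iw_sum. Qed.

Fixpoint EL (D : nat) (f : seq nat -> R) : R :=
  if D is D'.+1 then \sum_(i < 3) iw lam i * EL D' (fun w => f (nat_of_ord i :: w)) else f [::].

Fixpoint ES (Ds : seq nat) (f : seq (seq nat) -> R) : R :=
  if Ds is D :: r then EL D (fun w => ES r (fun W => f (w :: W))) else f [::].

Lemma ELS D f : EL D.+1 f = \sum_(i < 3) iw lam i * EL D (fun w => f (nat_of_ord i :: w)).
Proof. by []. Qed.

Lemma EL_le D f g : (forall w, size w = D -> f w <= g w) -> EL D f <= EL D g.
Proof.
elim: D f g => [|D IH] f g fg /=; first exact: fg.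
by apply: ler_sum => i _; rewrite ler_wpM2l//; apply: IH => w sw; apply: fg; rewrite /= sw.
Qed.

Lemma eq_EL D f g : (forall w, size w = D -> f w = g w) -> EL D f = EL D g.
Proof. by move=> fg; apply/le_anti/andP; split; apply: EL_le => w /fg ->. Qed.

Lemma EL_lin D f g c : EL D (fun w => f w + c * g w) = EL D f + c * EL D g.
Proof.
elim: D f g => [|D IH] f g //=; rewrite mulr_sumr -big_split /=; apply: eq_bigr => i _.
by rewrite (IH (fun w => f (nat_of_ord i :: w)) (fun w => g (nat_of_ord i :: w))); ring.
Qed.

Lemma EL_cst D c : EL D (fun=> c) = c.
Proof. by elim: D => //= D IH; under eq_bigr do rewrite IH; rewrite -mulr_suml iw1 mul1r. Qed.

Lemma ES_le Ds f g : (forall W, map size W = Ds -> f W <= g W) -> ES Ds f <= ES Ds g.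
Proof.
elim: Ds f g => [|D Ds IH] f g fg /=; first exact: fg.
by apply: EL_le => w sw; apply: IH => W sW; apply: fg; rewrite /= sw sW.
Qed.

Lemma eq_ES Ds f g : (forall W, map size W = Ds -> f W = g W) -> ES Ds f = ES Ds g.
Proof. by move=> fg; apply/le_anti/andP; split; apply: ES_le => W /fg ->. Qed.

Lemma ES_lin Ds f g c : ES Ds (fun W => f W + c * g W) = ES Ds f + c * ES Ds g.
Proof.
elim: Ds f g => [|D Ds IH] f g //=; rewrite -EL_lin; apply: eq_EL => w _.
exact: (IH (fun W => f (w :: W)) (fun W => g (w :: W))).
Qed.

Lemma ES_cst Ds c : ES Ds (fun=> c) = c.
Proof. by elim: Ds => //= D Ds IH; rewrite -[RHS](EL_cst D); apply: eq_EL. Qed.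

Lemma ES_D Ds f g : ES Ds (fun W => f W + g W) = ES Ds f + ES Ds g.
Proof.
have := ES_lin Ds f g 1; rewrite mul1r => <-; apply: eq_ES => W _; by rewrite mul1r.
Qed.

Lemma ES_cat Ds Ds' f : ES (Ds ++ Ds') f = ES Ds (fun W => ES Ds' (fun W' => f (W ++ W'))).
Proof. by elim: Ds f => //= D Ds IH f; apply: eq_EL => w _; rewrite IH. Qed.

Definition swap (i : nat) : nat := if i == 1%N then 2%N else if i == 2%N then 1%N else i.

Lemma EL_swap D f : EL D (fun w => f (map swap w)) = EL D f.
Proof.
elim: D f => //= D IH f; rewrite !big_ord_recl !big_ord0 /=.
rewrite (IH (fun w => f (0%N :: w))) (IH (fun w => f (2%N :: w))) (IH (fun w => f (1%N :: w))).
by rewrite /iw /=; ring.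
Qed.

Lemma ES_swap Ds f : ES Ds (fun W => f (map (map swap) W)) = ES Ds f.
Proof.
elim: Ds f => //= D Ds IH f.
under [LHS]eq_EL do rewrite (IH (fun W => f (map swap _ :: W))).
exact: (EL_swap D (fun w => ES Ds (fun W => f (w :: W)))).
Qed.

Definition lets (I : stacks) (xs : seq int) (Ds : seq nat) : seq (seq nat) :=
  [seq mkseq (I a.1) a.2 | a <- zip xs Ds].

Lemma lets_cons I x xs D Ds : lets I (x :: xs) (D :: Ds) = mkseq (I x) D :: lets I xs Ds.
Proof. by []. Qed.

Section Bridge.
Context (kap : nat) (kap_gt0 : (0 < kap)%N) (cs : seq coord).
Hypothesis cs_uniq : uniq cs.
Notation E := (E (letters kap) (cw lam kap)).

Let cw1 c : \sum_(i < letters kap c) cw lam kap c i = 1. Proof. exact: cw_sum. Qed.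

Lemma E_read x D l0 (F : (coord -> nat) -> seq nat -> R) om0 :
  (forall l, (l0 <= l < l0 + D)%N -> (false, x, l) \in cs) ->
  (forall om l i w, F (upd om (false, x, l) i) w = F om w) ->
  E cs (fun om => F om (mkseq (fun l => om (false, x, l0 + l)%N) D)) om0 =
  EL D (fun w => E cs (fun om => F om w) om0).
Proof.
elim: D l0 F => [|D IH] l0 F xin Fx //=.
rewrite (@E_cond _ _ _ _ cw1 cs _ om0 (false, x, l0)) //; last first.
  by apply: xin; rewrite leqnn addnS ltnS leq_addr.
rewrite /letters /cw /=; apply: eq_bigr => i _; congr (_ * _).
rewrite -(IH l0.+1 (fun om w => F om (nat_of_ord i :: w))) //; last first.
  by move=> l /andP[h1 h2]; apply: xin; rewrite (ltnW h1) addnS -addSn.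
apply: eq_E => om; rewrite Fx /mkseq /= addn0 /upd eqxx; congr (F om (_ :: _)).
rewrite (iotaDl 1 0) -map_comp; apply: eq_map => l /=.
by rewrite addnA addn1 xpair_eqE eqxx /= gtn_eqF// ltnS leq_addr.
Qed.

Lemma E_lets xs Ds f om0 : uniq xs -> size xs = size Ds ->
  (forall x D l, (x, D) \in zip xs Ds -> (l < D)%N -> (false, x, l) \in cs) ->
  E cs (fun om => f (lets (stack_of om) xs Ds)) om0 = ES Ds f.
Proof.
elim: xs Ds f => [|x xs IH] [|D Ds] f //=.
  by move=> _ _ _; exact: (@E_cst R _ (letters kap) (cw lam kap) cw1 cs (f [::]) om0).
move=> /andP[xn ux] [sz] inc.
rewrite -(eq_EL (f := fun w => E cs (fun om => f (w :: lets (stack_of om) xs Ds)) om0)).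
  rewrite -(E_read (x := x) (l0 := 0%N) (F := fun om w => f (w :: lets (stack_of om) xs Ds))) //.
  - by move=> l /andP[_ lD]; apply: (inc x D l) => //; rewrite inE eqxx.
  - move=> om l i w; congr (f (_ :: _)); apply/eq_in_map => -[y D'] yin /=.
    apply: eq_map => j; rewrite /stack_of /upd; case: eqP => // -[yx _].
    have : y \in unzip1 (zip xs Ds) by apply/mapP; exists (y, D').
    by rewrite unzip1_zip ?sz// yx (negbTE xn).
move=> w _; apply: (IH Ds (fun W => f (w :: W))) => //.
by move=> y D' l yin lD; apply: (inc y D' l) => //; rewrite inE yin orbT.
Qed.

End Bridge.

(* Reads a list up to the [l]-th left instruction: the number of right
   instructions read, and the rest of the list. *)
Fixpoint eat (l : nat) (w : seq nat) : nat * seq nat :=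
  if l is l'.+1 then
    (fix aux (w : seq nat) := if w is i :: r then
        if i == 1%N then eat l' r else let: (a, r') := aux r in ((a + (i == 2%N))%N, r')
      else (0%N, [::])) w
  else (0%N, w).

Lemma eat_cons l i w : eat l.+1 (i :: w) =
  if i == 1%N then eat l w else ((eat l.+1 w).1 + (i == 2%N), (eat l.+1 w).2)%N.
Proof. by rewrite /=; case: ifP => // _; case: (_ w). Qed.

Lemma eat_nil l : (eat l [::]).2 = [::].
Proof. by case: l. Qed.

Lemma eatP l w : exists2 r, w = r ++ (eat l w).2 &
  ((0 < size (eat l w).2)%N -> count_mem 1%N r = l) /\ count_mem 2%N r = (eat l w).1.
Proof.
elim: w l => [|i w IH] [|l]; try by exists [::].
rewrite eat_cons; case: eqP => [->|/eqP i1].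
  have [r e [h1 h2]] := IH l; exists (1%N :: r); first by rewrite /= -e.
  by split=> [s|]; rewrite /= ?h1 ?h2.
have [r e [h1 h2]] := IH l.+1; exists (i :: r); first by rewrite /= -e.
by split=> [s|]; rewrite /= ?h1// ?h2 ?(negbTE i1)// addnC.
Qed.

Lemma eat_le l w : ((eat l w).1 <= size w)%N.
Proof.
have [r -> [_ <-]] := eatP l w; rewrite size_cat; apply: leq_trans (leq_addr _ _).
exact: count_size.
Qed.

Lemma EL_take D Dg f : (Dg <= D)%N -> EL D (fun w => f (take Dg w)) = EL Dg f.
Proof.
elim: D Dg f => [|D IH] [|Dg] f //= DD; first by rewrite -[RHS](EL_cst D.+1).
by apply: eq_bigr => i _; congr (_ * _); exact: (IH Dg (fun w => f (nat_of_ord i :: w))).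
Qed.

(* The instructions following the [l]-th left one are independent of the past. *)
Lemma EL_eat D Dg l (f : nat -> seq nat -> R) : (forall a g, 0 <= f a g) ->
  EL D (fun w => (Dg < size (eat l w).2)%N%:R * f (eat l w).1 (take Dg (eat l w).2)) <=
  EL D (fun w => EL Dg (f (eat l w).1)).
Proof.
elim: D l f => [|D IH] l f f0.
  rewrite /= eat_nil mul0r -(EL_cst Dg 0); exact: EL_le.
case: l => [|l].
  have -> : EL D.+1 (fun w => EL Dg (f (eat 0 w).1)) = EL Dg (f 0%N).
    by rewrite -[RHS](EL_cst D.+1); apply: eq_EL.
  have [DD|DD] := leqP Dg D.+1.
    rewrite -(EL_take _ DD); apply: EL_le => w _; case: ltnP => _; rewrite ?mul1r// mul0r.
    exact: f0.
  rewrite -(EL_cst D.+1 (EL Dg (f 0%N))); apply: EL_le => w sw /=.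
  rewrite sw ltnNge (ltnW DD) /= mul0r -(EL_cst Dg 0); exact: EL_le.
rewrite !ELS; apply: ler_sum => i _; rewrite ler_wpM2l//.
case: (eqVneq (nat_of_ord i) 1%N) => [i1|i1].
  rewrite [leLHS](eq_EL (g := fun w => (Dg < size (eat l w).2)%N%:R * f (eat l w).1 (take Dg (eat l w).2))); last first.
    by move=> w _; rewrite eat_cons i1.
  rewrite [leRHS](eq_EL (g := fun w => EL Dg (f (eat l w).1))); last by move=> w _; rewrite eat_cons i1.
  exact: IH.
pose f' a := f (a + (nat_of_ord i == 2%N))%N.
rewrite [leLHS](eq_EL (g := fun w => (Dg < size (eat l.+1 w).2)%N%:R * f' (eat l.+1 w).1 (take Dg (eat l.+1 w).2))); last first.
  by move=> w _; rewrite eat_cons (negbTE i1).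
rewrite [leRHS](eq_EL (g := fun w => EL Dg (f' (eat l.+1 w).1))); last by move=> w _; rewrite eat_cons (negbTE i1).
by apply: IH => a g; exact: f0.
Qed.

(** A Chernoff bound with base 2 for the number of left instructions: each instruction contributes
    the mean [1 - iw lam 1 / 2] of a factor that is 1/2 for a left instruction and 1 otherwise. The
    factor [2 ^+ Dg] pays for the last [Dg] instructions, since [2 * (1 - iw lam 1 / 2) >= 1]. *)
Lemma EL_short D Dg l : EL D (fun w => (size (eat l w).2 <= Dg)%N%:R) <=
  2 ^+ l * 2 ^+ Dg * (1 - iw lam 1 / 2) ^+ D.
Proof.
have c1 : iw lam 1 <= 1.
  by rewrite -iw1 !big_ord_recl big_ord0 /= addr0 [leRHS]addrCA lerDl addr_ge0.
have rho0 : 2^-1 <= 1 - iw lam 1 / 2 by lra.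
have rho1 : 0 < 1 - iw lam 1 / 2 by lra.
elim: D l => [|D IH] l.
  rewrite /= eat_nil expr0 mulr1; have h : 1 <= 2 ^+ l * 2 ^+ Dg :> R by rewrite -exprD exprn_ege1// ler1n.
  by apply: le_trans h; rewrite lern1 leq_b1.
case: l => [|l].
  set B := (X in _ <= X); rewrite -[B](EL_cst D.+1); apply: EL_le => w sw; rewrite /B /= sw.
  case: (ltnP D Dg) => DD; last by rewrite !mulr_ge0// exprn_ge0// ltW.
  rewrite expr0 mul1r; apply: (@le_trans _ _ ((2 * (1 - iw lam 1 / 2)) ^+ D.+1)).
    by rewrite exprn_ege1//; lra.
  rewrite exprMn ler_wpM2r ?exprn_ge0 ?(ltW rho1)//; rewrite ler_eXn2l ?ltr1n//.
rewrite ELS.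
have bi (i : 'I_3) : EL D (fun w => (size (eat l.+1 (nat_of_ord i :: w)).2 <= Dg)%N%:R) <=
   (if nat_of_ord i == 1%N then 2^-1 else 1) * (2 ^+ l.+1 * 2 ^+ Dg * (1 - iw lam 1 / 2) ^+ D).
  case: eqP => [i1|/eqP i1].
    rewrite -(eq_EL (f := fun w => (size (eat l w).2 <= Dg)%N%:R)); last by move=> w _; rewrite eat_cons i1.
    by apply: le_trans (IH l) _; rewrite exprS !mulrA mulVf ?mul1r// pnatr_eq0.
  rewrite -(eq_EL (f := fun w => (size (eat l.+1 w).2 <= Dg)%N%:R)) ?mul1r//.
  by move=> w _; rewrite eat_cons (negbTE i1).
apply: (@le_trans _ _ (\sum_(i < 3) iw lam i * ((if nat_of_ord i == 1%N then 2^-1 else 1) *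
   (2 ^+ l.+1 * 2 ^+ Dg * (1 - iw lam 1 / 2) ^+ D)))).
  by apply: ler_sum => i _; rewrite ler_wpM2l.
have : iw lam 0 + iw lam 1 + iw lam 2 = 1 by rewrite -iw1 !big_ord_recl big_ord0 /=; ring.
rewrite !big_ord_recl big_ord0 /= exprS => e.
have -> : iw lam 2 = 1 - iw lam 0 - iw lam 1 by rewrite -e; ring.
rewrite [(1 - iw lam 1 / 2) ^+ D.+1]exprS le_eqVlt; apply/orP; left; apply/eqP.
by field.
Qed.

Lemma EL_short_small Dg lmax (e : R) : 0 < e -> exists D, forall l, (l <= lmax)%N ->
  EL D (fun w => (size (eat l w).2 <= Dg)%N%:R) <= e.
Proof.
move=> e0; set r := 1 - iw lam 1 / 2; set C := 2 ^+ lmax * 2 ^+ Dg : R.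
have c0 : 0 < iw lam 1 by rewrite /iw /= invr_gt0 mulr_gt0// addr_gt0.
have c1 : iw lam 1 <= 1.
  by rewrite -iw1 !big_ord_recl big_ord0 /= addr0 [leRHS]addrCA lerDl addr_ge0.
have C0 : 0 < C by rewrite mulr_gt0// exprn_gt0.
have : (fun D => r ^+ D) @ \oo --> (0 : R) by apply: cvg_expr; rewrite ger0_norm /r; lra.
move=> /cvgrPdist_le /(_ (e / C)) []; first by rewrite divr_gt0.
move=> D _ /(_ D (leqnn _)); rewrite sub0r normrN ger0_norm ?exprn_ge0 ?/r; try lra.
rewrite ler_pdivlMr// => h; exists D => l ll; apply: le_trans (EL_short _ _ _) _.
apply: le_trans h; rewrite mulrC ler_wpM2l ?exprn_ge0 ?/r; try lra.
by rewrite /C ler_wpM2r ?exprn_ge0// ler_eXn2l// ltr1n.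
Qed.

End Lists.

Definition nl (w : seq nat) (u : nat) : nat := count_mem 1%N (take u w).
Definition nr (w : seq nat) (u : nat) : nat := count_mem 2%N (take u w).

Definition settles (o : int) (w : seq nat) (u : nat) : Prop :=
  o <= 0 \/ [/\ o = 1, (0 < u)%N & is_sleep (nth 0%N w u.-1)].

Definition headL (W : seq (seq nat)) (U : seq nat) : nat :=
  if W is w :: _ then if U is u :: _ then nl w u else 0%N else 0%N.
Definition lastR (W : seq (seq nat)) (U : seq nat) : nat := nr (last [::] W) (last 0%N U).

(* [U] is a supersolution for the particles [sig] and the instructions [W] on
   consecutive sites, if [Rin] particles enter from the left. *)
Fixpoint super (Rin : int) (sig : seq nat) (W : seq (seq nat)) (U : seq nat) : Prop :=
  match sig, W, U with
  | [::], [::], [::] => True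
  | s :: sig', w :: W', u :: U' =>
    [/\ settles (s%:Z + Rin + (headL W' U')%:Z - (nl w u)%:Z - (nr w u)%:Z) w u,
        (u <= size w)%N & super (nr w u)%:Z sig' W' U']
  | _, _, _ => False
  end.

Lemma settles_le o o' w u : o' <= o -> settles o w u -> settles o' w u.
Proof.
move=> oo; case=> [h|[h1 h2 h3]]; first by left; exact: le_trans h.
by have [->|/eqP h] := eqVneq o' 1; [right|left; lia].
Qed.

Lemma super_le Rin Rin' sig W U : Rin' <= Rin -> super Rin sig W U -> super Rin' sig W U.
Proof.
case: sig W U => [|s sig] [|w W] [|u U] //= RR [h1 h2 h3]; split=> //.
apply: settles_le h1; lia.
Qed.

Lemma super_size Rin sig W U : super Rin sig W U -> size W = size sig /\ size U = size sig.
Proof.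
elim: sig Rin W U => [|s sig IH] Rin [|w W] [|u U] //= [_ _ /IH[-> ->]] //.
Qed.

Lemma super0 Rin m W : Rin <= 0 -> size W = m -> super Rin (nseq m 0%N) W (nseq m 0%N).
Proof.
move=> R0 <-; elim: W Rin R0 => //= w W IH Rin R0.
have hl : headL W (nseq (size W) 0%N) = 0%N by case: W {IH} => //= w' W'; rewrite /nl take0.
split=> //; last by apply: IH; rewrite /nr take0.
by left; rewrite hl /nl /nr take0 /=; lia.
Qed.

Lemma lastR0 m W : lastR W (nseq m 0%N) = 0%N.
Proof. by rewrite /lastR (_ : last 0%N (nseq m 0%N) = 0%N) ?/nr ?take0//; elim: m. Qed.

(** A supersolution never reads beyond the lists that it is given, so one found on lists cut at
    length [n] is valid on the full lists. *)
Lemma super_take n Rin sig W U : super Rin sig (map (take n) W) U ->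
  [/\ super Rin sig W U, headL (map (take n) W) U = headL W U & lastR (map (take n) W) U = lastR W U].
Proof.
have tk w u : (u <= size (take n w))%N -> take u (take n w) = take u w.
  by move=> h; rewrite take_takel//; apply: leq_trans h _; rewrite size_take_min geq_minl.
elim: sig Rin W U => [|s sig IH] Rin [|w W] [|u U] //= [h1 h2 h3].
have [g1 g2 g3] := IH _ _ _ h3.
have e1 : nl (take n w) u = nl w u by rewrite /nl tk.
have e2 : nr (take n w) u = nr w u by rewrite /nr tk.
have us : (u <= size w)%N by apply: leq_trans h2 _; rewrite size_take_min geq_minr.
split; [|by []|].
- split=> //; last by rewrite -e2.
  rewrite -e1 -e2 -g2; case: h1 => [h|[a b c]]; [by left|right; split=> //].
  move: c; rewrite nth_take//; apply: leq_trans (_ : u <= n)%N; first by rewrite prednK.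
  by apply: leq_trans h2 _; rewrite size_take_min geq_minl.
- move: g3; have [sW sU] := super_size g1; rewrite /lastR /=.
  case: W U sW sU {IH h1 h3 g1 g2} => [|w' W] [|u' U] /= sW sU h; [exact: e2| | |exact: h].
    by rewrite -sW in sU.
  by rewrite -sW in sU.
Qed.

Section Explore.
Variable K1 : nat.

(* If [l] left instructions are needed at a site, [(eat l w).1 + g] of them are
   needed at the next one, where [g] is minus the net flux to the right. *)
Fixpoint gseq (kin g0 : nat) (sigs pats : seq nat) : seq nat :=
  match sigs, pats with
  | s :: sigs', a :: pats' =>
    let g := (g0 + a - (s + kin + (if sigs' is [::] then K1 else 0)))%N in g :: gseq 0 g sigs' pats'
  | _, _ => [::]
  end.

Fixpoint rests (l : nat) (gs : seq nat) (W : seq (seq nat)) : seq (seq nat) :=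
  match gs, W with
  | g :: gs', w :: W' => (eat l w).2 :: rests ((eat l w).1 + g) gs' W'
  | _, _ => [::]
  end.

Fixpoint lout (l : nat) (gs : seq nat) (W : seq (seq nat)) : nat :=
  match gs, W with
  | g :: gs', w :: W' => lout ((eat l w).1 + g) gs' W'
  | _, _ => l
  end.

Fixpoint Us (l : nat) (gs : seq nat) (W : seq (seq nat)) (v : seq nat) : seq nat :=
  match gs, W, v with
  | g :: gs', w :: W', x :: v' => (size w - size (eat l w).2 + x)%N :: Us ((eat l w).1 + g) gs' W' v'
  | _, _, _ => [::]
  end.

Lemma size_gseq kin g0 sigs pats : size pats = size sigs -> size (gseq kin g0 sigs pats) = size sigs.
Proof. by elim: sigs kin g0 pats => [|s sigs IH] kin g0 [|a pats] //= [/IH ->]. Qed.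

Lemma size_rests l gs W : size W = size gs -> size (rests l gs W) = size gs.
Proof. by elim: gs l W => [|g gs IH] l [|w W] //= [/IH ->]. Qed.

Lemma gseq_le kin g0 sigs pats : all (fun g => (g <= g0 + sumn pats)%N) (gseq kin g0 sigs pats).
Proof.
elim: sigs kin g0 pats => [|s sigs IH] kin g0 [|a pats] //=.
set g := (g0 + a - _)%N; have gg : (g <= g0 + a)%N by exact: leq_subr.
rewrite addnA (leq_trans gg (leq_addr _ _)) /=.
apply: sub_all (IH 0%N g pats) => x /leq_trans; apply.
by rewrite leq_add2r.
Qed.

Lemma gseq_last kin g0 sigs pats : size pats = size sigs -> (0 < size sigs)%N ->
  (sumn sigs + kin + K1 <= g0)%N ->
  last g0 (gseq kin g0 sigs pats) = (g0 + sumn pats - sumn sigs - kin - K1)%N.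
Proof.
elim: sigs kin g0 pats => [|s sigs IH] kin g0 [|a pats] //= [sp] _ h.
case: sigs pats sp h IH => [|s' sigs] [|a' pats] // sp h IH; first by rewrite /= in h *; lia.
rewrite [last _ _]IH //; rewrite /= in h *; lia.
Qed.

Lemma eat_split l w x : (0 < size (eat l w).2)%N -> (x <= size (eat l w).2)%N ->
  let u := (size w - size (eat l w).2 + x)%N in
  [/\ nl w u = (l + nl (eat l w).2 x)%N, nr w u = ((eat l w).1 + nr (eat l w).2 x)%N, (u <= size w)%N &
     (0 < x)%N -> nth 0%N w u.-1 = nth 0%N (eat l w).2 x.-1].
Proof.
have [r] := eatP l w; set A := (eat l w).1; set t := (eat l w).2 => -> [h1 h2] t0 xt /=.
rewrite size_cat addnK /nl /nr !take_cat ltnNge leq_addr /= addKn !count_cat h1// h2.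
split=> //; first by rewrite leq_add2l.
by move=> x0; rewrite nth_cat ltnNge -ltnS prednK ?addn_gt0 ?x0 ?orbT// -addn1 leq_add2l x0 /= -subn1; congr nth; lia.
Qed.

(* Toppling [l] left instructions per site and then following the supersolution
   [v] for the pattern [pats] on the remaining instructions. *)
Lemma compose sigs pats W v l g0 kin (Rin Rv : int) sigs' W' U' :
  let gs := gseq kin g0 sigs pats in
  size W = size sigs -> size pats = size sigs -> (0 < size sigs)%N ->
  (sumn sigs + kin + K1 <= g0)%N ->
  all (fun r => 0 < size r)%N (rests l gs W) ->
  Rin <= l%:Z - g0%:Z + Rv + kin%:Z ->
  super Rv pats (rests l gs W) v -> (lastR (rests l gs W) v <= K1)%N ->
  (headL W' U' <= lout l gs W + K1)%N ->
  super ((lout l gs W)%:Z - (last g0 gs)%:Z + K1%:Z) sigs' W' U' ->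
  super Rin (sigs ++ sigs') (W ++ W') (Us l gs W v ++ U') /\
  headL (W ++ W') (Us l gs W v ++ U') = (l + headL (rests l gs W) v)%N.
Proof.
elim: sigs pats W v l g0 kin Rin Rv => [|s sigs IH] [|a pats] [|w W] [|x v] l g0 kin Rin Rv //=;
  try by case: (rests _ _ _).
move=> [sW] [sp] _ sg /andP[ok0 oks] HR [ho hx hv] hR hL hS.
set g := (g0 + a - _)%N in oks ho hv hR hL hS *.
have gE : g = (g0 + a - (s + kin + (if sigs is [::] then K1 else 0)))%N by [].
clearbody g.
have [e1 e2 e3 e4] := eat_split ok0 hx.
set u := (size w - _ + x)%N in e1 e2 e3 e4 *; set r := (eat l w).2 in e1 e2 e4 ok0 hx ho hR *.
set A := (eat l w).1 in e2 oks hv hR hL hS *.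
have lastletter : settles (a%:Z + Rv + (headL (rests (A + g) (gseq 0 g sigs pats) W) v)%:Z - (nl r x)%:Z - (nr r x)%:Z) w u.
  case: ho => [h|[h1 h2 h3]]; [by left|right; split=> //].
    by rewrite /u addn_gt0 h2 orbT.
  by rewrite e4.
case: sigs pats W v sW sp IH sg gE oks hv hR hL hS lastletter {ho} => [|s' sigs] [|a' pats] [|w' W] [|x' v] // sW sp IH sg gE oks hv hR hL hS ho.
  (* Last site of the block: the [K1] subtracted from its [g] pays for the left instructions that
     what follows may use beyond [lout l gs W]. *)
  split; last by rewrite e1.
  split=> //=.
    apply: settles_le ho; rewrite e1 e2 /=; rewrite /= in sg hL; move: hL HR sg gE; clear; lia.
  apply: super_le hS; rewrite e2 /=; move: hR; rewrite /lastR /=; clear; lia.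
have [||h1 h2] := IH (a' :: pats) (w' :: W) (x' :: v) (A + g)%N g 0%N (nr w u)%:Z (nr r x)%:Z sW sp isT _ oks _ hv hR hL hS.
- by move: sg gE; rewrite /=; clear; lia.
- by rewrite e2; clear; lia.
split; last by rewrite e1.
split=> //; apply: settles_le ho; rewrite h2 e1 e2; move: HR sg gE; rewrite /=; clear; lia.
Qed.

Definition tame (pats : seq nat) (W : seq (seq nat)) : Prop :=
  exists v, [/\ super 0 pats W v, (headL W v <= K1)%N & (lastR W v <= K1)%N].

(** When [l] left instructions are demanded at the first site, the site before it has spent [l - g0]
    right instructions while meeting its own demand, and at most [K1] more on its pattern; hence the
    inflow. *)
Definition solvable (l g0 : nat) (sig : seq nat) (W : seq (seq nat)) : Prop :=
  exists2 U, super (l%:Z - g0%:Z + K1%:Z) sig W U & (headL W U <= l + K1)%N.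

Lemma solvable_block sigs pats Dg W l g0 sigs' W' : let gs := gseq K1 g0 sigs pats in
  size W = size sigs -> size pats = size sigs -> (0 < size sigs)%N -> (sumn sigs + K1 + K1 <= g0)%N ->
  all (fun r => Dg < size r)%N (rests l gs W) -> tame pats (map (take Dg) (rests l gs W)) ->
  solvable (lout l gs W) (last g0 gs) sigs' W' -> solvable l g0 (sigs ++ sigs') (W ++ W').
Proof.
move=> gs sW sp s0 sg ok [v [hv hh hl]] [U' hS hL].
have [h1 h2 h3] := super_take hv.
have ok' : all (fun r => 0 < size r)%N (rests l gs W) by apply: sub_all ok => r; exact: leq_ltn_trans.
have HR : l%:Z - g0%:Z + K1%:Z <= l%:Z - g0%:Z + 0 + K1%:Z by lia.
rewrite h2 in hh; rewrite h3 in hl.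
have [c1 c2] := compose sW sp s0 sg ok' HR h1 hl hL hS.
by exists (Us l gs W v ++ U') => //; rewrite c2 leq_add2l.
Qed.

Context (R : realType) (lam : R).
Hypothesis lam_gt0 : 0 < lam.
Notation ES := (ES lam).
Notation EL := (EL lam).

(** The demand at a site depends on the sites to its left, but by [EL_eat] the instructions that
    remain there are independent of the past. Cut at [Dg], the remainders are thus dominated by
    fresh lists. *)
Lemma rests_prob Dg l gs Ds (Phi : seq (seq nat) -> R) : size Ds = size gs -> (forall W, 0 <= Phi W) ->
  ES Ds (fun W => (all (fun r => Dg < size r)%N (rests l gs W))%:R * Phi (map (take Dg) (rests l gs W))) <=
  ES (nseq (size gs) Dg) Phi.
Proof.
elim: gs l Ds Phi => [|g gs IH] l [|D Ds] Phi //= sD P0; first by rewrite mul1r.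
case: sD => sD.
pose f (A : nat) x := ES (nseq (size gs) Dg) (fun W => Phi (x :: W)).
have f0 A x : 0 <= f A x by rewrite -(ES_cst lam_gt0 (nseq (size gs) Dg) 0); apply: ES_le.
apply: (@le_trans _ _ (EL D (fun w => (Dg < size (eat l w).2)%N%:R * f (eat l w).1 (take Dg (eat l w).2)))).
  apply: EL_le => // w _; rewrite /f.
  have := IH ((eat l w).1 + g)%N Ds (fun W => Phi (take Dg (eat l w).2 :: W)) sD (fun W => P0 _).
  case: ltnP => _ /=; last first.
    move=> _; rewrite mul0r -(ES_cst lam_gt0 Ds 0); apply: ES_le => // W _.
    by rewrite mul0r.
  by rewrite mul1r.
apply: le_trans (EL_eat lam_gt0 _ _ _ f0) _.
rewrite -[leRHS](EL_cst lam_gt0 D); exact: EL_le.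
Qed.

Lemma block_depth Dg m lmax gmax (e : R) : 0 < e -> exists Ds lmax', size Ds = m /\
  forall l gs, (l <= lmax)%N -> size gs = m -> all (fun g => g <= gmax)%N gs ->
  ES Ds (fun W => (~~ all (fun r => Dg < size r)%N (rests l gs W))%:R) <= m%:R * e /\
  forall W, map size W = Ds -> (lout l gs W <= lmax')%N.
Proof.
move=> e0; elim: m lmax => [|m IH] lmax.
  exists [::], lmax; split=> // l [|//] ll _ _; split; first by rewrite /= mul0r.
  by case.
have [D hD] := EL_short_small lam_gt0 Dg lmax e0.
have [Ds [lmax' [sD hDs]]] := IH (D + gmax)%N.
exists (D :: Ds), lmax'; split; first by rewrite /= sD.
move=> l [|g gs] // ll [sg] /= /andP[gg ga].
have ll' w : size w = D -> ((eat l w).1 + g <= D + gmax)%N.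
  by move=> <-; apply: leq_add => //; exact: eat_le.
split; last first.
  by move=> [|w W] //= [sw sW]; apply: (hDs _ gs (ll' w sw) sg ga).2.
rewrite -natr1 mulrDl mul1r addrC.
apply: (@le_trans _ _ (EL D (fun w => (size (eat l w).2 <= Dg)%N%:R + m%:R * e * 1))); last first.
  by rewrite EL_lin EL_cst// mulr1 lerD2r; exact: hD.
apply: EL_le => // w sw; rewrite mulr1.
apply: (@le_trans _ _ (ES Ds (fun W => (size (eat l w).2 <= Dg)%N%:R
    + 1 * (~~ all (fun r => Dg < size r)%N (rests ((eat l w).1 + g) gs W))%:R))).
  apply: ES_le => // W _; rewrite mul1r negb_and -leqNgt.
  by case: leqP => _; rewrite /= ?add0r// lerDl.
have := ES_lin lam_gt0 Ds (fun=> (size (eat l w).2 <= Dg)%N%:R) (fun W => (~~ all (fun r => Dg < size r)%N (rests ((eat l w).1 + g) gs W))%:R) 1.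
move=> ->; by rewrite (ES_cst lam_gt0) mul1r lerD2l; exact: (hDs _ gs (ll' w sw) sg ga).1.
Qed.

Context (pats : seq nat) (Dg : nat) (delta z : R).
Notation m := (size pats).
Notation a := (sumn pats).
Hypothesis m_gt0 : (0 < m)%N.
Hypotheses (delta_ge0 : 0 <= delta) (delta_le1 : delta <= 1) (z_gt0 : 0 < z).
Hypothesis tame_prob : ES (nseq m Dg) (fun W => (~~ `[< tame pats W >])%:R) <= delta.

(* [c] is the number of bad blocks that can still be afforded: these are
   stabilized without the help of the pattern, at the cost of [a] each. *)
Definition budget (g0 : nat) (sigss : seq (seq nat)) (c : nat) : Prop :=
  forall i, (i < size sigss)%N ->
  (sumn (flatten (take i.+1 sigss)) + 2 * K1 * i.+1 + a * c <= g0 + a * i)%N.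

(** The first term is the exponential Markov bound for [c] or more bad blocks out of [B], the mean
    of [z] to the number of bad blocks divided by [z ^+ c]. It fits the recursion: a good block
    leaves [c] unchanged, a bad one has probability at most [delta] and lowers [c] by one. A block
    adds a depth error of at most [e] and at most doubles the accumulated one, whence [3 ^+ B]. *)
Lemma exploration B lmax gmax (e : R) : 0 < e -> exists2 Ds, size Ds = (B * m)%N &
  forall sigss, size sigss = B -> (forall s, s \in sigss -> size s = m) ->
  forall l g0 c, (l <= lmax)%N -> (g0 <= gmax)%N -> budget g0 sigss c ->
  ES Ds (fun W => (~~ `[< solvable l g0 (flatten sigss) W >])%:R) <= (1 + delta * z) ^+ B / z ^+ c + 3 ^+ B * e.
Proof.
move=> e0; have dz0 : 0 <= delta * z by rewrite mulr_ge0// ltW.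
have phi0 n c : 0 <= (1 + delta * z) ^+ n / z ^+ c.
  by rewrite mulr_ge0 ?exprn_ge0 ?invr_ge0 ?exprn_ge0 ?addr_ge0// ltW.
elim: B lmax gmax => [|B IH] lmax gmax.
  exists [::] => // -[|//] _ _ l g0 c ll gg _ /=.
  rewrite asboolT /=; last by exists [::].
  by rewrite addr_ge0// mulr_ge0 ?exprn_ge0// ltW.
have me0 : 0 < e / 2 / m%:R by rewrite !divr_gt0// ltr0n.
have [Ds1 [lmax' [sD1 hD1]]] := block_depth Dg m lmax (gmax + a) me0.
have [Ds2 sD2 hD2] := IH lmax' (gmax + a)%N.
exists (Ds1 ++ Ds2); first by rewrite size_cat sD1 sD2 mulSn.
move=> [|sig sigss] // [sB] sm l g0 [|c] ll gg bud.
  apply: (@le_trans _ _ 1); first by rewrite -[leRHS](ES_cst lam_gt0 (Ds1 ++ Ds2)); apply: ES_le => // W _; rewrite lern1 leq_b1.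
  rewrite expr0 divr1 -[leLHS]addr0; apply: lerD; last by rewrite mulr_ge0 ?exprn_ge0// ltW.
  by rewrite exprn_ege1// lerDl.
have ssig : size sig = m by apply: sm; rewrite mem_head.
have sm' s : s \in sigss -> size s = m by move=> h; apply: sm; rewrite inE h orbT.
have sig0 : (0 < size sig)%N by rewrite ssig.
have b0 := bud 0%N isT; rewrite /= take0 /= cats0 muln0 addn0 muln1 in b0.
have sg : (sumn sig + K1 + K1 <= g0)%N by move: b0; clear; lia.
(* Two readings of the same instructions: [gG] relies on the pattern, and [gB] is the fallback with
   the empty pattern, for which the zero odometer is a supersolution. In both cases the instructions
   of the later blocks are still unread. *)
set gG := gseq K1 g0 sig pats; set gB := gseq K1 g0 sig (nseq m 0%N).
have szG : size gG = m by rewrite size_gseq// ssig.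
have szB : size gB = m by rewrite size_gseq// ssig// size_nseq.
have sumB : sumn (nseq m 0%N) = 0%N by rewrite sumn_nseq mul0n.
have lG : last g0 gG = (g0 + a - sumn sig - K1 - K1)%N by apply: gseq_last.
have lB : last g0 gB = (g0 - sumn sig - K1 - K1)%N.
  by rewrite gseq_last ?sumB ?addn0// size_nseq.
have aG : all (fun g => g <= gmax + a)%N gG.
  by apply: sub_all (gseq_le _ _ _ _) => x /leq_trans; apply; rewrite leq_add2r.
have aB : all (fun g => g <= gmax + a)%N gB.
  by apply: sub_all (gseq_le _ _ _ _) => x /leq_trans; apply; rewrite sumB addn0 (leq_trans gg)// leq_addr.
have [oG LG] := hD1 l gG ll szG aG; have [oB LB] := hD1 l gB ll szB aB.
(* A good block adds [a] to [g0]; after a bad one, lowering [c] by one makes up for the missing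
   [a]. *)
have budG : budget (last g0 gG) sigss c.+1.
  move=> i iB; have := bud i.+1 iB; rewrite /= sumn_cat lG.
  move: (sumn (flatten _)) (sumn sig) sg => S s sg; rewrite !mulnS; clear -sg; lia.
have budB : budget (last g0 gB) sigss c.
  move=> i iB; have := bud i.+1 iB; rewrite /= sumn_cat lB.
  move: (sumn (flatten _)) (sumn sig) sg => S s sg; rewrite !mulnS; clear -sg; lia.
have gGm : (last g0 gG <= gmax + a)%N by rewrite lG; move: gg; clear; lia.
have gBm : (last g0 gB <= gmax + a)%N by rewrite lB; move: gg; clear; lia.
set x := (1 + delta * z) ^+ B / z ^+ c.+1 + 3 ^+ B * e.
set y := (1 + delta * z) ^+ B / z ^+ c + 3 ^+ B * e.
have x0 : 0 <= x by rewrite addr_ge0// mulr_ge0 ?exprn_ge0// ltW.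
have y0 : 0 <= y by rewrite addr_ge0// mulr_ge0 ?exprn_ge0// ltW.
pose okG W := all (fun r => Dg < size r)%N (rests l gG W).
pose okB W := all (fun r => Dg < size r)%N (rests l gB W).
pose bad W := ~~ `[< tame pats (map (take Dg) (rests l gG W)) >].
have step W1 : map size W1 = Ds1 ->
    ES Ds2 (fun W2 => (~~ `[< solvable l g0 (flatten (sig :: sigss)) (W1 ++ W2) >])%:R) <=
    (~~ okG W1)%:R + (~~ okB W1)%:R + x + y * ((okG W1)%:R * (bad W1)%:R).
  move=> sW1; have szW : size W1 = size sig by rewrite ssig -sD1 -sW1 size_map.
  have le1 : ES Ds2 (fun W2 => (~~ `[< solvable l g0 (flatten (sig :: sigss)) (W1 ++ W2) >])%:R) <= 1.
    by rewrite -[leRHS](ES_cst lam_gt0 Ds2); apply: ES_le => // W _; rewrite lern1 leq_b1.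
  case okg : (okG W1); last first.
    by apply: le_trans le1 _; rewrite mul0r mulr0 addr0 -addrA lerDl addr_ge0.
  case okb : (okB W1); last first.
    by apply: le_trans le1 _; rewrite add0r -addrA lerDl addr_ge0// mulr_ge0// mulr_ge0.
  rewrite /= !add0r mul1r; case bd : (bad W1) => /=.
    rewrite mulr1; apply: (@le_trans _ _ y); last by rewrite lerDr.
    apply: le_trans (hD2 sigss sB sm' (lout l gB W1) (last g0 gB) c (LB W1 sW1) gBm budB).
    apply: ES_le => // W2 _; rewrite ler_nat; case: asboolP => // nS; case: asboolP => // S.
    exfalso; apply: nS; apply: solvable_block S => //; rewrite ?size_nseq//; first exact: okb.
    exists (nseq m 0%N); split; last by rewrite lastR0.
      by apply: super0 => //; rewrite size_map size_rests// szW szB ssig.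
    by case: (map _ _) => // w W'; case: (nseq _ _) (mem_nseq m 0%N) => //= n s h; rewrite /nl (_ : n = 0%N) ?take0//; have := h n; rewrite mem_head => /esym/andP[_ /eqP].
  rewrite mulr0 addr0.
  apply: le_trans (hD2 sigss sB sm' (lout l gG W1) (last g0 gG) c.+1 (LG W1 sW1) gGm budG).
  apply: ES_le => // W2 _; rewrite ler_nat; case: asboolP => // nS; case: asboolP => // S.
  exfalso; apply: nS; apply: solvable_block S => //; [exact: okg|by move/negbFE: bd => /asboolP].
rewrite (ES_cat lam_gt0).
apply: (@le_trans _ _ (ES Ds1 (fun W1 => ((~~ okG W1)%:R + (~~ okB W1)%:R + x) + y * ((okG W1)%:R * (bad W1)%:R)))).
  by apply: ES_le => // W1; exact: step.
rewrite (ES_lin lam_gt0).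
have -> : ES Ds1 (fun W1 => (~~ okG W1)%:R + (~~ okB W1)%:R + x) =
    ES Ds1 (fun W1 => (~~ okG W1)%:R) + ES Ds1 (fun W1 => (~~ okB W1)%:R) + x.
  rewrite (ES_D lam_gt0 Ds1 (fun W1 => (~~ okG W1)%:R + (~~ okB W1)%:R) (fun=> x)).
  by rewrite (ES_D lam_gt0 Ds1 (fun W1 => (~~ okG W1)%:R)) (ES_cst lam_gt0).
have hb : ES Ds1 (fun W1 => (okG W1)%:R * (bad W1)%:R) <= delta.
  apply: le_trans tame_prob; rewrite -[in leRHS]szG.
  by apply: (@rests_prob Dg l gG Ds1 (fun W => (~~ `[< tame pats W >])%:R)); rewrite ?szG.
have m2 : m%:R * (e / 2 / m%:R) = e / 2 :> R by rewrite mulrC divfK// pnatr_eq0 -lt0n.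
rewrite m2 in oG oB.
have hy := ler_wpM2l y0 hb.
have e3 : 1 <= 3 ^+ B :> R by rewrite exprn_ege1// ler1n.
have key : x + y * delta <= (1 + delta * z) ^+ B.+1 / z ^+ c.+1 + 2 * (3 ^+ B * e).
  have -> : (1 + delta * z) ^+ B.+1 / z ^+ c.+1 = (1 + delta * z) ^+ B / z ^+ c.+1 + (1 + delta * z) ^+ B / z ^+ c * delta.
    rewrite !exprS; have zn : z != 0 by rewrite gt_eqF.
    have zcn : z ^+ c != 0 by rewrite expf_neq0.
    by field; rewrite zn zcn.
  have := ler_wpM2l (mulr_ge0 (exprn_ge0 B (ler0n R 3)) (ltW e0)) delta_le1.
  rewrite mulr1 /x /y mulrDl; lra.
have e4 : e <= 3 ^+ B * e by rewrite ler_peMl// ltW.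
have e5 : 3 ^+ B.+1 * e = 3 * (3 ^+ B * e) by rewrite exprS mulrA.
rewrite e5; move: oG oB hy key e4; rewrite -/(okG _) -/(okB _) -[2 * (3 ^+ B * e)]/(2 * (3 ^+ B * e)).
move: (ES Ds1 _) (ES Ds1 _) (y * _) (y * _) (3 ^+ B * e) (_ / z ^+ c.+1) => A1 A2 A3 A4 A5 A6.
clearbody x; lra.
Qed.

End Explore.

(** * Supersolutions and ejected particles *)

Lemma cnt_mkseq b s j D : (j <= D)%N -> cnt b s j = count_mem b (take j (mkseq s D)).
Proof.
move=> jD; rewrite /mkseq -map_take take_iota (minn_idPl jD).
elim: j {jD} => // j IH; rewrite -[in RHS](addn1 j) iotaD map_cat count_cat -IH /= add0n addn0.
by [].
Qed.

Lemma nl_mkseq s j D : (j <= D)%N -> nl (mkseq s D) j = cnt 1 s j.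
Proof. by move=> jD; rewrite (cnt_mkseq 1 s jD). Qed.

Lemma nr_mkseq s j D : (j <= D)%N -> nr (mkseq s D) j = cnt 2 s j.
Proof. by move=> jD; rewrite (cnt_mkseq 2 s jD). Qed.

Definition settled_at (sig : int -> nat) (I : stacks) (u : odometer) (x : int) : Prop :=
  occ sig I u x <= 0 \/ [/\ occ sig I u x = 1, (0 < u x)%N & is_sleep (I x (u x).-1)].

Lemma super_interval n a D sig I u : (forall x, x \in interval a n -> (u x <= D)%N) ->
  u (a + n%:Z + 1) = 0%N -> (forall x, x \in interval a n -> settled_at sig I u x) ->
  super (cnt 2 (I a) (u a))%:Z (map sig (interval a n)) (lets I (interval a n) (nseq n D)) (map u (interval a n)).
Proof.
elim: n a => // n IH a uD u0 su; rewrite intervalS.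
have a1 : a + 1 \in interval a n.+1 by rewrite mem_interval; lia.
have sub x : x \in interval (a + 1) n -> x \in interval a n.+1 by rewrite !mem_interval; lia.
have hl : headL (lets I (interval (a + 1) n) (nseq n D)) (map u (interval (a + 1) n)) = cnt 1 (I (a + 1 + 1)) (u (a + 1 + 1)).
  case: n u0 uD {IH su a1 sub} => [|n] u0 uD.
    by rewrite /= (_ : a + 1 + 1 = a + 1%N%:Z + 1)// u0.
  rewrite intervalS /= nl_mkseq//; apply: uD; rewrite mem_interval; lia.
rewrite /=; split.
- rewrite hl (nl_mkseq _ (uD _ a1)) (nr_mkseq _ (uD _ a1)).
  have := su _ a1; rewrite /settled_at /occ.
  rewrite (_ : a + 1 - 1 = a); last lia.
  move=> [h|[h1 h2 h3]]; [by left|right; split=> //].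
  by rewrite nth_mkseq// prednK// uD.
- by rewrite size_mkseq uD.
- rewrite (nr_mkseq _ (uD _ a1)); apply: IH => [x /sub/uD//||x /sub/su//].
  by rewrite -u0; congr u; lia.
Qed.

Lemma stabilizes_interval n a Ds sig I u Rin : size Ds = n ->
  super Rin (map sig (interval a n)) (lets I (interval a n) Ds) (map u (interval a n)) ->
  (cnt 2 (I a) (u a))%:Z <= Rin -> u (a + n%:Z + 1) = 0%N ->
  (forall x, x \in interval a n -> settled_at sig I u x) /\
  headL (lets I (interval a n) Ds) (map u (interval a n)) = cnt 1 (I (a + 1)) (u (a + 1)).
Proof.
elim: n a Ds Rin => [|n IH] a [|D Ds] Rin //.
  by move=> _ _ _ u0; split=> //=; rewrite (_ : a + 1 = a + 0%N%:Z + 1) ?u0//; lia.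
move=> [sD]; rewrite intervalS /= size_mkseq => -[h1 h2 h3] hR u0.
rewrite (nl_mkseq _ h2) (nr_mkseq _ h2) in h1 h3 *.
have [||g1 g2] := IH (a + 1) Ds _ sD h3; [exact: lexx|by rewrite -u0; congr u; lia|].
split=> // x; rewrite inE => /orP[/eqP ->|]; last exact: g1.
rewrite g2 in h1; rewrite /settled_at /occ (_ : a + 1 - 1 = a); last lia.
case: h1 => [h|[ho h0 hs]]; first by left; move: h hR; clear; lia.
have hs' : is_sleep (I (a + 1) (u (a + 1)).-1).
  by move: hs; rewrite nth_mkseq// prednK.
set o := (X in X <= 0); have [eo|no] := eqVneq o 1; [by right|left].
by move: no; rewrite /o; move: ho hR; clear; lia.
Qed.

Definition odometer_of (a : int) (n : nat) (U : seq nat) : odometer :=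
  fun x => if x \in interval a n then nth 0%N U (`|x - a|.-1)%N else 0%N.

Lemma map_odometer a n U : size U = n -> map (odometer_of a n U) (interval a n) = U.
Proof.
move=> sU; apply: (@eq_from_nth _ 0%N); first by rewrite size_map size_interval.
move=> i; rewrite size_map size_interval => ni; rewrite (nth_map 0) ?size_interval//.
rewrite (nth_map 0%N) ?size_iota// nth_iota// /odometer_of mem_interval (_ : a < _); last lia.
rewrite (_ : _ <= _)/=; last lia.
congr (nth _ _ _); lia.
Qed.

Lemma odometer_out a n U x : x \notin interval a n -> odometer_of a n U x = 0%N.
Proof. by rewrite /odometer_of => /negbTE ->. Qed.

Lemma stabilizes_odometer n a Ds sig I U Rin : size Ds = n -> 0 <= Rin ->
  super Rin (map sig (interval a n)) (lets I (interval a n) Ds) U ->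
  let u := odometer_of a n U in
  stabilizes [set` interval a n] sig I u /\
  headL (lets I (interval a n) Ds) U = cnt 1 (I (a + 1)) (u (a + 1)).
Proof.
move=> sD R0 hs u; have [_ sU] := super_size hs; rewrite size_map size_interval in sU.
have mU := map_odometer a sU; rewrite -mU in hs *.
have [||h1 h2] := stabilizes_interval sD hs; [|by rewrite odometer_out// mem_interval; lia|].
  by rewrite odometer_out ?mem_interval//; lia.
by split.
Qed.

(** * Reflection and minima of supersolutions *)

Section Reflection.
Context (c : int).
Definition mirror_stacks (I : stacks) : stacks := fun x l => swap (I (c - x) l).
Definition mirror (T : Type) (f : int -> T) : int -> T := fun x => f (c - x).

Lemma cnt_swap1 s j : cnt 1 (fun l => swap (s l)) j = cnt 2 s j.
Proof. by elim: j => //= j ->; congr (_ + _)%N; case: (s j) => [|[|[|]]]. Qed.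

Lemma cnt_swap2 s j : cnt 2 (fun l => swap (s l)) j = cnt 1 s j.
Proof. by elim: j => //= j ->; congr (_ + _)%N; case: (s j) => [|[|[|]]]. Qed.

Lemma occ_mirror sig I u x : occ (mirror sig) (mirror_stacks I) (mirror u) x = occ sig I u (c - x).
Proof.
rewrite /occ /mirror /mirror_stacks !cnt_swap1 !cnt_swap2.
rewrite (_ : c - (x - 1) = c - x + 1); last lia.
rewrite (_ : c - (x + 1) = c - x - 1); last lia.
lia.
Qed.

Lemma stabilizes_mirror V sig I u : stabilizes V (mirror sig) (mirror_stacks I) (mirror u) ->
  stabilizes (mirror V) sig I u.
Proof.
move=> h x Vx; have := h (c - x) Vx; rewrite occ_mirror (_ : c - (c - x) = x); last lia.
case=> [h1|[h1 h2 h3]]; [by left|right].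
rewrite /mirror /mirror_stacks (_ : c - (c - x) = x) in h2 h3; last lia.
split=> //; move: h3; rewrite /is_sleep /swap.
by case: (I x (u x).-1) => [|[|[|]]].
Qed.

End Reflection.

Definition minU (U V : seq nat) : seq nat := [seq minn a.1 a.2 | a <- zip U V].

Lemma nl_mono w u v : (u <= v)%N -> (nl w u <= nl w v)%N.
Proof. by move=> uv; rewrite /nl -(subnKC uv) takeD count_cat leq_addr. Qed.

Lemma nr_mono w u v : (u <= v)%N -> (nr w u <= nr w v)%N.
Proof. by move=> uv; rewrite /nr -(subnKC uv) takeD count_cat leq_addr. Qed.

Lemma headL_min W U V : size U = size V ->
  (headL W (minU U V) <= headL W U)%N /\ (headL W (minU U V) <= headL W V)%N.
Proof.
case: W U V => [|w W] [|u U] [|v V] //= _.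
by split; apply: nl_mono; [exact: geq_minl|exact: geq_minr].
Qed.

Lemma lastR_min W U V : size U = size V ->
  (lastR W (minU U V) <= lastR W U)%N /\ (lastR W (minU U V) <= lastR W V)%N.
Proof.
move=> sUV; suff e : last 0%N (minU U V) = minn (last 0%N U) (last 0%N V).
  by rewrite /lastR e; split; apply: nr_mono; [exact: geq_minl|exact: geq_minr].
case: U V sUV => [|u U] [|v V] //= [sUV].
elim: U V sUV u v => [|u' U IH] [|v' V] //= [sUV] u v; exact: IH.
Qed.

(** At each site the minimum agrees with one of the two odometers, while the neighbours use no more
    instructions than under that one. The inflow can only decrease, and [settles_le] applies. *)
Lemma super_min R1 R2 sig W U V : super R1 sig W U -> super R2 sig W V ->
  super (Num.min R1 R2) sig W (minU U V).
Proof.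
elim: sig R1 R2 W U V => [|s sig IH] R1 R2 [|w W] [|u U] [|v V] //= [h1 h2 h3] [k1 k2 k3].
have sUV : size U = size V by have [_ ->] := super_size h3; have [_ ->] := super_size k3.
have [m1 m2] := headL_min W sUV.
have r1 : Num.min R1 R2 <= R1 by rewrite ge_min lexx.
have r2 : Num.min R1 R2 <= R2 by rewrite ge_min lexx orbT.
split.
- rewrite -/(minU U V); case: (leqP u v) => uv; first by apply: settles_le h1; lia.
  by apply: settles_le k1; lia.
- by apply: leq_trans (geq_minl _ _) h2.
- apply: super_le (IH _ _ _ _ _ h3 k3).
  by rewrite le_min !lez_nat !nr_mono// ?geq_minl ?geq_minr.
Qed.

(** The two ends of a block are controlled by different supersolutions; their minimum controls
    both. *)
Lemma tame_min K1 pats W v v' : super 0 pats W v -> (headL W v <= K1)%N ->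
  super 0 pats W v' -> (lastR W v' <= K1)%N -> tame K1 pats W.
Proof.
move=> h1 h2 k1 k2; have := super_min h1 k1; rewrite minxx => hm.
have sv : size v = size v' by have [_ ->] := super_size h1; have [_ ->] := super_size k1.
exists (minU v v'); split=> //.
  by apply: leq_trans (headL_min W sv).1 h2.
by apply: leq_trans (lastR_min W sv).2 k2.
Qed.

Section Runs.
Context (R : realType) (lam : R).
Hypothesis lam_gt0 : 0 < lam.

Lemma depth_ge k : (k <= depth lam k)%N.
Proof.
rewrite /depth /ticks /steps size_map size_iota.
case: k => // k; have t1 : (1 <= Num.truncn (k.+1%:R * (1 + lam) * k.+2%:R))%N.
  rewrite -(@Num.Theory.truncn1 R); apply: le_truncn.
  have a1 : 1 <= 1 + lam by rewrite lerDl ltW.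
  have a2 : 1 <= k.+1%:R :> R by rewrite ler1n.
  have a3 : 1 <= k.+2%:R :> R by rewrite ler1n.
  by rewrite mulr_ege1// mulr_ege1.
move: t1; set t := Num.truncn _ => t1; apply: leq_trans (leq_pmull _ t1); lia.
Qed.

Lemma Ek_run k a n t sig (f : state -> R) : t <= k%:R -> (forall x, x \in interval a n -> (`|x| <= k)%N) ->
  (n <= k)%N -> (num_on (interval a n) (conf sig) <= k.+1)%N ->
  let J := steps lam t k in
  Ek lam k (fun om => f (run om (mem (interval a n)) (att (interval a n) 0 J) (start sig))) =
  tree lam k.+1 (interval a n) (att (interval a n) 0 J) f (start sig).
Proof.
move=> tk sub nk few J.
have jt : (J <= ticks lam k)%N by exact: steps_mono.
rewrite /Ek (@E_run R lam lam_gt0 k (interval a n) (interval_uniq a n) (box lam k) (ticks lam k) (depth lam k)) //.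
- exact: box_uniq.
- by move=> x i /sub xk; apply: box_tick; rewrite mem_zs.
- by move=> x i /sub xk; apply: box_stack; rewrite mem_zs.
- move=> x _; rewrite add0n /depth; apply: leq_mul => //.
  by rewrite size_interval size_map size_iota; lia.
Qed.

(** This is [absorption] for the steps up to time [t]; the loss of 1 in [t - 1] covers the
    rounding. *)
Lemma Ek_unstable k a n t sig : 1 < t -> t <= k%:R -> (forall x, x \in interval a n -> (`|x| <= k)%N) ->
  (n <= k)%N -> (num_on (interval a n) (conf sig) <= k.+1)%N ->
  Ek lam k (fun om => (awk (interval a n)
     (run om (mem (interval a n)) (att (interval a n) 0 (steps lam t k)) (start sig)).2)%:R) <=
  pot (quad R a n) (interval a n) (conf sig) / (t - 1).
Proof.
move=> t1 tk sub nk few; set J := steps lam t k.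
have t0 : 0 <= t.
  exact: ltW (lt_trans ltr01 t1).
rewrite (Ek_run (fun s => (awk (interval a n) s.2)%:R) tk sub nk few).
rewrite -/J (tree_att lam k (interval a n) 0 _ (fun e => (awk (interval a n) e)%:R)) /=.
have := absorption lam_gt0 (a := a) J few.
set g := iter _ _ _ _; set W := pot _ _ _ => h.
have g0 : 0 <= g.
  have := @iter_mono R lam lam_gt0 k a n J (fun=> 0) (fun e => (awk (interval a n) e)%:R) (conf sig) few (fun e _ => ler0n _ _).
  apply: le_trans; have := @iter_qstep_sub R lam (interval a n) (mesh R k) J (fun=> 0) (fun=> 0) (conf sig).
  by under eq_fun do rewrite subrr; move=> ->; rewrite subrr.
rewrite ler_pdivlMr ?subr_gt0// mulrC; apply: le_trans h; rewrite ler_wpM2r//.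
rewrite /drop_rate mulrA ler_pdivlMr ?addr_gt0//.
have /andP[_ h2] := steps_bounds lam_gt0 k t0.
have m1 := mesh_le1 R k; rewrite -/J in h2; rewrite mulrBl mul1r lerBlDr; apply: le_trans h2 _; rewrite lerD2l.
by apply: le_trans m1 _; rewrite lerDl; exact: ltW.
Qed.

End Runs.

(** * Stabilization of a block of the pattern *)

Section Blocks.
Context (R : realType) (lam : R).
Hypothesis lam_gt0 : 0 < lam.
Context (p q : nat).

Lemma legal_settled sig om (s : state) x : consistent sig om s -> (awake (s.2 x) == 0)%N ->
  settled_at sig (stack_of om) s.1 x.
Proof.
case=> l -> /eqP; have [p0 _] := l x; rewrite /st /settled_at.
case: ifP => [/and3P[/eqP h1 h2 h3] _|_ /= h]; [by right|left].
by move: p0 h; case: (occ _ _ _ _) => //= -[|k].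
Qed.

Lemma Ek_sum k (I : Type) (l : seq I) (F : I -> (coord -> nat) -> R) :
  Ek lam k (fun om => \sum_(i <- l) F i om) = \sum_(i <- l) Ek lam k (F i).
Proof. by rewrite /Ek E_sum// => c; exact: cw_sum. Qed.

Definition block_sig (a : int) (m : nat) (x : int) : nat := if x \in interval a m then pat p q 0 x else 0%N.

Lemma run_block_le om a m M J x : (forall x, x \in interval a m -> (`|x| <= M)%N) ->
  ((run om (mem (interval a m)) (att (interval a m) 0 J) (start (block_sig a m))).1 x <= (sys p q om M M 0 J).1 x)%N.
Proof.
move=> sub; rewrite /sys.
have -> : att (interval a m) 0 J = [seq b <- att (zs M) 0 J | b.1 \in interval a m].
  by rewrite (att_filter _ (fun x => x \in interval a m)) zs_interval.
rewrite (run_filter om (V := mem (interval a m)) (W := fun x => x \in interval a m)) //.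
apply: run_mono; try exact: consistent_start; last by [].
- by move=> y /= /sub; rewrite mem_zs.
- move=> y; rewrite /block_sig /patM; case: ifP => // yI.
  by rewrite (sub _ yI).
Qed.

(** The walk on the block alone is dominated by that on a surrounding box, to which [tight] applies.
    Its odometer is the desired supersolution outside three events of probability at most [e] each:
    the block is still active at time [r], the odometer at [z] exceeds [K], or that of some site
    exceeds [Dg]. *)
Lemma block_side (z : int) (K : nat) (e : R) a m (j : nat) : 0 < e -> z \in interval a m -> z = a + j.+1%:Z ->
  (forall M (r : rat) k0, exists2 k, (k0 <= k)%N &
    Ek lam k (fun om => (K < (sys p q om M M 0 (steps lam (ratr r) k)).1 z)%N%:R) <= e) ->
  exists Dg0, forall Dg, (Dg0 <= Dg)%N ->
  ES lam (nseq m Dg) (fun W => (~~ `[< exists2 v, super 0 (map (block_sig a m) (interval a m)) W v & (nth 0%N v j <= K)%N >])%:R) <= 3 * e.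
Proof.
move=> e0 zI zj tight.
set vs := interval a m; pose M := (`|a| + m + 1)%N.
have sub x : x \in vs -> (`|x| <= M)%N by rewrite /vs mem_interval /M; lia.
set sg := block_sig a m.
set W := pot (quad R a m) vs (conf sg).
have W0 : 0 <= W by exact: pot_quad_ge0.
(* A time by which the block is stable up to probability [e]. It grows with the block, but [K] does
   not, as [tight] holds at all times. *)
pose r : rat := (Num.truncn (W / e)).+2%:R.
have rR : ratr r = (Num.truncn (W / e)).+2%:R :> R by rewrite ratr_nat.
have r1 : 1 < ratr r :> R by rewrite rR ltr1n.
have rW : W / (ratr r - 1) <= e.
  rewrite rR -natr1 addrK ler_pdivrMr ?ltr0n// mulrC -ler_pdivrMr//; apply: ltW; exact: truncnS_gt.
(* Bounds the mean total odometer of the block; Markov's inequality turns it into the depth. *)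
set C := \sum_(x <- vs) (ratr r * (1 + lam) + 1) * Kz lam q x (ratr r).
have C0 : 0 <= C.
  rewrite sumr_ge0// => x _; rewrite mulr_ge0 ?Kz_ge0// addr_ge0// mulr_ge0 ?addr_ge0//; [lra|exact: ltW].
exists (Num.truncn (C / e)).+1 => Dg DD.
have CD : C / Dg%:R <= e.
  have D0 : 0 < Dg%:R :> R by rewrite ltr0n; apply: leq_trans DD.
  rewrite ler_pdivrMr// mulrC -ler_pdivrMr//; apply: (@le_trans _ _ (Num.truncn (C / e)).+1%:R).
    by apply/ltW/truncnS_gt.
  by rewrite ler_nat.
have [k1 _ hk1] := near_big_enough q M (ratr r : R).
have [k kk tk] := tight M r (maxn (maxn k1 (M + Dg)) (\sum_(x <- vs) num (conf sg x)))%N.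
move: kk; rewrite !geq_max => /andP[/andP[kk1 kM] kN].
have be : big_enough q M (ratr r : R) k by exact: hk1.
have [k3 Mk qk rk] := be.
set J := steps lam (ratr r) k in tk.
pose run_ om := run om (mem vs) (att vs 0 J) (start sg).
pose Good Wt := exists2 v, super 0 (map sg vs) Wt v & (nth 0%N v j <= K)%N.
have subk x : x \in vs -> (`|x| <= k)%N by move=> /sub h; exact: leq_trans h Mk.
rewrite -(@E_lets R lam lam_gt0 k.+1 isT (box lam k) (box_uniq lam k) vs (nseq m Dg)
   (fun W => (~~ `[< Good W >])%:R) (fun=> 0%N)) //; first last.
- move=> x D l xD lD; have /andP[xv /eqP DE] : (x \in vs) && (D == Dg).
    have := mem_nth (x, D) (s := zip vs (nseq m Dg)); move: (xD) => /(nthP (x, D))[i].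
    rewrite size_zip size_nseq size_interval minnn => im; rewrite nth_zip ?size_nseq ?size_interval//.
    by case=> <- <- _; rewrite mem_nth ?size_interval//= nth_nseq im.
  apply: box_stack; first by rewrite mem_zs subk.
  apply: leq_trans (depth_ge lam_gt0 k); rewrite DE in lD; apply: leq_trans lD _; exact: leq_trans (leq_addl _ _) kM.
- by rewrite size_interval size_nseq.
- exact: interval_uniq.
rewrite -/(Ek lam k (fun om => (~~ `[< Good (lets (stack_of om) vs (nseq m Dg)) >])%:R)).
apply: (@le_trans _ _ (Ek lam k (fun om => ((awk vs (run_ om).2)%:R + 1 * (K < (sys p q om M M 0 J).1 z)%N%:R)
   + 1 * (\sum_(x <- vs) ((Dg < (sys p q om M M 0 J).1 x)%N%:R))))).
  apply: Ek_le => // om; rewrite !mul1r; case: asboolP => [_|nG].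
    by rewrite !addr_ge0// sumr_ge0.
  case st: (awk vs (run_ om).2); first by rewrite /= -addrA lerDl addr_ge0// sumr_ge0.
  have [Kz|Kz] := ltnP K; first by rewrite /= add0r lerDl sumr_ge0.
  rewrite !add0r.
  have [/hasP[x xv xD]|/hasPn nD] := boolP (has (fun x => Dg < (sys p q om M M 0 J).1 x)%N vs).
    by rewrite (big_rem x)//= xD lerDl sumr_ge0.
  exfalso; apply: nG.
  have cons : consistent sg om (run_ om) by exact/consistent_run/consistent_start.
  have out x : x \notin vs -> (run_ om).1 x = 0%N by move=> xv; rewrite /run_ run_out.
  exists (map (run_ om).1 vs).
    have := @super_interval m a Dg sg (stack_of om) (run_ om).1.
    rewrite (out a) ?mem_interval ?ltxx//; apply.
    + move=> x xv; apply: leq_trans (run_block_le om J x sub) _; rewrite leqNgt; exact: nD.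
    + by apply: out; rewrite mem_interval; clear; lia.
    + move=> x xv; apply: legal_settled => //; move: st => /negbT/hasPn/(_ x xv).
      by rewrite -leqNgt leqn0.
  have jm : (j < m)%N by move: zI; rewrite mem_interval zj; clear; lia.
  rewrite (nth_map 0) ?size_interval// /vs /interval (nth_map 0%N) ?size_iota// nth_iota// add0n -zj.
  exact: leq_trans (run_block_le om J z sub) Kz.
rewrite !Ek_lin// Ek_sum !mul1r.
have h1 : Ek lam k (fun om => (awk vs (run_ om).2)%:R) <= e.
  apply: le_trans rW; apply: (Ek_unstable lam_gt0) => //.
    by apply: leq_trans Mk; rewrite /M; clear; lia.
  exact: leqW.
have h3 : \sum_(x <- vs) Ek lam k (fun om => (Dg < (sys p q om M M 0 J).1 x)%N%:R) <= e.
  apply: le_trans CD; rewrite /C mulr_suml; apply: ler_sum => x _.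
  have D0 : 0 < Dg%:R :> R by rewrite ltr0n; apply: leq_trans DD.
  rewrite ler_pdivlMr// mulrC.
  have := @Ek_lin R lam k (fun=> 0) (fun om => (Dg < (sys p q om M M 0 J).1 x)%N%:R) Dg%:R.
  rewrite Ek_cst// add0r => <-.
  have r0 : 0 <= ratr r :> R by lra.
  have := Ek_incr lam_gt0 p M 0 x (lexx 0) r0 be; rewrite subr0 => h.
  apply: le_trans (le_trans h _); last first.
    by rewrite ler_wpM2r ?Kz_ge0// lerD2l mesh_le1.
  apply: Ek_le => // om; rewrite add0r.
  have -> : steps lam 0 k = 0%N by rewrite /steps !mul0r Num.Theory.truncn0.
  rewrite /= subr0 -/J; case: ltnP => h'; rewrite ?mulr0// mulr1 ler_nat; exact: ltnW.
move: h1 tk h3; rewrite -/J; lra.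
Qed.

End Blocks.

Definition periodic (p q b : nat) : seq nat := mkseq (fun i => if (p %| i.+1)%N then q else 0%N) (p * b).

Lemma sumn_periodic p q b : (0 < p)%N -> sumn (periodic p q b) = (q * b)%N.
Proof.
move=> p0; elim: b => [|b IH]; first by rewrite /periodic !muln0.
have step i : sumn (mkseq (fun i => if (p %| i.+1)%N then q else 0%N) (p * b + i)) = (q * b + q * (i == p))%N
   \/ (p < i)%N.
  elim: i => [|i [IHi|h]]; [| |by right; exact: leqW].
    by left; rewrite addn0 eq_sym (gtn_eqF p0) muln0 addn0.
  have [ip|ip] := ltnP i p; last by right.
  left; rewrite addnS mkseqS sumn_rcons IHi (ltn_eqF ip) muln0 addn0 -addnS.
  rewrite dvdn_addr ?dvdn_mulr//; congr (_ + _)%N.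
  have [->|ne] := eqVneq i.+1 p; first by rewrite dvdnn muln1.
  by rewrite gtnNdvd ?muln0// ltn_neqAle ne.
by case: (step p) => [|/[!ltnn]//]; rewrite eqxx muln1 -mulnSr -mulnSr.
Qed.

Lemma super_prefix Rin s1 s2 W U : super Rin (s1 ++ s2) W U ->
  super Rin s1 (take (size s1) W) (take (size s1) U) /\
  (headL (take (size s1) W) (take (size s1) U) <= headL W U)%N.
Proof.
elim: s1 Rin W U => [|s s1 IH] Rin [|w W] [|u U] //= [h1 h2 /IH[h3 h4]]; split=> //; split=> //.
by apply: settles_le h1; move: h4; clear; lia.
Qed.

Lemma interval_cat a n n' : interval a (n + n') = interval a n ++ interval (a + n%:Z) n'.
Proof.
rewrite /interval iotaD map_cat; congr (_ ++ _).
by rewrite add0n -[in LHS](addn0 n) iotaDl -map_comp; apply: eq_map => i /=; lia.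
Qed.

Lemma flatten_blocks (T : Type) (f : int -> T) m i :
  flatten (mkseq (fun j => map f (interval (j * m)%N%:Z m)) i) = map f (interval 0 (i * m)).
Proof.
elim: i => // i IH; rewrite mkseqS -cats1 flatten_cat IH /= cats0 -map_cat.
by rewrite mulSnr interval_cat add0r.
Qed.

Lemma ES_take (R : realType) (lam : R) (lam_gt0 : 0 < lam) n Ds f :
  ES lam Ds (fun W => f (take n W)) = ES lam (take n Ds) f.
Proof.
elim: Ds n f => [|D Ds IH] [|n] f //=.
  rewrite -[RHS](ES_cst lam_gt0 (D :: Ds)) /=; by [].
by apply: (eq_EL lam_gt0) => w _; exact: (IH n (fun W => f (w :: W))).
Qed.

(** * The bound for the left sink *)

Section Bound.
Context (R : realType) (lam rho_FE : R).
Hypothesis lam_gt0 : 0 < lam.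
Hypothesis crit : is_critical_density lam rho_FE.

Lemma block_sig_periodic (p q : nat) (a : int) b : (p%:Z %| a)%Z ->
  map (block_sig p q a (p * b)) (interval a (p * b)) = periodic p q b.
Proof.
move=> pa; rewrite /interval -map_comp /periodic /mkseq; apply/eq_in_map => i; rewrite mem_iota => /= ib.
rewrite /block_sig mem_interval (_ : _ && _); last by move: ib; clear; lia.
rewrite /pat addr0.
suff -> : (p%:Z %| a + i.+1%:Z)%Z = (p %| i.+1)%N by [].
by rewrite rpredDl.
Qed.

(** The block is placed on [{1, ..., m}] to control its left end and on [{1 - m, ..., 0}] to control
    its right end. As [p] divides [m], both carry the same pattern in phase 0, and the lists of
    instructions have the same law; each side fails with probability at most [3 * (delta / 6)]. *)
Lemma tame_likely (p q : nat) (delta : R) : (0 < p)%N -> q%:R / p%:R < rho_FE -> 0 < delta ->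
  exists K1, forall b, (0 < b)%N -> exists Dg,
    ES lam (nseq (size (periodic p q b)) Dg) (fun W => (~~ `[< tame K1 (periodic p q b) W >])%:R) <= delta.
Proof.
move=> p0 sub d0; have e0 : 0 < delta / 6 by rewrite divr_gt0.
have [KL tL] := tight_chain lam_gt0 crit p0 sub 1 e0.
have [KR tR] := tight_chain lam_gt0 crit p0 sub 0 e0.
exists (maxn KL KR) => b b0; rewrite size_mkseq; set m := (p * b)%N.
have m0 : (0 < m)%N by rewrite muln_gt0 p0.
have [DL hL] : exists Dg0, forall Dg, (Dg0 <= Dg)%N -> ES lam (nseq m Dg)
    (fun W => (~~ `[< exists2 v, super 0 (periodic p q b) W v & (nth 0%N v 0 <= KL)%N >])%:R) <= 3 * (delta / 6).
  have := @block_side R lam lam_gt0 p q 1 KL _ 0 m 0%N e0; rewrite block_sig_periodic ?dvdz0//; apply=> //.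
  by rewrite mem_interval; move: m0; clear; lia.
have [DR hR] : exists Dg0, forall Dg, (Dg0 <= Dg)%N -> ES lam (nseq m Dg)
    (fun W => (~~ `[< exists2 v, super 0 (periodic p q b) W v & (nth 0%N v m.-1 <= KR)%N >])%:R) <= 3 * (delta / 6).
  have := @block_side R lam lam_gt0 p q 0 KR _ (- m%:Z) m m.-1 e0; rewrite block_sig_periodic; last first.
    by rewrite rpredN /m PoszM; apply: dvdz_mulr.
  apply=> //; first by rewrite mem_interval; move: m0; clear; lia.
  by move: m0; clear; lia.
exists (maxn DL DR).
have {}hL := hL _ (leq_maxl DL DR); have {}hR := hR _ (leq_maxr DL DR).
set Dg := maxn DL DR in hL hR *.
apply: (@le_trans _ _ (3 * (delta / 6) + 1 * (3 * (delta / 6)))); last by rewrite le_eqVlt; apply/orP; left; apply/eqP; field.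
apply: le_trans (lerD hL (ler_wpM2l ler01 hR)).
rewrite -(ES_lin lam_gt0); apply: ES_le => // W sW; rewrite mul1r.
case: asboolP => [_|nt]; first by rewrite addr_ge0.
case: asboolP => [[v sv kv]|_]; last by rewrite lerDl.
case: asboolP => [[v' sv' kv']|_]; last by rewrite lerDr.
exfalso; apply: nt; apply: (tame_min sv _ sv').
- apply: leq_trans (leq_maxl _ _); apply: leq_trans kv.
  rewrite /headL; case: (W) (v) => [|w ?] // [|u ?] //=.
  by rewrite /nl (leq_trans (count_size _ _))// size_take_min geq_minl.
- apply: leq_trans (leq_maxr _ _); apply: leq_trans kv'.
  have [_ sz] := super_size sv'; rewrite size_mkseq -/m in sz.
  by rewrite /lastR /nr (leq_trans (count_size _ _))// size_take_min -nth_last sz geq_minl.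
Qed.

Lemma left_bound (eps : R) : 0 < eps -> 0 < rho_FE -> exists eta c C : R, exists n0 : nat,
  [/\ 0 < eta, 0 < c, 0 < C & forall n sig e, (n0 <= n)%N -> 0 < e ->
    (forall x, (x <= n)%N -> (sumn (map sig (interval 0 x)))%:R <= rho_FE * x%:R + eta * n%:R) ->
    exists2 Ds, size Ds = n &
      ES lam Ds (fun W => (~~ `[< exists2 U, super 0 (map sig (interval 0 n)) W U &
        (headL W U)%:R <= eps * n%:R / 2 >])%:R) <= C * expR (- (c * n%:R)) + e].
Proof.
(* The reserve [g0] is about [eps * n / 4 = 10 * v * n]. It is spent on the imbalance of [sig]
   ([v * n]), the gap between [rr] and [rho_FE] ([2 * v * n]), the [K1] of all blocks ([4 * v * n]),
   the bad blocks ([2 * v * n]), and the current block with the rounding of [g0] ([v * n]). *)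
move=> eps0 rF0; pose v := eps / 40; have v0 : 0 < v by rewrite divr_gt0.
have [r] : exists r : rat, ratr r \in `]Num.max 0 (rho_FE - v), rho_FE[.
  by apply: rat_in_itvoo; rewrite gt_max rF0 ltrBlDr ltrDl.
rewrite in_itv /= gt_max => /andP[/andP[r0 /ltW rv] rF].
pose p := `|denq r|%N; pose q := `|numq r|%N.
have p0 : (0 < p)%N by rewrite absz_gt0 denq_neq0.
have rE : ratr r = q%:R / p%:R :> R.
  have qr : 0 <= numq r by rewrite numq_ge0 -(ler0q R) ltW.
  by rewrite /ratr /p /q !natr_absz ger0_norm// gtr0_norm.
move: r0 rv rF rE; move: (ratr r : R) => rr r0 rv rF rE.
(* If one block in [T] is bad, the loss per site is at most [rho_FE / T <= v]. *)
pose T := (Num.truncn (rho_FE / v)).+1.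
have TE : rho_FE <= v * T%:R by rewrite mulrC -ler_pdivrMr//; apply/ltW/truncnS_gt.
(* For [delta = z^-1] the numerator in [exploration] is [2 ^+ B], whereas with [c] close to [B / T]
   the denominator [z ^+ c] is at least [2 ^+ (2 * B) / z]. The quotient is at most
   [z * 2^-1 ^+ B]. *)
pose z : R := 2 ^+ (2 * T); have z0 : 0 < z by rewrite exprn_gt0.
have d0 : 0 < z^-1 by rewrite invr_gt0.
have d1 : z^-1 <= 1 by rewrite invf_le1// exprn_ege1// ler1n.
have sub : q%:R / p%:R < rho_FE by rewrite -rE.
have [K1 hK1] := tame_likely p0 sub d0.
(* [K1] being known, the blocks are made long enough for [K1 <= v * m]. *)
pose b := (Num.truncn (K1%:R / v)).+1; have [Dg hDg] := hK1 b isT.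
set pats := periodic p q b in hDg; pose m := size pats; pose a := sumn pats.
have mE : m = (p * b)%N by rewrite /m size_mkseq.
have aE : a = (q * b)%N by exact: sumn_periodic.
have m0 : (0 < m)%N by rewrite mE muln_gt0 p0.
have am : a%:R = rr * m%:R :> R.
  by rewrite rE mE aE !natrM mulrA divfK// pnatr_eq0 -lt0n.
have K1m : K1%:R <= v * m%:R :> R.
  apply: (@le_trans _ _ (v * b%:R)); last by rewrite ler_pM2l// ler_nat mE leq_pmull.
  by rewrite mulrC -ler_pdivrMr//; apply/ltW/truncnS_gt.
pose n0 := (m + (Num.truncn ((a%:R + 1) / v)).+1)%N.
have mR : 0 < m%:R :> R by rewrite ltr0n.
exists v, (1 / 2 / m%:R), z, n0; split=> // [|n sig e n0n e0 bal]; first by rewrite !divr_gt0.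
have mn : (m <= n)%N by apply: leq_trans n0n; exact: leq_addr.
have an : a%:R + 1 <= v * n%:R :> R.
  rewrite mulrC -ler_pdivrMr//; apply: le_trans (ltW (truncnS_gt _)) _.
  by rewrite ler_nat (leq_trans _ n0n)// leq_addl.
pose B := (n %/ m).+1.
have Bn : (n < B * m)%N by rewrite ltn_ceil.
have Bm : (B * m <= n + m)%N by rewrite mulSn addnC leq_add2r leq_divM.
pose c := (B %/ T)%N.
have cT : (T * c <= B)%N by rewrite mulnC leq_divM.
have Tc : (B <= T + T * c)%N by rewrite -mulnS mulnC ltnW// ltn_ceil.
have e'0 : 0 < e / 3 ^+ B by rewrite divr_gt0// exprn_gt0.
pose g0 := Num.truncn (eps * n%:R / 4).
have en0 : 0 <= eps * n%:R / 4 by rewrite divr_ge0// mulr_ge0// ltW.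
have g0l : g0%:R <= eps * n%:R / 4 by rewrite /g0 truncn_le.
have g0u : eps * n%:R / 4 < g0%:R + 1 by rewrite natr1 truncnS_gt.
have [Ds sD hDs] := exploration lam_gt0 m0 (ltW d0) d1 z0 hDg B g0 g0 e'0.
(* The [B] blocks cover slightly more than the [n] sites. The additional sites carry no particles,
   and [super_prefix] cuts them off in the end. *)
pose sg (x : int) := if x <= n%:Z then sig x else 0%N.
pose sigss := mkseq (fun j => map sg (interval (j * m)%N%:Z m)) B.
have pre x : (x <= n)%N -> map sg (interval 0 x) = map sig (interval 0 x).
  move=> xn; apply/eq_in_map => y; rewrite mem_interval /sg => yx.
  by rewrite (_ : y <= _)//; move: xn yx; clear; lia.
have tailE x : (n <= x)%N -> sumn (map sg (interval 0 x)) = sumn (map sig (interval 0 n)).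
  move=> nx; rewrite -(subnKC nx) interval_cat map_cat sumn_cat pre// -[RHS]addn0; congr (_ + _)%N.
  rewrite (_ : map sg _ = map (fun=> 0%N) (interval (0 + n%:Z) (x - n))); first by elim: (interval _ _).
  by apply/eq_in_map => w; rewrite mem_interval add0r /sg => /andP[nw _]; rewrite leNgt nw.
have bud : budget K1 pats g0 sigss c.
  move=> i; rewrite size_mkseq => iB.
  have -> : take i.+1 sigss = mkseq (fun j => map sg (interval (j * m)%N%:Z m)) i.+1.
    by rewrite /sigss /mkseq -map_take take_iota (minn_idPl iB).
  rewrite flatten_blocks -/a.
  set S := sumn _.
  have iN : (i.+1 * m <= n + m)%N by apply: leq_trans Bm; rewrite leq_mul2r iB orbT.
  have SE : S%:R <= rho_FE * (i.+1%:R * m%:R) + v * n%:R.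
    rewrite -natrM /S; have [h|h] := leqP (i.+1 * m) n; first by rewrite pre//; exact: bal.
    rewrite tailE ?(ltnW h)//; apply: le_trans (bal n (leqnn n)) _.
    by rewrite lerD2r ler_pM2l// ler_nat ltnW.
  rewrite -(ler_nat R) !natrD !natrM.
  have iNR : i.+1%:R * m%:R <= 2 * n%:R :> R.
    rewrite -natrM; apply: le_trans (_ : (n + m)%:R <= _); first by rewrite ler_nat.
    by rewrite natrD mulr_natl mulr2n lerD2l ler_nat.
  have BNR : B%:R * m%:R <= 2 * n%:R :> R.
    rewrite -natrM; apply: le_trans (_ : (n + m)%:R <= _); first by rewrite ler_nat.
    by rewrite natrD mulr_natl mulr2n lerD2l ler_nat.
  have hac : a%:R * c%:R <= 2 * v * n%:R :> R.
    rewrite am; have T0 : 0 < T%:R :> R by rewrite ltr0n.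
    rewrite -(ler_pM2r T0); apply: (@le_trans _ _ (rho_FE * (B%:R * m%:R))).
      rewrite (_ : rr * m%:R * c%:R * T%:R = rr * (T%:R * c%:R * m%:R)); last by ring.
      apply: ler_pM; rewrite ?(ltW r0) ?(ltW rF) ?mulr_ge0//.
      by rewrite ler_pM2r// -natrM ler_nat.
    apply: (@le_trans _ _ (v * T%:R * (2 * n%:R))); last by rewrite le_eqVlt; apply/orP; left; apply/eqP; ring.
    by apply: ler_pM => //; rewrite ?(ltW rF0) ?mulr_ge0.
  have h1 : rho_FE * (i.+1%:R * m%:R) <= a%:R * i.+1%:R + 2 * v * n%:R.
    apply: (@le_trans _ _ ((rr + v) * (i.+1%:R * m%:R))).
      by rewrite ler_pM2r ?mulr_gt0 ?ltr0n// -lerBlDr.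
    rewrite mulrDl am; apply: lerD.
      by rewrite le_eqVlt; apply/orP; left; apply/eqP; ring.
    by rewrite -mulrA (mulrCA 2 v) ler_pM2l.
  have h2 : 2 * K1%:R * i.+1%:R <= 4 * v * n%:R :> R.
    apply: (@le_trans _ _ (2 * (v * m%:R) * i.+1%:R)).
      by rewrite ler_pM2r ?ltr0n// ler_pM2l.
    rewrite (_ : 2 * (v * m%:R) * i.+1%:R = 2 * v * (i.+1%:R * m%:R)); last by ring.
    rewrite (_ : 4 * v * n%:R = 2 * v * (2 * n%:R)); last by ring.
    by rewrite ler_pM2l// mulr_gt0.
  have g0u' : 10 * v * n%:R < g0%:R + 1.
    by apply: le_lt_trans g0u; rewrite /v le_eqVlt; apply/orP; left; apply/eqP; field.
  rewrite (_ : a%:R * i.+1%:R = a%:R * i%:R + a%:R) in h1; last by rewrite -natr1; ring.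
  move: SE h1 h2 hac g0u' an.
  move: (_ * (_ * m%:R)) (a%:R * c%:R) (2 * K1%:R * _) (a%:R * i%:R) => A1 A2 A3 A4.
  by rewrite -!(mulrA _ v); move: (v * n%:R) => A5; lra.
exists (take n Ds); first by rewrite size_takel// sD -/m ltnW.
rewrite -(ES_take lam_gt0); apply: le_trans (_ : (1 + z^-1 * z) ^+ B / z ^+ c + 3 ^+ B * (e / 3 ^+ B) <= _).
  apply: le_trans (hDs sigss _ _ g0 g0 c (leqnn _) (leqnn _) bud) => //.
  - apply: ES_le => // W sW; rewrite ler_nat; case: asboolP => // nex.
    case: asboolP => // -[U sU hU]; exfalso; apply: nex.
    have Ff : flatten sigss = map sig (interval 0 n) ++ map sg (interval n%:Z (B * m - n)).
      by rewrite /sigss flatten_blocks -[in LHS](subnKC (ltnW Bn)) interval_cat map_cat pre// add0r.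
    move: sU; rewrite Ff => /super_prefix; rewrite size_map size_interval => -[s1 s2].
    exists (take n U); first by apply: super_le s1; rewrite subrr add0r.
    apply: le_trans (_ : (g0 + K1)%:R <= _); first by rewrite ler_nat; exact: leq_trans hU.
    rewrite natrD; have K1n : K1%:R <= v * n%:R by apply: le_trans K1m _; rewrite ler_pM2l// ler_nat.
    have vE : eps = 40 * v by rewrite /v; field.
    by move: g0l K1n (v0); rewrite vE; move: (ler0n R n) => n0'; nra.
  - by rewrite size_mkseq.
  - by move=> s /mapP[j _ ->]; rewrite size_map size_interval.
rewrite mulrCA divff ?mulr1 ?expf_neq0// lerD2r mulVf ?gt_eqF//.
rewrite (_ : 1 + 1 = 2 :> R) // ler_pdivrMr ?exprn_gt0//.
have h2 : 2^-1 ^+ B <= expR (- (1 / 2 / m%:R * n%:R)) :> R.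
  apply: (@le_trans _ _ (expR (- 2^-1) ^+ B)).
    apply: lerXn2r; rewrite ?nnegrE ?invr_ge0 ?expR_ge0//.
    by apply: le_trans (expR_ge1Dx _); rewrite le_eqVlt; apply/orP; left; apply/eqP; field.
  rewrite -expRM_natl ler_expR mulrN lerN2.
  rewrite (_ : 1 / 2 / m%:R * n%:R = n%:R / m%:R * 2^-1); last by field; rewrite gt_eqF.
  by rewrite ler_pM2r ?invr_gt0// ler_pdivrMr// -natrM ler_nat ltnW.
apply: (@le_trans _ _ (z * 2^-1 ^+ B * z ^+ c)); last first.
  by rewrite ler_pM2r ?exprn_gt0// ler_pM2l.
rewrite exprVn mulrAC ler_pdivlMr ?exprn_gt0// -exprD -exprS /z -exprM.
rewrite ler_eXn2l ?ltr1n//; move: Tc; clear; nia.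
Qed.

End Bound.

(** * From supersolutions to the sinks *)

Section Exits.
Context (om : coord -> nat) (n : nat) (sig : int -> nat) (as_ : seq (int * nat)).
Notation final := (run om (mem (interval 0 n)) as_ (start sig)).
Notation I := (stack_of om).

Let cons : consistent sig om final. Proof. exact/consistent_run/consistent_start. Qed.

Let out x : x \notin interval 0 n -> final.1 x = 0%N. Proof. by move=> xv; rewrite run_out. Qed.

Lemma exits_sinks : sig 0 = 0%N -> sig n.+1%:Z = 0%N ->
  awake (final.2 0) = cnt 1 (I 1) (final.1 1) /\ awake (final.2 n.+1%:Z) = cnt 2 (I n%:Z) (final.1 n%:Z).
Proof.
have [_ stE] := cons; move=> s0 sn; rewrite stE /st.
rewrite !(out (x := 0)) ?mem_interval// !(out (x := n.+1%:Z)) ?mem_interval; last by clear; lia.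
rewrite !andbF /occ s0 sn !(out (x := 0)) ?mem_interval// !(out (x := n.+1%:Z)) ?mem_interval; last by clear; lia.
rewrite !(out (x := 0 - 1)) ?mem_interval// !(out (x := n.+1%:Z + 1)) ?mem_interval; last by clear; lia.
rewrite (_ : n.+1%:Z - 1 = n%:Z); last by clear; lia.
by rewrite /= (_ : 0 + 1 = 1)//; split; clear; lia.
Qed.

Lemma exits_left Ds (e : nat -> Prop) : (forall i j, (i <= j)%N -> e j -> e i) -> size Ds = n ->
  (exists2 U, super 0 (map sig (interval 0 n)) (lets I (interval 0 n) Ds) U & e (headL (lets I (interval 0 n) Ds) U)) ->
  e (cnt 1 (I 1) (final.1 1)).
Proof.
move=> eM sD [U sU hU]; have [h1 h2] := stabilizes_odometer sD (lexx _) sU.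
rewrite h2 in hU; apply: eM hU; apply: cnt_le.
exact: (@run_stabilizes om (mem (interval 0 n)) sig _ as_ _ h1 (consistent_start sig om)).
Qed.

Lemma lets_mirror (c : int) xs Ds : lets (mirror_stacks c I) xs Ds =
  map (map swap) (lets I [seq c - x | x <- xs] Ds).
Proof.
elim: xs Ds => [|x xs IH] [|D Ds] //=; rewrite !lets_cons IH /=; congr (_ :: _).
by rewrite /mkseq -map_comp.
Qed.

(** In the reflected system the lists are read from right to left with the two jump instructions
    exchanged, which does not change their law by [ES_swap]. *)
Lemma exits_right Ds (e : nat -> Prop) : (forall i j, (i <= j)%N -> e j -> e i) -> size Ds = n ->
  let W := map (map swap) (lets I [seq n.+1%:Z - x | x <- interval 0 n] Ds) in
  (exists2 U, super 0 (map (mirror n.+1%:Z sig) (interval 0 n)) W U & e (headL W U)) ->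
  e (cnt 2 (I n%:Z) (final.1 n%:Z)).
Proof.
move=> eM sD W; rewrite /W -lets_mirror => -[U sU hU]; have [h1 h2] := stabilizes_odometer sD (lexx _) sU.
rewrite h2 /mirror_stacks cnt_swap1 in hU; set V := odometer_of _ _ _ in h1 hU.
have VE : mirror n.+1%:Z (mirror n.+1%:Z V) = V.
  by apply/funext => x; rewrite /mirror; congr V; clear; lia.
rewrite -VE in h1; have h3 := stabilizes_mirror h1.
have vE : mirror n.+1%:Z [set` interval 0 n] = [set` interval 0 n].
  apply/seteqP; split=> x; rewrite /mirror /= !mem_interval; clear; lia.
rewrite vE in h3; rewrite (_ : n.+1%:Z - (0 + 1) = n%:Z) in hU; last by clear; lia.
apply: eM hU; apply: cnt_le; apply: leq_trans (_ : (mirror n.+1%:Z V n%:Z <= _)%N).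
  exact: (@run_stabilizes om (mem (interval 0 n)) sig _ as_ _ h3 (consistent_start sig om)).
by rewrite /mirror (_ : n.+1%:Z - n%:Z = 0 + 1)//; clear; lia.
Qed.

End Exits.

Definition few_exits (R : realType) (n : nat) (e : R) : set config :=
  [set eta | stable (sites n) eta /\ (max_ejected n eta)%:R <= e].

Definition balanced (R : realType) (n : nat) (rho d : R) (sig : int -> nat) : Prop := forall x, (x <= n)%N ->
  (sumn (map sig (interval 0 x)))%:R <= rho * x%:R + d.

Section Exits.
Context (R : realType) (lam rho_FE : R).
Hypothesis lam_gt0 : 0 < lam.
Hypothesis crit : is_critical_density lam rho_FE.

Lemma sites_interval n : sites n = [set` interval 0 n].
Proof. by apply/seteqP; split=> x /=; rewrite /sites /= mem_interval add0r. Qed.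

Lemma Ek_lets k xs Ds f : uniq xs -> size xs = size Ds -> (forall x, x \in xs -> (`|x| <= k)%N) ->
  (forall D, D \in Ds -> (D <= k)%N) ->
  Ek lam k (fun om => f (lets (stack_of om) xs Ds)) = ES lam Ds f.
Proof.
move=> ux sz xk Dk; rewrite /Ek (@E_lets R lam lam_gt0 k.+1 isT (box lam k) (box_uniq lam k))//.
move=> x D l xD lD; have [xx DD] : x \in xs /\ D \in Ds.
  by split; [rewrite -(unzip1_zip (s := xs) (t := Ds)) ?sz//|rewrite -(unzip2_zip (s := xs) (t := Ds)) ?sz//]; apply/mapP; exists (x, D).
apply: box_stack; first by rewrite mem_zs xk.
by apply: leq_trans (depth_ge lam_gt0 k); apply: leq_trans lD _; rewrite Dk.
Qed.

(** Failure has three causes: no good supersolution on the left, none on the right, or activity at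
    time [t]. The two depth errors and the distance between chain and semigroup are [e / 3] each
    with [e] arbitrary, so none of them survives in the statement. The chain is chosen after the
    depths, so that it reads the lists entirely. *)
Lemma few_exits_likely (eps : R) : 0 < eps -> 0 < rho_FE -> exists eta c C : R, exists n0 : nat,
  [/\ 0 < eta, 0 < c, 0 < C & forall n sig t, (n0 <= n)%N -> 1 < t ->
    sig 0 = 0%N -> sig n.+1%:Z = 0%N -> balanced n rho_FE (eta * n%:R) sig ->
    balanced n rho_FE (eta * n%:R) (mirror n.+1%:Z sig) ->
    1 - C * expR (- (c * n%:R)) - pot (quad R 0 n) (interval 0 n) (conf sig) / (t - 1) <=
    fdd (sites n) lam [:: (t, few_exits n (eps * n%:R / 2))] (conf sig)].
Proof.
move=> eps0 rF0; have [eta [c [C [n0 [eta0 c0 C0 lb]]]]] := left_bound lam_gt0 crit eps0 rF0.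
exists eta, c, (2 * C), n0; split=> //; first by rewrite mulr_gt0.
move=> n sig t n0n t1 s0 sn bal bal'; set B := eps * n%:R / 2; set W := pot _ _ _.
have t0 : 0 <= t by apply/ltW/(lt_trans ltr01).
apply/ler_addgt0Pr => e e0; have e4 : 0 < e / 3 by rewrite divr_gt0.
have [Ds1 sD1 h1] := lb n sig _ n0n e4 bal.
have [Ds2 sD2 h2] := lb n _ _ n0n e4 bal'.
set vs := interval 0 n; pose N := num_on vs (conf sig).
have := @dfdd_cvg R lam lam_gt0 vs N [:: (t, steps lam t, few_exits n B)] (interval_uniq 0 n).
case=> [p|_]; first by rewrite inE => /eqP -> /=; split=> //; exact: steps_cvg.
move=> /(_ _ e4) cvg.
pose K := (\max_(D <- Ds1 ++ Ds2) D + n + N + (Num.truncn t).+1)%N.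
have [k [hk Kk]] : exists k, (forall eta : config, few vs N eta -> `|dfdd lam vs k [:: (steps lam t k, few_exits n B)] eta -
    fdd [set` vs] lam [:: (t, few_exits n B)] eta| <= e / 3) /\ (K <= k)%N.
  have : \forall k \near \oo, (K <= k)%N by exists K.
  by move=> h; have [k _ /(_ k (leqnn k)) [h3 h4]] := filterI cvg h; exists k.
have {}hk := hk (conf sig) (leqnn _).
have Dk D : (D \in Ds1) || (D \in Ds2) -> (D <= k)%N.
  rewrite -mem_cat => DD; apply: leq_trans Kk; rewrite /K -!addnA; apply: leq_trans (leq_addr _ _).
  exact: (leq_bigmax_seq (F := id)).
have nk : (n <= k)%N by apply: leq_trans Kk; rewrite /K; clear; lia.
have Nk : (N <= k.+1)%N by apply: leqW; apply: leq_trans Kk; rewrite /K; clear; lia.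
have tk : t <= k%:R.
  apply: le_trans (ltW (truncnS_gt t)) _; rewrite ler_nat; apply: leq_trans Kk; rewrite /K; exact: leq_addl.
have sub x : x \in vs -> (`|x| <= k)%N by rewrite mem_interval; move: nk; clear; lia.
set J := steps lam t k in hk.
pose fin om := run om (mem vs) (att vs 0 J) (start sig).
have dE : dfdd lam vs k [:: (J, few_exits n B)] (conf sig) = Ek lam k (fun om => \1_(few_exits n B) (fin om).2).
  rewrite (Ek_run lam_gt0 (fun s : state => \1_(few_exits n B) s.2) tk sub nk Nk).
  rewrite (@tree_att R lam k vs 0 J (fun s => \1_(few_exits n B) s)) /=.
  by congr (iter _ _ _ _); apply/funext => z; rewrite mulr1.
pose F1 (V : seq (seq nat)) := `[< exists2 U, super 0 (map sig vs) V U & (headL V U)%:R <= B >].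
pose F2 (V : seq (seq nat)) := `[< exists2 U, super 0 (map (mirror n.+1%:Z sig) vs) V U & (headL V U)%:R <= B >].
have key : 1 - ((C * expR (- (c * n%:R)) + e / 3) + (C * expR (- (c * n%:R)) + e / 3) + W / (t - 1)) <=
   Ek lam k (fun om => \1_(few_exits n B) (fin om).2).
  rewrite lerBlDl -(ES_swap lam_gt0) in h2 *.
  pose xs := [seq n.+1%:Z - x | x <- vs].
  have uxs : uniq xs by rewrite map_inj_uniq ?interval_uniq// => x y; clear; lia.
  have eM i j : (i <= j)%N -> (j%:R <= B) -> i%:R <= B by move=> ij; apply: le_trans; rewrite ler_nat.
  have g1 : Ek lam k (fun om => (~~ F1 (lets (stack_of om) vs Ds1))%:R) <= C * expR (- (c * n%:R)) + e / 3.
    rewrite (Ek_lets (fun V => (~~ F1 V)%:R)) ?interval_uniq ?size_interval//.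
    by move=> D DD; rewrite Dk ?DD.
  have g2 : Ek lam k (fun om => (~~ F2 (map (map swap) (lets (stack_of om) xs Ds2)))%:R) <= C * expR (- (c * n%:R)) + e / 3.
    rewrite (Ek_lets (fun V => (~~ F2 (map (map swap) V))%:R)) ?size_map ?size_iota//.
    - move=> x /mapP[y]; rewrite mem_interval => yv ->; move: yv nk; clear; lia.
    - by move=> D DD; rewrite Dk ?DD ?orbT.
  have g3 := Ek_unstable lam_gt0 t1 tk sub nk Nk.
  have : 1 <= Ek lam k (fun om => \1_(few_exits n B) (fin om).2 + 1 * ((~~ F1 (lets (stack_of om) vs Ds1))%:R +
     1 * ((~~ F2 (map (map swap) (lets (stack_of om) xs Ds2)))%:R + 1 * (awk vs (fin om).2)%:R))).
    rewrite -[leLHS](Ek_cst lam_gt0 k); apply: Ek_le => // om; rewrite !mul1r.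
    case: (boolP (F1 _)) => [/asboolP f1|_]; last by rewrite addrCA lerDl !addr_ge0// indicE.
    case: (boolP (F2 _)) => [/asboolP f2|_]; last by rewrite /= add0r addrCA lerDl !addr_ge0// indicE.
    case: (boolP (awk vs (fin om).2)) => st.
      by rewrite !add0r lerDr indicE.
    rewrite !add0r addr0 indicE mem_set//; split.
      move=> x; rewrite sites_interval /= => xv; move: st => /hasPn /(_ x xv).
      by rewrite -leqNgt leqn0 => /eqP.
    have [e1 e2] := exits_sinks om (att vs 0 J) s0 sn.
    rewrite /max_ejected; have [_|_] := leqP (awake ((fin om).2 0)).
      by rewrite e2; exact: (exits_right _ eM sD2 f2).
    by rewrite e1; exact: (exits_left _ eM sD1 f1).
  rewrite !Ek_lin// !mul1r => g.
  move: g g1 g2 g3; rewrite -/vs -/W -/J -/fin.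
  move: (Ek _ _ _) (Ek _ _ _) (Ek _ _ _) (Ek _ _ _) (W / _) (C * _) => a1 a2 a3 a4 a5 a6; lra.
rewrite sites_interval -/vs; move: hk key; rewrite dE ler_norml => /andP[_].
rewrite -(mulrA 2 C).
move: (Ek _ _ _) (fdd _ _ _ _) (W / _) (C * _) => a1 a2 a3 a4; lra.
Qed.

End Exits.

(** * Uniform placements *)

Lemma card_indicator (T : finType) (P : pred T) : #|P| = (\sum_(i : T) P i)%N.
Proof. by rewrite -sum1_card big_mkcond; apply: eq_bigr => i _. Qed.

Section Placements.
Context (n k : nat).
Implicit Types p : {ffun 'I_k -> 'I_n}.

Definition occupancy p (x : int) : nat := #|[pred i : 'I_k | (p i).+1%:Z == x]|.

Lemma occupancy_prefix p x : sumn (map (occupancy p) (interval 0 x)) = #|[pred i | p i < x]%N|.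
Proof.
elim: x => [|x IH]; first by rewrite eq_card0.
rewrite -addn1 interval_cat map_cat sumn_cat IH add0r /= addn0 /occupancy.
rewrite !card_indicator -big_split/=; apply: eq_bigr => i _.
rewrite addn1 ltnS (_ : ((p i).+1%:Z == _) = (p i == x :> nat)); last by apply/eqP/eqP; clear; lia.
by rewrite [in RHS]leq_eqVlt; case: eqVneq => [->|_]; rewrite ?ltnn ?addn0.
Qed.

Lemma occupancy_mirror p : mirror n.+1%:Z (occupancy p) = occupancy [ffun i => rev_ord (p i)].
Proof.
apply/funext => x; apply: eq_card => i; rewrite !inE ffunE /=.
have := ltn_ord (p i); move: (nat_of_ord (p i)) => j jn.
by apply/eqP/eqP; move: jn; clear; lia.
Qed.

Lemma placements_mgf (R : realType) (F : 'I_n -> R) : \sum_(p : {ffun 'I_k -> 'I_n}) \prod_(i < k) F (p i) = (\sum_j F j) ^+ k.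
Proof.
have := bigA_distr_bigA (fun (_ : 'I_k) j => F j); move=> /= <-.
by rewrite prodr_const card_ord.
Qed.

(** Exponential Markov inequality for a sum of [k] independent indicators of mean [x / n], written
    as a count of placements. *)
Lemma prefix_chernoff (R : realType) (h th : R) x : (0 < n)%N -> (x <= n)%N -> 0 <= h -> h <= 2^-1 ->
  #|[pred p : {ffun 'I_k -> 'I_n} | th < #|[pred i | p i < x]%N|%:R ]|%:R <=
  expR (k%:R * (x%:R / n%:R) * (h + 2 * h ^+ 2) - h * th) * (n ^ k)%:R.
Proof.
move=> n0 xn h0 h2.
apply: (@le_trans _ _ (\sum_(p : {ffun 'I_k -> 'I_n}) expR (h * (#|[pred i | p i < x]%N|%:R - th)))).
  rewrite card_indicator natr_sum; apply: ler_sum => p _ /=.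
  case: (ltP th) => [lt|_]; last exact: expR_ge0.
  by rewrite /= -[leLHS]expR0 ler_expR mulr_ge0// subr_ge0 ltW.
have -> : \sum_(p : {ffun 'I_k -> 'I_n}) expR (h * (#|[pred i | p i < x]%N|%:R - th)) =
    expR (- (h * th)) * (\sum_(j < n) expR (h * (j < x)%N%:R)) ^+ k.
  rewrite -placements_mgf mulr_sumr; apply: eq_bigr => p _.
  rewrite mulrBr expRD mulrC; congr (_ * _).
  by rewrite card_indicator natr_sum mulr_sumr expR_sum; apply: eq_bigr => i _.
have -> : \sum_(j < n) expR (h * (j < x)%N%:R) = n%:R + x%:R * (expR h - 1).
  rewrite (eq_bigr (fun j : 'I_n => 1 + (j < x)%N%:R * (expR h - 1))) => [|j _].
    rewrite big_split /= sumr_const card_ord -mulr_suml -natr_sum; congr (_ + _%:R * _).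
    have sx N : (\sum_(j < N) (j < x))%N = minn x N.
      by elim: N => [|N IH]; rewrite ?big_ord0 ?minn0// big_ord_recr/= IH; clear; lia.
    by rewrite sx (minn_idPl xn).
  by case: ltnP => _; rewrite ?mulr1 ?mulr0 ?expR0 ?mul1r ?mul0r ?addr0// addrC subrK.
have nR : 0 < n%:R :> R by rewrite ltr0n.
(* From [expR h <= 1 / (1 - h)], and [1 / (1 - h) <= 1 + h + 2 * h ^+ 2] for [h] at most 1/2. *)
have eh : expR h - 1 <= h + 2 * h ^+ 2.
  have hm : 0 < 1 - h by move: h2; lra.
  have : expR h <= (1 - h)^-1.
    by rewrite -[h in expR h]opprK expRN lef_pV2 ?posrE ?expR_gt0//; exact: expR_ge1Dx.
  have : (1 - h)^-1 <= 1 + h + 2 * h ^+ 2.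
    rewrite -[leLHS]mul1r ler_pdivrMr//.
    have : 0 <= h ^+ 2 * (1 - 2 * h) by rewrite mulr_ge0 ?sqr_ge0//; move: h2; lra.
    by rewrite !exprS expr0; move: (h) => y; nra.
  by move=> h3 h4; rewrite lerBlDl addrA; exact: le_trans h4 h3.
have -> : n%:R + x%:R * (expR h - 1) = n%:R * (1 + x%:R / n%:R * (expR h - 1)) :> R.
  by field; rewrite gt_eqF.
rewrite exprMn natrX expRD [leRHS]mulrAC [leLHS]mulrCA [leLHS]mulrC mulrAC.
rewrite ler_pM2r ?exprn_gt0// mulrC ler_pM2r ?expR_gt0//.
rewrite -(mulrA k%:R) expRM_natl; apply: lerXn2r; rewrite ?nnegrE ?expR_ge0//.
  by rewrite addr_ge0// mulr_ge0 ?divr_ge0// subr_ge0 -expR0 ler_expR.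
apply: le_trans (expR_ge1Dx _) _; rewrite ler_expR ler_wpM2l ?divr_ge0//.
Qed.

End Placements.

(** Union bound over the [n + 1] prefixes. The number of particles enters only through [rF * n + 1],
    which keeps the constants uniform in the density. *)
Lemma placements_balanced (R : realType) (rF eta : R) : 0 < rF -> 0 < eta -> exists c C : R, [/\ 0 < c, 0 < C &
  forall n k, (0 < n)%N -> k%:R <= rF * n%:R + 1 ->
  #|[pred p : {ffun 'I_k -> 'I_n} | ~~ `[< balanced n rF (eta * n%:R) (occupancy p) >]]|%:R <=
  C * expR (- (c * n%:R)) * (n ^ k)%:R].
Proof.
(* With this [h] the quadratic term [2 * h ^+ 2 * rF * n] is at most half of the gain [h * eta * n].
   The exponent [1 - 2 * c * n] remains, and one factor [expR (- (c * n))] absorbs the number of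
   prefixes. *)
move=> r0 e0; pose h := Num.min 2^-1 (eta / (4 * (rF + 1))).
have r1 : 0 < 4 * (rF + 1) by rewrite mulr_gt0// addr_gt0.
have h0 : 0 < h by rewrite lt_min invr_gt0 ltr0n divr_gt0.
have h2 : h <= 2^-1 by rewrite ge_min lexx.
have he : 4 * (rF + 1) * h <= eta by rewrite mulrC -ler_pdivlMr// ge_min lexx orbT.
pose c := eta * h / 4; have c0 : 0 < c by rewrite divr_gt0// mulr_gt0.
have C0 : 0 < expR 1 * (1 + c^-1) :> R by rewrite mulr_gt0 ?expR_gt0// addr_gt0// invr_gt0.
exists c, (expR 1 * (1 + c^-1)); split=> // n k n0 kn.
have nR : 0 < n%:R :> R by rewrite ltr0n.
pose bad x := [pred p : {ffun 'I_k -> 'I_n} | rF * x%:R + eta * n%:R < #|[pred i | p i < x]%N|%:R].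
apply: (@le_trans _ _ (\sum_(x < n.+1) #|bad x|%:R)).
  rewrite -natr_sum ler_nat card_indicator.
  apply: (@leq_trans (\sum_(p : {ffun 'I_k -> 'I_n}) \sum_(x < n.+1) (p \in bad x))); last first.
    by rewrite exchange_big; apply: leq_sum => x _; rewrite card_indicator; apply: leq_sum.
  apply: leq_sum => p _ /=; case: asboolP => // nb.
  have [x xn bx] : exists2 x, (x <= n)%N & p \in bad x.
    apply: contrapT => nx; apply: nb => x xn; apply: contraT; rewrite -ltNge occupancy_prefix => lt.
    by exfalso; apply: nx; exists x.
  by rewrite (bigD1 (Ordinal (xn : (x < n.+1)%N)))//= bx.
apply: (@le_trans _ _ (\sum_(x < n.+1) expR (1 - 2 * c * n%:R) * (n ^ k)%:R)).
  apply: ler_sum => x _; have xn : (x <= n)%N by rewrite -ltnS.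
  apply: le_trans (@prefix_chernoff n k R h _ x n0 xn (ltW h0) h2) _.
  rewrite ler_wpM2r// ler_expR.
  have kx : k%:R * (x%:R / n%:R) <= rF * x%:R + 1.
    apply: (@le_trans _ _ ((rF * n%:R + 1) * (x%:R / n%:R))); first by rewrite ler_wpM2r// divr_ge0.
    rewrite mulrDl mul1r -(mulrA rF) (mulrCA n%:R) divff ?gt_eqF// mulr1 lerD2l.
    by rewrite ler_pdivrMr// mul1r ler_nat.
  have hh : 0 <= h + 2 * h ^+ 2 by rewrite addr_ge0 ?mulr_ge0 ?exprn_ge0// ltW.
  apply: (@le_trans _ _ ((rF * x%:R + 1) * (h + 2 * h ^+ 2) - h * (rF * x%:R + eta * n%:R))).
    by rewrite lerD2r ler_wpM2r.
  have xR : rF * x%:R <= rF * n%:R by rewrite ler_pM2l// ler_nat.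
  have b1 : h + 2 * h ^+ 2 <= 1.
    have : h * h <= 2^-1 * 2^-1 by apply: ler_pM => //; exact: ltW.
    by rewrite expr2; move: h2; lra.
  have b2 : rF * x%:R * (2 * h ^+ 2) <= 2^-1 * (eta * h) * n%:R.
    apply: (@le_trans _ _ (rF * n%:R * (2 * h ^+ 2))).
      by rewrite ler_wpM2r// mulr_ge0// exprn_ge0// ltW.
    rewrite (_ : rF * n%:R * (2 * h ^+ 2) = 2^-1 * (4 * rF * h * h) * n%:R); last by field.
    rewrite ler_pM2r// ler_pM2l// ler_pM2r//; apply: le_trans he.
    by rewrite ler_pM2r// ler_pM2l// lerDl.
  rewrite /c; move: b1 b2; rewrite expr2.
  move: (n%:R : R) (x%:R : R) => y w; clear; nra.
rewrite sumr_const card_ord -[leLHS]mulr_natl mulrA ler_wpM2r//.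
rewrite (_ : 1 - 2 * c * n%:R = 1 + - (c * n%:R) + - (c * n%:R)); last by ring.
rewrite !expRD !mulrA ler_pM2r ?expR_gt0//.
rewrite -mulrA mulrCA ler_pM2l ?expR_gt0// expRN ler_pdivrMr ?expR_gt0//.
apply: (@le_trans _ _ ((1 + c^-1) * (1 + c * n%:R))); last by rewrite ler_pM2l ?expR_ge1Dx// addr_gt0// invr_gt0.
rewrite mulrDl !mul1r mulrDr mulr1 mulKf ?gt_eqF// -natr1.
have : 0 <= c * n%:R by rewrite mulr_ge0// ltW.
have : 0 < c^-1 by rewrite invr_gt0.
by move: (c * _) (c^-1) => a1 a2; lra.
Qed.

(** * The main estimate *)

Section Measurable.
Context (R : realType) (d : measure_display) (T : measurableType d) (P : probability T R).

Lemma measurable_config (Y : T -> config) (eta : config) :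
  (forall x a, measurable [set w | Y w x = a]) -> measurable [set w | Y w = eta].
Proof.
move=> mY; rewrite (_ : [set w | _] = [set w | forall x : int, Y w x = eta x]).
  by apply: measurable_all => x; exact: mY.
by apply/seteqP; split=> w /= h; [rewrite h|exact/funext].
Qed.

(** Different placements may give the same configuration; dividing by the multiplicity [mu] makes
    the sum of the [g p] equal to the integrand at each placement. Elsewhere that sum is 0, while
    the integrand is nonnegative. *)
Lemma placement_integral n k (Y : T -> config) M (F : config -> R) : (0 < n)%N -> (n <= M)%N ->
  (forall x a, measurable [set w | Y w x = a]) -> uniform_placement n k P Y -> (forall eta, 0 <= F eta) ->
  ((\sum_(p : {ffun 'I_k -> 'I_n}) F (place p) / (n ^ k)%:R)%:E <=
   \int[P]_w (F (truncate_config M (Y w)))%:E)%E.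
Proof.
move=> n0 nM mY uY F0.
have trunc_place (p : {ffun 'I_k -> 'I_n}) : truncate_config M (place p) = place p.
  apply/funext => x; rewrite /truncate_config; case: ifPn => // xM; congr Awake; apply/esym/eq_card0 => i.
  rewrite !inE; apply/negbTE; have := ltn_ord (p i); move: xM nM; clear; lia.
pose mu (eta : config) : R := #|[pred p : {ffun 'I_k -> 'I_n} | `[< place p = eta >]]|%:R.
have mE (p : {ffun 'I_k -> 'I_n}) : mu (place p) != 0.
  by rewrite pnatr_eq0 -lt0n; apply/card_gt0P; exists p; rewrite unfold_in /= asboolT.
have mp eta : measurable [set w | Y w = eta] by exact: measurable_config.
pose g (p : {ffun 'I_k -> 'I_n}) w : \bar R := ((F (place p) / mu (place p)) * \1_[set w | Y w = place p] w)%:E.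
have g0 p w : (0 <= g p w)%E by rewrite lee_fin mulr_ge0// divr_ge0.
have mg p : measurable_fun setT (g p).
  apply/measurable_EFinP; apply: measurable_funM; first exact: measurable_cst.
  exact: measurable_indic.
have ig p : (\int[P]_w g p w)%E = (F (place p) / (n ^ k)%:R)%:E.
  rewrite /g; under eq_integral do rewrite EFinM.
  rewrite ge0_integralZl//; last 2 first.
  - by apply/measurable_EFinP; exact: measurable_indic.
  - by rewrite lee_fin divr_ge0.
  rewrite integral_indic//; transitivity ((F (place p) / mu (place p))%:E * (mu (place p) / (n ^ k)%:R)%:E)%E.
    by congr (_ * _)%E; rewrite setIT; exact: uY.
  by rewrite -EFinM mulrA divfK.
have -> : (\sum_(p : {ffun 'I_k -> 'I_n}) F (place p) / (n ^ k)%:R)%:E = (\int[P]_w (\sum_p g p w))%E.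
  rewrite ge0_integral_sum//.
  by rewrite -sumEFin; apply: eq_bigr => p _; rewrite ig.
apply: ge0_le_integral => //.
- by move=> w _; rewrite sume_ge0.
- by apply: emeasurable_sum => p; exact: mg.
- apply/measurable_EFinP => _ B mB; rewrite setTI.
  apply: (@measurable_local_event _ _ Y M (fun eta => B (F (truncate_config M eta)))) => // eta zeta ez.
  suff -> : truncate_config M eta = truncate_config M zeta by [].
  by apply/funext => x; rewrite /truncate_config; case: ifP => // xM; apply: ez; rewrite mem_zs.
move=> w _; rewrite sumEFin lee_fin.
have [[q Yq]|nq] := pselect (exists q : {ffun 'I_k -> 'I_n}, Y w = place q); last first.
  rewrite big1 // => p _; rewrite indicE memNset ?mulr0// => h; apply: nq; by exists p.
rewrite Yq trunc_place (eq_bigr (fun p => F (place q) / mu (place q) * `[< place p = place q >]%:R)) => [|p _].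
  by rewrite -mulr_sumr -natr_sum -card_indicator divfK.
rewrite indicE; case: asboolP => [pq|pq]; first by rewrite pq mem_set.
by rewrite memNset ?mulr0//= Yq => h; exact: pq.
Qed.

End Measurable.

Lemma few_exits_local (R : realType) n (e : R) : local_within n.+1 (few_exits n e).
Proof.
move=> eta zeta ez [h1 h2].
have E x : 0 <= x <= n.+1%:Z -> eta x = zeta x by move=> xn; apply: ez; rewrite mem_zs; move: xn; clear; lia.
split; last by move: h2; rewrite /max_ejected (E 0)// (E n.+1%:Z)//; clear; lia.
move=> x Vx; rewrite -E; first exact: h1.
by move: Vx; rewrite /sites /=; clear; lia.
Qed.

Lemma fdd_sites_ge0 (R : realType) (lam t : R) n (G : set config) eta : 0 < lam -> 0 <= t ->
  0 <= fdd (sites n) lam [:: (t, G)] eta.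
Proof.
move=> l0 t0; rewrite sites_interval.
have sge0 (a : R * set config) : a \in [:: (t, G)] -> 0 <= a.1 by rewrite inE => /eqP ->.
by have /andP[] := fdd_bounds l0 eta (interval_uniq 0 n) sge0.
Qed.

(** The event at the single time [t] is contained in the one on the right. The latter is measurable
    by right-continuity: it depends on finitely many sites, and these keep their states for a while,
    so real times may be replaced by rational ones. *)
Lemma arw_few_exits (R : realType) (lam : R) n (d : measure_display) (T : measurableType d) (P : probability T R)
    (X : R -> T -> config) k (e t : R) : 0 < lam -> (0 < n)%N -> 0 <= t ->
  is_arw (sites n) lam P X -> uniform_placement n k P (X 0) ->
  ((\sum_(p : {ffun 'I_k -> 'I_n}) fdd (sites n) lam [:: (t, few_exits n e)] (place p) / (n ^ k)%:R)%:E <=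
   P [set w | exists t : R, [/\ (0 <= t)%R, stable (sites n) (X t w) & ((max_ejected n (X t w))%:R <= e)%R]])%E.
Proof.
move=> l0 n0 t0 [mX rX _ law] uX; pose G := few_exits n e.
have locG := @few_exits_local R n e; rewrite -/G in locG.
have mG u : 0 <= u -> measurable [set w | G (X u w)].
  by move=> u0; apply: (measurable_local_event _ locG) => x a; exact: mX.
apply: (@le_trans _ _ (P [set w | G (X t w)])); last first.
  apply: le_measure; rewrite ?inE; [exact: mG| |by move=> w [h1 h2]; exists t].
  rewrite (_ : [set w | _] = [set w | exists r : rat, 0 <= r /\ G (X (ratr r) w)]).
    apply: measurable_ex => r; have [r0|r0] := leP 0 r; last first.
      by rewrite (_ : [set w | _] = set0) //; apply/seteqP; split=> // w /= [].
    apply: measurable_and; first by rewrite (_ : [set w | _] = setT) //; apply/seteqP; split.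
    by apply: mG; rewrite ler0q.
  apply/seteqP; split=> w /= [u].
    move=> [u0 s1 s2].
    have near_all (l : seq int) : \forall v \near u^'+, forall x, x \in l -> X v w x = X u w x.
      elim: l => [|x l IH]; first by apply: filterE.
      apply: filterS2 (rX w x u u0) IH => v h1 h2 y; rewrite inE => /orP[/eqP->//|]; exact: h2.
    have [eps /= eps0 he] := near_all (zs n.+1).
    have [r] : exists r : rat, ratr r \in `]u, (u + eps)[ by apply: rat_in_itvoo; rewrite ltrDl.
    rewrite in_itv /= => /andP[ur re]; exists r; split.
      by rewrite -(ler0q R) (le_trans u0)// ltW.
    apply: (locG (X u w)) => // x xn; apply/esym/he => //=.
    by rewrite distrC ger0_norm ?subr_ge0 1?ltW// ltrBlDl.
  by move=> [r0 [h1 h2]]; exists (ratr u); split=> //; rewrite ler0q.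
have {}law := law [:: (t, G)].
have cv : (fun M : nat => (\int[P]_w (fdd (sites n) lam [:: (t, G)] (truncate_config M (X 0 w)))%:E)%E) @ \oo -->
    P [set w | G (X t w)].
  have -> : [set w | G (X t w)] = [set w | visits (fun t => X t w) 0 [:: (t, G)]].
    by apply/seteqP; split=> w /=; rewrite add0r => // -[].
  apply: law => a; rewrite inE => /eqP -> /=; split=> //; exists n.+1 => eta zeta ez.
  by apply: locG => x; rewrite mem_zs => /ez.
rewrite -(cvg_lim _ cv)//; apply: lime_ge; first by apply/cvg_ex; exists (P [set w | G (X t w)]).
exists n => // M /= nM; apply: placement_integral => //; first by move=> x a; exact: mX.
by move=> eta; exact: fdd_sites_ge0.
Qed.

Theorem proposition3 (R : realType) (lambda rho_FE : R)
  (lambda_gt0 : 0 < lambda) (rho_FE_crit : is_critical_density lambda rho_FE)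
  (eps : R) (eps_gt0 : 0 < eps) :
  exists c C : R, [/\ 0 < c, 0 < C &
    forall (rho : R) (n : nat), 0 < rho -> rho <= rho_FE -> (1 <= n)%N ->
    forall (d : measure_display) (T : measurableType d) (P : probability T R)
      (X : R -> T -> config),
      is_arw (sites n) lambda P X ->
      uniform_placement n `|Num.ceil (rho * n%:R)|%N P (X 0) ->
      ((1 - C * expR (- (c * n%:R)))%:E <=
       P [set w | exists t : R, [/\ (0 <= t)%R, stable (sites n) (X t w) &
            ((max_ejected n (X t w))%:R <= eps * n%:R / 2 :> R)%R]])%E].
Proof.
have [rF0|rF0] := ltP 0 rho_FE; last first.
  exists 1, 1; split=> // rho n r0 rF; have := lt_le_trans r0 (le_trans rF rF0); by rewrite ltxx.
have [eta [c1 [C1 [n0 [eta0 c10 C10 exits]]]]] := few_exits_likely lambda_gt0 rho_FE_crit eps_gt0 rF0.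
have [c2 [C2 [c20 C20 balance]]] := placements_balanced rF0 eta0.
pose c := Num.min c1 c2; have c0 : 0 < c by rewrite lt_min c10.
(* [C2] counts twice, for the placement and for its reflection. The last term makes the bound
   negative or zero for [n < n0]. *)
pose C := C1 + 2 * C2 + expR (c * n0%:R).
exists c, C; split=> //; first by rewrite !addr_gt0 ?mulr_gt0 ?expR_gt0.
move=> rho n r0 rF n_gt0 d T P X arw unif.
have ex0 x : 0 < expR x :> R by exact: expR_gt0.
have [nn|nn] := ltnP n n0.
  apply: (@le_trans _ _ 0%E); last exact: measure_ge0.
  rewrite lee_fin subr_le0; apply: (@le_trans _ _ (expR (c * n0%:R) * expR (- (c * n%:R)))).
    rewrite -expRD -[leLHS]expR0 ler_expR subr_ge0 ler_pM2l// ler_nat; exact: ltnW.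
  by rewrite ler_pM2r// /C lerDr addr_ge0 ?mulr_ge0// ltW.
set k := `|_|%N in unif.
(* The density enters only through this bound on the number of particles, so [c] and [C] do not
   depend on it. *)
have kn : k%:R <= rho_FE * n%:R + 1.
  have rn : 0 < rho * n%:R by rewrite mulr_gt0// ltr0n.
  apply: (@le_trans _ _ (rho * n%:R + 1)); last by rewrite lerD2r ler_pM2r// ltr0n.
  have cg : 0 < Num.ceil (rho * n%:R) by rewrite ceil_gt0.
  by rewrite /k natr_absz gtr0_norm// -lerBlDr -[1]/(1%:~R) -intrB ltW// ceilB1_lt.
have nk : 0 < (n ^ k)%:R :> R by rewrite ltr0n expn_gt0 n_gt0.
apply: (@le_trans _ _ (1 - C1 * expR (- (c1 * n%:R)) - 2 * (C2 * expR (- (c2 * n%:R))))%:E).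
  have mon c' : c <= c' -> expR (- (c' * n%:R)) <= expR (- (c * n%:R)) :> R.
    by move=> cc; rewrite ler_expR lerN2 ler_wpM2r.
  have m1 : C1 * expR (- (c1 * n%:R)) <= C1 * expR (- (c * n%:R)) by rewrite ler_pM2l// mon// ge_min lexx.
  have m2 : C2 * expR (- (c2 * n%:R)) <= C2 * expR (- (c * n%:R)) by rewrite ler_pM2l// mon// ge_min lexx orbT.
  have m3 : 0 <= expR (c * n0%:R) * expR (- (c * n%:R)) by rewrite mulr_ge0// ltW.
  rewrite lee_fin /C; move: m1 m2 m3.
  move: (expR (- (c1 * _))) (expR (- (c2 * _))) (expR (- (c * _))) (expR (c * _)) => E1 E2 E3 E4 m1 m2 m3.
  rewrite (_ : (C1 + 2 * C2 + E4) * E3 = C1 * E3 + 2 * (C2 * E3) + E4 * E3); last by ring.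
  move: m1 m2 m3; move: (C1 * E1) (C1 * E3) (C2 * E2) (C2 * E3) (E4 * E3) => a1 a2 a3 a4 a5; lra.
pose W := \sum_(p : {ffun 'I_k -> 'I_n}) pot (quad R 0 n) (interval 0 n) (place p).
have Wp (p : {ffun 'I_k -> 'I_n}) : 0 <= pot (quad R 0 n) (interval 0 n) (place p) by exact: pot_quad_ge0.
have W0 : 0 <= W by rewrite sumr_ge0.
apply/lee_addgt0Pr => e e0.
(* The time is chosen after [n], so large that the total instability over all placements is at most
   [e]; the constants are not affected. *)
pose t := W / e + 2; have We0 : 0 <= W / e by rewrite divr_ge0// ltW.
have t1 : 1 < t by rewrite /t; move: We0; lra.
have t0 : 0 <= t by apply/ltW/(lt_trans ltr01).
rewrite -leeBlDr//.
have lower := @arw_few_exits R lambda n d T P X k (eps * n%:R / 2) t lambda_gt0 n_gt0 t0 arw unif.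
apply: le_trans lower.
set G := few_exits _ _; rewrite -EFinB lee_fin -mulr_suml ler_pdivlMr//.
pose ok (p : {ffun 'I_k -> 'I_n}) := `[< balanced n rho_FE (eta * n%:R) (occupancy p) >].
pose rev (p : {ffun 'I_k -> 'I_n}) : {ffun 'I_k -> 'I_n} := [ffun i => rev_ord (p i)].
have revK : involutive rev by move=> p; apply/ffunP => i; rewrite !ffunE rev_ordK.
apply: (@le_trans _ _ (\sum_(p : {ffun 'I_k -> 'I_n}) (1 - C1 * expR (- (c1 * n%:R)) -
    pot (quad R 0 n) (interval 0 n) (place p) / (t - 1) - (~~ ok p)%:R - (~~ ok (rev p))%:R))); last first.
  apply: ler_sum => p _.
  have Wt : 0 <= pot (quad R 0 n) (interval 0 n) (place p) / (t - 1) by rewrite divr_ge0// subr_ge0 ltW.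
  have Ce : 0 <= C1 * expR (- (c1 * n%:R)) by rewrite mulr_ge0 ?expR_ge0// ltW.
  have F0 : 0 <= fdd (sites n) lambda [:: (t, G)] (place p).
    exact: fdd_sites_ge0.
  case: (boolP (ok p)) => [/asboolP b1|_]; last by move: Wt Ce F0 (ler0n R (~~ ok (rev p))) => /=; lra.
  case: (boolP (ok (rev p))) => [/asboolP b2|_]; last by move: Wt Ce F0 => /=; lra.
  rewrite !subr0; apply: exits => //; last by rewrite occupancy_mirror.
    by apply: eq_card0 => i; rewrite !inE.
  by apply: eq_card0 => i; rewrite !inE eqz_nat eqSS ltn_eqF.
have card_rev : \sum_(p : {ffun 'I_k -> 'I_n}) (~~ ok (rev p))%:R = \sum_p (~~ ok p)%:R :> R.
  by rewrite [RHS](reindex_inj (inv_inj revK)).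
have bad : \sum_p (~~ ok p)%:R <= C2 * expR (- (c2 * n%:R)) * (n ^ k)%:R.
  by rewrite -natr_sum -card_indicator; exact: balance.
have Wsum : \sum_(p : {ffun 'I_k -> 'I_n}) pot (quad R 0 n) (interval 0 n) (place p) / (t - 1) = W / (t - 1).
  by rewrite mulr_suml.
have cst (x : R) : \sum_(p : {ffun 'I_k -> 'I_n}) x = x * (n ^ k)%:R.
  by rewrite sumr_const card_ffun !card_ord mulr_natr.
rewrite !sumrB card_rev Wsum !cst mul1r.
have We : W / (t - 1) <= e * (n ^ k)%:R.
  apply: (@le_trans _ _ e); last by rewrite ler_peMr ?(ltW e0)// ler1n expn_gt0 n_gt0.
  rewrite ler_pdivrMr ?subr_gt0// /t -addrA mulrDr (mulrC e) divfK ?gt_eqF// lerDl.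
  by apply: mulr_ge0; [exact: ltW|lra].
rewrite !mulrBl mul1r -(mulrA 2); move: We bad.
by move: (W / _) (e * _) (\sum_p _) (C2 * _ * _) (C1 * _ * _) => a1 a2 a3 a4 a5; lra.
Qed.
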